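(* Let $X\subset(M,\pi)$ be a coregular submanifold of a Poisson manifold. Let $W$ be a complement to $TX^{\perp_\pi}$ in $TM|_X$ and let $\eta\in\mathcal{E}_W(-\sigma-\tau)$ be a closed extension, with corresponding local model $(U,\pi(W,\eta))$. Then a neighborhood of $X$ in its local Poisson saturation is Poisson diffeomorphic with the local model $(U,\pi(W,\eta))$.
   Context: Poisson conventions. $\pi^\sharp:T^*M\to TM$ is given by $\langle\pi^\sharp(\alpha),\beta\rangle=\pi(\alpha,\beta)$. For an embedded submanifold $i:X\hookrightarrow M$, $TX^\circ\subset T^*M|_X$ is the annihilator of $TX$ and $TX^{\perp_\pi}:=\pi^\sharp(TX^\circ)$. $X$ is coregular if $\mathrm{pr}\circ\pi^\sharp:T^*M|_X\to TM|_X/TX$ has constant rank; equivalently $TX^{\perp_\pi}$ has constant rank, and is then a vector subbundle of $TM|_X$. A Poisson submanifold is a submanifold $P$ with $\pi^\sharp(T^*M|_P)\subset TP$; it has an induced Poisson structure $\pi_P$. The saturation of $X$ in a Poisson manifold is the union of the symplectic leaves meeting $X$. Local Poisson saturation. A Poisson spray is a vector field $\chi$ on $T^*M$ with $\mathrm{d}\mathrm{pr}(\chi(\xi))=\pi^\sharp(\xi)$ for all $\xi\in T^*M$ and $m_t^*\chi=t\chi$ for all $t>0$, where $\mathrm{pr}:T^*M\to M$ is the projection and $m_t$ is fiberwise multiplication by $t$. On a neighborhood $\Sigma\subset T^*M$ of the zero section its flow $\phi^t_\chi$ is defined for $t\in[0,1]$, and $\exp_\chi:\Sigma\to M$, $\exp_\chi(\xi)=\mathrm{pr}(\phi^1_\chi(\xi))$.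 Choosing a complement to $TX^{\perp_\pi}$ in $TM|_X$ gives an inclusion $(TX^{\perp_\pi})^*\hookrightarrow T^*M|_X$; for $\Sigma$ small enough, $P:=\exp_\chi((TX^{\perp_\pi})^*\cap\Sigma)$ is an embedded Poisson submanifold containing $X$, it equals $\exp_\chi(\Sigma|_X)$, and (after shrinking) it is the saturation of $X$ in $(V,\pi|_V)$ for some open neighborhood $V$ of $X$. $(P,\pi_P)$ is called the local Poisson saturation of $X$. Dirac notions. $L_\pi=\{\pi^\sharp(\alpha)+\alpha:\alpha\in T^*M\}$. For a map $\varphi$ into a Dirac manifold with Dirac structure $L$, $\varphi^!L=\{v+(\mathrm{d}\varphi)^*\beta:\mathrm{d}\varphi(v)+\beta\in L\}$; for $X$ coregular, $i^!L_\pi$ is a smooth Dirac structure on $X$. For a closed two-form $\eta$, the gauge transform is $L^\eta=\{v+\alpha+\iota_v\eta:v+\alpha\in L\}$. A Dirac structure is Poisson on $U$ if it equals $L_{\pi'}$ there for some Poisson structure $\pi'$ on $U$. Local model. A complement $W$ to $TX^{\perp_\pi}$ in $TM|_X$ induces an inclusion $j:(TX^{\perp_\pi})^*\hookrightarrow T^*M|_X$ with image $W^\circ$ (dual to the projection $TM|_X\to TX^{\perp_\pi}$ along $W$). On $T\big((TX^{\perp_\pi})^*\big)|_X=TX\oplus(TX^{\perp_\pi})^*$ define skew forms $\sigma\in\Gamma(\wedge^2TX^{\perp_\pi})$, $\tau\in\Gamma(T^*X\otimes TX^{\perp_\pi})$ by $\sigma(\xi_1,\xi_2)=\pi(j(\xi_1),j(\xi_2))$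 and $\tau((v_1,\xi_1),(v_2,\xi_2))=\langle v_1,j(\xi_2)\rangle-\langle v_2,j(\xi_1)\rangle$. $\mathcal{E}_W(-\sigma-\tau)$ is the set of closed two-forms $\eta$ defined on a neighborhood of the zero section $X\subset(TX^{\perp_\pi})^*$ whose restriction along $X$ (as a bilinear form on $TX\oplus (TX^{\perp_\pi})^*$) is $\eta|_X=-\sigma-\tau$ (with zero component in $\Gamma(\wedge^2T^*X)$). With $\mathrm{pr}:(TX^{\perp_\pi})^*\to X$ the bundle projection, the Dirac structure $(\mathrm{pr}^!(i^!L_\pi))^\eta$ is Poisson on a neighborhood $U$ of $X$; the resulting Poisson manifold is denoted $(U,\pi(W,\eta))$ and called the local model corresponding with $W$ and $\eta$. The neighborhood $U$ of $X$ may be shrunk when necessary. *)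

(* Defs.v *)
From HB Require Import structures.
From Stdlib Require Import Relation_Operators.
From mathcomp Require Import all_boot all_order all_algebra.
From mathcomp Require Import all_classical all_reals all_analysis.
Set Implicit Arguments.
Unset Strict Implicit.
Unset Printing Implicit Defensive.
Import Order.TTheory GRing.Theory Num.Theory numFieldNormedType.Exports.
Local Open Scope classical_set_scope.
Local Open Scope ring_scope.

(** * Smooth manifolds *)

Fixpoint Ck (R : realType) (n : nat) (W : normedModType R) (k : nat)
    (O : set 'rV[R]_n) (g : 'rV[R]_n -> W) : Prop :=
  if k is k'.+1 then
    (forall x, O x -> differentiable g x) /\ (forall v, Ck k' O ('D_v g))
  else forall x, O x -> {for x, continuous g}.

Definition smooth_on (R : realType) (n : nat) (W : normedModType R)
    (O : set 'rV[R]_n) (g : 'rV[R]_n -> W) : Prop := forall k, Ck k O g.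

(** A set with an atlas.  A chart is a pair [c] of its domain [c.1] and its
    coordinate map [c.2], whose values outside [c.1] are irrelevant.  The axioms
    are in [is_manifold] below, so that the total spaces of bundles can be
    written down by giving their charts. *)
Record charted (R : realType) := Charted {
  carrier :> Type;
  mdim : nat;
  atlas : set (set carrier * (carrier -> 'rV[R]_mdim)) }.
Arguments atlas {R} c.
Arguments mdim {R} c.

Section Manifolds.
Context {R : realType}.
Implicit Types M N : charted R.

Definition mopen M (O : set M) : Prop :=
  forall c, atlas M c -> open (c.2 @` (c.1 `&` O)).

Definition mnbhs M (p : M) (A : set M) : Prop :=
  exists O, [/\ mopen O, O p & O `<=` A].

(** Smoothness of [f] near [p] in the coordinates of [c]. *)
Definition smooth_in M (c : set M * (M -> 'rV[R]_(mdim M)))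
    (W : normedModType R) (p : M) (f : M -> W) : Prop :=
  exists O (g : 'rV[R]_(mdim M) -> W),
    [/\ open O, O (c.2 p), smooth_on O g &
        forall q, c.1 q -> O (c.2 q) -> f q = g (c.2 q)].

(** An open condition on [p]. *)
Definition smooth_at M (W : normedModType R) (p : M) (f : M -> W) : Prop :=
  exists c, [/\ atlas M c, c.1 p & smooth_in c p f].

Definition smooth_map_at M N (phi : M -> N) (p : M) : Prop :=
  exists c, [/\ atlas N c, mnbhs p (phi @^-1` c.1) & smooth_at p (c.2 \o phi)].

Definition is_manifold M : Prop :=
  [/\ (forall p : M, exists2 c, atlas M c & c.1 p),
      (forall c, atlas M c ->
         (forall p q, c.1 p -> c.1 q -> c.2 p = c.2 q -> p = q) /\ mopen c.1),
      (forall c c' p, atlas M c -> atlas M c' -> c.1 p -> c'.1 p ->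
         smooth_in c p c'.2),
      (forall p q : M, p <> q -> exists O O',
         [/\ mopen O, mopen O', O p, O' q & O `&` O' = set0]) &
      (exists B : nat -> set M, (forall k, mopen (B k)) /\
         forall p O, mopen O -> O p -> exists k, B k p /\ B k `<=` O)].

End Manifolds.

(** * Linear algebra in subspaces [F] of an ambient vector space [V] *)

Section Linear.
Context {R : realType} {V : lmodType R}.

Definition is_subspace (F : set V) : Prop :=
  F 0 /\ forall (a : R) u v, F u -> F v -> F (a *: u + v).

Definition linear_on (F : set V) (f : V -> R^o) : Prop :=
  forall (a : R) u v, F u -> F v -> f (a *: u + v) = a * f u + f v.

(** [f] set to zero off [F]: the normal form of a functional on [F], making
    functionals that agree on [F] equal. *)
Definition restr (F : set V) (f : V -> R^o) : V -> R^o :=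
  fun v => if `[< F v >] then f v else 0.

Definition lin_dual (F : set V) : set (V -> R^o) :=
  [set f | linear_on F f /\ forall v, ~ F v -> f v = 0].

Definition skew_form (F : set V) (b : V -> V -> R^o) : Prop :=
  (forall u, F u -> linear_on F (b u)) /\
  (forall u v, F u -> F v -> b u v = - b v u).

(** The classes of [b 0, ..., b (r - 1)] form a basis of [(F + G) / G]. *)
Definition basis_mod (F G : set V) (r : nat) (b : 'I_r -> V) : Prop :=
  [/\ (forall k, F (b k)),
      (forall a : 'I_r -> R, G (\sum_(k < r) a k *: b k) -> forall k, a k = 0) &
      (forall v, F v -> exists a : 'I_r -> R, G (v - \sum_(k < r) a k *: b k))].

Definition is_basis (F : set V) (r : nat) (b : 'I_r -> V) : Prop :=
  basis_mod F [set 0] b.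

Lemma dual0 (F : set V) : lin_dual F (fun _ => 0).
Proof. by split=> // a u v _ _; rewrite mulr0 addr0. Qed.

Lemma dualZ (F : set V) (t : R) f : lin_dual F f -> lin_dual F (fun v => t * f v).
Proof.
move=> [lf f0]; split=> [a u v Fu Fv|v nFv]; last by rewrite f0 ?mulr0.
by rewrite lf// mulrDr !mulrA (mulrC t).
Qed.

End Linear.

(** * Tangent and cotangent spaces *)

Section Tangent.
Context {R : realType}.
Implicit Types M N P X : charted R.

(** Tangent vectors at [p] are the derivations of germs at [p] of smooth
    functions; they are extended by [0] to functions not smooth near [p].  All
    tangent spaces of [M] are subspaces of one vector space [tvec M]. *)
Definition tvec M := (M -> R^o) -> R^o.
Definition cvec M := tvec M -> R^o.

Definition tangent M (p : M) : set (tvec M) := [set v |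
  [/\ (forall (a : R) (f g : M -> R^o), smooth_at p f -> smooth_at p g ->
         v (fun q => a * f q + g q) = a * v f + v g),
      (forall f g : M -> R^o, smooth_at p f -> smooth_at p g ->
         v (fun q => f q * g q) = f p * v g + g p * v f),
      (forall f g : M -> R^o, smooth_at p f -> mnbhs p [set q | f q = g q] -> v f = v g) &
      (forall f : M -> R^o, ~ smooth_at p f -> v f = 0)]].

Definition cotangent M (p : M) : set (cvec M) := lin_dual (@tangent M p).

Definition dif M (f : M -> R^o) (p : M) : cvec M :=
  restr (@tangent M p) (fun v => v f).

Definition push M N (phi : M -> N) (p : M) (v : tvec M) : tvec N :=
  fun f => if `[< smooth_at (phi p) f >] then v (f \o phi) else 0.

Definition copull M N (phi : M -> N) (p : M) (b : cvec N) : cvec M :=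
  restr (@tangent M p) (fun v => b (push phi p v)).

(** [s] is smooth near [p], as a section of [phi^* TM]. *)
Definition smooth_along N M (phi : N -> M) (p : N) (s : N -> tvec M) : Prop :=
  mnbhs p [set q | tangent (phi q) (s q)] /\
  forall f : M -> R^o, smooth_at (phi p) f -> smooth_at p (fun q => s q f : R^o).

Definition vfield_at M (p : M) (Y : M -> tvec M) : Prop := smooth_along id p Y.

Definition lie M (Y Z : M -> tvec M) : M -> tvec M := fun p f =>
  if `[< smooth_at p f >]
  then Y p (fun q => Z q f) - Z p (fun q => Y q f) else 0.

Definition embedding N M (i : N -> M) : Prop :=
  [/\ (forall x, smooth_map_at i x),
      (forall x v w, tangent x v -> tangent x w ->
         push i x v = push i x w -> v = w),
      injective i &
      (forall O, mopen O -> exists2 O', mopen O' & O = i @^-1` O')].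

Definition integral_curve M (Y : M -> tvec M) (gam : R -> M) (a b : R) : Prop :=
  forall t, a < t < b -> forall f : M -> R^o, smooth_at (gam t) f ->
    is_derive (t : R^o) (1 : R^o) (f \o gam : R^o -> R^o) (Y (gam t) f).

(** * Vector subbundles of [phi^* TM] and the total spaces of their duals *)

Definition frame_on N M (phi : N -> M) (F : N -> set (tvec M)) (O : set N)
    (r : nat) (s : 'I_r -> N -> tvec M) : Prop :=
  forall q, O q ->
    is_basis (F q) (fun k => s k q) /\ forall k, smooth_along phi q (s k).

Definition subbundle N M (phi : N -> M) (F : N -> set (tvec M)) (r : nat) : Prop :=
  (forall q, is_subspace (F q)) /\
  forall p, exists O (s : 'I_r -> N -> tvec M),
    [/\ mopen O, O p & frame_on phi F O s].

Definition dual_point N M (F : N -> set (tvec M)) : Type :=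
  {e : N * cvec M | lin_dual (F e.1) e.2}.

Definition base N M (F : N -> set (tvec M)) (e : dual_point F) : N := (sval e).1.
Definition fib N M (F : N -> set (tvec M)) (e : dual_point F) : cvec M :=
  (sval e).2.

Definition zero_section N M (F : N -> set (tvec M)) (x : N) : dual_point F :=
  exist _ (x, fun=> 0) (dual0 (F x)).

Definition fib_scale N M (F : N -> set (tvec M)) (t : R) (e : dual_point F) :
    dual_point F :=
  exist _ ((sval e).1, fun v => t * (sval e).2 v) (dualZ t (svalP e)).

(** The charts of the total space of [F^*] are given by a chart [c] of [N] and
    a smooth frame [s] of [F]:
    [(x, xi) |-> (c x, xi (s_1 x), ..., xi (s_r x))]. *)
Definition dual_bundle N M (phi : N -> M) (F : N -> set (tvec M)) (r : nat) :
    charted R :=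
  @Charted R (dual_point F) (mdim N + r)%N
    [set C | exists c O (s : 'I_r -> N -> tvec M),
      [/\ atlas N c, mopen O /\ O `<=` c.1, frame_on phi F O s,
          C.1 = (@base N M F) @^-1` O &
          C.2 = fun e => row_mx (c.2 (base e))
                          (\row_(k < r) fib e (s k (base e)))]].

Definition cotangent_bundle M : charted R :=
  dual_bundle (@id M) (@tangent M) (mdim M).

(** The tangent vector at the zero of the fibre of [e] in the direction of [e]. *)
Definition vertical N M (phi : N -> M) (F : N -> set (tvec M)) (r : nat)
    (e : dual_bundle phi F r) : tvec (dual_bundle phi F r) := fun f =>
  if `[< @smooth_at R (dual_bundle phi F r) R^o (@zero_section N M F (base e)) f >]
  then derive1 (fun t : R => f (@fib_scale N M F t e)) 0 else 0.

(** * Two-forms *)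

Definition closed_form_on M (U : set M) (eta : M -> tvec M -> tvec M -> R^o) :
    Prop :=
  forall p, U p ->
  [/\ skew_form (tangent p) (eta p),
      (forall Y Z, vfield_at p Y -> vfield_at p Z ->
         smooth_at p (fun q => eta q (Y q) (Z q) : R^o)) &
      (forall Y1 Y2 Y3, vfield_at p Y1 -> vfield_at p Y2 -> vfield_at p Y3 ->
         Y1 p (fun q => eta q (Y2 q) (Y3 q)) - Y2 p (fun q => eta q (Y1 q) (Y3 q))
         + Y3 p (fun q => eta q (Y1 q) (Y2 q))
         - eta p (lie Y1 Y2 p) (Y3 p) + eta p (lie Y1 Y3 p) (Y2 p)
         - eta p (lie Y2 Y3 p) (Y1 p) = 0)].

(** * Poisson and Dirac structures *)

Definition bivector M := M -> cvec M -> cvec M -> R^o.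

Definition bracket M (pi : bivector M) (f g : M -> R^o) : M -> R^o :=
  fun q => pi q (dif f q) (dif g q).

Definition poisson_on M (U : set M) (pi : bivector M) : Prop :=
  forall p, U p ->
  [/\ skew_form (cotangent p) (pi p),
      (forall f g : M -> R^o, smooth_at p f -> smooth_at p g ->
         smooth_at p (bracket pi f g)) &
      (forall f g h : M -> R^o, smooth_at p f -> smooth_at p g -> smooth_at p h ->
         bracket pi f (bracket pi g h) p + bracket pi g (bracket pi h f) p
         + bracket pi h (bracket pi f g) p = 0)].

Definition sharp M (pi : bivector M) (p : M) (a : cvec M) : tvec M :=
  fun f => pi p a (dif f p).

Definition poisson_map_on M N (V : set M) (piM : bivector M) (piN : bivector N)
    (phi : M -> N) : Prop :=
  forall p, V p -> forall a b, cotangent (phi p) a -> cotangent (phi p) b ->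
    piM p (copull phi p a) (copull phi p b) = piN (phi p) a b.

Definition poisson_submanifold P M (pi : bivector M) (k : P -> M) : Prop :=
  embedding k /\
  forall p a, cotangent (k p) a ->
    exists2 v, tangent p v & push k p v = sharp pi (k p) a.

Definition leaf_step M (V : set M) (pi : bivector M) (p q : M) : Prop :=
  exists O (f : M -> R^o) (gam : R -> M) (a b s t : R),
    [/\ mopen O /\ O `<=` V, (forall x, O x -> smooth_at x f),
        (forall u, a < u < b -> O (gam u)) /\
          integral_curve (fun x => sharp pi x (dif f x)) gam a b,
        a < s < b /\ a < t < b & gam s = p /\ gam t = q].

(** The symplectic leaf through [p] of the restriction of [pi] to the open set
    [V]: the points of [V] reached from [p] along integral curves of locally
    defined Hamiltonian vector fields. *)
Definition symplectic_leaf M (V : set M) (pi : bivector M) (p : M) : set M :=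
  [set q | [/\ V p, V q & clos_refl_trans M (leaf_step V pi) p q]].

Definition saturation M (V : set M) (pi : bivector M) (A : set M) : set M :=
  [set q | exists p, symplectic_leaf V pi p `&` A !=set0 /\
                     symplectic_leaf V pi p q].

(** A family of sets of pairs (tangent vector, covector). *)
Definition dirac_field M := M -> set (tvec M * cvec M).

Definition poisson_graph M (pi : bivector M) : dirac_field M := fun p =>
  [set z | cotangent p z.2 /\ z.1 = sharp pi p z.2].

Definition dpull N M (phi : N -> M) (L : dirac_field M) : dirac_field N := fun q =>
  [set z | tangent q z.1 /\
     exists2 b, L (phi q) (push phi q z.1, b) & z.2 = copull phi q b].

Definition gauge_transform M (L : dirac_field M) (eta : M -> tvec M -> tvec M -> R^o) : dirac_field M :=
  fun p => [set z | exists2 a, L p (z.1, a) &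
     z.2 = fun w => a w + restr (tangent p) (eta p z.1) w].

(** * Coregular submanifolds and the local model *)

Definition tangent_image X M (i : X -> M) (x : X) : set (tvec M) :=
  push i x @` tangent x.

Definition annihilator X M (i : X -> M) (x : X) : set (cvec M) :=
  [set a | cotangent (i x) a /\ forall v, tangent_image i x v -> a v = 0].

Definition perp X M (i : X -> M) (pi : bivector M) (x : X) : set (tvec M) :=
  sharp pi (i x) @` annihilator i x.

(** [pr o pi^sharp : T^*M|_X -> TM|_X / TX] has constant rank [r]. *)
Definition coregular X M (i : X -> M) (pi : bivector M) (r : nat) : Prop :=
  forall x, exists b : 'I_r -> tvec M,
    basis_mod (sharp pi (i x) @` cotangent (i x)) (tangent_image i x) b.

Definition perp_dual X M (i : X -> M) (pi : bivector M) (r : nat) : charted R :=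
  dual_bundle i (perp i pi) r.

Definition is_complement X M (i : X -> M) (pi : bivector M) (r : nat)
    (W : X -> set (tvec M)) : Prop :=
  subbundle i W (mdim M - r) /\
  forall x, [/\ W x `<=` tangent (i x), W x `&` perp i pi x = [set 0] &
    forall v, tangent (i x) v -> exists2 a, perp i pi x a & W x (v - a)].

(** The inclusion [j] dual to the projection onto [perp] along [W]; the [xget]
    is the component in [perp] of a tangent vector. *)
Definition jmap X M (i : X -> M) (pi : bivector M) (W : X -> set (tvec M))
    (x : X) (xi : cvec M) : cvec M :=
  restr (tangent (i x))
    (fun v => xi (xget 0 [set a | perp i pi x a /\ W x (v - a)])).

(** [eta|_X = - sigma - tau]; the vectors of [T((TX^perp)^* )|_X] are written
    [d zero (v) + vertical e] with [v] in [TX] and [e] in [(TX^perp)^*]. *)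
Definition closed_extension X M (i : X -> M) (pi : bivector M) (r : nat)
    (W : X -> set (tvec M)) (D : set (perp_dual i pi r))
    (eta : perp_dual i pi r -> tvec (perp_dual i pi r) ->
           tvec (perp_dual i pi r) -> R^o) : Prop :=
  let z : X -> perp_dual i pi r := @zero_section X M (perp i pi) in
  let j x (e : perp_dual i pi r) := jmap i pi W x (fib e) in
  [/\ mopen D, (forall x, D (z x)), closed_form_on D eta &
      forall x v1 v2 (e1 e2 : perp_dual i pi r),
        tangent x v1 -> tangent x v2 -> base e1 = x -> base e2 = x ->
        eta (z x) (push z x v1 + vertical e1) (push z x v2 + vertical e2) =
        - pi (i x) (j x e1) (j x e2)
        - (j x e2 (push i x v1) - j x e1 (push i x v2))].

(** [(U, piU)] is the manifold [U] with the Poisson structure whose graph is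
    [(pr^! (i^! L_pi))^eta]. *)
Definition local_model X M (i : X -> M) (pi : bivector M) (r : nat)
    (eta : perp_dual i pi r -> tvec (perp_dual i pi r) ->
           tvec (perp_dual i pi r) -> R^o)
    (U : set (perp_dual i pi r)) (piU : bivector (perp_dual i pi r)) : Prop :=
  let pr : perp_dual i pi r -> X := @base X M (perp i pi) in
  [/\ mopen U, (forall x, U (@zero_section X M (perp i pi) x)), poisson_on U piU &
      forall e, U e -> gauge_transform (dpull pr (dpull i (poisson_graph pi))) eta e = poisson_graph piU e].

(** * The local Poisson saturation *)

Definition poisson_spray M (pi : bivector M)
    (chi : cotangent_bundle M -> tvec (cotangent_bundle M)) : Prop :=
  let pr : cotangent_bundle M -> M := @base M M (@tangent M) in
  let m (t : R) : cotangent_bundle M -> cotangent_bundle M :=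
    @fib_scale M M (@tangent M) t in
  [/\ (forall xi, vfield_at xi chi),
      (forall xi, push pr xi (chi xi) = sharp pi (pr xi) (fib xi)) &
      (forall t xi, 0 < t -> push (m t^-1) (m t xi) (chi (m t xi)) = t *: chi xi)].

(** [p = exp_chi xi], the flow of [xi] being defined for [t] in [[0, 1]]. *)
Definition spray_exp M (chi : cotangent_bundle M -> tvec (cotangent_bundle M))
    (xi : cotangent_bundle M) (p : M) : Prop :=
  exists (gam : R -> cotangent_bundle M) (eps : R),
    [/\ 0 < eps, gam 0 = xi, integral_curve chi gam (- eps) (1 + eps) &
        p = base (gam 1)].

(** [k : P -> M] embeds [P] as the submanifold
    [exp_chi ((TX^perp)^* `&` Sigma)], where [Sigma] is small enough for the
    latter to have the properties listed, and [piP] is the induced Poisson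
    structure. *)
Definition local_saturation X P M (i : X -> M) (pi : bivector M) (r : nat)
    (k : P -> M) (piP : bivector P) : Prop :=
  [/\ poisson_submanifold pi k, poisson_on setT piP, poisson_map_on setT piP pi k &
    exists chi (W : X -> set (tvec M)) (Sigma : set (cotangent_bundle M)),
    [/\ [/\ poisson_spray pi chi, is_complement i pi r W, mopen Sigma,
            (forall q, Sigma (@zero_section M M (@tangent M) q)) &
            (forall xi, Sigma xi -> exists p, spray_exp chi xi p)],
        range k = [set p | exists (e : perp_dual i pi r) xi,
          [/\ Sigma xi, base xi = i (base e),
              fib xi = jmap i pi W (base e) (fib e) & spray_exp chi xi p]],
        range i `<=` range k,
        range k = [set p | exists xi,
          [/\ Sigma xi, range i (base xi) & spray_exp chi xi p]] &
        exists V, [/\ mopen V, range i `<=` V &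
                      range k = saturation V pi (range i)]]].

Definition poisson_diffeo M N (V : set M) (piM : bivector M) (U : set N)
    (piN : bivector N) : Prop :=
  exists (phi : M -> N) (psi : N -> M),
  [/\ (forall p, V p -> [/\ U (phi p), psi (phi p) = p & smooth_map_at phi p]),
      (forall q, U q -> [/\ V (psi q), phi (psi q) = q & smooth_map_at psi q]) &
      poisson_map_on V piM piN phi].

End Tangent.

(* Main.v *)
(* Moser's argument. Let E be the dual of the bundle TX^perp. The exponential of
   the spray, restricted to E, lifts to a map f from a neighborhood of X in E to
   the saturation P; a counting argument with Baire's theorem gives
   dim P = dim E. With m_t the fibrewise dilation by t and alpha the contraction
   of eta with the Euler field, consider the equations
     eta(w, -) - m_t^*eta(w, -) + (f o m_t)^*beta = alpha,
     d(f o m_t) w = pi_P^#(beta)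
   in the pair (w, beta). Along X their matrix is invertible because
   eta = - sigma - tau there, and w vanishes to first order on X, so the flow psi
   of w is defined up to time 1 near X. The map f o psi_1 pulls the Dirac
   structure of pi_P back to the local model, is injective near X because it is
   the inclusion of X on the zero section, and is inverted by the inverse
   function theorem. *)
From HB Require Import structures.
Require Import Defs.
From mathcomp Require Import all_boot all_order all_algebra.
From mathcomp Require Import all_classical all_reals all_analysis.
From mathcomp Require Import ring lra.
Set Implicit Arguments.
Unset Strict Implicit.
Unset Printing Implicit Defensive.
Import Order.TTheory GRing.Theory Num.Theory numFieldNormedType.Exports.
Local Open Scope classical_set_scope.
Local Open Scope ring_scope.

(** Let $L_t$ be the pull-back by $f \circ m_t$ of the Dirac structure of $\pi_P$, gauge transformed
    by $\eta - m_t^*\eta$. As $f \circ m_0$ is the inclusion of $X$ after the projection and $\eta$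
    has no component on $TX$, $L_0$ is the Dirac structure of the local model, and $L_1$ is the
    plain pull-back by $f$. The system says that $(w, \alpha)$ lies in $L_t$. The field that is
    integrated is $u = (w - \mathrm{Euler})/t$, since $m_t$ itself contributes the velocity
    $\mathrm{Euler}/t$. It is smooth at $t = 0$ because the Euler field with $\beta = 0$ solves the
    system there, and its derivative vanishes along $X$ because $w$ and the Euler field have the
    same linear part. $X$ need not be compact: flows exist near single points and are glued by
    uniqueness, and injectivity near $X$ rests on a countable base and starlike neighborhoods. The
    saturation is given as a set of values of the exponential, for a complement that may differ from
    $W$; its dimension has to be read off from a smooth surjection. *)

Notation ev i := (delta_mx 0 i).
Notation is_d t := (is_derive (t : _^o) (1 : _^o)).

(** * Differentiability and functions of class C^k on row vectors *)

Section Calculus.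
Context {R : realType}.

Lemma near_dist (V : normedModType R) (z : V) e : 0 < e -> \forall y \near z, `|y - z| < e.
Proof. by move=> e0; apply/nbhs_normP; exists e => //= x; rewrite distrC. Qed.

Lemma norm_ballE (V : normedModType R) (z : V) (e : R) : [set y | `|y - z| < e] = ball z e.
Proof. by rewrite -ball_normE; apply/seteqP; split=> y /=; rewrite distrC. Qed.

(** The differential is phrased with little-o; this lemma and [diff_eps_ex] trade it for explicit
    estimates, the form in which mean value arguments deliver their conclusions. *)
Lemma diff_eps (V W : normedModType R) (f : V -> W) (df : {linear V -> W}) x :
 continuous df ->
 (forall e : R, 0 < e -> \forall h \near (0 : V),
   `|f (h + x) - f x - df h| <= e * `|h|) ->
 differentiable f x /\ 'd f x = df :> (V -> W).
Proof.
move=> cdf fe.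
have fo : f \o shift x = cst (f x) + df +o_ 0 id.
 apply/eqaddoP => e e0; near=> h.
 have : `|f (h + x) - f x - df h| <= e * `|h| by near: h; exact: fe.
 by rewrite opprD addrA.
have dfE := diff_unique cdf fo; split => //.
by apply/diff_locallyP; rewrite dfE; split.
Unshelve. all: by end_near. Qed.

Lemma diff_eps_ex (V W : normedModType R) (f : V -> W) x :
 differentiable f x -> forall e : R, 0 < e ->
  \forall h \near (0 : V), `|f (h + x) - f x - 'd f x h| <= e * `|h|.
Proof.
move=> /diff_locallyP[_ /eqaddoP fo] e e0; have {fo} := fo e e0.
by apply: filterS => h /=; rewrite /cst !fctE /= opprD addrA.
Qed.

Lemma differentiable_near (V W : normedModType R) (f g : V -> W) x :
 (\forall z \near x, f z = g z) -> differentiable f x -> differentiable g x.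
Proof.
move=> fg df; have cdf : continuous ('d f x) by exact: diff_continuous.
apply: (proj1 (diff_eps cdf _)).
move=> e e0; have [r /= r0 hr] := (nbhs_normP _ _).1 fg.
have hb : \forall h \near (0 : V), `|h| < r.
 by apply/nbhs_normP; exists r => //= h; rewrite /= ?sub0r ?normrN ?subr0 ?add0r ?normrN.
apply: filterS2 (diff_eps_ex df e0) hb => h fh hh.
rewrite -(nbhs_singleton fg) -(hr (h + x)) //=.
by rewrite opprD addrCA subrr addr0 normrN.
Qed.

Lemma continuous_near (V W : topologicalType) (f g : V -> W) x :
 (\forall z \near x, f z = g z) -> {for x, continuous f} ->
 {for x, continuous g}.
Proof.
move=> fg cf; rewrite /prop_for /continuous_at -(nbhs_singleton fg).
by apply: cvg_trans cf; exact: (@near_eq_cvg _ _ (nbhs x)).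
Qed.

Lemma rV_coord_sum (V : normedModType R) m (g : V -> 'rV[R]_m) :
 g = \sum_(j < m) (fun z => (g z 0 j : R^o) *: (ev j : 'rV[R]_m)).
Proof.
by apply/funext => z; rewrite fct_sumE [LHS]row_sum_delta.
Qed.

Lemma diff_rVP (V : normedModType R) m (g : V -> 'rV[R]_m) x :
 differentiable g x <-> forall j, differentiable (fun z => g z 0 j : R^o) x.
Proof.
split=> [dg j|dg].
 exact: (differentiable_comp dg (differentiable_coord _ _ _)).
rewrite (rV_coord_sum g); apply: differentiable_sum => j.
exact: differentiableZl.
Qed.

Lemma cont_rVP (V : topologicalType) m (g : V -> 'rV[R]_m) x :
 {for x, continuous g} <->
 forall j, {for x, continuous (fun z => g z 0 j : R^o)}.
Proof.
split=> [dg j|dg].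
 apply: (@continuous_comp _ _ _ g (fun N : 'rV[R]_m => N 0 j : R^o)) => //.
 exact: coord_continuous.
apply/cvgrPdist_lt => e e0; near=> y.
rewrite [ltLHS]/Num.Def.normr/= mx_normrE (bigmax_lt _ e0)//= => -[i j] _.
rewrite !mxE /= (ord1 i); move: j; near: y; apply: filter_forall => j.
by move/cvgrPdist_lt: (dg j) => /(_ e e0).
Unshelve. all: by end_near. Qed.

Lemma derive_rV n m (g : 'rV[R]_n -> 'rV[R]_m) x v j :
 derivable g x v ->
 ('D_v g x) 0 j = 'D_v (fun z => g z 0 j : R^o) x.
Proof. by move=> dg; rewrite derive_mx ?mxE. Qed.

Lemma derive_sumE n (W : normedModType R) (f : 'rV[R]_n -> W) x v :
 differentiable f x -> 'D_v f x = \sum_(i < n) v 0 i *: 'D_(ev i) f x.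
Proof.
move=> df; rewrite deriveE // {1}(row_sum_delta v) linear_sum.
by apply: eq_bigr => i _; rewrite linearZ /= deriveE.
Qed.

Lemma derive_compE (U V W : normedModType R) (g : U -> V)
  (f : V -> W) x v :
 differentiable g x -> differentiable f (g x) ->
 'D_v (f \o g) x = 'D_('D_v g x) f (g x).
Proof.
move=> dg df; rewrite deriveE; last exact: differentiable_comp.
by rewrite diff_comp //= !deriveE.
Qed.

(** [Ck] refers to the total function ['D_v g], and functions that agree on [O] have unrelated
    derivatives elsewhere. As [O] is open, the derivatives agree on [O] again and the induction goes
    on. *)
Lemma Ck_eq n (W : normedModType R) k (O : set 'rV[R]_n) (f g : 'rV[R]_n -> W) :
 open O -> (forall x, O x -> f x = g x) -> Ck k O f -> Ck k O g.
Proof.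
move=> oO; have nO x : O x -> \forall z \near x, O z.
 by move=> Ox; exact: open_nbhs_nbhs.
elim: k f g => [|k IH] f g fg.
 move=> cf x Ox; apply: continuous_near (cf x Ox).
 by apply: filterS (nO x Ox) => z; exact: fg.
have nfg x : O x -> \forall z \near x, f z = g z.
 by move=> Ox; apply: filterS (nO x Ox) => z; exact: fg.
move=> [df Df]; split=> [x Ox|v].
 exact: differentiable_near (nfg x Ox) (df x Ox).
apply: IH (Df v) => x Ox; exact: near_eq_derive (nfg x Ox).
Qed.

Lemma Ck_sub n (W : normedModType R) k (O O' : set 'rV[R]_n) (f : 'rV[R]_n -> W) :
 O' `<=` O -> Ck k O f -> Ck k O' f.
Proof.
move=> sO; elim: k f => [|k IH] f; first by move=> cf x /sO; exact: cf.
by move=> [df Df]; split=> [x /sO|v]; [exact: df|exact: IH (Df v)].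
Qed.

Lemma Ck_S n (W : normedModType R) k (O : set 'rV[R]_n) (f : 'rV[R]_n -> W) :
 Ck k.+1 O f -> Ck k O f.
Proof.
elim: k f => [|k IH] f [df Df]; last by split=> // v; exact: IH (Df v).
by move=> x Ox; exact: differentiable_continuous (df x Ox).
Qed.

Lemma Ck_cst n (W : normedModType R) k (O : set 'rV[R]_n) (w : W) :
 Ck k O (fun _ => w).
Proof.
elim: k w => [|k IH] w; first by move=> x _; exact: cst_continuous.
split=> [x _|v]; first exact: differentiable_cst.
by rewrite (_ : 'D_v _ = fun=> 0) //; apply/funext => x; exact: derive_cst.
Qed.

Lemma Ck_lin n m k (O : set 'rV[R]_n) (A : 'M[R]_(n, m)) :
 Ck k O (fun z => z *m A).
Proof.
have dA x : differentiable (fun z : 'rV[R]_n => z *m A) x.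
 apply/diff_rVP => j; under eq_fun do rewrite mxE.
 rewrite (_ : (fun _ => _) = \sum_i (fun z : 'rV[R]_n => z 0 i *: A i j : R^o)).
  apply: differentiable_sum => i; apply: differentiableZl.
  exact: differentiable_coord.
 by apply/funext => z; rewrite fct_sumE.
case: k => [|k]; first by move=> x _; exact: differentiable_continuous.
split=> // v; rewrite (_ : 'D_v _ = fun=> v *m A); first exact: Ck_cst.
apply/funext => x; rewrite deriveE // (_ : (fun z => _) = mulmxr A) //.
rewrite diff_lin // => z; exact: differentiable_continuous.
Qed.

Lemma Ck_coord n k (O : set 'rV[R]_n) j : Ck k O (fun z : 'rV[R]_n => z 0 j : R^o).
Proof.
have dA x : differentiable (fun z : 'rV[R]_n => z 0 j : R^o) x.
 exact: differentiable_coord.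
case: k => [|k]; first by move=> x _; exact: differentiable_continuous.
split=> // v; rewrite (_ : 'D_v _ = fun=> v 0 j); first exact: Ck_cst.
apply/funext => x; rewrite deriveE //.
have @f : {linear 'rV[R]_n -> R^o}.
 by exists (fun N : 'rV[R]_n => N 0 j); do 2![eexists]; do ?[constructor];
   rewrite ?mxE// => ? *; rewrite ?mxE//; move=> ?; rewrite !mxE.
rewrite (_ : (fun _ => _) = f) // diff_lin // => z; exact: coord_continuous.
Qed.

Lemma Ck_add n (W : normedModType R) k (O : set 'rV[R]_n) (f g : 'rV[R]_n -> W) :
 open O -> Ck k O f -> Ck k O g -> Ck k O (fun z => f z + g z).
Proof.
move=> oO; elim: k f g => [|k IH] f g.
 by move=> cf cg x Ox; apply: continuousD; [exact: cf|exact: cg].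
move=> [df Df] [dg Dg]; split=> [x Ox|v].
 by apply: differentiableD; [exact: df|exact: dg].
apply: Ck_eq (IH _ _ (Df v) (Dg v)) => // x Ox.
by rewrite deriveD //; apply: diff_derivable; [exact: df|exact: dg].
Qed.

Lemma Ck_mul n k (O : set 'rV[R]_n) (f g : 'rV[R]_n -> R^o) :
 open O -> Ck k O f -> Ck k O g -> Ck k O (fun z => f z * g z : R^o).
Proof.
move=> oO; elim: k f g => [|k IH] f g.
 by move=> cf cg x Ox; apply: continuousM; [exact: cf|exact: cg].
move=> hf hg; have [df Df] := hf; have [dg Dg] := hg; split=> [x Ox|v].
 by apply: differentiableM; [exact: df|exact: dg].
apply: Ck_eq (Ck_add oO (IH _ _ (Ck_S hf) (Dg v)) (IH _ _ (Ck_S hg) (Df v))) => //.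
by move=> x Ox; rewrite deriveM //; apply: diff_derivable; [exact: df|exact: dg].
Qed.

Lemma Ck_sum n (W : normedModType R) k (O : set 'rV[R]_n) (I : finType)
  (f : I -> 'rV[R]_n -> W) : open O ->
 (forall i, Ck k O (f i)) -> Ck k O (fun z => \sum_i f i z).
Proof.
move=> oO hf; rewrite (_ : (fun _ => _) = \sum_i f i); last first.
 by apply/funext => z; rewrite fct_sumE.
elim/big_ind: _ => [|g h|i _]; [exact: Ck_cst|exact: Ck_add|exact: hf].
Qed.

(** The derivative of $1/f$ is $-f^{-2}\,Df$, in which $1/f$ is not differentiated any more, so the
    induction hypothesis on $1/f$ itself closes the step. *)
Lemma Ck_inv n k (O : set 'rV[R]_n) (f : 'rV[R]_n -> R^o) :
 open O -> (forall x, O x -> f x != 0) -> Ck k O f ->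
 Ck k O (fun z => (f z)^-1 : R^o).
Proof.
move=> oO f0; elim: k => [|k IH].
 by move=> cf x Ox; apply: continuousV; [exact: f0|exact: cf].
move=> hf; have [df Df] := hf; split=> [x Ox|v].
 by apply: differentiableV; [exact: df|exact: f0].
have hV := IH (Ck_S hf).
apply: Ck_eq (Ck_mul oO (Ck_mul oO (Ck_cst k O (-1 : R^o)) (Ck_mul oO hV hV)) (Df v)) => //.
move=> x Ox; rewrite deriveV; first by rewrite mulN1r -invfM -expr2.
 exact: f0.
by apply: diff_derivable; exact: df.
Qed.

Lemma Ck_rVP n m k (O : set 'rV[R]_n) (g : 'rV[R]_n -> 'rV[R]_m) : open O ->
 Ck k O g <-> forall j, Ck k O (fun z => g z 0 j : R^o).
Proof.
move=> oO; elim: k g => [|k IH] g.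
 split=> [cg j x Ox|cg x Ox]; first exact: (cont_rVP _ _).1 (cg _ Ox) j.
 by apply/cont_rVP => j; exact: cg.
split=> [[dg Dg] j|hg].
 split=> [x Ox|v]; first by move/diff_rVP: (dg _ Ox).
 apply: Ck_eq ((IH _).1 (Dg v) j) => // x Ox; rewrite derive_rV //.
 exact/diff_derivable/dg.
have dg x : O x -> differentiable g x.
 by move=> Ox; apply/diff_rVP => j; exact: (hg j).1.
split=> // v; apply/IH => j; apply: Ck_eq ((hg j).2 v) => // x Ox.
by rewrite derive_rV //; exact/diff_derivable/dg.
Qed.

(** The chain rule in coordinates turns the derivative into a sum of products. [f] enters through
    its partial derivatives, which is why the induction generalizes over [f] while [g] stays
    fixed. *)
Lemma Ck_comp n m k (O : set 'rV[R]_n) (O' : set 'rV[R]_m)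
  (g : 'rV[R]_n -> 'rV[R]_m) (f : 'rV[R]_m -> R^o) :
 open O -> open O' -> (forall x, O x -> O' (g x)) ->
 Ck k O g -> Ck k O' f -> Ck k O (f \o g).
Proof.
move=> oO oO' OO'; elim: k f => [|k IH] f.
 by move=> cg cf x Ox; apply: continuous_comp; [exact: cg|exact/cf/OO'].
move=> hg [df Df]; have [dg Dg] := hg; split=> [x Ox|v].
 by apply: differentiable_comp; [exact: dg|exact/df/OO'].
apply: (@Ck_eq _ _ _ _
 (fun x => \sum_i ('D_v g x) 0 i * ('D_(ev i) f \o g) x : R^o)) => //.
 move=> x Ox; rewrite (derive_compE v (dg x Ox) (df _ (OO' _ Ox))).
 by rewrite (derive_sumE _ (df _ (OO' _ Ox))).
apply: Ck_sum => // i; apply: Ck_mul => //.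
 by move: i; apply/(Ck_rVP k _ oO); exact: Dg.
by apply: IH; [exact: Ck_S|exact: Df].
Qed.

End Calculus.

(** * Germs of smooth functions and smooth matrices *)

Section Germs.
Context {R : realType}.

(** Smoothness of a germ: the domain is hidden, so that sums, products, inverses and composites can
    be formed without intersecting domains by hand. *)
Definition sm n (W : normedModType R) (x : 'rV[R]_n) (f : 'rV[R]_n -> W) :=
 exists O, [/\ open O, O x & smooth_on O f].

Lemma sm_on n (W : normedModType R) (O : set 'rV[R]_n) x (f : 'rV[R]_n -> W) :
 open O -> O x -> smooth_on O f -> sm x f.
Proof. by exists O. Qed.

Lemma sm_nbhs n (W : normedModType R) x (f : 'rV[R]_n -> W) :
 sm x f -> \forall z \near x, sm z f.
Proof.
move=> [ O [oO Ox sf]]; apply: filterS (open_nbhs_nbhs (conj oO Ox)) => z Oz.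
by exists O.
Qed.

Lemma sm_open n (W : normedModType R) (O : set 'rV[R]_n) (f : 'rV[R]_n -> W) :
 open O -> (forall x, O x -> sm x f) -> smooth_on O f.
Proof.
move=> oO hf k; elim: k f hf => [|k IH] f hf.
 move=> x /hf [ O' [_ O'x /(_ 0%N)]]; exact.
split=> [x /hf [ O' [_ O'x /(_ 1%N)[+ _]]]|v]; first exact.
apply: IH => x /hf [ O' [oO' O'x sf]]; exists O'; split=> // j.
by have [_] := sf j.+1; exact.
Qed.

Lemma sm_near n (W : normedModType R) x (f g : 'rV[R]_n -> W) :
 (\forall z \near x, f z = g z) -> sm x f -> sm x g.
Proof.
move=> /nbhs_normP[r /= r0 hr] [ O [oO Ox sf]]; exists (O `&` ball x r); split.
- by apply: openI => //; exact: ball_open.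
- by split=> //; exact: ballxx.
move=> k; apply: (@Ck_eq _ _ _ _ _ f).
- by apply: openI => //; exact: ball_open.
- by move=> z [_]; rewrite -ball_normE; exact: hr.
- by apply: Ck_sub (sf k) => z [].
Qed.

Lemma sm_diff n (W : normedModType R) x (f : 'rV[R]_n -> W) :
 sm x f -> differentiable f x.
Proof. by move=> [ O [_ Ox /(_ 1%N)[+ _]]]; exact. Qed.

Lemma sm_cont n (W : normedModType R) x (f : 'rV[R]_n -> W) :
 sm x f -> {for x, continuous f}.
Proof. by move=> /sm_diff; exact: differentiable_continuous. Qed.

Lemma sm_D n (W : normedModType R) x (f : 'rV[R]_n -> W) v :
 sm x f -> sm x ('D_v f).
Proof.
by move=> [ O [oO Ox sf]]; exists O; split=> // k; have [_] := sf k.+1; exact.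
Qed.

Lemma sm2 n (W W' : normedModType R) x (f : 'rV[R]_n -> W) (g : 'rV[R]_n -> W') :
 sm x f -> sm x g ->
 exists O, [/\ open O, O x, smooth_on O f & smooth_on O g].
Proof.
move=> [ O [oO Ox sf]] [ O' [oO' O'x sg]]; exists (O `&` O'); split=> //.
- exact: openI.
- by move=> k; apply: Ck_sub (sf k) => z [].
- by move=> k; apply: Ck_sub (sg k) => z [].
Qed.

Lemma sm_cst n (W : normedModType R) (x : 'rV[R]_n) (w : W) : sm x (fun _ => w).
Proof.
by exists setT; split=> //; [exact: openT|move=> k; exact: Ck_cst].
Qed.

Lemma sm_lin n m (x : 'rV[R]_n) (A : 'M[R]_(n, m)) : sm x (fun z => z *m A).
Proof.
by exists setT; split=> //; [exact: openT|move=> k; exact: Ck_lin].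
Qed.

Lemma sm_coord n (x : 'rV[R]_n) j : sm x (fun z : 'rV[R]_n => z 0 j : R^o).
Proof.
by exists setT; split=> //; [exact: openT|move=> k; exact: Ck_coord].
Qed.

Lemma sm_id n (x : 'rV[R]_n) : sm x id.
Proof. by have := sm_lin x 1%:M; under eq_fun do rewrite mulmx1. Qed.

Lemma sm_add n (W : normedModType R) x (f g : 'rV[R]_n -> W) :
 sm x f -> sm x g -> sm x (fun z => f z + g z).
Proof.
move=> sf sg; have [ O [oO Ox hf hg]] := sm2 sf sg.
by exists O; split=> // k; exact: Ck_add.
Qed.

Lemma sm_mul n x (f g : 'rV[R]_n -> R^o) :
 sm x f -> sm x g -> sm x (fun z => f z * g z : R^o).
Proof.
move=> sf sg; have [ O [oO Ox hf hg]] := sm2 sf sg.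
by exists O; split=> // k; exact: Ck_mul.
Qed.

Lemma sm_opp n x (f : 'rV[R]_n -> R^o) : sm x f -> sm x (fun z => - f z : R^o).
Proof.
move=> sf; under eq_fun do rewrite -mulN1r.
by apply: sm_mul => //; exact: sm_cst.
Qed.

Lemma sm_sub n x (f g : 'rV[R]_n -> R^o) :
 sm x f -> sm x g -> sm x (fun z => f z - g z : R^o).
Proof. by move=> sf sg; apply: sm_add => //; exact: sm_opp. Qed.

Lemma sm_sum n (W : normedModType R) (I : finType) (P : pred I) x
  (f : I -> 'rV[R]_n -> W) :
 (forall i, sm x (f i)) -> sm x (fun z => \sum_(i | P i) f i z).
Proof.
move=> hf; under eq_fun do rewrite big_mkcond /=.
elim: (index_enum I) => [|i s IH].
 by under eq_fun do rewrite big_nil; exact: sm_cst.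
under eq_fun do rewrite big_cons; apply: sm_add => //.
by case: (P i) => //; exact: sm_cst.
Qed.

Lemma sm_prod n (I : finType) (P : pred I) x (f : I -> 'rV[R]_n -> R^o) :
 (forall i, sm x (f i)) -> sm x (fun z => \prod_(i | P i) f i z : R^o).
Proof.
move=> hf; under eq_fun do rewrite big_mkcond /=.
elim: (index_enum I) => [|i s IH].
 by under eq_fun do rewrite big_nil; exact: sm_cst.
under eq_fun do rewrite big_cons; apply: sm_mul => //.
by case: (P i) => //; exact: sm_cst.
Qed.

Lemma sm_inv n x (f : 'rV[R]_n -> R^o) :
 sm x f -> f x != 0 -> sm x (fun z => (f z)^-1 : R^o).
Proof.
move=> sf f0; have [ O [oO Ox hf]] := sf.
have /nbhs_normP[r /= r0 hr] : \forall z \near x, f z != 0.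
 have /cvgrPdist_lt cf := sm_cont sf.
 have e0 : 0 < `|f x| by rewrite normr_gt0.
 apply: filterS (cf _ e0) => z /=; apply: contraTneq => ->.
 by rewrite subr0 ltxx.
have oO' : open (O `&` ball x r) by apply: openI => //; exact: ball_open.
exists (O `&` ball x r); split=> //; first by split=> //; exact: ballxx.
move=> k; apply: Ck_inv => //.
 by move=> z [_]; rewrite -ball_normE; exact: hr.
by apply: Ck_sub (hf k) => z [].
Qed.

Lemma sm_rVP n m x (g : 'rV[R]_n -> 'rV[R]_m) :
 sm x g <-> forall j, sm x (fun z => g z 0 j : R^o).
Proof.
split=> [[ O [oO Ox sg]] j|hg].
 by exists O; split=> // k; apply: (Ck_rVP k _ oO).1.
rewrite (_ : g = fun z => \sum_(j < m) g z 0 j *: ev j); last first.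
 by apply/funext => z; rewrite [LHS]row_sum_delta.
apply: sm_sum => j; have [ O [oO Ox sg]] := hg j; exists O; split=> // k.
apply/(Ck_rVP k _ oO) => l; under eq_fun do rewrite !mxE.
by apply: Ck_mul => //; exact: Ck_cst.
Qed.

Lemma sm_comp n m x (g : 'rV[R]_n -> 'rV[R]_m) (f : 'rV[R]_m -> R^o) :
 sm x g -> sm (g x) f -> sm x (f \o g).
Proof.
move=> sg [ O' [oO' O'x sf]]; have [ O [oO Ox hg]] := sg.
have /nbhs_normP[r /= r0 hr] : \forall z \near x, O' (g z).
 apply: (sm_cont sg); exact: open_nbhs_nbhs.
have oB : open (O `&` ball x r) by apply: openI => //; exact: ball_open.
exists (O `&` ball x r); split=> //; first by split=> //; exact: ballxx.
move=> k; apply: (Ck_comp oB oO') (sf k).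
 by move=> z [_]; rewrite -ball_normE; exact: hr.
by apply: Ck_sub (hg k) => z [].
Qed.

Lemma sm_comp_rV n m p x (g : 'rV[R]_n -> 'rV[R]_m) (f : 'rV[R]_m -> 'rV[R]_p) :
 sm x g -> sm (g x) f -> sm x (f \o g).
Proof.
move=> sg /sm_rVP sf; apply/sm_rVP => j.
exact: (@sm_comp _ _ _ g (fun z => f z 0 j : R^o)).
Qed.

(** Smoothness entry by entry, so that products, determinants and inverses of matrices reduce to
    scalar functions. *)
Definition smM n p q (x : 'rV[R]_n) (A : 'rV[R]_n -> 'M[R]_(p, q)) :=
 forall i j, sm x (fun z => A z i j : R^o).

Lemma smM_mul n p q s x (A : 'rV[R]_n -> 'M[R]_(p, q)) (B : 'rV[R]_n -> 'M[R]_(q, s)) :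
 smM x A -> smM x B -> smM x (fun z => A z *m B z).
Proof.
move=> sA sB i j; under eq_fun do rewrite mxE.
by apply: sm_sum => k; exact: sm_mul.
Qed.

Lemma smM_tr n p q x (A : 'rV[R]_n -> 'M[R]_(p, q)) :
 smM x A -> smM x (fun z => (A z)^T).
Proof. by move=> sA i j; under eq_fun do rewrite mxE; exact: sA. Qed.

Lemma smM_add n p q x (A B : 'rV[R]_n -> 'M[R]_(p, q)) :
 smM x A -> smM x B -> smM x (fun z => A z + B z).
Proof. by move=> sA sB i j; under eq_fun do rewrite mxE; exact: sm_add. Qed.

Lemma smM_opp n p q x (A : 'rV[R]_n -> 'M[R]_(p, q)) :
 smM x A -> smM x (fun z => - A z).
Proof. by move=> sA i j; under eq_fun do rewrite mxE; exact: sm_opp. Qed.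

Lemma smM_cst n p q (x : 'rV[R]_n) (A : 'M[R]_(p, q)) : smM x (fun _ => A).
Proof. by move=> i j; exact: sm_cst. Qed.

Lemma smM_row n q (x : 'rV[R]_n) (A : 'rV[R]_n -> 'rV[R]_q) :
 smM x A <-> sm x A.
Proof.
split=> [sA|/sm_rVP sA i j]; first by apply/sm_rVP => j; exact: sA.
by rewrite (ord1 i); exact: sA.
Qed.

Lemma smM_det n p x (A : 'rV[R]_n -> 'M[R]_p) :
 smM x A -> sm x (fun z => \det (A z) : R^o).
Proof.
move=> sA; rewrite /determinant; apply: sm_sum => s; apply: sm_mul.
 exact: sm_cst.
by apply: sm_prod => i; exact: sA.
Qed.

(** Cramer's formula, valid where the determinant does not vanish. This holds near [x]; elsewhere
    [invmx] returns its argument, hence the detour through [sm_near]. *)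
Lemma smM_invmx n p x (A : 'rV[R]_n -> 'M[R]_p) :
 smM x A -> A x \in unitmx -> smM x (fun z => invmx (A z)).
Proof.
move=> sA uA; have dA := smM_det sA.
have nz : \det (A x) != 0 by rewrite -unitfE -unitmxE.
have ev : \forall z \near x, A z \in unitmx.
 have /cvgrPdist_lt cf := sm_cont dA.
 have e0 : 0 < `|\det (A x)| by rewrite normr_gt0.
 apply: filterS (cf _ e0) => z /=; rewrite unitmxE unitfE.
 by apply: contraTneq => ->; rewrite subr0 ltxx.
move=> i j; apply: (@sm_near _ _ _ (fun z => (\det (A z))^-1 * (\adj (A z)) i j)).
 by apply: filterS ev => z uz; rewrite /invmx uz !mxE.
apply: sm_mul; first exact: sm_inv.
under eq_fun do rewrite mxE; rewrite /cofactor; apply: sm_mul; first exact: sm_cst.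
by apply: smM_det => k l; under eq_fun do rewrite !mxE; exact: sA.
Qed.

Lemma smM_block n p1 p2 q1 q2 x (A : 'rV[R]_n -> 'M[R]_(p1, q1)) B C
  (D : 'rV[R]_n -> 'M[R]_(p2, q2)) :
 smM x A -> smM x B -> smM x C -> smM x D ->
 smM x (fun z => block_mx (A z) (B z) (C z) (D z)).
Proof.
move=> sA sB sC sD i j.
case: (split_ordP i) => i' ->; case: (split_ordP j) => j' ->.
- by under eq_fun do rewrite block_mxEul; exact: sA.
- by under eq_fun do rewrite block_mxEur; exact: sB.
- by under eq_fun do rewrite block_mxEdl; exact: sC.
- by under eq_fun do rewrite block_mxEdr; exact: sD.
Qed.

Lemma smM_rowmx n p q1 q2 x (A : 'rV[R]_n -> 'M[R]_(p, q1)) (B : 'rV[R]_n -> 'M[R]_(p, q2)) :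
 smM x A -> smM x B -> smM x (fun z => row_mx (A z) (B z)).
Proof.
move=> sA sB i j; case: (split_ordP j) => j' ->.
- by under eq_fun do rewrite row_mxEl; exact: sA.
- by under eq_fun do rewrite row_mxEr; exact: sB.
Qed.

Lemma smM_comp n m p q x (g : 'rV[R]_n -> 'rV[R]_m) (A : 'rV[R]_m -> 'M[R]_(p, q)) :
 sm x g -> smM (g x) A -> smM x (fun z => A (g z)).
Proof. by move=> sg sA i j; exact: (@sm_comp _ _ _ g (fun z => A z i j : R^o)). Qed.

(** Vectors are rows: the derivative along [v] is [v *m Jac g x], so this is the transpose of the
    usual Jacobian matrix and the chain rule multiplies from left to right. *)
Definition Jac n m (g : 'rV[R]_n -> 'rV[R]_m) (x : 'rV[R]_n) : 'M[R]_(n, m) :=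
 \matrix_(i, j) ('D_(ev i) g x) 0 j.

Lemma JacE n m (g : 'rV[R]_n -> 'rV[R]_m) x v :
 differentiable g x -> 'D_v g x = v *m Jac g x.
Proof.
move=> dg; rewrite derive_sumE //; apply/rowP => j; rewrite summxE !mxE.
by apply: eq_bigr => i _; rewrite !mxE.
Qed.

Lemma smM_Jac n m (g : 'rV[R]_n -> 'rV[R]_m) x : sm x g -> smM x (Jac g).
Proof.
move=> sg i j; under eq_fun do rewrite mxE.
by move: j; apply/sm_rVP; exact: sm_D.
Qed.

Lemma Jac_comp n m p (g : 'rV[R]_n -> 'rV[R]_m) (f : 'rV[R]_m -> 'rV[R]_p) x :
 differentiable g x -> differentiable f (g x) ->
 Jac (f \o g) x = Jac g x *m Jac f (g x).
Proof.
move=> dg df; apply/row_matrixP => i; rewrite !rowE mulmxA -(JacE _ dg) -(JacE _ df).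
by rewrite -(JacE _ (differentiable_comp dg df)) derive_compE.
Qed.

Lemma line_derive n (W : normedModType R) (f : 'rV[R]_n -> W) x v (t : R) :
 differentiable f (x + t *: v) ->
 is_d t (fun s : R^o => f (x + s *: v)) ('D_v f (x + t *: v)).
Proof.
move=> df; have dl : is_d t (fun s : R^o => x + s *: v) v.
 rewrite -[X in is_derive _ _ _ X]add0r.
 apply: is_deriveD; apply: DeriveDef; first exact/diff_derivable.
 by rewrite deriveE // diff_val /= scale1r.
have [dl1 dl2] := dl; have dl3 : differentiable (fun s : R^o => x + s *: v) t.
 exact/derivable1_diffP.
apply: DeriveDef; first by apply: diff_derivable; exact: differentiable_comp.
by rewrite (derive_compE (f := f) _ dl3) // dl2.
Qed.

End Germs.

Notation scomp g f := (@sm_comp_rV _ _ _ _ _ g f).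

(** * Mean value estimates, Gronwall bounds and symmetry of second derivatives *)

Section MeanValue.
Context {R : realType}.

Lemma MVT_real (f df : R -> R) (a b : R) : a < b ->
 (forall s, a <= s <= b -> {for s, continuous f}) ->
 (forall s, a < s < b -> is_d s (f : R^o -> R^o) (df s)) ->
 exists2 c, a < c < b & f b - f a = df c * (b - a).
Proof.
move=> ab cf dfE.
have d x : x \in `]a, b[%R -> is_derive (x : R) 1 f (df x) by rewrite in_itv /= => /dfE.
have c : {within `[a, b], continuous f}.
 apply: continuous_in_subspaceT => x; rewrite inE /= in_itv /=; exact: cf.
by have [x] := MVT ab d c; rewrite in_itv /=; exists x.
Qed.

Lemma is_d_cont (W : normedModType R) (f : R^o -> W) s df :
 is_d s f df -> {for s, continuous f}.
Proof. by move=> [/derivable1_diffP /differentiable_continuous]. Qed.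

Lemma is_d_rVP m (g : R^o -> 'rV[R]_m) (s : R) (dg : 'rV[R]_m) :
 is_d s g dg <->
 forall j, is_d s (fun z => g z 0 j : R^o) (dg 0 j).
Proof.
split=> [[d1 d2] j|hd].
 have := (derivable_mxP _ _ _).1 d1 0 j => dj; apply: DeriveDef => //.
 by rewrite -d2 derive_mx ?mxE.
have dg1 : derivable (g : R^o -> _) s 1.
 by apply/derivable_mxP => i j; rewrite (ord1 i); have [] := hd j.
apply: DeriveDef => //; rewrite derive_mx //; apply/rowP => j; rewrite mxE.
by have [] := hd j.
Qed.

Lemma rV_normE m (v : 'rV[R]_m) : `|v| = \big[Num.max/0]_(j < m) `|v 0 j|.
Proof.
rewrite [LHS]mx_normrE; apply/le_anti/andP; split.
 apply: bigmax_le => [|[i j] _]; first by elim/big_ind: _ => // x y; rewrite le_max => ->.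
 by rewrite (ord1 i) /=; exact: (le_bigmax _ (fun j => `|v 0 j|) j).
apply: bigmax_le => [|j _]; first by elim/big_ind: _ => // x y; rewrite le_max => ->.
exact: (le_bigmax _ (fun i : 'I_1 * 'I_m => `|v i.1 i.2|) (0, j)).
Qed.

Lemma norm_le_rV m (v : 'rV[R]_m) (c : R) : 0 <= c ->
 (`|v| <= c) <-> (forall j, `|v 0 j| <= c).
Proof.
move=> c0; rewrite rV_normE; split=> [vc j|vc]; last exact: bigmax_le.
by apply: le_trans vc; exact: (le_bigmax _ (fun j => `|v 0 j|) j).
Qed.

Lemma coord_le m (v : 'rV[R]_m) j : `|v 0 j| <= `|v|.
Proof. by move: j; apply/norm_le_rV. Qed.

Lemma rV_norm_lt m (v : 'rV[R]_m) (c : R) : 0 < c ->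
 (`|v| < c) <-> (forall j, `|v 0 j| < c).
Proof.
move=> c0; rewrite rV_normE; split=> [vc j|vc]; last exact: bigmax_lt.
by apply: le_lt_trans vc; exact: (le_bigmax _ (fun j => `|v 0 j|) j).
Qed.

Lemma curve_MVT m (al dal : R -> 'rV[R]_m) (c t0 t1 : R) : t0 <= t1 -> 0 <= c ->
 (forall s, t0 <= s <= t1 -> {for s, continuous al}) ->
 (forall s, t0 < s < t1 -> is_d s (al : R^o -> _) (dal s) /\ `|dal s| <= c) ->
 `|al t1 - al t0| <= c * (t1 - t0).
Proof.
rewrite le_eqVlt => /predU1P[-> c0 _ _|t01 c0 ca da].
 by rewrite !subrr normr0 mulr0.
apply/norm_le_rV => [|j]; first by rewrite mulr_ge0 // subr_ge0 ltW.
have [s st|s st|s sb] := @MVT_real (fun s => al s 0 j) (fun s => dal s 0 j) t0 t1 t01.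
- by have /cont_rVP := ca s st; exact.
- by have [/is_d_rVP + _] := da s st; exact.
- rewrite !mxE => ->; rewrite normrM (gtr0_norm (x := t1 - t0)) ?subr_gt0 //.
 rewrite ler_pM2r ?subr_gt0 //; have [_] := da s sb; apply: le_trans.
 exact: coord_le.
Qed.

Lemma curve_MVT_sym m (al dal : R -> 'rV[R]_m) (c t0 t1 s s' : R) : 0 <= c ->
 (forall s, t0 <= s <= t1 -> {for s, continuous al}) ->
 (forall s, t0 < s < t1 -> is_d s (al : R^o -> _) (dal s) /\ `|dal s| <= c) ->
 t0 <= s <= t1 -> t0 <= s' <= t1 ->
 `|al s - al s'| <= c * `|s - s'|.
Proof.
move=> c0 ca da; wlog ss' : s s' / s' <= s => [hw|].
 have [|/ltW] := leP s' s => h; first exact: hw.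
 by move=> h1 h2; rewrite distrC (distrC s); exact: hw.
move=> /andP[h1 h2] /andP[h3 h4]; rewrite (ger0_norm (x := s - s')) ?subr_ge0 //.
apply: (curve_MVT ss' c0) => u /andP[u1 u2].
 by apply: ca; rewrite (le_trans h3) //= (le_trans u2).
by apply: da; rewrite (le_lt_trans h3) //= (lt_le_trans u2).
Qed.

Lemma curve_const m (al : R -> 'rV[R]_m) (t0 t1 : R) : t0 <= t1 ->
 (forall s, t0 <= s <= t1 -> {for s, continuous al}) ->
 (forall s, t0 < s < t1 -> is_d s (al : R^o -> _) 0) ->
 al t1 = al t0.
Proof.
move=> t01 ca da; apply/eqP; rewrite -subr_eq0 -normr_le0.
rewrite -(mul0r (t1 - t0)).
by apply: (@curve_MVT _ al (fun=> 0)) => // s /da; split=> //; rewrite normr0.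
Qed.

(* A Gronwall estimate for intervals so short that no exponential is needed. *)
Lemma curve_growth m (al dal : R -> 'rV[R]_m) (L e t0 t1 : R) :
 0 <= L -> 0 <= e -> L * (t1 - t0) <= 2^-1 ->
 (forall s, t0 <= s <= t1 -> {for s, continuous al}) ->
 (forall s, t0 < s < t1 -> is_d s (al : R^o -> _) (dal s) /\
   `|dal s| <= L * `|al s| + e) ->
 forall s s0, t0 <= s <= t1 -> t0 <= s0 <= t1 ->
 `|al s| <= 2 * (`|al s0| + e * (t1 - t0)).
Proof.
move=> L0 e0 LT ca da s s0 st s0t.
have t01 : t0 <= t1 by case/andP: st => /le_trans h /h.
have [c ct cmax] : exists2 c, t0 <= c <= t1 & forall t, t0 <= t <= t1 -> `|al t| <= `|al c|.
 have [|c] := @EVT_max R (fun t => `|al t|) t0 t1 t01.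
  apply: continuous_in_subspaceT => x; rewrite inE /= in_itv /= => xt.
  by apply: continuous_comp (@norm_continuous _ _ _); exact: ca.
 by rewrite in_itv /= => ct cm; exists c => // t tt; apply: cm; rewrite in_itv.
have {}da t : t0 < t < t1 -> is_d t (al : R^o -> _) (dal t) /\
   `|dal t| <= L * `|al c| + e.
 move=> tt; have [d1 d2] := da t tt; split=> //; apply: le_trans d2 _.
 rewrite lerD2r ler_wpM2l //; apply: cmax.
 by case/andP: tt => /ltW -> /ltW ->.
apply: le_trans (cmax _ st) _.
have c0 : 0 <= L * `|al c| + e by rewrite addr_ge0 // mulr_ge0.
have := curve_MVT_sym c0 ca da ct s0t.
have T : `|c - s0| <= t1 - t0.
 by rewrite ler_norml; move: ct s0t => /andP[? ?] /andP[? ?]; lra.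
move=> h; have h1 : `|al c| <= `|al s0| + (L * `|al c| + e) * (t1 - t0).
 rewrite -(subrK (al s0) (al c)) (le_trans (ler_normD _ _)) // addrC lerD2l.
 rewrite subrK; apply: le_trans h _; exact: ler_wpM2l.
rewrite mulrDl -mulrA (mulrC _ (t1 - t0)) mulrA in h1.
have h2 : L * (t1 - t0) * `|al c| <= 2^-1 * `|al c| by exact: ler_wpM2r.
by lra.
Qed.

Lemma MVT_line n (f : 'rV[R]_n -> R^o) x v :
 (forall s, 0 <= s <= 1 -> differentiable f (x + s *: v)) ->
 exists2 s, 0 < s < 1 & f (x + v) - f x = 'D_v f (x + s *: v).
Proof.
move=> df.
have [|s st|s st|s sb] := @MVT_real (fun s : R => f (x + s *: v)) (fun s => 'D_v f (x + s *: v)) 0 1.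
- exact: ltr01.
- by apply: is_d_cont; apply: line_derive; exact: df.
- by apply: line_derive; apply: df; case/andP: st => /ltW -> /ltW.
- by rewrite scale1r scale0r addr0 subr0 mulr1 => fE; exists s.
Qed.

(** With $g(z) = f(z + hv) - f(z)$, the second difference is the increment of $g$ along $hu$. The
    mean value theorem makes it $h$ times a difference of two values of ['D_u f] at distance $O(h)$
    from [x], and differentiability of ['D_u f] at [x] makes this difference $h$ times the mixed
    derivative, up to $o(h)$. *)
Lemma second_difference n (f : 'rV[R]_n -> R^o) x u v : sm x f ->
 forall e : R, 0 < e -> \forall h \near (0 : R),
 `|f (x + h *: u + h *: v) - f (x + h *: u) - f (x + h *: v) + f x
  - h ^+ 2 * 'D_v ('D_u f) x| <= e * h ^+ 2.
Proof.
move=> sf e e0; have dD := sm_diff (sm_D u sf).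
pose c := `|u| + `|v| + 1; have c0 : 0 < c by rewrite ltr_wpDl // addr_ge0.
(* The two intermediate points lie within $c|h|$ of [x], so an error rate of [e / (2 * c)] at each
   adds up to $e|h|$. *)
have e'0 : 0 < e / (2 * c) by rewrite divr_gt0 // mulr_gt0.
have /nbhs_normP[r1 /= r10 hr1] := sm_nbhs sf.
have /nbhs_normP[r2 /= r20 hr2] := diff_eps_ex dD e'0.
pose r := Num.min r1 r2; have r0 : 0 < r by rewrite lt_min r10.
have hb : \forall h \near (0 : R), `|h| < r / c.
 apply/nbhs_normP; exists (r / c) => /=; first by rewrite divr_gt0.
 by move=> h; rewrite /= sub0r normrN.
apply: filterS hb => h hh.
have {hh}hh : `|h| * c < r by rewrite -ltr_pdivlMr.
have bnd (a b : R) : 0 <= a <= 1 -> 0 <= b <= 1 -> `|a *: (h *: u) + b *: (h *: v)| <= `|h| * (`|u| + `|v|).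
 move=> /andP[a0 a1] /andP[b0 b1]; apply: le_trans (ler_normD _ _) _.
 rewrite !normrZ mulrDr (ger0_norm a0) (ger0_norm b0).
 by apply: lerD; rewrite ler_piMl // mulr_ge0.
have bnd' (a b : R) : 0 <= a <= 1 -> 0 <= b <= 1 -> `|a *: (h *: u) + b *: (h *: v)| < r.
 move=> ha hb; apply: le_lt_trans (bnd a b ha hb) _; apply: le_lt_trans hh.
 by rewrite ler_wpM2l // /c lerDl.
have sf' (a b : R) : 0 <= a <= 1 -> 0 <= b <= 1 -> sm (x + a *: (h *: u) + b *: (h *: v)) f.
 move=> ha hb; apply: hr1 => /=.
 rewrite -addrA opprD addrA subrr add0r normrN.
 by apply: lt_le_trans (bnd' a b ha hb) _; rewrite /r ge_min lexx.
pose g z := f (z + h *: v) - f z.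
have i01 : 0 <= (1 : R) <= 1 by rewrite ler01 lexx.
have i00 : 0 <= (0 : R) <= 1 by rewrite lexx ler01.
have dsh s : 0 <= s <= 1 -> differentiable (fun z => f (z + h *: v)) (x + s *: (h *: u)).
 move=> hs; apply: differentiable_comp.
  by apply: differentiableD => //; exact: differentiable_cst.
 by apply: sm_diff; have := sf' s 1 hs i01; rewrite scale1r.
have df0 s : 0 <= s <= 1 -> differentiable f (x + s *: (h *: u)).
 by move=> hs; apply: sm_diff; have := sf' s 0 hs i00; rewrite scale0r addr0.
have [s hs|s hs] := @MVT_line _ g x (h *: u).
 by apply: differentiableB; [exact: dsh|exact: df0].
have hs' : 0 <= s <= 1 by case/andP: hs => /ltW -> /ltW ->.
have d1 : derivable (fun z => f (z + h *: v)) (x + s *: (h *: u)) (h *: u).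
 by apply: diff_derivable; exact: dsh.
have d2 : derivable f (x + s *: (h *: u)) (h *: u).
 by apply: diff_derivable; exact: df0.
rewrite /g (deriveB d1 d2).
have -> : 'D_(h *: u) (fun z => f (z + h *: v)) (x + s *: (h *: u)) =
  'D_(h *: u) f (x + s *: (h *: u) + h *: v).
 set y := x + s *: (h *: u).
 have s1 : differentiable f (y + h *: v).
  by apply: sm_diff; have := sf' s 1 hs' i01; rewrite scale1r.
 have s2 : differentiable (fun z => z + h *: v) y.
  exact: differentiableD (@ex_diff _ _ _ _ _ _ _ (is_diff_id y)) (differentiable_cst _ y).
 have s3 : 'D_(h *: u) (fun z => z + h *: v) y = h *: u.
  have d3 : derivable (fun _ : 'rV[R]_n => h *: v) y (h *: u).
   exact: derivable_cst.
  have d4 : derivable (@id 'rV[R]_n) y (h *: u) by exact: derivable_id.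
  by rewrite (deriveD d4 d3) derive_id derive_cst addr0.
 by have := derive_compE (h *: u) s2 s1; rewrite s3.
have DZ z : differentiable f z -> 'D_(h *: u) f z = h * 'D_u f z.
 by move=> dz; rewrite !deriveE // linearZ.
have {DZ}-> : 'D_(h *: u) f (x + s *: (h *: u) + h *: v) = h * 'D_u f (s *: (h *: u) + h *: v + x).
 rewrite DZ; first by congr (h * 'D_u f _); rewrite [RHS]addrC addrA.
 by apply: sm_diff; have := sf' s 1 hs' i01; rewrite scale1r.
have -> : 'D_(h *: u) f (x + s *: (h *: u)) = h * 'D_u f (s *: (h *: u) + x).
 have d0 := df0 s hs'.
 by rewrite [X in _ = h * 'D_u f X]addrC (deriveE _ d0) (deriveE _ d0) linearZ.
move=> gE.
pose w1 := s *: (h *: u) + h *: v; pose w2 := s *: (h *: u).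
have nw1 : `|w1| <= `|h| * c /\ `|w1| < r2.
 have := bnd s 1 hs' i01; have := bnd' s 1 hs' i01; rewrite scale1r -/w1 => h1 h2.
 split; first by apply: le_trans h2 _; rewrite ler_wpM2l // /c lerDl.
 by apply: lt_le_trans h1 _; rewrite ge_min lexx orbT.
have nw2 : `|w2| <= `|h| * c /\ `|w2| < r2.
 have := bnd s 0 hs' i00; have := bnd' s 0 hs' i00; rewrite scale0r addr0 -/w2 => h1 h2.
 split; first by apply: le_trans h2 _; rewrite ler_wpM2l // /c lerDl.
 by apply: lt_le_trans h1 _; rewrite ge_min lexx orbT.
have e1 := hr2 w1; have e2 := hr2 w2; rewrite /= !sub0r !normrN in e1 e2.
have {}e1 := e1 nw1.2; have {}e2 := e2 nw2.2.
rewrite -!deriveE // in e1 e2.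
have Dw : 'D_w1 ('D_u f) x - 'D_w2 ('D_u f) x = h * 'D_v ('D_u f) x.
 by rewrite !deriveE // -linearB /w1 addrC addKr linearZ.
rewrite -/w1 -/w2 in gE.
have -> : f (x + h *: u + h *: v) - f (x + h *: u) - f (x + h *: v) + f x
  = h * ('D_u f (w1 + x) - 'D_u f (w2 + x)).
 have aux (p q t y : R) : p - q - t + y = p - q - (t - y) by ring.
 by rewrite mulrBr -gE; exact: aux.
rewrite expr2 -mulrA -Dw -mulrBr normrM.
set a1 := 'D_u f (w1 + x) in e1 *; set a2 := 'D_u f (w2 + x) in e2 *.
have aux (p q t y z : R) : p - q - (y - z) = (p - t - y) - (q - t - z) by ring.
rewrite (aux a1 a2 ('D_u f x)).
have b : e / (2 * c) * (`|h| * c) = e * `|h| / 2.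
 have cn : c != 0 by rewrite gt_eqF.
 by field.
have hh2 : h * h = `|h| * `|h| by rewrite -normrM ger0_norm // -expr2 sqr_ge0.
rewrite [X in e * X](_ : _ = `|h| * `|h|) ?expr2 // [leRHS]mulrCA.
apply: ler_wpM2l => //; apply: le_trans (ler_normB _ _) _.
have f1 : e / (2 * c) * `|w1| <= e * `|h| / 2 by rewrite -b; exact: (ler_wpM2l (ltW e'0) nw1.1).
have f2 : e / (2 * c) * `|w2| <= e * `|h| / 2 by rewrite -b; exact: (ler_wpM2l (ltW e'0) nw2.1).
by apply: le_trans (lerD (le_trans e1 f1) (le_trans e2 f2)) _; rewrite -splitr.
Qed.

(** The second difference is symmetric in [u] and [v], so both iterated derivatives approximate the
    same quantity after division by $h^2$. *)
Lemma schwarz_real n (f : 'rV[R]_n -> R^o) x u v : sm x f ->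
 'D_u ('D_v f) x = 'D_v ('D_u f) x.
Proof.
move=> sf; apply/eqP; rewrite -subr_eq0 -normr_le0; apply/ler_addgt0Pr => e e0.
rewrite add0r; have e2 : 0 < e / 2 by rewrite divr_gt0.
have h1 := second_difference u v sf e2; have h2 := second_difference v u sf e2.
have /nbhs_ballP[r1 /= r10 hr1] := h1; have /nbhs_ballP[r2 /= r20 hr2] := h2.
pose h := Num.min r1 r2 / 2.
have h0 : 0 < h by rewrite divr_gt0 // lt_min r10.
have hmin : h < Num.min r1 r2 by rewrite ltr_pdivrMr // ltr_pMr ?ltr1n // lt_min r10.
have hb1 : ball (0 : R) r1 h.
 by rewrite /ball /= sub0r normrN gtr0_norm //; move: hmin; rewrite lt_min => /andP[].
have hb2 : ball (0 : R) r2 h.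
 by rewrite /ball /= sub0r normrN gtr0_norm //; move: hmin; rewrite lt_min => /andP[].
have {h1 hr1 hb1}h1 := hr1 _ hb1; have {h2 hr2 hb2}h2 := hr2 _ hb2.
have hp : 0 < h ^+ 2 by rewrite exprn_gt0.
rewrite -(ler_pM2l hp).
have aux (a b c d p q k : R) : `|a - b - c + d - k * q| <= e / 2 * k ->
  `|a - c - b + d - k * p| <= e / 2 * k -> `|k * (p - q)| <= k * e.
 move=> b1 b2; have -> : k * (p - q) =
  (a - b - c + d - k * q) - (a - c - b + d - k * p) by ring.
 apply: le_trans (ler_normB _ _) _; apply: le_trans (lerD b1 b2) _.
 by rewrite -mulrDl -splitr mulrC.
rewrite -[X in X * _ <= _](gtr0_norm hp) -normrM.
rewrite (addrAC x (h *: v)) in h2.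
exact: aux h1 h2.
Qed.

Lemma schwarz n m (f : 'rV[R]_n -> 'rV[R]_m) x u v : sm x f ->
 'D_u ('D_v f) x = 'D_v ('D_u f) x.
Proof.
move=> sf; apply/rowP => j.
have nf : \forall z \near x, sm z f by exact: sm_nbhs.
have DD w w' : ('D_w ('D_w' f) x) 0 j = 'D_w ('D_w' (fun z => f z 0 j : R^o)) x.
 rewrite derive_rV; last by apply/diff_derivable/sm_diff/sm_D.
 apply: near_eq_derive; apply: filterS nf => z sz.
 by rewrite derive_rV //; exact/diff_derivable/sm_diff.
have sj := (sm_rVP x f).1 sf j.
exact: (etrans (DD u v) (etrans (schwarz_real u v sj) (esym (DD v u)))).
Qed.

End MeanValue.

(** * Compactness of segments, partial derivatives and Picard iteration *)

Section Analysis.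
Context {R : realType}.

(** Compactness of the segment, for properties that carry a radius: a radius that works near each
    time is replaced by a common one. Uniformity in time is drawn from here in the estimates on
    differential equations. *)
Lemma segment_uniform (a b : R) (Q : R -> R -> Prop) :
 (forall t r r', Q t r -> r' <= r -> Q t r') ->
 (forall t, a <= t <= b -> exists2 r, 0 < r & forall t', `|t' - t| < r -> Q t' r) ->
 exists2 r, 0 < r & forall t, a <= t <= b -> Q t r.
Proof.
move=> Qmono Qloc.
have /compact_near_coveringP cov := @segment_compact R a b.
have [|r /= r0 hr] := @cov R (at_right 0) (fun r t => Q t r) _.
 move=> t; rewrite /= in_itv /= => /Qloc[r r0 Qr].
 exists ([set t' | `|t' - t| < r], [set r' | r' <= r]) => /=.
  split; first by apply/nbhs_ballP; exists r => //= y; rewrite /ball /= distrC.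
  exact: nbhs_right_le r0.
 by move=> [t' r'] /= [h1 h2]; exact: Qmono (Qr _ h1) h2.
exists (r / 2); first by rewrite divr_gt0.
move=> t tab; apply: (hr (r / 2)) => /=.
- by rewrite sub0r normrN gtr0_norm ?divr_gt0 // ltr_pdivrMr // ltr_pMr // ltr1n.
- by rewrite divr_gt0.
- by rewrite /= in_itv.
Qed.

(** Connectedness of the segment, by a supremum. The local hypothesis carries [P] between any two
    points near [t0], in both directions, which spares separate proofs of openness and
    closedness. *)
Lemma segment_induction (P : R -> Prop) :
 (forall t0, 0 <= t0 <= 1 -> exists2 e, 0 < e &
   forall t1 t2, 0 <= t1 <= 1 -> 0 <= t2 <= 1 -> `|t1 - t0| < e -> `|t2 - t0| < e ->
   P t1 -> P t2) ->
 P 0 -> P 1.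
Proof.
move=> loc P0; pose S := [set t : R | 0 <= t <= 1 /\ P t].
have S0 : S 0 by rewrite /S /= lexx ler01.
have ubS : ubound S 1 by move=> t [/andP[]].
have supS : has_sup S by split; [exists 0|exists 1].
pose s := sup S; have s1 : s <= 1 by apply: ge_sup => //; exists 0.
have s0 : 0 <= s by apply: ub_le_sup => //; exists 1.
have [|e e0 he] := loc s; first by rewrite s0.
have [t1 [t11 Pt1] ht1] := sup_adherent e0 supS.
have t1s : t1 <= s by apply: ub_le_sup => //; exists 1.
have d1 : `|t1 - s| < e by rewrite ler0_norm ?subr_le0 // opprB ltrBlDl -ltrBlDr.
have [h|h] := ltP (s + e / 2) 1; last first.
 apply: (he t1) => //; first by rewrite ler01 lexx.
 by rewrite ger0_norm ?subr_ge0 //; lra.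
have : S (s + e / 2).
 have r1 : 0 <= s + e / 2 <= 1 by rewrite (ltW h) addr_ge0 // divr_ge0 // ltW.
 split=> //; apply: (he t1) => //.
 by rewrite addrAC subrr add0r gtr0_norm; lra.
move=> /(ub_le_sup supS.2); rewrite -/s; lra.
Qed.

Lemma is_derive_affine (c s0 s : R) :
 is_d s (fun t : R^o => c * (t - s0) : R^o) c.
Proof.
have d1 : is_d s (@id R^o) 1 := is_derive_id _ _.
have d2 : is_d s (fun _ : R^o => s0 : R^o) 0 := is_derive_cst _ _ _.
have d3 := is_deriveZ c (is_deriveB d1 d2).
by have := d3; rewrite subr0 [_ *: _]mulr1.
Qed.

Lemma rV_partial_sum n (v : 'rV[R]_n) :
 \sum_(i < n) v 0 i *: ev i = v.
Proof. by rewrite [RHS]row_sum_delta. Qed.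

(** The increment is telescoped by switching on one coordinate of [h] after another. Each piece is
    an increment in one variable, treated by the mean value theorem, and continuity of the partial
    derivatives moves the intermediate points to [z]. *)
Lemma differentiable_partial n (f : 'rV[R]_n -> R^o) (g : 'I_n -> 'rV[R]_n -> R^o) z :
 (\forall y \near z, forall j, is_derive y (ev j : 'rV[R]_n) f (g j y)) ->
 (forall j, {for z, continuous (g j)}) -> differentiable f z.
Proof.
move=> df cg.
pose df0 (h : 'rV[R]_n) : R^o := (h *m \col_j g j z) 0 0.
have ldf0 : linear df0 by move=> a u v; rewrite /df0 mulmxDl -scalemxAl !mxE.
pose Ldf := GRing.isLinear.Build _ _ _ _ _ ldf0.
pose ldf : {linear 'rV[R]_n -> R^o} := HB.pack df0 Ldf.
have df0E h : ldf h = \sum_j h 0 j * g j z.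
 by rewrite /= /df0 mxE; apply: eq_bigr => j _; rewrite mxE.
have cldf : continuous ldf.
 move=> x; rewrite (_ : (ldf : _ -> _) = fun h => \sum_j h 0 j * g j z : R^o).
  apply: (@sm_cont _ _ _ _ (fun h => \sum_j h 0 j * g j z : R^o)).
  by apply: sm_sum => j; apply: sm_mul; [exact: sm_coord|exact: sm_cst].
 by apply/funext => h; exact: df0E.
apply: (proj1 (diff_eps cldf _)) => e e0.
(* The denominator is $n + 1$, not $n$, so that dimension zero is no exception. *)
pose e' := e / (n%:R + 1); have e'0 : 0 < e' by rewrite divr_gt0 // ltr_wpDl.
have cg' : \forall y \near z, forall j, `|g j z - g j y| < e'.
 by apply: (@filter_forall _ _ (fun j y => `|g j z - g j y| < e') (nbhs z)) => j; move/cvgrPdist_lt: (cg j); exact.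
have /nbhs_normP[r /= r0 hr] : \forall y \near z,
  (forall j, is_derive y (ev j : 'rV[R]_n) f (g j y)) /\ forall j, `|g j z - g j y| < e'.
 exact: filterI.
apply/nbhs_normP; exists r => //= h; rewrite /= sub0r normrN => hrr.
(* The truncation of [h] to its first [k] coordinates: the corners of the telescoping path. *)
pose H (k : nat) := \sum_(i < n | (i < k)%N) h 0 i *: ev i : 'rV[R]_n.
have HE k j : H k 0 j = if (j < k)%N then h 0 j else 0.
 rewrite /H summxE (eq_bigr (fun i : 'I_n => if i == j then h 0 i else 0)); last first.
  by move=> i _; rewrite !mxE eqxx /= eq_sym; case: eqP => _; rewrite ?mulr1 ?mulr0.
 case: ifP => jk; first by rewrite (bigD1 j) //= eqxx big1 ?addr0 // => i /andP[_ /negPf ->].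
 by rewrite big1 // => i ik; case: eqP => // ij; rewrite ij jk in ik.
have bH (w : 'rV[R]_n) : (forall j, `|w 0 j| <= `|h 0 j|) -> `|w| < r.
 move=> hw; apply: le_lt_trans hrr; apply/norm_le_rV => // j.
 by apply: le_trans (hw j) _; exact: coord_le.
suff key k : (k <= n)%N ->
  `|f (H k + z) - f z - \sum_(i < n | (i < k)%N) h 0 i * g i z| <= k%:R * (e' * `|h|).
 have := key n (leqnn n); rewrite (_ : H n = h); last first.
  by apply/rowP => j; rewrite HE ltn_ord.
 rewrite (eq_bigl xpredT) => [h1|i]; last by rewrite ltn_ord.
 have -> : df0 h = \sum_j h 0 j * g j z by exact: df0E.
 apply: le_trans h1 _; rewrite mulrA ler_wpM2r // /e' mulrA ler_pdivrMr ?ltr_wpDl //.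
 by rewrite mulrC; apply: ler_wpM2l; [exact: ltW|rewrite lerDl].
elim: k => [_|k IH kn].
 rewrite /H big_pred0 ?add0r ?subrr ?mul0r; last by move=> i; rewrite ltn0.
 by rewrite big_pred0 ?subrr ?normr0 // => i; rewrite ltn0.
have {}IH := IH (ltnW kn).
pose j := Ordinal kn.
have eqj (i : 'I_n) : (i < k.+1)%N && (i != j) = (i < k)%N.
 by rewrite ltnS ltn_neqAle andbC -(inj_eq val_inj).
have HS : H k.+1 = h 0 j *: ev j + H k.
 rewrite /H (bigD1 j) /=; last by rewrite ltnSn.
 by congr (_ + _); apply: eq_bigl.
rewrite (bigD1 j) /= ?ltnSn // (eq_bigl _ _ eqj).
have inb (s : R) : 0 <= s <= 1 -> `|H k + s *: (h 0 j *: ev j)| < r.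
 move=> /andP[s0 s1]; apply: bH => i; rewrite mxE HE !mxE eqxx /=.
 case: ifP => ik.
  rewrite (_ : i == j = false) ?mulr0 ?addr0 //.
  by apply/eqP => ij; rewrite ij /= ltnn in ik.
 rewrite add0r; case: eqP => [->|_]; last by rewrite !mulr0 normr0.
 by rewrite mulr1 normrM (ger0_norm s0) ler_piMl.
have dj s : 0 <= s <= 1 -> forall i, is_derive (H k + s *: (h 0 j *: ev j) + z) (ev i : 'rV[R]_n) f (g i (H k + s *: (h 0 j *: ev j) + z)).
 move=> s01; apply: (hr _ _).1; rewrite /= opprD addrCA subrr addr0 normrN; exact: inb.
have ld (s : R) : 0 <= s <= 1 -> is_d s
  (fun s : R^o => f (H k + s *: (h 0 j *: ev j) + z))
  (h 0 j * g j (H k + s *: (h 0 j *: ev j) + z)).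
 move=> s01; have [d1 d2] := dj s s01 j.
 pose F (t : R^o) : R^o := f (t *: ev j + (H k + s *: (h 0 j *: ev j) + z)).
 have dF : is_d 0 F (g j (H k + s *: (h 0 j *: ev j) + z)).
  have d1' := (derivable1P _ _ _).1 d1; apply: DeriveDef => //.
  rewrite -d2 /derive; set p1 := fun h => _; set p2 := fun h => _.
  suff -> : p1 = p2 by [].
  by apply/funext => t; rewrite /p1 /p2 /F /= addr0 scale0r add0r [_%:A]mulr1.
 pose G (t : R^o) : R^o := h 0 j * (t - s).
 have dG : is_d s G (h 0 j).
  exact: is_derive_affine.
 have G0 : G s = 0 by rewrite /G subrr mulr0.
 have -> : (fun s : R^o => f (H k + s *: (h 0 j *: ev j) + z)) = F \o G.
  apply/funext => t; rewrite /F /G /=; congr f.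
  by apply/rowP => i; rewrite ![in LHS]mxE ![in RHS]mxE; ring.
 rewrite -G0 in dF; have [f1 f2] := dF; have [g1 g2] := dG.
 have f1' : differentiable F (G s) := (derivable1_diffP _ _).1 f1.
 have g1' : differentiable G s := (derivable1_diffP _ _).1 g1.
 apply: DeriveDef; first by apply: diff_derivable; exact: differentiable_comp.
 rewrite (derive_compE _ g1' f1') g2 -f2 -[in LHS](mulr1 (h 0 j)) !deriveE //.
 exact: linearZ.
have [||s s01 fE] := @MVT_real R (fun s : R => f (H k + s *: (h 0 j *: ev j) + z))
 (fun s => h 0 j * g j (H k + s *: (h 0 j *: ev j) + z)) 0 1 ltr01.
- by move=> s s01; exact: is_d_cont (ld s s01).
- by move=> s /andP[/ltW s0 /ltW s1]; apply: ld; rewrite s0.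
have s01' : 0 <= s <= 1 by case/andP: s01 => /ltW -> /ltW ->.
rewrite scale1r scale0r addr0 subr0 mulr1 in fE.
have hg : forall i, `|g i z - g i (H k + s *: (h 0 j *: ev j) + z)| < e'.
 by apply: (hr _ _).2; rewrite /= opprD addrCA subrr addr0 normrN; exact: inb.
rewrite HS (addrC (h 0 j *: _)) -(subrK (f (H k + z)) (f _)) fE.
set S := \sum_(i < n | _) _ in IH *; set gs := g j (_ + _) in hg *.
have -> : h 0 j * gs + f (H k + z) - f z - (h 0 j * g j z + S) =
 (f (H k + z) - f z - S) - h 0 j * (g j z - gs) by ring.
apply: le_trans (ler_normB _ _) _; rewrite -natr1 mulrDl mul1r lerD //.
rewrite normrM mulrC ler_pM //; first by apply/ltW; exact: hg.
exact: coord_le.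
Qed.

Lemma Ck_partial n k (O : set 'rV[R]_n) (f : 'rV[R]_n -> R^o) (g : 'I_n -> 'rV[R]_n -> R^o) :
 open O -> (forall z j, O z -> is_derive z (ev j : 'rV[R]_n) f (g j z)) ->
 (forall j, Ck k O (g j)) -> Ck k.+1 O f.
Proof.
move=> oO dg cg.
have cg0 j : Ck 0 O (g j) by elim: (k) (cg j) => // l IH /Ck_S.
have df z : O z -> differentiable f z.
 move=> Oz; apply: (@differentiable_partial _ _ g).
  have : \forall y \near z, O y by exact: open_nbhs_nbhs.
  by apply: filterS => y Oy j; exact: dg.
 by move=> j; exact: cg0.
split=> // v; apply: (@Ck_eq _ _ _ _ _ (fun z => \sum_j v 0 j *: g j z)) => //.
 move=> z Oz; rewrite derive_sumE; last exact: df.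
 by apply: eq_bigr => j _; have [_ ->] := dg z j Oz.
apply: Ck_sum => // j; apply: Ck_mul => //; exact: Ck_cst.
Qed.

(** With $q_k$ the tail of the geometric series, the intervals $[s_k - q_k, s_k + q_k]$ are nested.
    The supremum of the left ends lies in all of them, which gives the limit together with its
    rate. *)
Lemma geometric_limit (s : nat -> R) (M : R) :
 (forall k, `|s k.+1 - s k| <= M * 2^-1 ^+ k) ->
 exists l, forall k, `|s k - l| <= 2 * M * 2^-1 ^+ k.
Proof.
move=> hs; pose q k := 2 * M * 2^-1 ^+ k : R.
have M0 : 0 <= M by have := hs 0%N; rewrite expr0 mulr1; apply: le_trans.
have q0 k : 0 <= q k by rewrite /q mulr_ge0 ?mulr_ge0 // exprn_ge0 // invr_ge0.
have qS k : q k = q k.+1 + M * 2^-1 ^+ k.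
 by rewrite /q exprS; field.
have lo j k : (j <= k)%N -> s j - q j <= s k - q k.
 move=> /subnK <-; elim: (k - j)%N => // l IH; apply: le_trans IH _.
 rewrite addSn; have := hs (l + j)%N; have := qS (l + j)%N.
 by move=> ->; rewrite ler_norml => /andP[]; lra.
have hi j k : (j <= k)%N -> s k + q k <= s j + q j.
 move=> /subnK <-; elim: (k - j)%N => // l IH; apply: le_trans IH.
 rewrite addSn; have := hs (l + j)%N; have := qS (l + j)%N.
 by move=> ->; rewrite ler_norml => /andP[]; lra.
have lohi j k : s j - q j <= s k + q k.
 have h1 := lo _ _ (leq_maxl j k); have h2 := hi _ _ (leq_maxr j k).
 by have := q0 (maxn j k); lra.
pose S := [set x | exists k, x = s k - q k].
have S0 : S !=set0 by exists (s 0%N - q 0%N), 0%N.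
exists (sup S) => k; rewrite -/(q k).
have h1 : s k - q k <= sup S.
 by apply: ub_le_sup; [exists (s 0%N + q 0%N) => x [j ->]|exists k].
have h2 : sup S <= s k + q k by apply: ge_sup => // x [j ->].
by rewrite ler_norml; lra.
Qed.

Lemma antiderivative (g : R -> R) (a b : R) : continuous g -> a < b ->
 exists G : R -> R, forall t, a < t < b -> is_d t (G : R^o -> R^o) (g t).
Proof.
move=> cg ab; exists (fun x => \int[lebesgue_measure]_(t in `[a, x]) g t)%R.
move=> t /andP[at_ tb].
have ig : (@lebesgue_measure R).-integrable `[a, b] (EFin \o g).
 apply: continuous_compact_integrable; first exact: segment_compact.
 exact: continuous_subspaceT.
have [d1 d2] := continuous_FTC1_closed tb ig at_ (cg t).
by apply: DeriveDef; [exact: d1|rewrite -d2 derive1E].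
Qed.

Lemma antiderivative_rV m (g : R -> 'rV[R]_m) (a b : R) : continuous g -> a < b ->
 exists G : R -> 'rV[R]_m, forall t, a < t < b ->
  is_d t (G : R^o -> _) (g t).
Proof.
move=> cg ab.
have /choice[G hG] : forall j : 'I_m, exists G : R -> R, forall t, a < t < b ->
  is_d t (G : R^o -> R^o) (g t 0 j).
 move=> j; apply: antiderivative => // t.
 by have /cont_rVP := cg t; exact.
exists (fun t => \row_j G j t) => t tab; apply/is_d_rVP => j.
by under eq_fun do rewrite mxE; exact: hG.
Qed.

(** For [a <= b], the retraction of the line onto $[a, b]$. It extends functions of time from the
    segment to the line without increasing Lipschitz constants. *)
Definition clip (a b t : R) := Num.max a (Num.min b t).

Lemma clip_id a b t : a <= t <= b -> clip a b t = t.
Proof. by move=> /andP[h1 h2]; rewrite /clip min_r // max_r. Qed.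

Lemma clip_in a b t : a <= b -> a <= clip a b t <= b.
Proof. by move=> ab; rewrite /clip le_max lexx /= ge_max ab ge_min lexx. Qed.

Lemma clip_lip a b s t : `|clip a b s - clip a b t| <= `|s - t|.
Proof.
rewrite /clip; case: (leP b s) => h1; case: (leP b t) => h2;
 rewrite ?(min_l h1) ?(min_r (ltW h1)) ?(min_l h2) ?(min_r (ltW h2)).
all: case: (leP a _) => h3; try (case: (leP a _) => h4).
all: rewrite ?subrr ?normr0 ?normr_ge0 //.
all: rewrite ?ler_norml; try (apply/andP; split).
all: have := ler_norm (s - t); have := ler_norm (t - s); rewrite (distrC t s); lra.
Qed.

Lemma clip_cont a b : continuous (clip a b).
Proof.
move=> t; apply/cvgrPdist_lt => e e0.
apply/nbhs_normP; exists e => //= s hs; apply: le_lt_trans hs; exact: clip_lip.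
Qed.

(** Since [L * (b - a)] is at most $1/2$, one Picard step halves distances in the supremum norm and
    the iterates converge geometrically. The initial time $0$ is inside the interval, so the
    solution runs in both directions. *)
Lemma picard m (v : R -> 'rV[R]_m -> 'rV[R]_m) (a b L : R) x0 :
 a < 0 -> 0 < b -> 0 <= L -> L * (b - a) <= 2^-1 ->
 (forall t x y, `|v t x - v t y| <= L * `|x - y|) ->
 (forall phi : R -> 'rV[R]_m, continuous phi -> continuous (fun t => v t (phi t))) ->
 exists phi : R -> 'rV[R]_m, phi 0 = x0 /\ forall t, a < t < b ->
  is_d t (phi : R^o -> _) (v t (phi t)).
Proof.
move=> a0 b0 L0 LT lip cv; have ab : a <= b by lra.
(* [psi] is the image of [phi] under the Picard operator, frozen outside $[a, b]$ by [clip] so that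
   estimates hold on the whole line. *)
pose good (phi psi : R -> 'rV[R]_m) := [/\ continuous psi, psi 0 = x0,
 (forall t, psi (clip a b t) = psi t) &
 (forall t, a <= t <= b -> {for t, continuous psi}) /\
 (forall t, a < t < b -> is_d t (psi : R^o -> _) (v t (phi t)))].
have ex phi : continuous phi -> exists psi, good phi psi.
 move=> cphi; have [||G hG] := @antiderivative_rV _ (fun t => v t (phi t)) (a - 1) (b + 1).
 - exact: cv.
 - by lra.
 have cpsi : continuous (fun t => G (clip a b t) - G 0 + x0).
  move=> t; apply: (@continuous_comp _ _ _ (clip a b) (fun s => G s - G 0 + x0)).
   exact: clip_cont.
  apply: continuousD; last exact: cst_continuous.
  apply: continuousB; last exact: cst_continuous.
  apply: is_d_cont; apply: hG.
  by have /andP[] := clip_in t ab; move=> ? ?; lra.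
 exists (fun t => G (clip a b t) - G 0 + x0); split; first exact: cpsi.
 - by rewrite clip_id ?subrr ?add0r //; lra.
 - by move=> t; rewrite (clip_id (clip_in t ab)).
 split=> [t _|t tab]; first exact: cpsi.
 apply: (@near_eq_is_derive _ _ _ (fun t => G t - G 0 + x0)).
  have : \forall s \near t, s \in `]a, b[%R by apply: near_in_itvoo; rewrite in_itv.
  apply: filterS => s; rewrite in_itv /= => /andP[h1 h2].
  by rewrite clip_id // ltW //= ltW.
 have dG : is_d t (G : R^o -> _) (v t (phi t)).
  by apply: hG; case/andP: tab => ? ?; lra.
 have dc w : is_d t (fun _ : R^o => w : 'rV[R]_m) 0 := is_derive_cst _ _ _.
 have := is_deriveD (is_deriveB dG (dc (G 0))) (dc x0).
 by rewrite subr0 addr0.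
have cmp phi phi' psi psi' c : good phi psi -> good phi' psi' ->
  (forall t, a <= t <= b -> `|phi t - phi' t| <= c) ->
  forall t, `|psi t - psi' t| <= 2^-1 * c.
 move=> [_ i1 c1 [k1 d1]] [_ i2 c2 [k2 d2]] hc t.
 have c0 : 0 <= c by apply: le_trans (hc 0 _) => //; lra.
 rewrite -c1 -c2; have ct := clip_in t ab.
 have h0 : a <= 0 <= b by lra.
 have ML : 0 <= L * c by exact: mulr_ge0.
 have k12 s : a <= s <= b -> {for s, continuous (fun s => psi s - psi' s)}.
  by move=> st; apply: continuousB; [exact: k1|exact: k2].
 have d12 s : a < s < b -> is_d s ((fun s => psi s - psi' s) : R^o -> _)
   (v s (phi s) - v s (phi' s)) /\ `|v s (phi s) - v s (phi' s)| <= L * c.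
  move=> st; split; first exact: is_deriveB (d1 s st) (d2 s st).
  apply: le_trans (lip _ _ _) _; apply: ler_wpM2l => //; apply: hc.
  by case/andP: st => /ltW -> /ltW ->.
 have := curve_MVT_sym ML k12 d12 ct h0.
 rewrite i1 i2 subrr subr0 => /le_trans; apply.
 rewrite -mulrA mulrCA mulrC; apply: ler_wpM2r => //.
 apply: le_trans LT; apply: ler_wpM2l => //; rewrite subr0.
 by rewrite ler_norml; case/andP: ct => ? ?; lra.
(* An image exists for continuous [phi] only, so the iteration runs on functions bundled with their
   continuity. *)
pose nxt (p : {phi : R -> 'rV[R]_m | continuous phi}) : {phi : R -> 'rV[R]_m | continuous phi} :=
 let h := cid (ex _ (svalP p)) in
 exist _ (sval h) (let: And4 c _ _ _ := svalP h in c).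
have nxtP p : good (sval p) (sval (nxt p)) by exact: (svalP (cid (ex _ (svalP p)))).
pose p0 : {phi : R -> 'rV[R]_m | continuous phi} :=
 exist (fun phi : R -> 'rV[R]_m => continuous phi) (fun _ => x0)
  (fun t => @cst_continuous _ _ x0 t).
pose f k := iter k nxt p0; pose F k := sval (f k).
have goodF k : good (F k) (F k.+1) by exact: nxtP.
have [M hM] : exists M, forall t, `|F 1%N t - F 0%N t| <= M.
 have [g1 g2 g3 [g4 _]] := goodF 0%N.
 have cF1 : continuous (fun t => `|F 1%N t - F 0%N t|).
  move=> t; apply: (@continuous_comp _ _ _ (fun t => F 1%N t - F 0%N t) Num.norm).
   by apply: continuousB; [exact: g1|exact: cst_continuous].
  exact: norm_continuous.
 have [c _ cm] := EVT_max ab (continuous_subspaceT cF1).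
 exists (`|F 1%N c - F 0%N c|) => t; rewrite -(g3 t).
 have -> : F 0%N t = F 0%N (clip a b t) by [].
 apply: cm.
 by rewrite in_itv /=; exact: clip_in.
have hF k t : `|F k.+1 t - F k t| <= M * 2^-1 ^+ k.
 elim: k t => [|k IH] t; first by rewrite expr0 mulr1.
 rewrite exprS mulrCA; apply: (cmp _ _ _ _ _ (goodF k.+1) (goodF k)) => s _; exact: IH.
have /choice[phi hphi] : forall t, exists l : 'rV[R]_m, forall k, `|F k t - l| <= 2 * M * 2^-1 ^+ k.
 move=> t; have /choice[l hl] : forall j : 'I_m, exists l : R, forall k, `|F k t 0 j - l| <= 2 * M * 2^-1 ^+ k.
  move=> j; apply: geometric_limit => k; apply: le_trans (hF k t).
  by have := coord_le (F k.+1 t - F k t) j; rewrite !mxE.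
 exists (\row_j l j) => k; apply/norm_le_rV => [|j]; last by rewrite !mxE.
 have M0 : 0 <= M by apply: le_trans (hM 0).
 by rewrite mulr_ge0 ?mulr_ge0 // exprn_ge0 // invr_ge0.
have small e : 0 < e -> exists k, 2 * M * 2^-1 ^+ k < e.
 move=> e0; have /cvgrPdist_lt/(_ _ e0) : (fun k => geometric (2 * M) (2^-1 : R) k) @ \oo --> (0 : R).
  by apply: cvg_geometric; rewrite ger0_norm ?invr_ge0 // invf_lt1 ?ltr1n.
 move=> [N _ /(_ N (leqnn N))] /=; rewrite sub0r normrN => h; exists N.
 by apply: le_lt_trans h; exact: ler_norm.
have cphi : continuous phi.
 move=> t; apply/cvgrPdist_lt => e e0.
 have [k hk] : exists k, 2 * M * 2^-1 ^+ k < e / 3 by apply: small; rewrite divr_gt0.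
 have cF : {for t, continuous (F k)} by exact: (svalP (f k)).
 have e3 : 0 < e / 3 by rewrite divr_gt0.
 move/cvgrPdist_lt: cF => /(_ _ e3); apply: filterS => s hs.
 have h1 := hphi t k; have h2 := hphi s k.
 rewrite (_ : phi t - phi s = (F k t - F k s) - (F k t - phi t) + (F k s - phi s)).
  apply: le_lt_trans (ler_normD _ _) _; apply: le_lt_trans (lerD (ler_normB _ _) (lexx _)) _.
  by lra.
 by rewrite !opprB; apply/rowP => j; rewrite !mxE; ring.
(* One more Picard step, applied to the limit: its image is the limit of the shifted sequence, hence
   the limit itself, which is therefore a solution. *)
have [psi gpsi] := ex phi cphi.
have E : psi = phi.
 apply/funext => t; apply/eqP; rewrite -subr_eq0 -normr_le0; apply/ler_addgt0Pr => e e0.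
 rewrite add0r; have [k hk] : exists k, 2 * M * 2^-1 ^+ k < e / 2 by apply: small; rewrite divr_gt0.
 have h1 := @cmp _ _ _ _ (e / 2) gpsi (goodF k).
 have h2 : `|psi t - F k.+1 t| <= 2^-1 * (e / 2).
  apply: h1 => s _; rewrite distrC; apply: le_trans (hphi s k) _; exact: ltW.
 have h3 := hphi t k.+1.
 have M0 : 0 <= M by apply: le_trans (hM 0).
 have h4 : 2 * M * 2^-1 ^+ k.+1 <= 2 * M * 2^-1 ^+ k.
  apply: ler_wpM2l; first by rewrite mulr_ge0.
  by rewrite exprS ler_piMl ?exprn_ge0 ?invr_ge0 // invf_le1 ?ler1n.
 rewrite -(subrK (F k.+1 t) (psi t)) -addrA; apply: le_trans (ler_normD _ _) _.
 lra.
by exists phi; have [_ i _ [_ d]] := gpsi; rewrite E in i d.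
Qed.

End Analysis.

(** * Time-dependent coordinates and strict differentiability *)

Section TimeSpace.
Context {R : realType}.

(** A time and a point packed in one row vector, time first, so that the calculus of row vectors
    covers time-dependent objects. *)
Definition tx p (t : R) (x : 'rV[R]_p) : 'rV[R]_(1 + p) := row_mx t%:M x.
Definition tm p (z : 'rV[R]_(1 + p)) : R := z 0 (lshift p 0).
Definition sp p (z : 'rV[R]_(1 + p)) : 'rV[R]_p := rsubmx z.

Lemma tm_tx p t (x : 'rV[R]_p) : tm (tx t x) = t.
Proof. by rewrite /tm /tx row_mxEl mxE eqxx. Qed.

Lemma sp_tx p t (x : 'rV[R]_p) : sp (tx t x) = x.
Proof. exact: row_mxKr. Qed.

Lemma tx_eta p (z : 'rV[R]_(1 + p)) : tx (tm z) (sp z) = z.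
Proof.
rewrite -[RHS]hsubmxK; congr row_mx; apply/rowP => j.
by rewrite (ord1 j) !mxE eqxx.
Qed.

Lemma txB p t t' (x x' : 'rV[R]_p) : tx t x - tx t' x' = tx (t - t') (x - x').
Proof. by rewrite /tx opp_row_mx add_row_mx raddfB. Qed.

Lemma txD p t t' (x x' : 'rV[R]_p) : tx t x + tx t' x' = tx (t + t') (x + x').
Proof. by rewrite /tx add_row_mx raddfD. Qed.

Lemma txZ p (s t : R) (x : 'rV[R]_p) : s *: tx t x = tx (s * t) (s *: x).
Proof. by rewrite /tx scale_row_mx scale_scalar_mx. Qed.

Lemma row_mx_norm_lt m n (x : 'rV[R]_m) (y : 'rV[R]_n) (r : R) : 0 < r ->
 (`|row_mx x y| < r) <-> (`|x| < r /\ `|y| < r).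
Proof.
move=> r0; split=> [/(rV_norm_lt _ r0) h|[hx hy]].
 split; apply/(rV_norm_lt _ r0) => j.
  by have := h (lshift n j); rewrite row_mxEl.
 by have := h (rshift m j); rewrite row_mxEr.
apply/(rV_norm_lt _ r0) => j; case: (split_ordP j) => i ->.
 by rewrite row_mxEl; move: i; apply/(rV_norm_lt _ r0).
by rewrite row_mxEr; move: i; apply/(rV_norm_lt _ r0).
Qed.

Lemma row_mx_norm_le m n (x : 'rV[R]_m) (y : 'rV[R]_n) (r : R) : 0 <= r ->
 `|x| <= r -> `|y| <= r -> `|row_mx x y| <= r.
Proof.
move=> r0 hx hy; apply/norm_le_rV => // j; case: (split_ordP j) => i ->.
 by rewrite row_mxEl; move: i; apply/norm_le_rV.
by rewrite row_mxEr; move: i; apply/norm_le_rV.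
Qed.

Lemma scalar_norm (t : R) : `|(t%:M : 'rV[R]_1)| = `|t|.
Proof.
apply/le_anti/andP; split; last by have := coord_le (t%:M : 'rV[R]_1) 0; rewrite mxE eqxx.
by apply/norm_le_rV => // j; rewrite (ord1 j) mxE eqxx.
Qed.

Lemma tx_norm_lt p t (x : 'rV[R]_p) (r : R) : 0 < r ->
 (`|tx t x| < r) <-> (`|t| < r /\ `|x| < r).
Proof. by move=> r0; rewrite /tx row_mx_norm_lt // scalar_norm. Qed.

Lemma tx_norm_le p t (x : 'rV[R]_p) (r : R) : `|t| <= r -> `|x| <= r -> `|tx t x| <= r.
Proof.
move=> h1 h2; apply: row_mx_norm_le => //; first exact: le_trans h1.
by rewrite scalar_norm.
Qed.

Lemma sm_tx_row n p (z : 'rV[R]_n) (f : 'rV[R]_n -> R^o) (g : 'rV[R]_n -> 'rV[R]_p) :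
 sm z f -> sm z g -> sm z (fun z => tx (f z) (g z)).
Proof.
move=> sf sg; apply/smM_row; apply: smM_rowmx; last exact/smM_row.
by move=> i j; under eq_fun do rewrite (ord1 i) (ord1 j) mxE eqxx mulr1n.
Qed.

Lemma tx_norm0 p (x : 'rV[R]_p) : `|tx 0 x| = `|x|.
Proof.
apply/le_anti/andP; split; first by apply: tx_norm_le; rewrite ?normr0.
by apply/norm_le_rV => // j; have := coord_le (tx 0 x) (rshift 1 j); rewrite /tx row_mxEr.
Qed.

Lemma sm_tm p (z : 'rV[R]_(1 + p)) : sm z (@tm p : _ -> R^o).
Proof. exact: sm_coord. Qed.

Lemma sm_sp p (z : 'rV[R]_(1 + p)) : sm z (@sp p).
Proof.
apply/sm_rVP => j; under eq_fun do rewrite mxE; exact: sm_coord.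
Qed.

Lemma Ck_row_mx n m q k (O : set 'rV[R]_n) (f : 'rV[R]_n -> 'rV[R]_m)
  (g : 'rV[R]_n -> 'rV[R]_q) : open O -> Ck k O f -> Ck k O g ->
 Ck k O (fun z => row_mx (f z) (g z)).
Proof.
move=> oO cf cg; apply/(Ck_rVP k _ oO) => j; case: (split_ordP j) => i ->.
 by under eq_fun do rewrite row_mxEl; move: i; apply/(Ck_rVP k _ oO).
by under eq_fun do rewrite row_mxEr; move: i; apply/(Ck_rVP k _ oO).
Qed.

Lemma Ck_comp_rV n m q k (O : set 'rV[R]_n) (O' : set 'rV[R]_m)
  (g : 'rV[R]_n -> 'rV[R]_m) (f : 'rV[R]_m -> 'rV[R]_q) :
 open O -> open O' -> (forall x, O x -> O' (g x)) ->
 Ck k O g -> Ck k O' f -> Ck k O (f \o g).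
Proof.
move=> oO oO' h cg cf; apply/(Ck_rVP k _ oO) => j.
have hf := (Ck_rVP k f oO').1 cf j; exact: (Ck_comp oO oO' h cg hf).
Qed.

Lemma Ck_smooth n (W : normedModType R) k (O : set 'rV[R]_n) (f : 'rV[R]_n -> W) :
 open O -> (forall x, O x -> sm x f) -> Ck k O f.
Proof. by move=> oO /(sm_open oO); exact. Qed.

Lemma Ck_local n (W : normedModType R) k (O : set 'rV[R]_n) (f : 'rV[R]_n -> W) :
 (forall z, O z -> exists O', [/\ open O', O' z & Ck k O' f]) -> Ck k O f.
Proof.
elim: k f => [|k IH] f h.
 by move=> z /h[ O' [_ O'z]]; exact.
split=> [z /h[ O' [_ O'z [+ _]]]|v]; first exact.
by apply: IH => z /h[ O' [oO' O'z [_ hD]]]; exists O'; split=> //; exact: hD.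
Qed.

Lemma is_d_eps (V W : normedModType R) (f : V -> W) z v (k : W) :
 (forall e : R, 0 < e -> exists2 r : R, 0 < r & forall s : R, `|s| < r ->
  `|f (s *: v + z) - f z - s *: k| <= e * `|s|) ->
 is_derive z v f k.
Proof.
move=> h; suff c : (fun s : R => s^-1 *: (f (s *: v + z) - f z)) @ 0^' --> k.
 by apply: DeriveDef; [apply/cvg_ex; exists k|exact: cvg_lim c].
apply/cvgrPdist_le => e e0; have [r r0 hr] := h e e0.
near=> s.
have s0 : s != 0 by near: s; exact: nbhs_dnbhs_neq.
have sr : `|s| < r by near: s; exact: dnbhs0_lt.
have -> : k - s^-1 *: (f (s *: v + z) - f z) = - (s^-1 *: (f (s *: v + z) - f z - s *: k)).
 by rewrite [in RHS]scalerBr scalerA mulVf // scale1r opprB.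
rewrite normrN normrZ normfV mulrC ler_pdivrMr ?normr_gt0 //; exact: hr.
Unshelve. all: by end_near. Qed.

Lemma is_derive_1 (W : normedModType R) (f : R^o -> W) (t : R) k :
 is_d t f k -> forall e : R, 0 < e ->
 exists2 r : R, 0 < r & forall s : R, `|s| < r -> `|f (s + t) - f t - s *: k| <= e * `|s|.
Proof.
move=> [/derivable1_diffP df dk] e e0.
have /nbhs_normP[r /= r0 hr] := diff_eps_ex df e0; exists r => // s sr.
have := hr s; rewrite /= sub0r normrN => /(_ sr).
by rewrite -{2}(mulr1 s) [s * 1](_ : _ = s *: (1 : R^o)) // linearZ /= -deriveE // dk.
Qed.

(** Functions of class C^1 are strictly differentiable: in a small ball one linear map approximates
    all increments, and it may be the derivative at any third point of the ball. The mean value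
    theorem is applied to each component. *)
Lemma strict_diff n m (O : set 'rV[R]_n) (u : 'rV[R]_n -> 'rV[R]_m) z :
 open O -> O z -> Ck 1 O u -> forall e : R, 0 < e -> exists2 r : R, 0 < r &
 forall z1 z2 z3, `|z1 - z| < r -> `|z2 - z| < r -> `|z3 - z| < r ->
 `|u z1 - u z2 - 'D_(z1 - z2) u z3| <= e * `|z1 - z2|.
Proof.
(* The factor $2$: the derivatives at two points of the ball are compared through the one at [z]. *)
move=> oO Oz [du cDu] e e0; pose e' := e / (2 * (n%:R + 1)).
have e'0 : 0 < e' by rewrite divr_gt0 // mulr_gt0 // ltr_wpDl.
have nO : \forall y \near z, O y by exact: open_nbhs_nbhs.
have nD : \forall y \near z, forall i : 'I_n, `|'D_(ev i) u z - 'D_(ev i) u y| < e'.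
 apply: (@filter_forall _ _ (fun i y => `|'D_(ev i) u z - 'D_(ev i) u y| < e') (nbhs z)) => i.
 by have /cvgrPdist_lt := cDu (ev i) z Oz; exact.
have /nbhs_normP[r /= r0 hr] : \forall y \near z,
  O y /\ forall i : 'I_n, `|'D_(ev i) u z - 'D_(ev i) u y| < e'.
 exact: filterI.
exists r => // z1 z2 z3 h1 h2 h3; pose w := z1 - z2.
have seg (s : R) : 0 <= s <= 1 -> `|z2 + s *: w - z| < r.
 move=> /andP[s0 s1]; have -> : z2 + s *: w - z = (1 - s) *: (z2 - z) + s *: (z1 - z).
  by apply/rowP => j; rewrite !mxE; ring.
 apply: le_lt_trans (ler_normD _ _) _; rewrite !normrZ (ger0_norm s0) ger0_norm ?subr_ge0 //.
 pose M := Num.max `|z2 - z| `|z1 - z|.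
 have Mr : M < r by rewrite gt_max h2.
 apply: le_lt_trans Mr.
 have m1 : `|z2 - z| <= M by rewrite le_max lexx.
 have m2 : `|z1 - z| <= M by rewrite le_max lexx orbT.
 have g1 : (1 - s) * `|z2 - z| <= (1 - s) * M by rewrite ler_wpM2l // subr_ge0.
 have g2 : s * `|z1 - z| <= s * M by rewrite ler_wpM2l.
 by apply: le_trans (lerD g1 g2) _; rewrite -mulrDl subrK mul1r.
apply/norm_le_rV => [|j]; first by rewrite mulr_ge0 // ltW.
have duj y : O y -> differentiable (fun y => u y 0 j : R^o) y.
 by move=> /du /diff_rVP; exact.
have z2s s : 0 <= s <= 1 -> O (z2 + s *: w).
 by move=> /seg hs; apply: (hr _ _).1; rewrite /= distrC.
have [s hs|s s01 sE] := @MVT_line _ _ (fun y => u y 0 j : R^o) z2 w.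
 exact: duj (z2s s hs).
have s01' : 0 <= s <= 1 by case/andP: s01 => /ltW -> /ltW ->.
rewrite -/w !mxE (_ : u z1 = u (z2 + w)); last by rewrite /w addrC subrK.
rewrite sE.
have Oz3 : O z3 by apply: (hr _ _).1; rewrite /= distrC.
have Oy := z2s s s01'; set y := z2 + s *: w in Oy sE *.
have -> : ('D_w u z3) 0 j = 'D_w (fun y => u y 0 j : R^o) z3.
 by rewrite derive_rV //; exact/diff_derivable/du.
rewrite (derive_sumE w (duj _ Oz3)) (derive_sumE w (duj _ Oy)) -sumrB.
apply: le_trans (ler_norm_sum _ _ _) _.
have -> : e * `|w| = e / (n%:R + 1) * `|w| * (n%:R + 1).
 by rewrite mulrAC divfK // gt_eqF // ltr_wpDl.
apply: (@le_trans _ _ (\sum_(i < n) e / (n%:R + 1) * `|w|)); last first.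
 rewrite sumr_const card_ord -[leLHS]mulr_natr; apply: ler_wpM2l; last by rewrite lerDl.
 by rewrite mulr_ge0 // divr_ge0 // ltW // ltr_wpDl.
apply: ler_sum => i _; rewrite -scalerBr normrM mulrC.
apply: ler_pM => //; last exact: coord_le.
have b1 q : `|q - z| < r -> O q -> `|'D_(ev i) (fun y => u y 0 j : R^o) z - 'D_(ev i) (fun y => u y 0 j : R^o) q| <= e'.
 move=> hq Oq; have dd q' : O q' -> 'D_(ev i) (fun y => u y 0 j : R^o) q' = ('D_(ev i) u q') 0 j.
  by move=> Oq'; rewrite derive_rV //; exact/diff_derivable/du.
 rewrite (dd _ Oz) (dd _ Oq).
 have := (hr q); rewrite /= distrC => /(_ hq)[_ /(_ i)/ltW]; apply: le_trans.
 by have := coord_le ('D_(ev i) u z - 'D_(ev i) u q) j; rewrite !mxE.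
have k1 := b1 _ h3 Oz3; have k2 := b1 _ (seg s s01') Oy.
have -> : e / (n%:R + 1) = e' + e'.
 rewrite /e'; have : n%:R + 1 != 0 :> R by rewrite gt_eqF // ltr_wpDl.
 by move: (n%:R + 1) => N N0; field.
move: k1 k2; move: ('D_(ev i) _ z3) ('D_(ev i) _ y) ('D_(ev i) _ z) => p q t k1 k2.
have -> : q - p = (t - p) - (t - q) by ring.
by apply: le_trans (ler_normB _ _) _; exact: lerD.
Qed.

End TimeSpace.

(** * Differential equations with parameters *)

Section GeneralODE.
Context {R : realType}.

Definition t3 p m (t : R) (x : 'rV[R]_p) (y : 'rV[R]_m) : 'rV[R]_(1 + (p + m)) :=
 tx t (row_mx x y).

Definition lp p m (y : 'rV[R]_(p + m)) : 'rV[R]_p := lsubmx y.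
Definition rp p m (y : 'rV[R]_(p + m)) : 'rV[R]_m := rsubmx y.

Definition dom0 p (a b : R) (B : set 'rV[R]_p) : set 'rV[R]_(1 + p) :=
 [set z | a < tm z < b /\ B (sp z)].

Definition dom p m (a b : R) (B : set 'rV[R]_p) (Y : set 'rV[R]_m) :
  set 'rV[R]_(1 + (p + m)) :=
 [set z | a < tm z < b /\ (B (lp (sp z)) /\ Y (rp (sp z)))].

(** [h] solves $y' = u(t, x, y)$ with parameter $x$ and initial value [h0] at time $0$. Wherever
    this is used, [L * (b - a)] is at most $1/4$, so that [curve_growth] can replace the exponential
    Gronwall bound. *)
Definition ode p m (a b L : R) (B : set 'rV[R]_p) (Y : set 'rV[R]_m)
  (u : 'rV[R]_(1 + (p + m)) -> 'rV[R]_m) (h : 'rV[R]_(1 + p) -> 'rV[R]_m)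
  (h0 : 'rV[R]_p -> 'rV[R]_m) : Prop :=
 [/\ open B /\ open Y,
  (forall t x, a < t < b -> B x -> Y (h (tx t x))),
  (forall x, B x -> h (tx 0 x) = h0 x),
  (forall t x, a < t < b -> B x ->
   is_d t (fun s : R^o => h (tx s x)) (u (t3 t x (h (tx t x))))) &
  (forall t x y y', a < t < b -> B x -> Y y -> Y y' ->
   `|u (t3 t x y) - u (t3 t x y')| <= L * `|y - y'|)].

Lemma t3B p m t t' (x x' : 'rV[R]_p) (y y' : 'rV[R]_m) :
 t3 t x y - t3 t' x' y' = t3 (t - t') (x - x') (y - y').
Proof. by rewrite /t3 txB opp_row_mx add_row_mx. Qed.

Lemma t3D p m t t' (x x' : 'rV[R]_p) (y y' : 'rV[R]_m) :
 t3 t x y + t3 t' x' y' = t3 (t + t') (x + x') (y + y').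
Proof. by rewrite /t3 txD add_row_mx. Qed.

Lemma t3Z p m s t (x : 'rV[R]_p) (y : 'rV[R]_m) :
 s *: t3 t x y = t3 (s * t) (s *: x) (s *: y).
Proof. by rewrite /t3 txZ scale_row_mx. Qed.

Lemma t3_norm_le p m t (x : 'rV[R]_p) (y : 'rV[R]_m) (r : R) :
 `|t| <= r -> `|x| <= r -> `|y| <= r -> `|t3 t x y| <= r.
Proof.
move=> h1 h2 h3; apply: tx_norm_le => //; apply: row_mx_norm_le => //.
exact: le_trans h1.
Qed.

Lemma dom_t3 p m a b (B : set 'rV[R]_p) (Y : set 'rV[R]_m) t x y :
 dom a b B Y (t3 t x y) <-> a < t < b /\ (B x /\ Y y).
Proof. by rewrite /dom /= /t3 tm_tx sp_tx /lp /rp row_mxKl row_mxKr. Qed.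

Lemma dom0_tx p a b (B : set 'rV[R]_p) t x :
 dom0 a b B (tx t x) <-> a < t < b /\ B x.
Proof. by rewrite /dom0 /= tm_tx sp_tx. Qed.

Lemma open_preimage n (T : topologicalType) (f : 'rV[R]_n -> T) (A : set T) :
 open A -> (forall x, {for x, continuous f}) -> open (f @^-1` A).
Proof. by move=> oA cf; apply: open_comp => // x _; exact: cf. Qed.

Lemma open_tm p (a b : R) : open [set z : 'rV[R]_(1 + p) | a < tm z < b].
Proof.
have -> : [set z : 'rV[R]_(1 + p) | a < tm z < b] = @tm R p @^-1` `]a, b[.
 by apply/seteqP; split=> z /=; rewrite in_itv.
apply: open_preimage; first exact: itv_open.
by move=> x; exact: sm_cont (sm_tm x).
Qed.

Lemma open_dom0 p a b (B : set 'rV[R]_p) : open B -> open (dom0 a b B).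
Proof.
move=> oB; apply: openI; first exact: open_tm.
apply: (@open_preimage _ _ (@sp R p) B oB) => x; exact: sm_cont (sm_sp x).
Qed.

Lemma sm_lsub p m (z : 'rV[R]_(p + m)) : sm z (@lp p m).
Proof.
apply: (proj2 (sm_rVP z (@lp p m))) => j.
have -> : (fun y : 'rV[R]_(p + m) => lp y 0 j : R^o) = (fun y => y 0 (lshift m j) : R^o).
 by apply/funext => y; rewrite /lp mxE.
exact: sm_coord.
Qed.

Lemma sm_rsub p m (z : 'rV[R]_(p + m)) : sm z (@rp p m).
Proof.
apply: (proj2 (sm_rVP z (@rp p m))) => j.
have -> : (fun y : 'rV[R]_(p + m) => rp y 0 j : R^o) = (fun y => y 0 (rshift p j) : R^o).
 by apply/funext => y; rewrite /rp mxE.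
exact: sm_coord.
Qed.

Lemma open_dom p m a b (B : set 'rV[R]_p) (Y : set 'rV[R]_m) :
 open B -> open Y -> open (dom a b B Y).
Proof.
move=> oB oY; apply: openI; first exact: open_tm.
apply: openI.
 apply: (@open_preimage _ _ (@lp p m \o @sp R (p + m)) B oB) => x.
 by apply: continuous_comp; [exact: sm_cont (sm_sp _)|exact: sm_cont (sm_lsub _)].
apply: (@open_preimage _ _ (@rp p m \o @sp R (p + m)) Y oY) => x.
by apply: continuous_comp; [exact: sm_cont (sm_sp _)|exact: sm_cont (sm_rsub _)].
Qed.

Lemma continuous_ext (V W : topologicalType) (f g : V -> W) x :
 (forall z, f z = g z) -> {for x, continuous f} -> {for x, continuous g}.
Proof. by move=> /funext ->. Qed.

Lemma cont_row_mx (T : topologicalType) p m (f : T -> 'rV[R]_p) (g : T -> 'rV[R]_m) t :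
 {for t, continuous f} -> {for t, continuous g} ->
 {for t, continuous (fun s => row_mx (f s) (g s))}.
Proof.
move=> /cont_rVP cf /cont_rVP cg; apply/cont_rVP => j.
case: (split_ordP j) => i ->; first by apply: continuous_ext (cf i) => s; rewrite row_mxEl.
by apply: continuous_ext (cg i) => s; rewrite row_mxEr.
Qed.

Lemma cont_t3 p m (f : R -> R) (x : 'rV[R]_p) (g : R -> 'rV[R]_m) t :
 {for t, continuous f} -> {for t, continuous g} ->
 {for t, continuous (fun s => t3 (f s) x (g s))}.
Proof.
move=> cf cg; apply: cont_row_mx; last first.
 by apply: cont_row_mx; [exact: cst_continuous|exact: cg].
apply/cont_rVP => j; apply: continuous_ext cf => s.
by rewrite (ord1 j) mxE eqxx mulr1n.
Qed.

Lemma strict_diff_curve n m (O : set 'rV[R]_n) (u : 'rV[R]_n -> 'rV[R]_m)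
  (q : R -> 'rV[R]_n) c d : open O -> Ck 1 O u ->
 (forall t, c <= t <= d -> {for t, continuous q} /\ O (q t)) ->
 forall e : R, 0 < e -> exists2 r : R, 0 < r & forall t, c <= t <= d -> forall w, `|w| < r ->
 `|u (q t + w) - u (q t) - 'D_w u (q t)| <= e * `|w|.
Proof.
move=> oO cu hq e e0; apply: (@segment_uniform R c d (fun t r => forall w, `|w| < r ->
 `|u (q t + w) - u (q t) - 'D_w u (q t)| <= e * `|w|)).
 by move=> t r r' h rr' w wr'; apply: h; exact: lt_le_trans rr'.
move=> t /hq[/cvgrPdist_lt cq Oq]; have [r r0 hr] := strict_diff oO Oq cu e0.
have r20 : 0 < r / 2 by rewrite divr_gt0.
have /nbhs_ballP[s /= s0 hs] := cq _ r20.
exists (Num.min s (r / 2)); first by rewrite lt_min s0.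
move=> t'; rewrite lt_min => /andP[h1 _] w; rewrite lt_min => /andP[_ wr].
have h2 : `|q t' - q t| < r / 2.
 by rewrite distrC; apply: hs; rewrite /ball /= distrC.
have h3 : `|q t' - q t| < r by apply: lt_trans h2 _; lra.
have h4 : `|q t' + w - q t| < r.
 rewrite addrAC; apply: le_lt_trans (ler_normD _ _) _.
 by rewrite [ltRHS]splitr; exact: ltrD.
by have := hr (q t' + w) (q t') (q t') h4 h3 h3; rewrite (addrC (q t')) addrK.
Qed.

Lemma ode_cont p m a b L (B : set 'rV[R]_p) (Y : set 'rV[R]_m) u h h0 :
 ode a b L B Y u h h0 -> forall t x, a < t < b -> B x ->
 {for t, continuous (fun s => h (tx s x))} /\
 {for t, continuous (fun s => t3 s x (h (tx s x)))} /\
 dom a b B Y (t3 t x (h (tx t x))).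
Proof.
move=> [[oB oY] hY _ hd _] t x tab Bx.
have ch : {for t, continuous (fun s => h (tx s x))} := is_d_cont (hd t x tab Bx).
split; first exact: ch.
split; last by apply/dom_t3; split; [exact: tab|split; [exact: Bx|exact: hY]].
apply: (@cont_t3 _ _ id x (fun s => h (tx s x))) => //.
Qed.

(** The difference of the solutions for two parameters obeys a Gronwall inequality whose
    inhomogeneous term compares [u] at the two parameters along the solution for [x]. Compactness of
    $[c, d]$ makes this term uniformly small. *)
Lemma ode_unif p m a b L (B : set 'rV[R]_p) (Y : set 'rV[R]_m) u h h0 x c d :
 0 <= L -> L * (b - a) <= 4^-1 ->
 ode a b L B Y u h h0 -> Ck 0 (dom a b B Y) u -> Ck 0 B h0 ->
 B x -> a < c -> c <= 0 -> 0 <= d -> d < b -> forall e : R, 0 < e ->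
 exists2 r : R, 0 < r & forall x', `|x' - x| < r -> B x' /\
  forall t, c <= t <= d -> `|h (tx t x') - h (tx t x)| <= e.
Proof.
move=> L0 LT H cu ch0 Bx ac c0 d0 db e e0; have [[oB oY] hY hi hd hl] := H.
have tab t : c <= t <= d -> a < t < b.
 by move=> ?; lra.
have ba : 0 < b - a by lra.
(* Chosen so that [e1 * (b - a)] is [e / 4]. The initial values contribute another [e / 4], and
   [curve_growth] doubles the sum. *)
pose e1 := e / (4 * (b - a)); have e10 : 0 < e1 by rewrite divr_gt0 // mulr_gt0.
have [r r0 hr] : exists2 r : R, 0 < r & forall t, c <= t <= d -> forall x', `|x' - x| < r ->
  B x' /\ `|u (t3 t x' (h (tx t x))) - u (t3 t x (h (tx t x)))| <= e1.
 apply: (@segment_uniform R c d (fun t r => forall x', `|x' - x| < r ->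
  B x' /\ `|u (t3 t x' (h (tx t x))) - u (t3 t x (h (tx t x)))| <= e1)).
  by move=> t r r' hr rr' x' xr'; apply: hr; exact: lt_le_trans rr'.
 move=> t /tab tt; have [cht [cq Dq]] := ode_cont H tt Bx.
 have e12 : 0 < e1 / 2 by rewrite divr_gt0.
 have /cvgrPdist_lt/(_ _ e12) := cu _ Dq.
 have nD : \forall z \near t3 t x (h (tx t x)), dom a b B Y z.
  by apply: open_nbhs_nbhs; split=> //; exact: open_dom.
 move=> nu; have /nbhs_normP[r /= r0 hr] : \forall z \near t3 t x (h (tx t x)),
   dom a b B Y z /\ `|u (t3 t x (h (tx t x))) - u z| < e1 / 2 by exact: filterI.
 have /cvgrPdist_lt/(_ _ r0)/nbhs_ballP[s /= s0 hs] := cht.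
 exists (Num.min s (r / 2)); first by rewrite lt_min s0 divr_gt0.
 move=> t'; rewrite lt_min => /andP[h1 h1'] x'; rewrite lt_min => /andP[_ xr].
 have h2 : `|h (tx t' x) - h (tx t x)| < r.
  by rewrite distrC; apply: hs; rewrite /ball /= distrC.
 have rr : r / 2 < r by clear - r0; lra.
 have nq x2 : `|x2 - x| < r -> `|t3 t x (h (tx t x)) - t3 t' x2 (h (tx t' x))| < r.
  move=> hx2; rewrite t3B /t3 tx_norm_lt // row_mx_norm_lt // distrC (distrC x) (distrC (h _)).
  by split; first exact: lt_trans rr.
 have [D1 h3] := hr _ (nq x' (lt_trans xr rr)).
 have [_ h4] : dom a b B Y (t3 t' x (h (tx t' x))) /\
   `|u (t3 t x (h (tx t x))) - u (t3 t' x (h (tx t' x)))| < e1 / 2.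
  by apply: hr; apply: nq; rewrite subrr normr0.
 split; first by case/dom_t3: D1 => _ [].
 apply: le_trans (ler_distD (u (t3 t x (h (tx t x)))) _ _) _.
 by rewrite [leRHS]splitr distrC; apply: lerD; apply: ltW.
have e4 : 0 < e / 4 by rewrite divr_gt0.
have /cvgrPdist_lt/(_ _ e4)/nbhs_normP[s /= s0 hs] := ch0 x Bx.
exists (Num.min r s); first by rewrite lt_min r0.
move=> x'; rewrite lt_min => /andP[xr xs].
have [Bx' _] : B x' /\ `|u (t3 0 x' (h (tx 0 x))) - u (t3 0 x (h (tx 0 x)))| <= e1.
 by apply: hr => //; rewrite c0.
split=> // t tcd.
have z0 : c <= 0 <= d by rewrite c0.
have LT' : L * (d - c) <= 2^-1.
 have l1 : L * (d - c) <= L * (b - a) by rewrite ler_wpM2l //; lra.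
 by apply: le_trans l1 _; apply: le_trans LT _; lra.
have cal s' : c <= s' <= d -> {for s', continuous (fun s => h (tx s x') - h (tx s x))}.
 by move=> /tab st; apply: continuousB; [exact: (ode_cont H st Bx').1|exact: (ode_cont H st Bx).1].
have dal s' : c < s' < d -> is_d s' ((fun s => h (tx s x') - h (tx s x)) : R^o -> _)
  (u (t3 s' x' (h (tx s' x'))) - u (t3 s' x (h (tx s' x)))) /\
  `|u (t3 s' x' (h (tx s' x'))) - u (t3 s' x (h (tx s' x)))| <= L * `|h (tx s' x') - h (tx s' x)| + e1.
 move=> /andP[cs' s'd]; have st : c <= s' <= d by rewrite !ltW.
 have st' := tab _ st; split; first exact: is_deriveB (hd _ _ st' Bx') (hd _ _ st' Bx).
 apply: le_trans (ler_distD (u (t3 s' x' (h (tx s' x)))) _ _) _.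
 apply: lerD; first by apply: hl => //; exact: hY.
 by have [_] := hr s' st x' xr.
have := curve_growth L0 (ltW e10) LT' cal dal tcd z0.
rewrite (hi _ Bx') (hi _ Bx) => /le_trans; apply.
have b1 : `|h0 x' - h0 x| <= e / 4 by rewrite distrC; apply/ltW/hs; rewrite /= distrC.
have b2 : e1 * (d - c) <= e / 4.
 have -> : e / 4 = e1 * (b - a).
  by rewrite /e1; field; rewrite gt_eqF.
 by rewrite ler_wpM2l // ?ltW //; lra.
by lra.
Qed.

End GeneralODE.

(** * Smooth dependence on parameters *)

Section SmoothDependence.
Context {R : realType}.

Lemma cont_epsP (V W : normedModType R) (f : V -> W) x :
 {for x, continuous f} <-> forall e : R, 0 < e ->
  exists2 r : R, 0 < r & forall y, `|y - x| < r -> `|f y - f x| < e.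
Proof.
split=> [/cvgrPdist_lt cf e e0|h].
 have /nbhs_normP[r /= r0 hr] := cf e e0; exists r => // y yr.
 by rewrite distrC; apply: hr; rewrite /= distrC.
apply/cvgrPdist_lt => e e0; have [r r0 hr] := h e e0.
apply/nbhs_normP; exists r => //= y yr; rewrite distrC; apply: hr.
by rewrite distrC.
Qed.

Lemma t3_sum p m (y : 'rV[R]_m) :
 t3 0 (0 : 'rV[R]_p) y = \sum_i y 0 i *: t3 0 0 (ev i).
Proof.
rewrite {1}(row_sum_delta y); elim/big_rec2: _ => [|i s1 s2 _ <-].
 by rewrite /t3 /tx row_mx0 raddf0 row_mx0.
by rewrite t3Z t3D mulr0 scaler0 addr0 addr0.
Qed.

Lemma Ck_scale n m k (O : set 'rV[R]_n) (f : 'rV[R]_n -> R^o) (g : 'rV[R]_n -> 'rV[R]_m) :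
 open O -> Ck k O f -> Ck k O g -> Ck k O (fun z => f z *: g z).
Proof.
move=> oO cf cg; apply/(Ck_rVP k _ oO) => j; under eq_fun do rewrite mxE.
by apply: Ck_mul => //; move: j; apply/(Ck_rVP k _ oO).
Qed.

Lemma Ck_lsp p k (O : set 'rV[R]_(1 + p)) : open O -> Ck k O (@sp R p).
Proof. by move=> oO; apply: Ck_smooth => // z _; exact: sm_sp. Qed.

Lemma norm_ev n (j : 'I_n) : `|(ev j : 'rV[R]_n)| <= 1.
Proof.
apply/norm_le_rV => // i; rewrite !mxE; case: (_ && _) => /=.
 by rewrite normr1.
by rewrite normr0.
Qed.

Lemma derive_bound n m (u : 'rV[R]_n -> 'rV[R]_m) q v (K : R) :
 differentiable u q -> (\forall s \near (0 : R), `|u (s *: v + q) - u q| <= K * `|s|) ->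
 `|'D_v u q| <= K.
Proof.
move=> du hK; apply/ler_addgt0Pr => e e0.
have /cvg_ex[/= l ul] : derivable u q v by exact: diff_derivable.
have lE : 'D_v u q = l by exact: cvg_lim ul.
rewrite -lE in ul; move/cvgrPdist_lt: ul => /(_ e e0) h1.
have h2 : \forall s \near (0 : R)^', `|u (s *: v + q) - u q| <= K * `|s|.
 exact: nbhs_dnbhs.
have [s [[h3 h4] s0]] : exists s : R, (`|'D_v u q - s^-1 *: (u (s *: v + q) - u q)| < e /\
  `|u (s *: v + q) - u q| <= K * `|s|) /\ s != 0.
 have h5 : \forall s \near (0 : R)^', (`|'D_v u q - s^-1 *: (u (s *: v + q) - u q)| < e /\
   `|u (s *: v + q) - u q| <= K * `|s|) /\ s != 0.
  near=> s; split; [split|]; near: s => //; exact: nbhs_dnbhs_neq.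
 by have [s hs] := filter_ex h5; exists s.
rewrite -(subrK (s^-1 *: (u (s *: v + q) - u q)) ('D_v u q)).
apply: le_trans (ler_normD _ _) _; rewrite addrC; apply: lerD; last exact: ltW.
by rewrite normrZ normfV mulrC ler_pdivrMr ?normr_gt0.
Unshelve. all: by end_near. Qed.

Lemma ev_lshift1 p (j : 'I_1) : (ev (lshift p j) : 'rV[R]_(1 + p)) = tx 1 0.
Proof.
apply/rowP => i; case: (split_ordP i) => j' ->; rewrite /tx ?row_mxEl ?row_mxEr mxE eqxx /=.
 by rewrite (ord1 j) (ord1 j') eqxx mxE.
by rewrite eq_rlshift mxE.
Qed.

Lemma ev_rshift1 p (j : 'I_p) : (ev (rshift 1 j) : 'rV[R]_(1 + p)) = tx 0 (ev j).
Proof.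
apply/rowP => i; case: (split_ordP i) => j' ->; rewrite /tx ?row_mxEl ?row_mxEr mxE eqxx /=.
 by rewrite eq_lrshift mxE (ord1 j').
by rewrite eq_rshift mxE eqxx.
Qed.

(** The derivative in a parameter solves the linearized equation. Along the solution, which is of
    class C^k by induction, this equation has a right side of class C^k and the same Lipschitz
    constant, so its own solution is of class C^k by induction; the time derivative is [u] along the
    solution. The induction ranges over all dimensions and state sets because the linearized
    equation has the whole space as its state set. *)
Theorem ode_Ck k : forall p m (a b L : R) (B : set 'rV[R]_p) (Y : set 'rV[R]_m) u h h0,
 a < 0 -> 0 < b -> 0 <= L -> L * (b - a) <= 4^-1 ->
 ode a b L B Y u h h0 -> Ck k (dom a b B Y) u -> Ck k B h0 ->
 Ck k (dom0 a b B) h.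
Proof.
elim: k => [|k IH] p m a b L B Y u h h0 a0 b0 L0 LT H cu ch0.
 have [[oB oY] hY hi hd hl] := H.
 move=> z [tz Bz]; rewrite -(tx_eta z); set t := tm z in tz *; set x := sp z in Bz *.
 apply/cont_epsP => e e0; have e3 : 0 < e / 3 by rewrite divr_gt0.
 have [at_ tb] := andP tz.
 (* A compact interval inside $(a, b)$ that contains both $0$, where the initial value sits, and a
    neighborhood of [t]. *)
 pose c := Num.min 0 ((a + t) / 2); pose d := Num.max 0 ((b + t) / 2).
 have ac : a < c by rewrite /c lt_min a0 /=; lra.
 have ct : c < t \/ t = c /\ False by left; rewrite /c gt_min; apply/orP; right; lra.
 have {}ct : c < t by case: ct => // -[].
 have db : d < b by rewrite /d gt_max b0 /=; lra.
 have td : t < d by rewrite /d lt_max; apply/orP; right; lra.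
 have c0 : c <= 0 by rewrite /c ge_min lexx.
 have d0 : 0 <= d by rewrite /d le_max lexx.
 have [r r0 hr] := ode_unif L0 LT H cu ch0 Bz ac c0 d0 db e3.
 have /cvgrPdist_lt/(_ _ e3)/nbhs_ballP[s /= s0 hs] := (ode_cont H tz Bz).1.
 pose r' := Num.min (Num.min r s) (Num.min (t - c) (d - t)).
 have r'0 : 0 < r' by rewrite !lt_min r0 s0 !subr_gt0 ct td.
 exists r' => // y; rewrite distrC -(tx_eta y) txB.
 move=> /(tx_norm_lt _ _ r'0) []; rewrite !lt_min.
 move=> /andP[/andP[_ ts] /andP[tc tdd]] /andP[/andP[xr _] _].
 have cyd : c <= tm y <= d.
  by move: tc tdd; rewrite !ltr_norml => /andP[_ h1] /andP[h2 _]; clear - h1 h2; apply/andP; split; lra.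
 rewrite distrC in xr; have [_ /(_ _ cyd) h2] := hr _ xr.
 have h1 := hs (tm y) ts; rewrite /= in h1.
 rewrite distrC; apply: le_lt_trans (ler_distD (h (tx (tm y) x)) _ _) _.
 rewrite (distrC _ (h (tx (tm y) (sp y)))); apply: lt_trans (ltr_leD h1 h2) _.
 clear - e0; lra.
have [[oB oY] hY hi hd hl] := H.
have cu' := Ck_S cu; have ch0' := Ck_S ch0.
have hk := IH _ _ _ _ _ _ _ _ _ _ a0 b0 L0 LT H cu' ch0'.
have C0 n q (V : normedModType R) (O : set 'rV[R]_n) (f : 'rV[R]_n -> V) : Ck q O f -> Ck 0 O f.
 by elim: q f => // q IHq f /Ck_S; exact: IHq.
have C1 n (V : normedModType R) (O : set 'rV[R]_n) (f : 'rV[R]_n -> V) : Ck k.+1 O f -> Ck 1 O f.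
 by move=> [h1 h2]; split=> // v; exact: (C0 _ _ _ _ _ (h2 v)).
have oD : open (dom a b B Y) by exact: open_dom.
have oD0 : open (dom0 a b B) by exact: open_dom0.
pose q (z : 'rV[R]_(1 + p)) := t3 (tm z) (sp z) (h z).
have qD z : dom0 a b B z -> dom a b B Y (q z).
 move=> [h1 h2]; apply/dom_t3; split=> //; split=> //.
 by rewrite -(tx_eta z); exact: hY.
have qk : Ck k (dom0 a b B) q.
 apply: Ck_row_mx => //; last by apply: Ck_row_mx => //; exact: Ck_lsp.
 apply/(Ck_rVP k _ oD0) => j; apply: (@Ck_eq _ _ _ _ _ (fun z => z 0 (lshift p 0) : R^o)) => //.
  by move=> z _; rewrite (ord1 j) mxE eqxx.
 exact: Ck_coord.
have Duk v : Ck k (dom0 a b B) (fun z => 'D_v u (q z)).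
 have cv : Ck k (dom a b B Y) ('D_v u) by case: cu => _; exact.
 exact: (Ck_comp_rV oD0 oD qD qk cv).
have duq z : dom0 a b B z -> differentiable u (q z) by move=> /qD; exact: cu.1.
(* The Lipschitz bound of [u] in the state bounds its partial differential, so the linearized
   equation inherits the constant [L]. *)
have lipD z y : dom0 a b B z -> `|'D_(t3 0 0 y) u (q z)| <= L * `|y|.
 move=> Dz; apply: derive_bound; first exact: duq.
 have [tz Bz] := Dz; have oYz : \forall y' \near h z, Y y'.
  by apply: open_nbhs_nbhs; split=> //; rewrite -(tx_eta z); exact: hY.
 have cs : (fun s : R => s *: y + h z) @ (0 : R) --> h z.
  have : {for (0 : R^o), continuous (fun s : R^o => s *: y + h z)}.
   apply: continuousD; last exact: cst_continuous.
   by apply: continuousZr_tmp; exact: cvg_id.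
  by rewrite /prop_for /continuous_at scale0r add0r.
 have nY : \forall s \near (0 : R), Y (s *: y + h z) := cs _ oYz.
 apply: filterS nY => s Ys.
 have -> : s *: t3 0 (0 : 'rV[R]_p) y + q z = t3 (tm z) (sp z) (s *: y + h z).
  by rewrite /q t3Z t3D mulr0 add0r scaler0 add0r.
 have Yh : Y (h z) by rewrite -(tx_eta z); exact: hY.
 apply: le_trans (hl _ _ _ _ tz Bz Ys Yh) _.
 by rewrite addrK normrZ -mulrA (mulrC `|s|).
(* The right side of the linearized equation for the parameter [j]: the differential of [u] in the
   state applied to the unknown, plus the derivative of [u] in that parameter, both taken along the
   solution [h]. *)
pose lin (j : 'I_p) (z : 'rV[R]_(1 + (p + m))) : 'rV[R]_m :=
 let z0 := tx (tm z) (lp (sp z)) in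
 \sum_(i < m) (rp (sp z)) 0 i *: 'D_(t3 0 0 (ev i)) u (q z0) + 'D_(t3 0 (ev j) 0) u (q z0).
have linE j t x y : dom0 a b B (tx t x) ->
  lin j (t3 t x y) = 'D_(t3 0 (ev j) y) u (q (tx t x)).
 move=> Dz; rewrite /lin /t3 tm_tx sp_tx /lp /rp row_mxKl row_mxKr -!/(t3 _ _ _).
 have -> : t3 0 (ev j) y = t3 0 0 y + t3 0 (ev j) 0 :> 'rV[R]_(1 + (p + m)).
  by rewrite t3D !addr0 add0r.
 have du := duq _ Dz; rewrite !(deriveE _ du) linearD /= t3_sum linear_sum.
 by congr (_ + _); apply: eq_bigr => i _; rewrite linearZ (deriveE _ du).
have lin0E t x y y' j : dom0 a b B (tx t x) ->
  lin j (t3 t x y) - lin j (t3 t x y') = 'D_(t3 0 0 (y - y')) u (q (tx t x)).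
 move=> Dz; rewrite !linE //; have du := duq _ Dz; rewrite !(deriveE _ du) -linearB /=.
 by rewrite t3B !subrr.
have linC j : Ck k (dom a b B setT) (lin j).
 have oDT : open (dom a b B (setT : set 'rV[R]_m)) by apply: open_dom => //; exact: openT.
 pose g0 (z : 'rV[R]_(1 + (p + m))) := tx (tm z) (lp (sp z)).
 have g0D z : dom a b B setT z -> dom0 a b B (g0 z).
  by move=> [h1 [h2 _]]; apply/dom0_tx.
 have sg0 z : sm z g0.
  apply: sm_tx_row; first exact: sm_tm.
  by apply: (scomp (@sp R (p + m)) (@lp R p m)); [exact: sm_sp|exact: sm_lsub].
 have cg0 : Ck k (dom a b B (setT : set 'rV[R]_m)) g0.
  by apply: Ck_smooth.
 apply: Ck_add => //; last exact: (Ck_comp_rV oDT oD0 g0D cg0 (Duk _)).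
 apply: Ck_sum => // i; apply: Ck_scale => //; last exact: (Ck_comp_rV oDT oD0 g0D cg0 (Duk _)).
 apply: Ck_smooth => // z _.
 apply: (@sm_comp R _ _ z (@rp R p m \o @sp R (p + m)) (fun y => y 0 i : R^o)); last exact: sm_coord.
 by apply: (scomp (@sp R (p + m)) (@rp R p m)); [exact: sm_sp|exact: sm_rsub].
(* The claim is local, so the interval is shrunk to $(c, d)$ with closure inside $(a, b)$. There the
   linearized equation can be extended by [clip] and solved by Picard iteration. *)
apply: Ck_local => z Dz; have [tz Bz] := Dz.
have [c [d [[ac c0 ct] [db d0 td]]]] : exists c d, [/\ a < c, c < 0 & c < tm z] /\ [/\ d < b, 0 < d & tm z < d].
 have [at_ tb] := andP tz.
 exists (Num.min (a / 2) ((a + tm z) / 2)), (Num.max (b / 2) ((b + tm z) / 2)).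
 clear - a0 b0 at_ tb; split; first split; rewrite ?lt_min ?gt_min ?lt_max ?gt_max.
 - by apply/andP; split; lra.
 - by apply/orP; left; lra.
 - by apply/orP; right; lra.
 split; rewrite ?lt_min ?gt_min ?lt_max ?gt_max.
 - by apply/andP; split; lra.
 - by apply/orP; left; lra.
 - by apply/orP; right; lra.
exists (dom0 c d B); split; [exact: open_dom0|by split; rewrite ?ct|].
have sub t : c <= t <= d -> a < t < b.
 by move=> /andP[ct' td']; rewrite (lt_le_trans ac ct') (le_lt_trans td' db).
have sub' t : c < t < d -> a < t < b.
 by move=> /andP[ct' td']; rewrite (lt_trans ac ct') (lt_trans td' db).
have cd : c <= d := ltW (lt_trans c0 d0).
have LTcd : L * (d - c) <= 4^-1.
 by apply: le_trans LT; rewrite ler_wpM2l //; clear - ac db; lra.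
have LTcd2 : L * (d - c) <= 2^-1 by apply: le_trans LTcd _; clear; lra.
have ex j x : exists phi : R -> 'rV[R]_m, B x -> phi 0 = 'D_(ev j) h0 x /\
  forall t, c < t < d -> is_d t (phi : R^o -> _) (lin j (t3 t x (phi t))).
 have [Bx|nB] := pselect (B x); last by exists (fun _ => 0) => /nB.
 have Dc t : dom0 a b B (tx (clip c d t) x).
  by apply/dom0_tx; split=> //; apply: sub; exact: clip_in.
 have [||phi [h1 h2]] := @picard R m (fun t y => lin j (t3 (clip c d t) x y)) c d L ('D_(ev j) h0 x) c0 d0 L0 LTcd2.
 - by move=> t y y'; rewrite lin0E //; exact: lipD.
 - move=> phi cphi t.
  apply: (@continuous_comp _ _ _ (fun t => t3 (clip c d t) x (phi t)) (lin j)).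
   by apply: (@cont_t3 R p m (clip c d) x phi); [exact: clip_cont|exact: cphi].
  apply: (C0 _ _ _ _ _ (linC j)); apply/dom_t3; split=> //.
  by apply: sub; exact: clip_in.
 exists phi => _; split; first exact: h1.
 move=> t tcd; have tE : clip c d t = t.
  by apply: clip_id; case/andP: tcd => /ltW -> /ltW ->.
 by have := h2 t tcd; rewrite tE.
have /choice[ka0 hka0] : forall jx : 'I_p * 'rV[R]_p, exists phi : R -> 'rV[R]_m, B jx.2 ->
  phi 0 = 'D_(ev jx.1) h0 jx.2 /\
  forall t, c < t < d -> is_d t (phi : R^o -> _) (lin jx.1 (t3 t jx.2 (phi t))).
 by move=> [j x]; exact: ex.
pose ka j (z : 'rV[R]_(1 + p)) := ka0 (j, sp z) (tm z).
have odeka j : ode c d L B setT (lin j) (ka j) ('D_(ev j) h0).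
 split=> //.
 - by split=> //; exact: openT.
 - by move=> x Bx; rewrite /ka tm_tx sp_tx; have [] := hka0 (j, x) Bx.
 - move=> t x tcd Bx; rewrite /ka tm_tx sp_tx.
  have -> : (fun s : R^o => ka0 (j, sp (tx s x)) (tm (tx s x))) = ka0 (j, x).
   by apply/funext => s; rewrite tm_tx sp_tx.
  by have [_] := hka0 (j, x) Bx; apply.
 - move=> t x y y' tcd Bx _ _; rewrite lin0E; first by apply: lipD; apply/dom0_tx; split=> //; exact: sub'.
  by apply/dom0_tx; split=> //; exact: sub'.
have linC' j : Ck k (dom c d B setT) (lin j).
 by apply: Ck_sub (linC j) => y [h1 h2]; split=> //; exact: sub'.
have kaC j : Ck k (dom0 c d B) (ka j).
 by apply: (IH _ _ _ _ _ _ _ _ _ _ c0 d0 L0 LTcd (odeka j) (linC' j)); case: ch0 => _; exact.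
have subD y : dom0 c d B y -> dom0 a b B y by move=> [h1 h2]; split=> //; exact: sub'.
(* The solution of the linearized equation is the derivative of [h] in the parameter: the remainder
   of the first-order expansion, [al] below, satisfies a Gronwall inequality with a small
   inhomogeneous term. *)
have dka j y : dom0 c d B y -> is_derive y (tx 0 (ev j) : 'rV[R]_(1 + p)) h (ka j y).
 move=> Dy; have [ty By] := Dy.
 rewrite -(tx_eta y); set t0 := tm y in ty *; set x := sp y in By *.
 pose c' := Num.min 0 t0; pose d' := Num.max 0 t0.
 have c'0 : c' <= 0 by rewrite ge_min lexx.
 have d'0 : 0 <= d' by rewrite le_max lexx.
 have [ct0 td0] := andP ty.
 have cc' : c < c' by rewrite lt_min c0.
 have dd' : d' < d by rewrite gt_max d0.
 have ac' : a < c' := lt_trans ac cc'.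
 have db' : d' < b := lt_trans dd' db.
 have dcab : d' - c' <= b - a by apply: lerB; exact: ltW.
 have sb t : c' <= t <= d' -> c < t < d.
  by move=> /andP[h1 h2]; rewrite (lt_le_trans cc') //= (le_lt_trans h2).
 have t0cd : c' <= t0 <= d' by rewrite ge_min le_max lexx !orbT.
 have z0cd : c' <= 0 <= d' by rewrite c'0.
 have [K hK] : exists K, forall t, c' <= t <= d' -> `|ka j (tx t x)| <= K.
  have c'd' : c' <= d' := le_trans c'0 d'0.
  have cka : {within `[c', d'], continuous (fun t => `|ka j (tx t x)|)}.
   apply: continuous_in_subspaceT => t; rewrite inE /= in_itv /= => /sb tt.
   apply: (@continuous_comp _ _ _ (fun t => ka j (tx t x)) Num.norm).
    exact: (ode_cont (odeka j) tt By).1.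
   exact: norm_continuous.
  have [t1 _ ht1] := EVT_max c'd' cka.
  by exists (`|ka j (tx t1 x)|) => t tt; apply: ht1; rewrite in_itv.
 have K0 : 0 <= K by apply: le_trans (hK 0 z0cd).
 apply: is_d_eps => e e0.
 have ba : 0 < b - a by rewrite subr_gt0 (lt_trans a0).
 (* The first bound keeps [(L + e1) * (b - a)] below $1/2$, to which [L] contributes at most $1/4$
    by hypothesis. The second makes the inhomogeneous term contribute at most $|s| e / 4$. *)
 pose e1 := Num.min (1 / (4 * (b - a))) (e / (4 * (1 + K) * (b - a))).
 have e10 : 0 < e1 by rewrite lt_min !divr_gt0 // ?mulr_gt0 // ltr_pwDl.
 have e1a : e1 * (b - a) <= 4^-1.
  apply: (@le_trans _ _ (1 / (4 * (b - a)) * (b - a))); last by rewrite mul1r invfM divfK // gt_eqF.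
  by rewrite ler_wpM2r ?(ltW ba) // ge_min lexx.
 have e1b : e1 * (1 + K) * (b - a) <= e / 4.
  apply: (@le_trans _ _ (e / (4 * (1 + K) * (b - a)) * (1 + K) * (b - a))).
   apply: ler_wpM2r; first exact: ltW.
   apply: ler_wpM2r; first by rewrite addr_ge0.
   by rewrite ge_min lexx orbT.
  have n1 : 1 + K != 0 by rewrite gt_eqF // ltr_pwDl.
  have n2 : b - a != 0 by rewrite gt_eqF.
  by rewrite le_eqVlt; apply/orP; left; apply/eqP; field; rewrite n1 n2.
 have qcont t : c' <= t <= d' -> {for t, continuous (fun s => t3 s x (h (tx s x)))} /\ dom a b B Y (t3 t x (h (tx t x))).
  by move=> /sb/sub' tt; exact: (ode_cont H tt By).2.
 have [r1 r10 hr1] := strict_diff_curve oD (C1 _ _ _ _ cu) qcont e10.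
 have r12 : 0 < r1 / 2 by rewrite divr_gt0.
 have [r2 r20 hr2] := ode_unif L0 LT H (C0 _ _ _ _ _ cu) (C0 _ _ _ _ _ ch0) By ac' c'0 d'0 db' r12.
 have dh0 : differentiable h0 x by case: ch0 => + _; apply.
 have e4 : 0 < e / 4 by rewrite divr_gt0.
 have /nbhs_normP[r3 /= r30 hr3] := diff_eps_ex dh0 e4.
 exists (Num.min r1 (Num.min r2 r3)); first by rewrite !lt_min r10 r20.
 move=> s; rewrite !lt_min => /and3P[sr1 sr2 sr3].
 have nse : `|s *: (ev j : 'rV[R]_p)| <= `|s|.
  by rewrite normrZ ler_piMr // norm_ev.
 pose xs := s *: ev j + x.
 have [Bxs hxs] : B xs /\ forall t, c' <= t <= d' -> `|h (tx t xs) - h (tx t x)| <= r1 / 2.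
  by apply: hr2; rewrite /xs addrK; exact: le_lt_trans sr2.
 have -> : s *: tx 0 (ev j) + tx t0 x = tx t0 xs by rewrite txZ txD mulr0 add0r.
 pose al t := h (tx t xs) - h (tx t x) - s *: ka j (tx t x).
 pose dal t := u (t3 t xs (h (tx t xs))) - u (t3 t x (h (tx t x))) - s *: lin j (t3 t x (ka j (tx t x))).
 have dalE t : c < t < d -> is_d t (al : R^o -> _) (dal t).
  move=> tt; have tt' := sub' _ tt; have [_ _ _ hda _] := odeka j.
  exact: is_deriveB (is_deriveB (hd _ _ tt' Bxs) (hd _ _ tt' By)) (is_deriveZ s (hda _ _ tt By)).
 have cal t : c' <= t <= d' -> {for t, continuous al}.
  by move=> /sb tt; exact: is_d_cont (dalE t tt).
 have bal t : c' < t < d' -> is_d t (al : R^o -> _) (dal t) /\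
   `|dal t| <= (L + e1) * `|al t| + e1 * (1 + K) * `|s|.
  move=> /andP[/ltW t1 /ltW t2]; have tt : c' <= t <= d' by rewrite t1.
  split; first by apply: dalE; exact: sb.
  have Dt : dom0 a b B (tx t x) by apply/dom0_tx; split=> //; apply: sub'; exact: sb.
  pose dh := h (tx t xs) - h (tx t x).
  pose w := t3 0 (s *: ev j) dh : 'rV[R]_(1 + (p + m)).
  have qE : q (tx t x) = t3 t x (h (tx t x)) by rewrite /q tm_tx sp_tx.
  have wr : `|w| < r1.
   have dhr : `|dh| < r1.
    by apply: le_lt_trans (hxs t tt) _; rewrite ltr_pdivrMr // ltr_pMr // ltr1n.
   have nsr : `|s *: (ev j : 'rV[R]_p)| < r1 by exact: le_lt_trans sr1.
   apply/(tx_norm_lt _ _ r10); split; first by rewrite normr0.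
   by apply/(row_mx_norm_lt _ _ r10).
  have := hr1 t tt w wr; rewrite {1}/w t3D addr0 (addrC x) (addrC (h (tx t x))) subrK -/xs => h1.
  have du := duq _ Dt; rewrite qE in du.
  have Dw : 'D_w u (t3 t x (h (tx t x))) = s *: lin j (t3 t x (ka j (tx t x))) + 'D_(t3 0 0 (al t)) u (t3 t x (h (tx t x))).
   rewrite linE // qE !(deriveE _ du) -linearZ -linearD /= t3Z t3D mulr0 !addr0.
   by rewrite /al addrC subrK.
  rewrite Dw opprD addrA in h1.
  have h2 := lipD _ (al t) Dt; rewrite qE in h2.
  have wb : `|w| <= `|s| + `|al t| + `|s| * K.
   apply: t3_norm_le; first by rewrite normr0 !addr_ge0 // mulr_ge0.
    by apply: le_trans nse _; rewrite -addrA lerDl addr_ge0 // mulr_ge0.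
   have -> : dh = al t + s *: ka j (tx t x) by rewrite /al subrK.
   apply: le_trans (ler_normD _ _) _; rewrite normrZ.
   apply: lerD; first by rewrite lerDr.
   by rewrite ler_wpM2l // hK.
  rewrite -[dal t](subrK ('D_(t3 0 0 (al t)) u (t3 t x (h (tx t x))))).
  apply: le_trans (ler_normD _ _) _.
  have h3 : e1 * `|w| <= e1 * (`|s| + `|al t| + `|s| * K) by rewrite ler_wpM2l // ltW.
  have h4 := lerD (le_trans h1 h3) h2.
  apply: le_trans h4 _; rewrite le_eqVlt; apply/orP; left; apply/eqP; ring.
 have LT' : (L + e1) * (d' - c') <= 2^-1.
  have h1 : (L + e1) * (d' - c') <= (L + e1) * (b - a).
   by rewrite ler_wpM2l ?addr_ge0 ?(ltW e10).
  apply: le_trans h1 _; rewrite mulrDl; move: LT e1a; clear; lra.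
 have Le : 0 <= L + e1 by rewrite addr_ge0 // ltW.
 have Ee : 0 <= e1 * (1 + K) * `|s| by rewrite !mulr_ge0 ?addr_ge0 ?(ltW e10).
 have := curve_growth Le Ee LT' cal bal t0cd z0cd => /le_trans; apply.
 have a0E : `|al 0| <= e / 4 * `|s|.
  have [_ _ hi' _ _] := odeka j.
  rewrite /al (hi _ Bxs) (hi _ By) (hi' _ By).
  have := hr3 (s *: ev j); rewrite /= sub0r normrN => /(_ (le_lt_trans nse sr3)).
  rewrite -deriveE // => h1.
  have -> : s *: 'D_(ev j) h0 x = 'D_(s *: ev j) h0 x by rewrite !(deriveE _ dh0) linearZ.
  apply: le_trans h1 _; rewrite ler_wpM2l //; exact: ltW.
 have e1c : e1 * (1 + K) * `|s| * (d' - c') <= e / 4 * `|s|.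
  rewrite mulrAC ler_wpM2r //; apply: le_trans e1b.
  by rewrite ler_wpM2l ?mulr_ge0 ?addr_ge0 ?(ltW e10).
 have h5 := lerD a0E e1c.
 apply: (@le_trans _ _ (2 * (e / 4 * `|s| + e / 4 * `|s|))); first by rewrite ler_wpM2l.
 by rewrite le_eqVlt; apply/orP; left; apply/eqP; field.
have oD0c : open (dom0 c d B) by exact: open_dom0.
have dt y : dom0 c d B y -> is_derive y (tx 1 0 : 'rV[R]_(1 + p)) h (u (q y)).
 move=> Dy; have [ty By] := subD _ Dy.
 have qE : q y = t3 (tm y) (sp y) (h (tx (tm y) (sp y))) by rewrite tx_eta.
 rewrite qE; apply: is_d_eps => e e0.
 have [r r0 hr] := is_derive_1 (hd _ _ ty By) e0; exists r => // s sr.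
 have -> : s *: tx 1 0 + y = tx (s + tm y) (sp y).
  by rewrite -{1}(tx_eta y) txZ txD mulr1 scaler0 add0r.
 by have := hr s sr; rewrite (tx_eta y).
apply/(Ck_rVP _ _ oD0c) => l.
pose g (i : 'I_(1 + p)) (y : 'rV[R]_(1 + p)) : R^o :=
 match fintype.split i with inl _ => u (q y) 0 l | inr j => ka j y 0 l end.
apply: (@Ck_partial R (1 + p)%N k (dom0 c d B) (fun y => h y 0 l : R^o) g oD0c).
 move=> y i Dy; case: (split_ordP i) => j ->.
  rewrite ev_lshift1.
  rewrite /g (unsplitK (inl j)); have [h1 h2] := dt y Dy; apply: DeriveDef.
   by move/derivable_mxP: h1; exact.
  by rewrite -h2 derive_rV.
 rewrite ev_rshift1.
 rewrite /g (unsplitK (inr j)); have [h1 h2] := dka j y Dy; apply: DeriveDef.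
  by move/derivable_mxP: h1; exact.
 by rewrite -h2 derive_rV.
rewrite /g => i; case: (fintype.split i) => j; last by move: l {g}; apply/(Ck_rVP _ _ oD0c).
move: l {g}; apply/(Ck_rVP k (fun y => u (q y)) oD0c).
apply: (@Ck_comp_rV R _ _ _ _ (dom0 c d B) (dom a b B Y) q u) => //.
 by move=> y /subD; exact: qD.
by apply: Ck_sub qk.
Qed.

End SmoothDependence.

(** * Flows of time-dependent vector fields *)

Section Flows.
Context {R : realType}.

(** Compactness again. The tube sticks out beyond both ends, so that the closed time interval lies
    inside the open domains built from it. *)
Lemma segment_near n (a b : R) (x0 : 'rV[R]_n) (P : 'rV[R]_(1 + n) -> Prop) :
 (forall t, a <= t <= b -> \forall z \near tx t x0, P z) ->
 exists2 r : R, 0 < r & forall t x, a - r <= t <= b + r -> `|x - x0| <= r -> P (tx t x).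
Proof.
move=> hP; have [ba|ab] := ltP b a.
 exists ((a - b) / 4); first by rewrite divr_gt0 // subr_gt0.
 by move=> t x /andP[? ?]; exfalso; lra.
have [r r0 hr] : exists2 r, 0 < r & forall t, a <= t <= b -> forall s x, `|s - t| < r ->
  `|x - x0| < r -> P (tx s x).
 apply: (@segment_uniform R a b (fun t r => forall s x, `|s - t| < r ->
  `|x - x0| < r -> P (tx s x))).
  move=> t r r' h rr' s x h1 h2; apply: h; exact: lt_le_trans rr'.
 move=> t /hP /nbhs_normP[r /= r0 hr]; exists (r / 2); first by rewrite divr_gt0.
 move=> t' tt' s x st xx; apply: hr => /=; rewrite txB tx_norm_lt // distrC (distrC x0).
 split; last by apply: lt_trans xx _; lra.
 by apply: le_lt_trans (ler_distD t' _ _) _; rewrite [ltRHS]splitr; exact: ltrD.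
exists (r / 2); first by rewrite divr_gt0.
move=> t x /andP[h1 h2] xr.
have rr : r / 2 < r by lra.
apply: (hr (clip a b t)); [exact: clip_in| |exact: le_lt_trans rr].
have [h|h] := ltP t a; first by rewrite /clip min_r ?max_l ?ler0_norm; lra.
have [h'|h'] := ltP b t; first by rewrite /clip min_l ?max_r ?ger0_norm; lra.
by rewrite clip_id ?h // subrr normr0.
Qed.

Lemma derive_le n m (u : 'rV[R]_n -> 'rV[R]_m) z (c : R) : differentiable u z ->
 (forall i, `|'D_(ev i) u z| <= c) -> forall v, `|'D_v u z| <= n%:R * c * `|v|.
Proof.
move=> du hc v; rewrite derive_sumE //; apply: le_trans (ler_norm_sum _ _ _) _.
apply: (@le_trans _ _ (\sum_(i < n) c * `|v|)); last first.
 by rewrite sumr_const card_ord -[leLHS]mulr_natl mulrA.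
apply: ler_sum => i _; rewrite normrZ mulrC; apply: ler_pM => //.
exact: coord_le.
Qed.

Lemma derive_lip n m (u : 'rV[R]_n -> 'rV[R]_m) z w (L : R) : 0 <= L ->
 (forall s, 0 <= s <= 1 -> differentiable u (z + s *: w) /\ `|'D_w u (z + s *: w)| <= L * `|w|) ->
 `|u (z + w) - u z| <= L * `|w|.
Proof.
move=> L0 h; apply/norm_le_rV => [|j]; first by rewrite mulr_ge0.
have [s /h[] /diff_rVP//|s hs] := @MVT_line R n (fun y => u y 0 j : R^o) z w.
have [|du hu] := h s; first by case/andP: hs => /ltW -> /ltW.
rewrite !mxE => ->; apply: le_trans hu.
rewrite -derive_rV; first exact: coord_le.
exact: diff_derivable.
Qed.

(** The norm is the maximum norm, so truncating each coordinate is a Lipschitz retraction onto the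
    closed ball. It turns a field given on the ball into one that is Lipschitz everywhere. *)
Definition projball n (z0 : 'rV[R]_n) (r : R) (y : 'rV[R]_n) : 'rV[R]_n :=
 \row_j clip (z0 0 j - r) (z0 0 j + r) (y 0 j).

Lemma projball_in n (z0 : 'rV[R]_n) r y : 0 <= r -> `|projball z0 r y - z0| <= r.
Proof.
move=> r0; apply/norm_le_rV => // j; rewrite !mxE ler_norml.
have /andP[h1 h2] : z0 0 j - r <= clip (z0 0 j - r) (z0 0 j + r) (y 0 j) <= z0 0 j + r.
 by apply: clip_in; lra.
by lra.
Qed.

Lemma projball_lip n (z0 : 'rV[R]_n) r y y' : `|projball z0 r y - projball z0 r y'| <= `|y - y'|.
Proof.
apply/norm_le_rV => // j; rewrite !mxE; apply: le_trans (clip_lip _ _ _ _) _.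
by have := coord_le (y - y') j; rewrite !mxE.
Qed.

Lemma projball_id n (z0 : 'rV[R]_n) r y : `|y - z0| <= r -> projball z0 r y = y.
Proof.
move=> h; apply/rowP => j; rewrite mxE clip_id //.
have := le_trans (coord_le (y - z0) j) h; rewrite !mxE ler_norml => /andP[? ?].
by lra.
Qed.

Lemma sm_eta3 n (z : 'rV[R]_(1 + (n + n))) (u : 'rV[R]_(1 + n) -> 'rV[R]_n) :
 sm (tx (tm z) (rp (sp z))) u -> sm z (fun z => u (tx (tm z) (rp (sp z)))).
Proof.
move=> su; apply: (@sm_comp_rV R _ _ _ z (fun z => tx (tm z) (rp (sp z))) u) => //.
apply: sm_tx_row; first exact: sm_tm.
by apply: (scomp (@sp R (n + n)) (@rp R n n)); [exact: sm_sp|exact: sm_rsub].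
Qed.

(** Picard iteration solves the truncated field. The bound on [K * (b - a)] keeps curves from the
    half ball inside the ball, where truncation changes nothing; smoothness is [ode_Ck] with the
    initial point as the parameter. *)
Lemma flow_box n (u : 'rV[R]_(1 + n) -> 'rV[R]_n) (a b L K r : R) z0 :
 a < 0 -> 0 < b -> 0 <= L -> 0 <= K -> 0 < r ->
 L * (b - a) <= 4^-1 -> K * (b - a) < r / 2 ->
 (forall t x, a <= t <= b -> `|x - z0| <= r -> sm (tx t x) u) ->
 (forall t x, a <= t <= b -> `|x - z0| <= r -> `|u (tx t x)| <= K) ->
 (forall t x x', a <= t <= b -> `|x - z0| <= r -> `|x' - z0| <= r ->
   `|u (tx t x) - u (tx t x')| <= L * `|x - x'|) ->
 exists Phi : 'rV[R]_(1 + n) -> 'rV[R]_n,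
  (forall x, `|x - z0| < r / 2 -> Phi (tx 0 x) = x) /\
  forall t x, a < t < b -> `|x - z0| < r / 2 ->
  [/\ sm (tx t x) Phi, `|Phi (tx t x) - z0| < r &
   is_d t (fun s : R^o => Phi (tx s x)) (u (tx t (Phi (tx t x))))].
Proof.
move=> a0 b0 L0 K0 r0 LT KT su uK uL.
have ab : a <= b by lra.
have LT2 : L * (b - a) <= 2^-1 by apply: le_trans LT _; lra.
pose v t y := u (tx (clip a b t) (projball z0 r y)).
have ct t : a <= clip a b t <= b by exact: clip_in.
have pb y : `|projball z0 r y - z0| <= r by apply: projball_in; exact: ltW.
have ex x : exists phi : R -> 'rV[R]_n, phi 0 = x /\ forall t, a < t < b ->
  is_d t (phi : R^o -> _) (v t (phi t)).
 apply: (@picard R n v a b L x) => //.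
  move=> t y y'; apply: le_trans (uL _ _ _ (ct t) (pb y) (pb y')) _.
  by rewrite ler_wpM2l // projball_lip.
 move=> phi cphi t; apply: (@continuous_comp _ _ _ (fun t => tx (clip a b t) (projball z0 r (phi t))) u).
  apply: cont_row_mx.
   apply/cont_rVP => j; apply: continuous_ext (@clip_cont R a b t) => s.
   by rewrite (ord1 j) mxE eqxx mulr1n.
  apply: (@continuous_comp _ _ _ phi (projball z0 r)); first exact: cphi.
  apply/cont_epsP => e e0; exists e => // y hy; apply: le_lt_trans hy.
  exact: projball_lip.
 by apply: sm_cont; exact: su.
have /choice[phi hphi] := ex.
have vK t y : `|v t y| <= K by exact: uK.
have cphi x t : a < t < b -> {for t, continuous (phi x)}.
 by move=> tt; exact: is_d_cont ((hphi x).2 t tt).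
have stay x t : a < t < b -> `|x - z0| < r / 2 -> `|phi x t - z0| < r.
 move=> tt xr; pose c := Num.min 0 t; pose d := Num.max 0 t.
 have [at_ tb] := andP tt.
 have ac : a < c by rewrite lt_min a0.
 have db : d < b by rewrite gt_max b0.
 have sb s : c <= s <= d -> a < s < b.
  by clear - ac db; lra.
 have tcd : c <= t <= d by rewrite ge_min le_max lexx !orbT.
 have z0cd : c <= 0 <= d by rewrite ge_min le_max lexx.
 have c1 s : c <= s <= d -> {for s, continuous (phi x)} by move=> /sb; exact: cphi.
 have d1 s : c < s < d -> is_d s (phi x : R^o -> _) (v s (phi x s)) /\ `|v s (phi x s)| <= K.
  move=> /andP[/ltW h1 /ltW h2]; split; last exact: vK.
  by apply: (hphi x).2; apply: sb; rewrite h1.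
 have := curve_MVT_sym K0 c1 d1 tcd z0cd; rewrite (hphi x).1 subr0 => h1.
 have h2 : K * `|t| <= K * (b - a).
  by rewrite ler_wpM2l // ler_norml; clear - a0 b0 at_ tb; lra.
 apply: le_lt_trans (ler_distD x _ _) _.
 apply: lt_trans (ler_ltD (le_trans h1 h2) xr) _; lra.
pose Phi (z : 'rV[R]_(1 + n)) := phi (sp z) (tm z).
have PhiE t x : Phi (tx t x) = phi x t by rewrite /Phi tm_tx sp_tx.
have dPhi t x : a < t < b -> `|x - z0| < r / 2 ->
  is_d t (fun s : R^o => Phi (tx s x)) (u (tx t (Phi (tx t x)))).
 move=> tt xr; have -> : (fun s : R^o => Phi (tx s x)) = phi x.
  by apply/funext => s; rewrite PhiE.
 have := (hphi x).2 t tt; rewrite PhiE /v clip_id; last by case/andP: tt => /ltW -> /ltW.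
 by rewrite projball_id // ltW // stay.
pose B := [set x : 'rV[R]_n | `|x - z0| < r / 2].
pose Y := [set x : 'rV[R]_n | `|x - z0| < r].
have oball (e : R) : open [set x : 'rV[R]_n | `|x - z0| < e].
 by rewrite norm_ballE; exact: ball_open.
pose u3 (z : 'rV[R]_(1 + (n + n))) := u (tx (tm z) (rp (sp z))).
have u3E t x y : u3 (t3 t x y) = u (tx t y).
 by rewrite /u3 /t3 tm_tx sp_tx /rp row_mxKr.
have H : ode a b L B Y u3 Phi id.
 split.
 - by split; exact: oball.
 - by move=> t x tt Bx; rewrite PhiE; exact: stay.
 - by move=> x _; rewrite PhiE (hphi x).1.
 - by move=> t x tt Bx; rewrite u3E; exact: dPhi.
 - move=> t x y y' /andP[/ltW h1 /ltW h2] _ Yy Yy'; rewrite !u3E; apply: uL; rewrite ?h1 //; exact: ltW.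
have oD : open (dom a b B Y) by apply: open_dom; exact: oball.
have sPhi : smooth_on (dom0 a b B) Phi.
 move=> k; apply: (ode_Ck a0 b0 L0 LT H); last by apply: Ck_smooth => [|x _]; [exact: oball|exact: sm_id].
 apply: Ck_smooth => // z [/andP[h1 h2] [_ Yz]]; apply: sm_eta3; apply: su; first by rewrite !ltW.
 exact: ltW.
exists Phi; split; first by move=> x _; rewrite PhiE (hphi x).1.
move=> t x tt xr; split; [|by rewrite PhiE; exact: stay|exact: dPhi].
exists (dom0 a b B); split=> //; first by apply: open_dom0; exact: oball.
by apply/dom0_tx.
Qed.

(** Where a field vanishes together with its first derivative, its Lipschitz constant is as small as
    desired, so the unit time interval counts as short and the flow reaches time one without
    continuation. The derivative at [z0] stays the identity because the variational equation has
    coefficient zero there. *)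
Lemma flow_fixed n (u : 'rV[R]_(1 + n) -> 'rV[R]_n) z0 :
 (forall t, 0 <= t <= 1 -> [/\ sm (tx t z0) u, u (tx t z0) = 0 &
   forall v, 'D_(tx 0 v) u (tx t z0) = 0]) ->
 exists2 e : R, 0 < e & exists Phi : 'rV[R]_(1 + n) -> 'rV[R]_n,
  [/\ (forall x, `|x - z0| < e -> Phi (tx 0 x) = x),
   (forall t x, - e < t < 1 + e -> `|x - z0| < e -> sm (tx t x) Phi /\
    is_d t (fun s : R^o => Phi (tx s x)) (u (tx t (Phi (tx t x))))),
   (forall t, 0 <= t <= 1 -> Phi (tx t z0) = z0) &
   (forall t v, 0 <= t <= 1 -> 'D_(tx 0 v) Phi (tx t z0) = v)].
Proof.
(* The resulting constant [L] is at most $1/16$, and the time interval $(-s, 1 + s)$ has length at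
   most $2$ since $s \le 1/2$. *)
move=> hu; pose c : R := (16 * (n%:R + 1))^-1.
have c0 : 0 < c by rewrite invr_gt0 mulr_gt0 // ltr_wpDl.
pose L := n%:R * c.
have L0 : 0 <= L by rewrite mulr_ge0 // ltW.
have L16 : L <= 16^-1.
 rewrite /L /c invfM mulrCA -[leRHS]mulr1 ler_wpM2l // ler_pdivrMr ?ltr_wpDl //.
 by rewrite mul1r lerDl.
have [r1 r10 hr1] : exists2 r : R, 0 < r & forall t x, 0 - r <= t <= 1 + r -> `|x - z0| <= r ->
  sm (tx t x) u /\ forall i : 'I_n, `|'D_(tx 0 (ev i)) u (tx t x)| <= c.
 apply: (@segment_near n 0 1 z0 (fun z => sm z u /\ forall i : 'I_n, `|'D_(tx 0 (ev i)) u z| <= c)) => t t01.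
 have [su _ Du] := hu t t01; apply: filterI; first exact: sm_nbhs.
 apply: (@filter_forall _ _ (fun i z => `|'D_(tx 0 (ev i)) u z| <= c) (nbhs (tx t z0))) => i.
 have /cvgrPdist_lt/(_ _ c0) := sm_cont (sm_D (tx 0 (ev i)) su).
 by apply: filterS => z; rewrite Du sub0r normrN => /ltW.
have D0 t x v : sm (tx t x) u -> (forall i : 'I_n, `|'D_(tx 0 (ev i)) u (tx t x)| <= c) ->
  `|'D_(tx 0 v) u (tx t x)| <= L * `|v|.
 move=> su hc; have du := sm_diff su.
 have -> : tx 0 v = \sum_i v 0 i *: tx 0 (ev i).
  rewrite {1}(row_sum_delta v); elim/big_rec2: _ => [|i s1 s2 _ <-].
   by rewrite /tx raddf0 row_mx0.
  by rewrite txZ txD mulr0 addr0.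
 rewrite deriveE // linear_sum; apply: le_trans (ler_norm_sum _ _ _) _.
 apply: (@le_trans _ _ (\sum_(i < n) c * `|v|)); last first.
  by rewrite sumr_const card_ord -[leLHS]mulr_natl mulrA.
 apply: ler_sum => i _; rewrite linearZ normrZ mulrC -deriveE //; apply: ler_pM => //.
 exact: coord_le.
pose r := Num.min r1 1; have r0 : 0 < r by rewrite lt_min r10 ltr01.
have rr1 : r <= r1 by rewrite ge_min lexx.
have r16 : 0 < r / 16 by rewrite divr_gt0.
have [r2 r20 hr2] : exists2 s : R, 0 < s & forall t x, 0 - s <= t <= 1 + s -> `|x - z0| <= s ->
  `|u (tx t x)| <= r / 16.
 apply: (@segment_near n 0 1 z0 (fun z => `|u z| <= r / 16)) => t t01.
 have [su u0 _] := hu t t01; have /cvgrPdist_lt/(_ _ r16) := sm_cont su.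
 by apply: filterS => z; rewrite u0 sub0r normrN => /ltW.
pose s := Num.min (Num.min r1 r2) (2^-1).
have s0 : 0 < s by rewrite !lt_min r10 r20 /= invr_gt0 ltr0n.
have s2 : s <= 2^-1 by rewrite ge_min lexx orbT.
have sr1 : s <= r1 by rewrite !ge_min lexx.
have sr2 : s <= r2 by rewrite !ge_min lexx orbT.
have tr1 t : - s <= t <= 1 + s -> 0 - r1 <= t <= 1 + r1.
 by move=> ?; lra.
have tr2 t : - s <= t <= 1 + s -> 0 - r2 <= t <= 1 + r2.
 by move=> ?; lra.
have su t x : - s <= t <= 1 + s -> `|x - z0| <= r -> sm (tx t x) u.
 by move=> /tr1 tt xr; have [] := hr1 t x tt (le_trans xr rr1).
have uL t x x' : - s <= t <= 1 + s -> `|x - z0| <= r -> `|x' - z0| <= r ->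
   `|u (tx t x) - u (tx t x')| <= L * `|x - x'|.
 move=> tt xr xr'.
 have -> : u (tx t x) = u (tx t x' + tx 0 (x - x')) by rewrite txD addr0 addrC subrK.
 rewrite -[`|x - _|]tx_norm0; apply: derive_lip => // q q01; rewrite txZ txD mulr0 addr0.
 have xq : `|x' + q *: (x - x') - z0| <= r.
  have -> : x' + q *: (x - x') - z0 = (1 - q) *: (x' - z0) + q *: (x - z0).
   by apply/rowP => j; rewrite !mxE; ring.
  have /andP[q0 q1] := q01.
  apply: le_trans (ler_normD _ _) _; rewrite !normrZ (ger0_norm q0) ger0_norm ?subr_ge0 //.
  have g1 : (1 - q) * `|x' - z0| <= (1 - q) * r by rewrite ler_wpM2l // subr_ge0.
  have g2 : q * `|x - z0| <= q * r by rewrite ler_wpM2l.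
  by apply: le_trans (lerD g1 g2) _; rewrite -mulrDl subrK mul1r.
 have [su' hc] := hr1 t _ (tr1 _ tt) (le_trans xq rr1).
 by split; [exact: sm_diff|rewrite tx_norm0; exact: D0].
have uK t x : - s <= t <= 1 + s -> `|x - z0| <= r -> `|u (tx t x)| <= r / 8.
 move=> tt xr; rewrite -(subrK (u (tx t z0)) (u _)); apply: le_trans (ler_normD _ _) _.
 have zz : `|z0 - z0| <= r by rewrite subrr normr0 ltW.
 have h1 := uL t x z0 tt xr zz.
 have h2 : `|u (tx t z0)| <= r / 16 by apply: hr2; [exact: tr2|rewrite subrr normr0 ltW].
 have h3 : L * `|x - z0| <= r / 16 by rewrite mulrC; apply: ler_pM.
 by apply: le_trans (lerD (le_trans h1 h3) h2) _; clear; lra.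
have ns0 : - s < 0 by rewrite oppr_lt0.
have s10 : 0 < 1 + s by rewrite addr_gt0.
have K0 : 0 <= r / 8 by rewrite divr_ge0 // ltW.
have LT : L * (1 + s - - s) <= 4^-1.
 have h : L * (1 + s - - s) <= L * 2 by rewrite ler_wpM2l //; clear - s2; lra.
 by apply: le_trans h _; clear - L16; lra.
have KT : r / 8 * (1 + s - - s) < r / 2.
 have h : r / 8 * (1 + s - - s) <= r / 8 * 2 by rewrite ler_wpM2l //; clear - s2; lra.
 by apply: le_lt_trans h _; clear - r0; lra.
have [Phi [Phi0 PhiH]] := flow_box ns0 s10 L0 K0 r0 LT KT su uK uL.
pose e := Num.min s (r / 2).
have e0 : 0 < e by rewrite lt_min s0 divr_gt0.
have es : e <= s by rewrite ge_min lexx.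
have er : e <= r / 2 by rewrite ge_min lexx orbT.
have z0r : `|z0 - z0| < r / 2 by rewrite subrr normr0 divr_gt0.
have ts t : - e < t < 1 + e -> - s < t < 1 + s.
 by clear - es; lra.
have t01 t : 0 <= t <= 1 -> - s < t < 1 + s.
 by clear - s0; lra.
have PhiC t : 0 <= t <= 1 -> {for t, continuous (fun s => Phi (tx s z0))}.
 by move=> /t01 tt; have [_ _] := PhiH t z0 tt z0r; exact: is_d_cont.
have fixed t : 0 <= t <= 1 -> Phi (tx t z0) = z0.
 move=> tt; apply/eqP; rewrite -subr_eq0 -normr_le0.
 have L1 : L * (1 - 0) <= 2^-1 by rewrite subr0 mulr1; apply: le_trans L16 _; clear; lra.
 have c1 q : 0 <= q <= 1 -> {for q, continuous (fun s => Phi (tx s z0) - z0)}.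
  by move=> /PhiC cq; apply: continuousB; [exact: cq|exact: cst_continuous].
 have d1 q : 0 < q < 1 -> is_d q ((fun s => Phi (tx s z0) - z0) : R^o -> _) (u (tx q (Phi (tx q z0))))
   /\ `|u (tx q (Phi (tx q z0)))| <= L * `|Phi (tx q z0) - z0| + 0.
  move=> q01; have q01' : 0 <= q <= 1 by case/andP: q01 => /ltW -> /ltW.
  have [_ Pr dP] := PhiH q z0 (t01 _ q01') z0r.
  split.
   have dc : is_d q (fun _ : R^o => z0) 0 := is_derive_cst _ _ _.
   by have := is_deriveB dP dc; rewrite subr0.
  have [_ u0 _] := hu q q01'; rewrite addr0 -[u (tx q (Phi _))]subr0 -u0.
  apply: uL; [|exact: ltW|by rewrite subrr normr0 ltW].
  by case/andP: (t01 _ q01') => /ltW -> /ltW.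
 have z01 : 0 <= (0 : R) <= 1 by rewrite lexx ler01.
 have := curve_growth L0 (lexx 0) L1 c1 d1 tt z01.
 by rewrite (Phi0 _ z0r) subrr normr0 mul0r addr0 mulr0.
exists e => //; exists Phi; split=> //.
- by move=> x xe; apply: Phi0; exact: lt_le_trans er.
- move=> t x te xe; have [] := PhiH t x (ts _ te) (lt_le_trans xe er); split=> //.
- move=> t v tt.
 have smP q : 0 <= q <= 1 -> sm (tx q z0) Phi by move=> /t01 qq; have [] := PhiH q z0 qq z0r.
 have nearP q : 0 <= q <= 1 -> \forall z \near tx q z0, 'D_(tx 1 0) Phi z = u (tx (tm z) (Phi z)).
  move=> qq; have := t01 _ qq => /andP[q1 q2].
  pose r' := Num.min (Num.min (q + s) (1 + s - q)) (r / 2).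
  have r'0 : 0 < r' by rewrite !lt_min divr_gt0 // andbT; clear - q1 q2; lra.
  apply/nbhs_normP; exists r' => // z /= hz; have := hz.
  rewrite distrC -{1}(tx_eta z) txB => /(tx_norm_lt _ _ r'0)[].
  rewrite !lt_min => /andP[/andP[h1 h2] _] /andP[_ h3].
  have tz : - s < tm z < 1 + s.
   by move: h1 h2; rewrite !ltr_norml => /andP[h1 h2] /andP[h4 h5]; move: h1 h2 h4 h5; clear; lra.
  have [sP _ dP] := PhiH (tm z) (sp z) tz h3.
  have : is_derive (tx (tm z) (sp z)) (tx 1 0) Phi (u (tx (tm z) (Phi (tx (tm z) (sp z))))).
   apply: is_d_eps => e' e'0; have [r3 r30 hr3] := is_derive_1 dP e'0.
   exists r3 => // q' hq'; have -> : q' *: tx 1 0 + tx (tm z) (sp z) = tx (q' + tm z) (sp z).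
    by rewrite txZ txD mulr1 scaler0 add0r.
   exact: hr3.
  by rewrite (tx_eta z); case.
 (* By symmetry of second derivatives, the time derivative of [J] is the derivative along [v] of
    $u(t, \Phi)$, which vanishes at the fixed point; so [J] keeps its value at time zero. *)
 pose J q := 'D_(tx 0 v) Phi (tx q z0).
 have dJ q : 0 <= q <= 1 -> is_d q (J : R^o -> _) 0.
  move=> qq; have sP := smP q qq.
  have h1 : 'D_(tx 1 0) ('D_(tx 0 v) Phi) (tx q z0) = 0.
   rewrite schwarz //; rewrite (near_eq_derive _ (nearP q qq)).
   have [su' _ Du'] := hu q qq.
   pose G (z : 'rV[R]_(1 + n)) := tx (tm z) (Phi z).
   have sG : sm (tx q z0) G by apply: sm_tx_row; [exact: sm_tm|exact: sP].
   have GE : G (tx q z0) = tx q z0 by rewrite /G tm_tx fixed.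
   have su2 : differentiable u (G (tx q z0)) by rewrite GE; exact: sm_diff.
   have -> : 'D_(tx 0 v) (fun z => u (tx (tm z) (Phi z))) (tx q z0) = 'D_('D_(tx 0 v) G (tx q z0)) u (G (tx q z0)).
    exact: (derive_compE _ (sm_diff sG) su2).
   have -> : 'D_(tx 0 v) G (tx q z0) = tx 0 (sp ('D_(tx 0 v) G (tx q z0))).
    rewrite -[LHS]tx_eta; congr tx; rewrite /tm derive_rV; last exact/diff_derivable/sm_diff.
    have -> : (fun z : 'rV[R]_(1 + n) => G z 0 (lshift n 0) : R^o) = (fun z => z 0 (lshift n 0) : R^o).
     by apply/funext => z; rewrite /G /tx row_mxEl mxE eqxx.
    rewrite -derive_rV; first by rewrite derive_id /tx row_mxEl mxE.
    exact: derivable_id.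
   by rewrite GE.
  have sD : differentiable ('D_(tx 0 v) Phi) (tx 0 z0 + q *: tx 1 0).
   by rewrite txZ txD mulr1 add0r scaler0 addr0; apply: sm_diff; exact: sm_D.
  have := line_derive sD; rewrite txZ txD mulr1 add0r scaler0 addr0 h1.
  have -> : (fun s0 : R^o => 'D_(tx 0 v) Phi (tx 0 z0 + s0 *: tx 1 0)) = J.
   by apply/funext => w; rewrite txZ txD mulr1 add0r scaler0 addr0.
  exact.
 have /andP[t0 t1] := tt.
 have -> : 'D_(tx 0 v) Phi (tx t z0) = J 0.
  apply: (@curve_const R n J 0 t t0) => q /andP[q0 q1].
   by apply: is_d_cont; apply: dJ; rewrite q0 (le_trans q1).
  by apply: dJ; rewrite (ltW q0) (le_trans (ltW q1)).
 rewrite /J; have zz1 : 0 <= (0 : R) <= 1 by rewrite lexx ler01.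
 have : is_derive (tx 0 z0) (tx 0 v) Phi v.
  apply: is_d_eps => e' e'0.
  exists (r / 2 / (`|v| + 1)); first by rewrite !divr_gt0 // ltr_wpDl.
  move=> q hq; rewrite txZ txD mulr0 addr0.
  have vr : `|q *: v + z0 - z0| < r / 2.
   rewrite addrK normrZ; move: hq; rewrite ltr_pdivlMr ?ltr_wpDl // => hq.
   by apply: le_lt_trans hq; rewrite ler_wpM2l // lerDl.
  by rewrite (Phi0 _ vr) (Phi0 _ z0r) addrK subrr normr0 mulr_ge0 // ltW.
 by case.
Qed.

End Flows.

(** * Parameter integrals, Hadamard's lemma and local uniqueness *)

Section Consequences.
Context {R : realType}.

Lemma derivable_smM n p q x v (A : 'rV[R]_n -> 'M[R]_(p, q)) :
 smM x A -> derivable A x v.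
Proof. by move=> sA; apply/derivable_mxP => i j; exact/diff_derivable/sm_diff. Qed.

Lemma derive_smM n p q x v (A : 'rV[R]_n -> 'M[R]_(p, q)) i j :
 smM x A -> ('D_v A x) i j = 'D_v (fun z => A z i j : R^o) x.
Proof. by move=> sA; rewrite derive_mx ?mxE //; exact: derivable_smM. Qed.

Lemma derive_mul n p q s x v (A : 'rV[R]_n -> 'M[R]_(p, q)) (B : 'rV[R]_n -> 'M[R]_(q, s)) :
 smM x A -> smM x B ->
 'D_v (fun z => A z *m B z) x = 'D_v A x *m B x + A x *m 'D_v B x.
Proof.
move=> sA sB; apply/matrixP => i j; rewrite derive_smM; last exact: smM_mul.
rewrite !mxE (_ : (fun z => _) = \sum_k (fun z => A z i k * B z k j : R^o)); last first.
 by apply/funext => z; rewrite fct_sumE mxE.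
have dA k : derivable (fun z => A z i k : R^o) x v by exact/diff_derivable/sm_diff.
have dB k : derivable (fun z => B z k j : R^o) x v by exact/diff_derivable/sm_diff.
rewrite derive_sum => [|k]; last exact: derivableM.
rewrite -big_split /=; apply: eq_bigr => k _; rewrite (deriveM (dA k) (dB k)).
by rewrite !derive_smM // addrC; congr (_ + _); rewrite [LHS]mulrC.
Qed.

Lemma sm_lip n m (u : 'rV[R]_n -> 'rV[R]_m) z0 : sm z0 u ->
 exists L r : R, [/\ 0 <= L, 0 < r & forall x x', `|x - z0| < r -> `|x' - z0| < r ->
  `|u x - u x'| <= L * `|x - x'|].
Proof.
move=> su; have [ O [oO Oz sO]] := su.
have [r r0 hr] := strict_diff oO Oz (sO 1%N) (@ltr01 R).
pose c := \big[Num.max/0]_(i < n) `|'D_(ev i) u z0|.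
have hc i : `|'D_(ev i) u z0| <= c by exact: (le_bigmax _ (fun i => `|'D_(ev i) u z0|) i).
have c0 : 0 <= c by rewrite /c; elim/big_ind: _ => // x y x0 _; rewrite le_max x0.
exists (1 + n%:R * c), r; split=> //; first by rewrite addr_ge0 // mulr_ge0.
move=> x x' hx hx'; have zz : `|z0 - z0| < r by rewrite subrr normr0.
have h1 := hr x x' z0 hx hx' zz; have h2 := derive_le (sm_diff su) hc (x - x').
rewrite -(subrK ('D_(x - x') u z0) (u x - u x')); apply: le_trans (ler_normD _ _) _.
by rewrite mulrDl; exact: lerD.
Qed.

(** The integral of $G(s, x)$ over $0 \le s \le 1$ is the time-one value of the equation $y' = G(t,
    x)$, with Lipschitz constant zero, and smoothness in [x] is then [ode_Ck]. The primitive [F]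
    gives access to the integral by differentiation. *)
Lemma param_integral p (G : 'rV[R]_(1 + p) -> R^o) x0 :
 (forall s, 0 <= s <= 1 -> sm (tx s x0) G) ->
 exists I : 'rV[R]_p -> R^o, sm x0 I /\ \forall x \near x0, exists F : R -> R,
  (forall s, 0 <= s <= 1 -> is_d s (F : R^o -> R^o) (G (tx s x))) /\
  I x = F 1 - F 0.
Proof.
move=> sG; have [r r0 hr] : exists2 r : R, 0 < r & forall t x, 0 - r <= t <= 1 + r -> `|x - x0| <= r -> sm (tx t x) G.
 by apply: (@segment_near R p 0 1 x0 (fun z => sm z G)) => t t01; apply: sm_nbhs; exact: sG.
pose a := - r; pose b := 1 + r.
have a0 : a < 0 by rewrite oppr_lt0.
have b0 : 0 < b by rewrite addr_gt0.
have ab : a <= b by lra.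
have b1 : 1 < b by rewrite ltrDl.
have sG' t x : a <= t <= b -> `|x - x0| <= r -> sm (tx t x) G.
 by move=> tt; apply: hr; rewrite sub0r.
pose B := [set x : 'rV[R]_p | `|x - x0| < r].
have oB : open B by rewrite /B norm_ballE; exact: ball_open.
have ex x : exists phi : R -> 'rV[R]_1, B x -> phi 0 = 0 /\ forall t, a < t < b ->
  is_d t (phi : R^o -> _) (G (tx t x))%:M.
 have [Bx|nB] := pselect (B x); last by exists (fun=> 0) => /nB.
 have [|||phi [h1 h2]] := @picard R 1 (fun t _ => (G (tx (clip a b t) x))%:M) a b 0 0 a0 b0 (lexx 0).
 - by rewrite mul0r invr_ge0.
 - by move=> t x1 x2; rewrite subrr normr0 mul0r.
 - move=> phi _ t; apply/cont_rVP => j.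
  apply: (@continuous_ext _ _ (fun t => G (tx (clip a b t) x))).
   by move=> s; rewrite (ord1 j) mxE eqxx mulr1n.
  apply: (@continuous_comp _ _ _ (fun t => tx (clip a b t) x) G).
   apply: cont_row_mx; last exact: cst_continuous.
   apply/cont_rVP => j'; apply: continuous_ext (@clip_cont R a b t) => s.
   by rewrite (ord1 j') mxE eqxx mulr1n.
  by apply: sm_cont; apply: sG'; [exact: clip_in|exact: ltW].
 exists phi => _; split; first exact: h1.
 move=> t tt; have tE : clip a b t = t.
  by apply: clip_id; case/andP: tt => /ltW -> /ltW ->.
 by have := h2 t tt; rewrite tE.
have /choice[phi hphi] := ex.
pose h (z : 'rV[R]_(1 + p)) := phi (sp z) (tm z).
pose u (z : 'rV[R]_(1 + (p + 1))) : 'rV[R]_1 := (G (tx (tm z) (lp (sp z))))%:M.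
have uE t x y : u (t3 t x y) = (G (tx t x))%:M by rewrite /u /t3 tm_tx sp_tx /lp row_mxKl.
have H : ode a b 0 B setT u h (fun _ => 0).
 split=> //.
 - by split=> //; exact: openT.
 - by move=> x Bx; rewrite /h tm_tx sp_tx (hphi x Bx).1.
 - move=> t x tt Bx; rewrite uE; have -> : (fun s : R^o => h (tx s x)) = phi x.
   by apply/funext => s; rewrite /h tm_tx sp_tx.
  exact: (hphi x Bx).2.
 - by move=> t x y y' _ _ _ _; rewrite !uE subrr normr0 mul0r.
have sh : smooth_on (dom0 a b B) h.
 have L4 : 0 * (b - a) <= 4^-1 :> R by rewrite mul0r invr_ge0.
 move=> k; apply: (ode_Ck a0 b0 (lexx 0) L4 H); last exact: Ck_cst.
 apply: Ck_smooth; first by apply: open_dom => //; exact: openT.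
 move=> z [/andP[/ltW h1 /ltW h2] [Bz _]]; apply/sm_rVP => j.
 have -> : (fun z => u z 0 j : R^o) = (fun z => G (tx (tm z) (lp (sp z)))).
  by apply/funext => y; rewrite /u (ord1 j) mxE eqxx mulr1n.
 apply: (@sm_comp R _ _ z (fun z => tx (tm z) (lp (sp z))) G).
  apply: sm_tx_row; first exact: sm_tm.
  by apply: (scomp (@sp R (p + 1)) (@lp R p 1)); [exact: sm_sp|exact: sm_lsub].
 by apply: sG'; [rewrite h1|exact: ltW].
exists (fun x => h (tx 1 x) 0 0); split.
 apply: (@sm_comp R _ _ x0 (fun x => h (tx 1 x)) (fun y => y 0 0 : R^o)); last exact: sm_coord.
 apply: (@sm_comp_rV R _ _ _ x0 (fun x => tx 1 x) h); first by apply: sm_tx_row; [exact: sm_cst|exact: sm_id].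
 exists (dom0 a b B); split=> //; first exact: open_dom0.
 apply/dom0_tx; split; last by rewrite /B /= subrr normr0.
 by lra.
have : \forall x \near x0, B x by apply: open_nbhs_nbhs; split=> //; rewrite /B /= subrr normr0.
apply: filterS => x Bx; exists (fun s => phi x s 0 0); split.
 move=> s /andP[s0 s1]; have ss : a < s < b by lra.
 by have /is_d_rVP/(_ 0) := (hphi x Bx).2 s ss; rewrite mxE eqxx mulr1n.
by rewrite /h tm_tx sp_tx (hphi x Bx).1 mxE subr0.
Qed.

Lemma curve_const_real (f : R -> R) :
 (forall s, 0 <= s <= 1 -> is_d s (f : R^o -> R^o) 0) -> f 1 = f 0.
Proof.
move=> df; have [|s s01|s s01|s _] := @MVT_real R f (fun=> 0) 0 1.
- exact: ltr01.
- by apply: is_d_cont; exact: df.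
- by apply: df; case/andP: s01 => /ltW -> /ltW ->.
by rewrite mul0r => /eqP; rewrite subr_eq0 => /eqP.
Qed.

(** The quotient is $\int_0^1 \partial_t f(st, z)\,ds$, which makes sense at time zero. It serves to
    divide by $t$ a field that vanishes at $t = 0$. *)
Lemma hadamard_time n (f : 'rV[R]_(1 + n) -> R^o) z0 : sm (tx 0 z0) f ->
 exists g : 'rV[R]_(1 + n) -> R^o, sm (tx 0 z0) g /\
  \forall z \near tx 0 z0, f z = f (tx 0 (sp z)) + tm z * g z.
Proof.
move=> sf; pose sc (z : 'rV[R]_(1 + (1 + n))) := tx (tm z * tm (sp z)) (sp (sp z)).
pose G (z : 'rV[R]_(1 + (1 + n))) : R^o := 'D_(tx 1 0) f (sc z).
have ssc z : sm z sc.
 apply: sm_tx_row.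
  apply: sm_mul; first exact: sm_tm.
  by apply: (@sm_comp R _ _ _ (@sp R _) (@tm R n : _ -> R^o)); [exact: sm_sp|exact: sm_tm].
 by apply: (scomp (@sp R _) (@sp R n)); [exact: sm_sp|exact: sm_sp].
have scE s z : sc (tx s z) = tx (s * tm z) (sp z) by rewrite /sc tm_tx sp_tx.
have sG s : 0 <= s <= 1 -> sm (tx s (tx 0 z0)) G.
 move=> _; apply: (@sm_comp R _ _ _ sc ('D_(tx 1 0) f)); first exact: ssc.
 by rewrite scE tm_tx sp_tx mulr0; exact: sm_D.
have [I [sI nI]] := param_integral sG; exists I; split=> //.
have nf : \forall z \near tx 0 z0, forall s, 0 <= s <= 1 -> sm (tx (s * tm z) (sp z)) f.
 have /nbhs_normP[r /= r0 hr] := sm_nbhs sf.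
 apply/nbhs_normP; exists r => // z /= hz s /andP[s0 s1].
 apply: hr => /=; rewrite txB sub0r; move: hz.
 rewrite -{1}(tx_eta z) txB sub0r => /(tx_norm_lt _ _ r0)[h1 h2].
 apply/(tx_norm_lt _ _ r0); split=> //; apply: le_lt_trans h1.
 by rewrite !normrN normrM (ger0_norm s0) ler_piMl.
apply: filterS2 nI nf => z [F [dF IE]] sfz.
pose c s := f (tx (s * tm z) (sp z)) - tm z * F s.
have dc s : 0 <= s <= 1 -> is_d s (c : R^o -> R^o) 0.
 move=> s01; have d1 := dF s s01; rewrite /G scE in d1.
 have sD : differentiable f (tx 0 (sp z) + s *: tx (tm z) 0).
  by rewrite txZ txD add0r scaler0 addr0; apply: sm_diff; exact: sfz.
 have := line_derive sD; have -> : (fun q : R^o => f (tx 0 (sp z) + q *: tx (tm z) 0)) = (fun q => f (tx (q * tm z) (sp z))).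
  by apply/funext => q; rewrite txZ txD add0r scaler0 addr0.
 rewrite txZ txD add0r scaler0 addr0 => d2.
 have df : differentiable f (tx (s * tm z) (sp z)) by apply: sm_diff; exact: sfz.
 have e1 : 'D_(tx (tm z) 0) f (tx (s * tm z) (sp z)) = tm z *: ('D_(tx 1 0) f (tx (s * tm z) (sp z)) : R^o).
  by rewrite !(deriveE _ df) -linearZ /= txZ mulr1 scaler0.
 by have := is_deriveB d2 (is_deriveZ (tm z) d1); rewrite e1 subrr.
have := curve_const_real dc; rewrite /c mul1r mul0r tx_eta IE => h.
by move: h; move: (f z) (f _) (F 1) (F 0) (tm z) => p q s t w h; lra.
Qed.

(** The same integral along rays from [z0]. It is what makes derivations at a point combinations of
    partial derivatives. *)
Lemma hadamard n (f : 'rV[R]_n -> R^o) z0 : sm z0 f ->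
 exists g : 'I_n -> 'rV[R]_n -> R^o, (forall i, sm z0 (g i)) /\
  \forall z \near z0, f z = f z0 + \sum_i (z - z0) 0 i * g i z.
Proof.
move=> sf; pose sc (z : 'rV[R]_(1 + n)) := z0 + tm z *: (sp z - z0).
pose G i (z : 'rV[R]_(1 + n)) : R^o := 'D_(ev i) f (sc z).
have ssc z : sm z sc.
 apply/sm_rVP => j; under eq_fun do rewrite !mxE.
 apply: sm_add; first exact: sm_cst.
 apply: sm_mul; first exact: sm_tm.
 apply: sm_sub; last exact: sm_cst.
 have -> : (fun z : 'rV[R]_(1 + n) => z 0 (rshift 1 j) : R^o) = (fun z => sp z 0 j : R^o).
  by apply/funext => y; rewrite mxE.
 by move: j; apply/sm_rVP; exact: sm_sp.
have scE s z : sc (tx s z) = z0 + s *: (z - z0) by rewrite /sc tm_tx sp_tx.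
have sG i s : 0 <= s <= 1 -> sm (tx s z0) (G i).
 move=> _; apply: (@sm_comp R _ _ _ sc ('D_(ev i) f)); first exact: ssc.
 by rewrite scE subrr scaler0 addr0; exact: sm_D.
have /choice[I hI] i := param_integral (sG i).
exists I; split; first by move=> i; exact: (hI i).1.
have nI : \forall z \near z0, forall i, exists F : R -> R,
  (forall s, 0 <= s <= 1 -> is_d s (F : R^o -> R^o) (G i (tx s z))) /\
  I i z = F 1 - F 0.
 apply: (@filter_forall _ _ (fun i z => exists F : R -> R,
  (forall s, 0 <= s <= 1 -> is_d s (F : R^o -> R^o) (G i (tx s z))) /\
  I i z = F 1 - F 0) (nbhs z0)) => i; exact: (hI i).2.
have nf : \forall z \near z0, forall s, 0 <= s <= 1 -> sm (z0 + s *: (z - z0)) f.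
 have /nbhs_normP[r /= r0 hr] := sm_nbhs sf.
 apply/nbhs_normP; exists r => // z /= hz s /andP[s0 s1].
 apply: hr => /=; rewrite opprD addrA subrr sub0r normrN normrZ (ger0_norm s0) distrC.
 by apply: le_lt_trans hz; rewrite ler_piMl.
apply: filterS2 nI nf => z /choice[F hF] sfz.
pose c s := f (z0 + s *: (z - z0)) - \sum_i (z - z0) 0 i * F i s.
have dc s : 0 <= s <= 1 -> is_d s (c : R^o -> R^o) 0.
 move=> s01; have df := sm_diff (sfz s s01); have d1 := line_derive df.
 have d2 i : is_d s ((z - z0) 0 i *: (F i : R^o -> R^o)) ((z - z0) 0 i *: (G i (tx s z) : R^o)).
  by apply: is_deriveZ; exact: (hF i).1.
 have d3 := is_derive_sum d2; have := is_deriveB d1 d3.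
 have -> : (fun q : R^o => f (z0 + q *: (z - z0)) : R^o) - \sum_i (z - z0) 0 i *: (F i : R^o -> R^o) = c.
  by apply/funext => q; rewrite /c !fctE fct_sumE.
 by rewrite derive_sumE // /G scE subrr.
have := curve_const_real dc; rewrite /c scale1r scale0r addr0 (addrC z0) subrK => h.
have -> : \sum_i (z - z0) 0 i * I i z = \sum_i (z - z0) 0 i * F i 1 - \sum_i (z - z0) 0 i * F i 0.
 by rewrite -sumrB; apply: eq_bigr => i _; rewrite (hF i).2 mulrBr.
by move: h; move: (f z) (f z0) (\sum_i _ * F i 1) (\sum_i _ * F i 0) => p q s t h; lra.
Qed.

Lemma short_flow n (f : 'rV[R]_n -> 'rV[R]_n) z0 (P : 'rV[R]_n -> Prop) : sm z0 f ->
 (\forall z \near z0, P z) ->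
 exists2 e : R, 0 < e & exists Phi : 'rV[R]_(1 + n) -> 'rV[R]_n,
  (forall x, `|x - z0| < e -> Phi (tx 0 x) = x) /\
  forall t x, - e < t < e -> `|x - z0| < e -> [/\ sm (tx t x) Phi, P (Phi (tx t x)) &
    is_d t (fun s : R^o => Phi (tx s x)) (f (Phi (tx t x)))].
Proof.
move=> sf nP; have [L [r1 [L0 r10 lip]]] := sm_lip sf.
have /nbhs_normP[r2 /= r20 hr2] : \forall z \near z0, sm z f /\ P z.
 by apply: filterI => //; exact: sm_nbhs.
pose r := Num.min r1 r2 / 2; have rm : 0 < Num.min r1 r2 by rewrite lt_min r10.
have r0 : 0 < r by rewrite divr_gt0.
have rr : r < Num.min r1 r2 by rewrite ltr_pdivrMr // ltr_pMr // ltr1n.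
have rr1 : r < r1 by apply: lt_le_trans rr _; rewrite ge_min lexx.
have rr2 : r < r2 by apply: lt_le_trans rr _; rewrite ge_min lexx orbT.
pose K := `|f z0| + L * r.
have K0 : 0 <= K by rewrite addr_ge0 // mulr_ge0 // ltW.
(* The first bound makes the Lipschitz constant times the length of the interval at most $1/4$; the
   second keeps the displacement below half the radius. *)
pose T := Num.min ((8 * (L + 1))^-1) (r / (8 * (K + 1))).
have T0 : 0 < T by rewrite lt_min invr_gt0 !divr_gt0 // mulr_gt0 // ltr_wpDl.
have nT : - T < 0 by rewrite oppr_lt0.
have LT : L * (T - - T) <= 4^-1.
 have h1 : L * T <= 8^-1.
  apply: (@le_trans _ _ ((L + 1) * (8 * (L + 1))^-1)).
   by apply: ler_pM => //; [exact: ltW|rewrite lerDl|rewrite ge_min lexx].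
  by rewrite invfM mulrCA divff ?mulr1 // gt_eqF // ltr_wpDl.
 by rewrite opprK mulrDr; lra.
have KT : K * (T - - T) < r / 2.
 have h1 : K * T <= r / 8.
  apply: (@le_trans _ _ ((K + 1) * (r / (8 * (K + 1))))).
   by apply: ler_pM => //; [exact: ltW|rewrite lerDl|rewrite ge_min lexx orbT].
  have nK : K + 1 != 0 by rewrite gt_eqF // ltr_wpDl.
  rewrite le_eqVlt; apply/orP; left; apply/eqP.
  by move: (K + 1) nK => k nk; field.
 by rewrite opprK mulrDr; lra.
have su t x : - T <= t <= T -> `|x - z0| <= r -> sm (tx t x) (fun z => f (sp z)).
 move=> _ xr; apply: (scomp (@sp R n) f); first exact: sm_sp.
 by rewrite sp_tx; apply: (hr2 _ _).1; rewrite /= distrC; exact: le_lt_trans rr2.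
have uL t x x' : - T <= t <= T -> `|x - z0| <= r -> `|x' - z0| <= r ->
  `|f (sp (tx t x)) - f (sp (tx t x'))| <= L * `|x - x'|.
 by move=> _ h1 h2; rewrite !sp_tx; apply: lip; exact: le_lt_trans rr1.
have uK t x : - T <= t <= T -> `|x - z0| <= r -> `|f (sp (tx t x))| <= K.
 move=> tt xr; rewrite sp_tx -(subrK (f z0) (f x)); apply: le_trans (ler_normD _ _) _.
 rewrite addrC lerD2l; apply: le_trans (lip _ _ _ _) _; first exact: le_lt_trans rr1.
  by rewrite subrr normr0.
 by rewrite ler_wpM2l.
have [Phi [h1 h2]] := flow_box nT T0 L0 K0 r0 LT KT su uK uL.
exists (Num.min T (r / 2)); first by rewrite lt_min T0 divr_gt0.
exists Phi; split; first by move=> x; rewrite lt_min => /andP[_]; exact: h1.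
move=> t x /andP[t1 t2]; rewrite lt_min => /andP[_ xr].
have tT : - T < t < T.
 have m : Num.min T (r / 2) <= T by rewrite ge_min lexx.
 by lra.
have [a1 a2 a3] := h2 t x tT xr; split=> //; last by rewrite sp_tx in a3.
by apply: (hr2 _ _).2; rewrite /= distrC; exact: lt_trans rr2.
Qed.

Lemma local_uniqueness n (u : 'rV[R]_(1 + n) -> 'rV[R]_n) t0 z0 : sm (tx t0 z0) u ->
 exists2 e : R, 0 < e & forall (al be : R -> 'rV[R]_n) t1 t2, t0 - e < t1 -> t2 < t0 + e ->
  (forall s, t1 <= s <= t2 -> [/\ {for s, continuous al}, {for s, continuous be},
    `|al s - z0| < e & `|be s - z0| < e]) ->
  (forall s, t1 < s < t2 -> is_d s (al : R^o -> _) (u (tx s (al s))) /\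
    is_d s (be : R^o -> _) (u (tx s (be s)))) ->
  forall s s', t1 <= s <= t2 -> t1 <= s' <= t2 -> al s = be s -> al s' = be s'.
Proof.
move=> su; have [L [r [L0 r0 lip]]] := sm_lip su.
pose e := Num.min r ((4 * (L + 1))^-1).
have e0 : 0 < e by rewrite lt_min r0 invr_gt0 mulr_gt0 // ltr_wpDl.
exists e => // al be t1 t2 h1 h2 hc hd s s' st st' E.
have er : e <= r by rewrite ge_min lexx.
have LT : L * (t2 - t1) <= 2^-1.
 have h3 : L * e <= 4^-1.
  apply: (@le_trans _ _ ((L + 1) * (4 * (L + 1))^-1)).
   by apply: ler_pM => //; [exact: ltW|rewrite lerDl|rewrite ge_min lexx orbT].
  by rewrite invfM mulrCA divff ?mulr1 // gt_eqF // ltr_wpDl.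
 have h4 : L * (t2 - t1) <= L * (e + e) by rewrite ler_wpM2l //; lra.
 by apply: le_trans h4 _; rewrite mulrDr; lra.
have c1 q : t1 <= q <= t2 -> {for q, continuous (fun s => al s - be s)}.
 by move=> /hc[ca cb _ _]; exact: continuousB.
have d1 q : t1 < q < t2 -> is_d q ((fun s => al s - be s) : R^o -> _)
  (u (tx q (al q)) - u (tx q (be q))) /\
  `|u (tx q (al q)) - u (tx q (be q))| <= L * `|al q - be q| + 0.
 move=> qt; have [da db] := hd q qt; split; first exact: is_deriveB.
 have /andP[q1 q2] := qt; have [|_ _ ba bb] := hc q; first by rewrite !ltW.
 rewrite addr0; have -> : `|al q - be q| = `|tx q (al q) - tx q (be q)|.
  rewrite txB subrr; apply/le_anti/andP; split; last by apply: tx_norm_le; rewrite ?normr0.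
  by apply/norm_le_rV => // j; have := coord_le (tx 0 (al q - be q)) (rshift 1 j); rewrite /tx row_mxEr.
 have qe : `|q - t0| < r by apply: lt_le_trans er; rewrite ltr_norml; lra.
 by apply: lip; rewrite txB; apply/(tx_norm_lt _ _ r0); split=> //; exact: lt_le_trans er.
have := curve_growth L0 (lexx 0) LT c1 d1 st' st.
rewrite E subrr normr0 mul0r addr0 mulr0 normr_le0 subr_eq0 => /eqP; exact.
Qed.

End Consequences.

(** * The inverse function theorem *)

Section InverseFunction.
Context {R : realType}.

Lemma derive_coord n (v x : 'rV[R]_n) j : 'D_v (fun z : 'rV[R]_n => z 0 j : R^o) x = v 0 j.
Proof.
have di : derivable (@id 'rV[R]_n) x v by exact: derivable_id.
by have := derive_rV j di; rewrite derive_id.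
Qed.

Lemma derive_sp n (v x : 'rV[R]_(1 + n)) : 'D_v (@sp R n) x = sp v.
Proof.
apply/rowP => j; rewrite derive_rV; last exact/diff_derivable/sm_diff/sm_sp.
have -> : (fun z : 'rV[R]_(1 + n) => sp z 0 j : R^o) = (fun z => z 0 (rshift 1 j) : R^o).
 by apply/funext => z; rewrite mxE.
by rewrite derive_coord mxE.
Qed.

Lemma derive_tm n (v x : 'rV[R]_(1 + n)) : 'D_v (@tm R n : _ -> R^o) x = tm v.
Proof. exact: derive_coord. Qed.

Lemma JacE_sm n m (g : 'rV[R]_n -> 'rV[R]_m) x v : sm x g -> 'D_v g x = v *m Jac g x.
Proof. by move=> sg; apply: JacE; exact: sm_diff. Qed.

Lemma Jac_eq n m (g : 'rV[R]_n -> 'rV[R]_m) x (A : 'M[R]_(n, m)) :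
 sm x g -> (forall v, 'D_v g x = v *m A) -> Jac g x = A.
Proof.
by move=> sg h; apply/row_matrixP => i; rewrite !rowE -(JacE_sm _ sg).
Qed.

Lemma sm_subV n m x (f g : 'rV[R]_n -> 'rV[R]_m) :
 sm x f -> sm x g -> sm x (fun z => f z - g z).
Proof.
move=> /sm_rVP sf /sm_rVP sg; apply/sm_rVP => j; under eq_fun do rewrite !mxE.
exact: sm_sub.
Qed.

Lemma smM_scale n p q x (f : 'rV[R]_n -> R^o) (A : 'rV[R]_n -> 'M[R]_(p, q)) :
 sm x f -> smM x A -> smM x (fun z => f z *: A z).
Proof. by move=> sf sA i j; under eq_fun do rewrite mxE; exact: sm_mul. Qed.

Lemma unit_near n p x (A : 'rV[R]_n -> 'M[R]_p) : smM x A -> A x \in unitmx ->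
 \forall z \near x, A z \in unitmx.
Proof.
move=> sA uA; have dA := smM_det sA.
have /cvgrPdist_lt cf := sm_cont dA.
have e0 : 0 < `|\det (A x)| by rewrite normr_gt0 -unitfE -unitmxE.
apply: filterS (cf _ e0) => z /=; rewrite unitmxE unitfE.
by apply: contraTneq => ->; rewrite subr0 ltxx.
Qed.

Lemma near_comp n m (g : 'rV[R]_n -> 'rV[R]_m) x (P : 'rV[R]_m -> Prop) :
 {for x, continuous g} -> (\forall y \near g x, P y) -> \forall z \near x, P (g z).
Proof. by move=> cg nP; exact: cg _ nP. Qed.

(** A homotopy: the field [w] is chosen so that $(1 - t) z + t g(z)$ is constant along its flow.
    This is the starting point at time zero and the image under [g] at time one, so the time-one
    flow is a right inverse. Strict differentiability makes [g] injective near [z0], and the right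
    inverse becomes two-sided. *)
Lemma local_inverse_id n (g : 'rV[R]_n -> 'rV[R]_n) z0 :
 sm z0 g -> g z0 = z0 -> Jac g z0 = 1%:M ->
 exists h, [/\ sm z0 h, h z0 = z0, (\forall z \near z0, h (g z) = z) &
  \forall y \near z0, g (h y) = y].
Proof.
move=> sg g0 Jg.
(* The derivative in $z$ of $(1 - t) z + t g(z)$. The field [w] solves [w *m Q = p], where [p] is
   minus the derivative in $t$. *)
pose Q (z : 'rV[R]_(1 + n)) := 1%:M + tm z *: (Jac g (sp z) - 1%:M).
pose p (z : 'rV[R]_(1 + n)) := sp z - g (sp z).
pose w (z : 'rV[R]_(1 + n)) := p z *m invmx (Q z).
have Q0 t : Q (tx t z0) = 1%:M by rewrite /Q tm_tx sp_tx Jg subrr scaler0 addr0.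
have sgs t : sm (tx t z0) (fun z => g (sp z)).
 by apply: (scomp (@sp R n) g); [exact: sm_sp|rewrite sp_tx].
have sJ t : smM (tx t z0) (fun z => Jac g (sp z)).
 by apply: (@smM_comp R _ _ _ _ _ (@sp R n) (Jac g)); [exact: sm_sp|rewrite sp_tx; exact: smM_Jac].
have sQ t : smM (tx t z0) Q.
 apply: smM_add; first exact: smM_cst.
 apply: smM_scale; first exact: sm_tm.
 by apply: smM_add => //; exact: smM_cst.
have uQ t : Q (tx t z0) \in unitmx by rewrite Q0 unitmx1.
have sp_ t : sm (tx t z0) p by apply: sm_subV; [exact: sm_sp|exact: sgs].
have sV t : smM (tx t z0) (fun z => invmx (Q z)) by exact: smM_invmx.
have sw t : sm (tx t z0) w.
 by apply/smM_row; apply: smM_mul; [exact/smM_row|exact: sV].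
have [e e0 [Phi [Phi0 PhiH Phiz DPhi]]] : exists2 e : R, 0 < e & exists Phi : 'rV[R]_(1 + n) -> 'rV[R]_n,
  [/\ (forall x, `|x - z0| < e -> Phi (tx 0 x) = x),
   (forall t x, - e < t < 1 + e -> `|x - z0| < e -> sm (tx t x) Phi /\
    is_d t (fun s : R^o => Phi (tx s x)) (w (tx t (Phi (tx t x))))),
   (forall t, 0 <= t <= 1 -> Phi (tx t z0) = z0) &
   (forall t v, 0 <= t <= 1 -> 'D_(tx 0 v) Phi (tx t z0) = v)].
 apply: flow_fixed => t t01; split; [exact: sw|by rewrite /w /p sp_tx g0 subrr mul0mx|].
 move=> v; rewrite (derive_mul _ _ (sV t)); last exact/smM_row.
 have -> : p (tx t z0) = 0 by rewrite /p sp_tx g0 subrr.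
 have -> : 'D_(tx 0 v) p (tx t z0) = 0.
  have d1 : derivable (@sp R n) (tx t z0) (tx 0 v) by exact/diff_derivable/sm_diff/sm_sp.
  have d2 : derivable (fun z => g (sp z)) (tx t z0) (tx 0 v) by exact/diff_derivable/sm_diff/sgs.
  rewrite (deriveB d1 d2) derive_sp sp_tx.
  have dg : differentiable g (sp (tx t z0)) by rewrite sp_tx; exact: sm_diff.
  have := derive_compE (tx 0 v) (sm_diff (sm_sp (tx t z0))) dg.
  rewrite derive_sp !sp_tx (JacE_sm _ sg) Jg mulmx1 => h1.
  apply/eqP; rewrite subr_eq0; apply/eqP; rewrite -[LHS]h1; congr ('D_ _ _ _).
 by rewrite mul0mx mul0mx addr0.
pose h x := Phi (tx 1 x).
have i01 : 0 <= (1 : R) <= 1 by rewrite ler01 lexx.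

have zz : `|z0 - z0| < e by rewrite subrr normr0.
have te t : 0 <= t <= 1 -> - e < t < 1 + e.
 by move=> ?; lra.
have sh : sm z0 h.
 apply: (scomp (fun x => tx 1 x) Phi).
  by apply: sm_tx_row; [exact: sm_cst|exact: sm_id].
 exact: (PhiH 1 z0 (te _ i01) zz).1.
have h0 : h z0 = z0 by exact: Phiz.
have nE : \forall x \near z0, `|x - z0| < e by exact: near_dist.
have nQ t : \forall z \near tx t z0, Q z \in unitmx /\ sm (sp z) g.
 apply: filterI; first exact: unit_near.
 apply: (@near_comp _ _ (@sp R n) _ (fun y => sm y g)); first exact: sm_cont (sm_sp _).
 by rewrite sp_tx; exact: sm_nbhs.
have [r r0 hr] : exists2 r : R, 0 < r & forall t x, 0 - r <= t <= 1 + r -> `|x - z0| <= r ->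
  Q (tx t (Phi (tx t x))) \in unitmx /\ sm (Phi (tx t x)) g.
 pose P (z : 'rV[R]_(1 + n)) := Q (tx (tm z) (Phi z)) \in unitmx /\ sm (Phi z) g.
 have [r r0 hr] : exists2 r : R, 0 < r & forall t x, 0 - r <= t <= 1 + r -> `|x - z0| <= r -> P (tx t x).
  apply: segment_near => t t01; have sP := (PhiH t z0 (te _ t01) zz).1.
  have sG : sm (tx t z0) (fun z => tx (tm z) (Phi z)) by apply: sm_tx_row; [exact: sm_tm|].
  have nQt := nQ t; have := @near_comp _ _ _ _ (fun z => Q z \in unitmx /\ sm (sp z) g) (sm_cont sG).
  rewrite tm_tx (Phiz _ t01) => /(_ nQt); apply: filterS => z [a1 a2].
  by split=> //; rewrite sp_tx in a2.
 exists r; first exact: r0.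
 move=> t x tt xr; have [a1 a2] := hr t x tt xr.
 by split; [rewrite tm_tx in a1|exact: a2].
have gh : \forall y \near z0, g (h y) = y.
 have nr : \forall x \near z0, `|x - z0| < r by exact: near_dist.
 apply: filterS2 nE nr => x xe xr.
 pose c t := Phi (tx t x) + t *: (g (Phi (tx t x)) - Phi (tx t x)).
 have dc t : 0 <= t <= 1 -> is_d t (c : R^o -> _) 0.
  move=> t01; have [sP dP] := PhiH t x (te _ t01) xe.
  have [|uu sg'] := hr t x _ (ltW xr); first by case/andP: t01 => ? ?; lra.
  set y := Phi (tx t x) in dP uu sg' *; set W := w (tx t y) in dP.
  have dgP : is_d t (fun s : R^o => g (Phi (tx s x))) (W *m Jac g y).
   have [d1 d2] := dP; have dP1 : differentiable (fun s : R^o => Phi (tx s x)) t := (derivable1_diffP _ _).1 d1.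
   have dg1 : differentiable g (Phi (tx t x)) by exact: sm_diff.
   apply: DeriveDef; first by apply: diff_derivable; exact: (differentiable_comp dP1 dg1).
   by have := derive_compE (1 : R^o) dP1 dg1; rewrite d2 (JacE_sm _ sg').
  have dI : is_d t (@id R^o) 1 := is_derive_id _ _.
  have dgB := is_deriveB dgP dP.
  have dS : is_d t (fun s : R^o => s *: (g (Phi (tx s x)) - Phi (tx s x)))
    (t *: (W *m Jac g y - W) + (g y - y)).
   apply/is_d_rVP => j.
   have dj := (is_d_rVP _ _ _).1 dgB j.
   have := is_deriveM dI dj.
   have -> : (@id R^o : R^o -> R) * (fun z : R^o => ((fun s : R^o => g (Phi (tx s x))) - (fun s : R^o => Phi (tx s x))) z 0 j) =
     (fun z : R^o => (z *: (g (Phi (tx z x)) - Phi (tx z x))) 0 j).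
    by apply/funext => s; rewrite !fctE !mxE.
   move=> [e1 e2]; apply: DeriveDef => //; rewrite e2 !fctE !mxE /=.
   by rewrite [_ *: 1]mulr1.
  have := is_deriveD dP dS; suff -> : W + (t *: (W *m Jac g y - W) + (g y - y)) = 0 by [].
  have -> : W + (t *: (W *m Jac g y - W) + (g y - y)) = W *m Q (tx t y) + (g y - y).
   rewrite /Q tm_tx sp_tx mulmxDr mulmx1 -scalemxAr mulmxBr mulmx1 addrA //.
  by rewrite /W /w mulmxKV // /p sp_tx addrC subrKA subrr.
 have := @curve_const R n c 0 1 ler01.
 rewrite /c scale1r scale0r addr0 (Phi0 _ xe) addrC subrK; apply.
  by move=> s s01; exact: is_d_cont (dc s s01).
 by move=> s /andP[s0 s1]; apply: dc; rewrite !ltW.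
exists h; split=> //.
have [ O [oO Oz sO]] := sg; have half0 : 0 < 2^-1 :> R by rewrite invr_gt0.
have [s s0 hs] := strict_diff oO Oz (sO 1%N) half0.
have inj z1 z2 : `|z1 - z0| < s -> `|z2 - z0| < s -> g z1 = g z2 -> z1 = z2.
 move=> h1 h2 gE; have := hs z1 z2 z0 h1 h2; rewrite subrr normr0 => /(_ s0).
 rewrite gE subrr sub0r normrN (JacE_sm _ sg) Jg mulmx1 => h3.
 apply/eqP; rewrite -subr_eq0 -normr_le0.
 by move: h3; move: `|z1 - z2| => q h3; lra.
have ns : \forall z \near z0, `|z - z0| < s by exact: near_dist.
have cg := sm_cont sg.
have n1 : \forall z \near z0, g (h (g z)) = g z.
 by apply: (@near_comp _ _ g _ (fun y => g (h y) = y)) => //; rewrite g0.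
have n2 : \forall z \near z0, `|h (g z) - z0| < s.
 apply: (@near_comp _ _ g _ (fun y => `|h y - z0| < s)) => //; rewrite g0.
 by apply: (@near_comp _ _ h _ (fun y => `|y - z0| < s)); [exact: sm_cont|rewrite h0].
have n12 : \forall z \near z0, g (h (g z)) = g z /\ `|h (g z) - z0| < s by exact: filterI.
by apply: filterS2 n12 ns => z [a b] c; exact: inj b c a.
Qed.

(** Composition with the affine map [T] produces a fixed point at which the derivative is the
    identity. *)
Theorem inverse_function n (g : 'rV[R]_n -> 'rV[R]_n) z0 :
 sm z0 g -> Jac g z0 \in unitmx ->
 exists h, [/\ sm (g z0) h, h (g z0) = z0, (\forall z \near z0, h (g z) = z) &
  \forall y \near g z0, g (h y) = y].
Proof.
move=> sg uJ; pose V := invmx (Jac g z0).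
pose T y := (y - g z0) *m V + z0; pose T' y := (y - z0) *m Jac g z0 + g z0.
have T'T y : T' (T y) = y by rewrite /T' /T addrK mulmxKV // subrK.

have sT y : sm y T.
 apply: sm_add; last exact: sm_cst.
 apply: (scomp (fun y => y - g z0) (fun y => y *m V)); last exact: sm_lin.
 by apply: sm_subV; [exact: sm_id|exact: sm_cst].
have sT' y : sm y T'.
 apply: sm_add; last exact: sm_cst.
 apply: (scomp (fun y => y - z0) (fun y => y *m Jac g z0)); last exact: sm_lin.
 by apply: sm_subV; [exact: sm_id|exact: sm_cst].
have JT y : Jac T y = V.
 apply: Jac_eq => // v; have d0 : derivable (fun _ : 'rV[R]_n => z0) y v by exact: derivable_cst.
 have d1 : smM y (fun y => y - g z0) by apply/smM_row; apply: sm_subV; [exact: sm_id|exact: sm_cst].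
 have d2 : derivable (fun y => (y - g z0) *m V) y v.
  by apply: derivable_smM; apply: smM_mul => //; exact: smM_cst.
 have d3 : derivable (@id 'rV[R]_n) y v by exact: derivable_id.
 have d4 : derivable (fun _ : 'rV[R]_n => g z0) y v by exact: derivable_cst.
 rewrite (deriveD d2 d0) derive_cst addr0 (derive_mul _ d1 (smM_cst _ V)).
 by rewrite derive_cst mulmx0 addr0 (deriveB d3 d4) derive_id derive_cst subr0.
have [h [sh h0 hg gh]] : exists h, [/\ sm z0 h, h z0 = z0, (\forall z \near z0, h ((T \o g) z) = z) &
  \forall y \near z0, (T \o g) (h y) = y].
 apply: local_inverse_id.
 - exact: sm_comp_rV.
 - by rewrite /= /T subrr mul0mx add0r.
 - rewrite Jac_comp; [|exact: sm_diff|exact: sm_diff].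
  by rewrite JT mulmxV.
have T0 : T (g z0) = z0 by rewrite /T subrr mul0mx add0r.
exists (h \o T); split=> //=.
- by apply: sm_comp_rV => //; rewrite T0.
- by rewrite T0.
have nT : \forall y \near g z0, (T \o g) (h (T y)) = T y.
 by apply: (@near_comp _ _ T _ (fun y => (T \o g) (h y) = y)); [exact: sm_cont|rewrite T0].
by apply: filterS nT => y /= /(congr1 T'); rewrite !T'T.
Qed.

End InverseFunction.

Notation cht M := (set (carrier M) * (carrier M -> 'rV_(mdim M)))%type.

(** * Manifolds and smooth maps read in charts *)

Section LocalManifolds.
Context {R : realType}.
Implicit Types M N : charted R.

(** The local axioms of [is_manifold] together with separation: the ones that are established below
    for total spaces of dual bundles. *)
Definition lman M : Prop :=
 [/\ (forall p : M, exists2 c, atlas M c & c.1 p),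
   (forall c, atlas M c ->
     (forall p q, c.1 p -> c.1 q -> c.2 p = c.2 q -> p = q) /\ mopen c.1),
   (forall c c' p, atlas M c -> atlas M c' -> c.1 p -> c'.1 p ->
     smooth_in c p c'.2) &
   (forall p q : M, p <> q -> exists O O',
     [/\ mopen O, mopen O', O p, O' q & O `&` O' = set0])].

Lemma manifold_lman M : is_manifold M -> lman M.
Proof. by case. Qed.

(** The inverse of a chart. The point [p] is the default value off the image, so the germ of
    [cinv c p] at a point of the image does not depend on it. *)
Definition cinv M (c : cht M) (p : M) (z : 'rV[R]_(mdim M)) : M :=
 match pselect (exists q, c.1 q /\ c.2 q = z) with
 | left h => sval (cid h) | right _ => p end.

Lemma near_open (T : topologicalType) (x : T) (A : set T) : (\forall z \near x, A z) ->
 exists V, [/\ open V, V x & V `<=` A].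
Proof. by move=> h; have : nbhs x A by []; rewrite nbhsE => -[V [oV Vx] VA]; exists V; split. Qed.

Lemma open_mn M (p : M) O : mopen O -> O p -> mnbhs p O.
Proof. by move=> oO Op; exists O; split. Qed.

Lemma mnbhs_self M (p : M) A : mnbhs p A -> A p.
Proof. by move=> [ O [_ Op OA]]; exact: OA. Qed.

Lemma mnbhs_sub M (p : M) (A B : set M) : A `<=` B -> mnbhs p A -> mnbhs p B.
Proof. by move=> AB [ O [oO Op OA]]; exists O; split=> //; exact: subset_trans OA AB. Qed.

Section Charts.
Context {M : charted R} (hM : lman M).
Implicit Types (c : set M * (M -> 'rV[R]_(mdim M))) (p q : M) (A : set M).

Lemma chart_ex p : exists2 c, atlas M c & c.1 p.
Proof. by case: hM. Qed.

Lemma chart_inj c p q : atlas M c -> c.1 p -> c.1 q -> c.2 p = c.2 q -> p = q.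
Proof. by case: hM => _ h _ _ /h[+ _]; exact. Qed.

Lemma copen c : atlas M c -> mopen c.1.
Proof. by case: hM => _ h _ _ /h[]. Qed.

Lemma cinvK c p q : atlas M c -> c.1 q -> cinv c p (c.2 q) = q.
Proof.
move=> ac cq; rewrite /cinv; case: pselect => [h|[]]; last by exists q.
by case: cid => q' [cq' E] /=; exact: chart_inj E.
Qed.

Lemma near_image c p (O : set M) : atlas M c -> c.1 p -> mopen O -> O p ->
 \forall z \near c.2 p, exists q, [/\ c.1 q, O q & c.2 q = z].
Proof.
move=> ac cp oO Op; have I : (c.2 @` (c.1 `&` O)) (c.2 p) by exists p.
have := open_nbhs_nbhs (conj (oO c ac) I).
by apply: filterS => z [q [cq Oq] <-]; exists q.
Qed.

(** Stated from openness of chart domains and smoothness of transitions alone, because it serves to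
    prove that total spaces are separated, when [lman] is not yet available for them. *)
Lemma mopen_chart0 c V : (forall c', atlas M c' -> mopen c'.1) ->
 (forall c c' p, atlas M c -> atlas M c' -> c.1 p -> c'.1 p -> smooth_in c p c'.2) ->
 atlas M c -> open V -> mopen [set q | c.1 q /\ V (c.2 q)].
Proof.
move=> op tr ac oV c' ac'; rewrite openE => _ [q [c'q [cq Vq]] <-].
have [ O [g [oO Oq sg gE]]] : smooth_in c' q c.2 by exact: tr.
have cg : {for c'.2 q, continuous g} by exact: sm_cont (sm_on oO Oq sg).
have Vg : \forall z \near c'.2 q, V (g z).
 by apply: near_comp cg _; rewrite -gE //; exact: open_nbhs_nbhs.
apply: filterS3 (near_image ac' c'q (op _ ac) cq) Vg (open_nbhs_nbhs (conj oO Oq)).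
move=> z [q' [c'q' cq' <-]] Vz Oz; exists q' => //; split=> //; split=> //.
by rewrite gE.
Qed.

Lemma mopen_chart c V : atlas M c -> open V -> mopen [set q | c.1 q /\ V (c.2 q)].
Proof. by apply: mopen_chart0; [exact: copen|case: hM]. Qed.

Lemma mnbhsP c p A : atlas M c -> c.1 p ->
 (mnbhs p A <-> \forall z \near c.2 p, A (cinv c p z)).
Proof.
move=> ac cp; split=> [[ O [oO Op OA]]|nA].
 apply: filterS (near_image ac cp oO Op) => z [q [cq Oq <-]].
 by rewrite cinvK //; exact: OA.
have [V [oV Vp VA]] := near_open nA.
exists [set q | c.1 q /\ V (c.2 q)]; split=> //; first exact: mopen_chart.
by move=> q [cq Vq]; have := VA _ Vq; rewrite cinvK.
Qed.

Lemma cinvP c p : atlas M c -> c.1 p ->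
 \forall z \near c.2 p, c.1 (cinv c p z) /\ c.2 (cinv c p z) = z.
Proof.
move=> ac cp; apply: filterS (near_image ac cp (copen ac) cp) => z [q [cq _ <-]].
by rewrite cinvK.
Qed.

Lemma mnbhs_filter p : Filter (mnbhs p).
Proof.
have [c ac cp] := chart_ex p; split.
- by rewrite (mnbhsP _ ac cp); apply: filterE.
- by move=> A B; rewrite !(mnbhsP _ ac cp) => h1 h2; exact: filterI.
- exact: mnbhs_sub.
Qed.

Lemma mnbhsI p A B : mnbhs p A -> mnbhs p B -> mnbhs p (A `&` B).
Proof. by have F := mnbhs_filter p; exact: filterI. Qed.

Lemma mopenP (O : set M) : mopen O <-> forall p, O p -> mnbhs p O.
Proof.
split=> [oO p Op|h c ac]; first exact: open_mn.
rewrite openE => _ [q [cq Oq] <-].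
move: (h q Oq); rewrite (mnbhsP _ ac cq) => nO.
apply: filterS2 nO (cinvP ac cq) => z Oz [cz E].
by exists (cinv c q z).
Qed.

Lemma mopenI (O O' : set M) : mopen O -> mopen O' -> mopen (O `&` O').
Proof.
rewrite !mopenP => h h' p [Op O'p]; apply: mnbhsI; [exact: h|exact: h'].
Qed.

Lemma mopenT : mopen [set: M].
Proof. by rewrite mopenP => p _; have F := mnbhs_filter p; exact: filterT. Qed.

Lemma near_pre c p (A : set 'rV[R]_(mdim M)) : atlas M c -> c.1 p ->
 (\forall z \near c.2 p, A z) -> mnbhs p (fun q => c.1 q /\ A (c.2 q)).
Proof.
move=> ac cp /near_open[V [oV Vp VA]].
exists [set q | c.1 q /\ V (c.2 q)]; split=> //; first exact: mopen_chart.
by move=> q [cq /VA].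
Qed.

Lemma chart_change c c' p : atlas M c -> atlas M c' -> c.1 p -> c'.1 p ->
 sm (c.2 p) (c'.2 \o cinv c p).
Proof.
move=> ac ac' cp c'p; have [ O [g [oO Op sg gE]]] : smooth_in c p c'.2.
 by case: hM => _ _ + _; exact.
apply: (sm_near _ (sm_on oO Op sg)).
apply: filterS2 (cinvP ac cp) (open_nbhs_nbhs (conj oO Op)) => z [cz E] Oz.
by rewrite /= gE ?E.
Qed.

Section SmoothAt.
Context {W : normedModType R}
 (compW : forall m n z (g : 'rV[R]_n -> 'rV[R]_m) (f : 'rV[R]_m -> W), sm z g -> sm (g z) f -> sm z (f \o g)).

(** All that is asked of the target is that smooth germs compose; scalar functions and row vectors
    are the two instances. *)
Lemma smooth_atPg c p (f : M -> W) : atlas M c -> c.1 p ->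
 (smooth_at p f <-> sm (c.2 p) (f \o cinv c p)).
Proof.
move=> ac cp; split=> [[c' [ac' c'p [ O [g [oO Op sg gE]]]]]|s].
 have sc := chart_change ac ac' cp c'p.
 have E0 : (c'.2 \o cinv c p) (c.2 p) = c'.2 p by rewrite /= cinvK.
 have := compW sc (_ : sm ((c'.2 \o cinv c p) (c.2 p)) g).
 rewrite E0 => /(_ (sm_on oO Op sg)); apply: sm_near.
 have h1 : \forall z \near c.2 p, c'.1 (cinv c p z).
  by apply/(mnbhsP _ ac cp); exact: open_mn (copen ac') _.
 have h2 : \forall z \near c.2 p, O ((c'.2 \o cinv c p) z).
  apply: near_comp (sm_cont sc) _; rewrite E0; exact: open_nbhs_nbhs.
 by apply: filterS2 h1 h2 => z c'z Oz; rewrite /= gE.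
case: s => O [oO Op sg]; exists c; split=> //.
by exists O, (f \o cinv c p); split=> // q cq Oq; rewrite /= cinvK.
Qed.

End SmoothAt.

Lemma smoothP c p (f : M -> R^o) : atlas M c -> c.1 p ->
 (smooth_at p f <-> sm (c.2 p) (f \o cinv c p)).
Proof. by apply: smooth_atPg => m n z g h; exact: sm_comp. Qed.

Lemma smooth_atVP c p k (f : M -> 'rV[R]_k) : atlas M c -> c.1 p ->
 (smooth_at p f <-> sm (c.2 p) (f \o cinv c p)).
Proof. by apply: smooth_atPg => m n z g h; exact: sm_comp_rV. Qed.

Lemma smooth_near p (f g : M -> R^o) : mnbhs p (fun q => f q = g q) ->
 smooth_at p f -> smooth_at p g.
Proof.
have [c ac cp] := chart_ex p; rewrite (mnbhsP _ ac cp) !(smoothP _ ac cp).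
exact: sm_near.
Qed.

Lemma smooth_at_mnbhs p (f : M -> R^o) : smooth_at p f -> mnbhs p (fun q => smooth_at q f).
Proof.
have [c ac cp] := chart_ex p => /(smoothP _ ac cp) s.
apply: mnbhs_sub (near_pre ac cp (sm_nbhs s)) => q [cq sq].
apply/(smoothP _ ac cq); apply: sm_near sq.
by apply: filterS (near_image ac cq (copen ac) cq) => z [q' [cq' _ <-]] /=; rewrite !cinvK.
Qed.

Lemma smooth_at_add p (f g : M -> R^o) : smooth_at p f -> smooth_at p g ->
 smooth_at p (fun q => f q + g q : R^o).
Proof.
have [c ac cp] := chart_ex p; rewrite !(smoothP _ ac cp); exact: sm_add.
Qed.

Lemma smooth_at_mul p (f g : M -> R^o) : smooth_at p f -> smooth_at p g ->
 smooth_at p (fun q => f q * g q : R^o).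
Proof.
have [c ac cp] := chart_ex p; rewrite !(smoothP _ ac cp); exact: sm_mul.
Qed.

Lemma smooth_cst p (a : R) : smooth_at p (fun _ : M => a : R^o).
Proof.
have [c ac cp] := chart_ex p; rewrite (smoothP _ ac cp); exact: sm_cst.
Qed.

Lemma smooth_coord c p j : atlas M c -> c.1 p -> smooth_at p (fun q => c.2 q 0 j : R^o).
Proof.
move=> ac cp; apply/(smoothP _ ac cp); apply: sm_near (sm_coord _ j).
by apply: filterS (cinvP ac cp) => z [_ E]; rewrite /= E.
Qed.

Lemma smooth_at_fun c p (g : 'rV[R]_(mdim M) -> R^o) : atlas M c -> c.1 p ->
 sm (c.2 p) g -> smooth_at p (g \o c.2).
Proof.
move=> ac cp sg; apply/(smoothP _ ac cp); apply: sm_near sg.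
by apply: filterS (cinvP ac cp) => z [_ E]; rewrite /= E.
Qed.

End Charts.

(** The coordinate expression of [phi] in two charts, meaningful as a germ at [c.2 p]. *)
Definition hat M N (c : cht M) (c' : cht N)
 (phi : M -> N) (p : M) : 'rV[R]_(mdim M) -> 'rV[R]_(mdim N) := c'.2 \o phi \o cinv c p.

Section Maps.
Context {M N : charted R} (hM : lman M) (hN : lman N).
Implicit Types (c : set M * (M -> 'rV[R]_(mdim M))).

Lemma smap_cont (phi : M -> N) p A : smooth_map_at phi p -> mnbhs (phi p) A ->
 mnbhs p (phi @^-1` A).
Proof.
move=> [c' [ac' n' s]]; have c'p : c'.1 (phi p) by have := mnbhs_self n'.
have [c ac cp] := chart_ex hM p.
move: s => /(smooth_atVP hM _ ac cp) s /(mnbhsP hN _ ac' c'p) nA.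
apply/(mnbhsP hM _ ac cp).
have h1 : \forall z \near c.2 p, A (cinv c' (phi p) ((c'.2 \o phi \o cinv c p) z)).
 apply: (near_comp (P := fun w => A (cinv c' (phi p) w)) (sm_cont s)).
 by rewrite /= cinvK.
move: n' => /(mnbhsP hM _ ac cp) n'.
by apply: filterS2 h1 n' => z /= + c'z; rewrite cinvK.
Qed.

Lemma smapP (phi : M -> N) p c (c' : cht N) : atlas M c -> c.1 p -> atlas N c' -> c'.1 (phi p) ->
 (smooth_map_at phi p <-> mnbhs p (phi @^-1` c'.1) /\ sm (c.2 p) (hat c c' phi p)).
Proof.
move=> ac cp ac' c'p; split; last first.
 by move=> [n s]; exists c'; split=> //; apply/(smooth_atVP hM _ ac cp).
move=> s; have n' := smap_cont s (open_mn (copen hN ac') c'p).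
split=> //; case: s => d [ad n sd]; have dp : d.1 (phi p) by have := mnbhs_self n.
move: sd => /(smooth_atVP hM _ ac cp) sd.
have sc := chart_change hN ad ac' dp c'p.
have E0 : (d.2 \o phi \o cinv c p) (c.2 p) = d.2 (phi p) by rewrite /= cinvK.
rewrite -E0 in sc; have := sm_comp_rV sd sc; apply: sm_near.
move: n => /(mnbhsP hM _ ac cp) n.
by apply: filterS n => z dz; rewrite /hat /= cinvK.
Qed.

Lemma smooth_comp (phi : M -> N) p (f : N -> R^o) : smooth_map_at phi p ->
 smooth_at (phi p) f -> smooth_at p (f \o phi).
Proof.
move=> s sf; have [c ac cp] := chart_ex hM p; have [c' ac' c'p] := chart_ex hN (phi p).
move: s => /(smapP ac cp ac' c'p)[n s]; move: sf => /(smoothP hN _ ac' c'p) sf.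
apply/(smoothP hM _ ac cp); have := sm_comp s (f := f \o cinv c' (phi p)).
rewrite /hat /= cinvK // => /(_ sf); apply: sm_near.
move: n => /(mnbhsP hM _ ac cp) n.
by apply: filterS n => z dz /=; rewrite cinvK.
Qed.

Lemma smooth_map_near (phi phi' : M -> N) p : mnbhs p (fun q => phi q = phi' q) ->
 smooth_map_at phi p -> smooth_map_at phi' p.
Proof.
move=> n s; have [c ac cp] := chart_ex hM p; have [c' ac' c'p] := chart_ex hN (phi p).
have E := mnbhs_self n; have c'p' : c'.1 (phi' p) by rewrite -E.
move: s => /(smapP ac cp ac' c'p)[n' s].
apply/(smapP ac cp ac' c'p'); split.
 by apply: mnbhs_sub (mnbhsI hM n n') => q [Eq]; rewrite /= -Eq.
apply: sm_near s; move: n => /(mnbhsP hM _ ac cp) n.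
by apply: filterS n => z; rewrite /hat /= => ->.
Qed.

Lemma hatK c (c' : cht N) (phi : M -> N) p q : atlas M c -> c.1 q -> hat c c' phi p (c.2 q) = c'.2 (phi q).
Proof. by move=> ac cq; rewrite /hat /= cinvK. Qed.

End Maps.

Lemma hat_comp M N (Q : charted R) (hM : lman M) (hN : lman N) c c' c2 (phi : M -> N) (psi : N -> Q) p :
 atlas M c -> c.1 p -> atlas N c' -> mnbhs p (phi @^-1` c'.1) ->
 \forall z \near c.2 p, hat c c2 (psi \o phi) p z = hat c' c2 psi (phi p) (hat c c' phi p z).
Proof.
move=> ac cp ac' /(mnbhsP hM _ ac cp); apply: filterS => z c'z.
by rewrite /hat /= cinvK.
Qed.

Lemma smap_comp M N (Q : charted R) (hM : lman M) (hN : lman N) (hQ : lman Q)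
 (phi : M -> N) (psi : N -> Q) p :
 smooth_map_at phi p -> smooth_map_at psi (phi p) -> smooth_map_at (psi \o phi) p.
Proof.
move=> s s'; have [c ac cp] := chart_ex hM p; have [c' ac' c'p] := chart_ex hN (phi p).
have [c2 ac2 c''p] := chart_ex hQ (psi (phi p)).
apply/(smapP hM hQ (phi := psi \o phi) ac cp ac2 c''p).
move: (s) => /(smapP hM hN ac cp ac' c'p)[n1 s1].
move: (s') => /(smapP hN hQ ac' c'p ac2 c''p)[n2 s2].
split; first exact: smap_cont s n2.
rewrite -(hatK hM c' phi p ac cp) in s2.
apply: sm_near (sm_comp_rV s1 s2).
by apply: filterS (hat_comp hM hN c2 psi ac cp ac' n1) => z /= ->.
Qed.

End LocalManifolds.

(** * Tangent vectors and covectors in coordinates *)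

Section TangentCoordinates.
Context {R : realType}.
Implicit Types M N : charted R.

Definition crd M (c : cht M) (v : tvec M) : 'rV[R]_(mdim M) := \row_i v (fun q => c.2 q 0 i).

(** The derivation with components [a]. It vanishes on functions that are not smooth, in accordance
    with the normal form imposed by [tangent], so that equal derivations are equal functions. *)
Definition vec M (c : cht M) (p : M) (a : 'rV[R]_(mdim M)) : tvec M := fun f =>
 if `[< smooth_at p (f : M -> R^o) >] then 'D_a (f \o cinv c p : _ -> R^o) (c.2 p) else 0.

Lemma crdD M (c : cht M) (a : R) u v : crd c (a *: u + v) = a *: crd c u + crd c v.
Proof. by apply/rowP => i; rewrite !mxE. Qed.

Lemma fct_lin (T : Type) (a : R) (u v : T -> R^o) x : (a *: u + v) x = a * u x + v x.
Proof. by []. Qed.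

Section TangentVectors.
Context {M : charted R} (hM : lman M).
Implicit Types (c : set M * (M -> 'rV[R]_(mdim M))) (p q : M) (v : tvec M).

Lemma tangent_linear p v (a : R) (f g : M -> R^o) : tangent p v -> smooth_at p f -> smooth_at p g ->
 v (fun q => a * f q + g q) = a * v f + v g.
Proof. by case=> h _ _ _; exact: h. Qed.

Lemma tangent_leib p v (f g : M -> R^o) : tangent p v -> smooth_at p f -> smooth_at p g ->
 v (fun q => f q * g q) = f p * v g + g p * v f.
Proof. by case=> _ h _ _; exact: h. Qed.

Lemma tangent_local p v (f g : M -> R^o) : tangent p v -> smooth_at p f ->
 mnbhs p (fun q => f q = g q) -> v f = v g.
Proof. by case=> _ _ h _; exact: h. Qed.

Lemma tangent_nonsmooth p v (f : M -> R^o) : tangent p v -> ~ smooth_at p f -> v f = 0.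
Proof. by case=> _ _ _ h; exact: h. Qed.

Lemma tangent_add p v (f g : M -> R^o) : tangent p v -> smooth_at p f -> smooth_at p g ->
 v (fun q => f q + g q) = v f + v g.
Proof.
move=> tv sf sg; have := tangent_linear 1 tv sf sg.
by rewrite mul1r => <-; congr (v _); apply/funext => q; rewrite mul1r.
Qed.

Lemma tangent_cst p v (a : R) : tangent p v -> v (fun _ => a) = 0.
Proof.
move=> tv; have s1 : smooth_at p (fun _ : M => 1 : R^o) by exact: smooth_cst.
have v1 : v (fun _ => 1) = 0.
 have := tangent_leib tv s1 s1; rewrite !mul1r => h.
 have {}h : v (fun _ : M => 1 : R^o) + v (fun _ : M => 1 : R^o) = v (fun _ : M => 1 : R^o).
  by rewrite -h; congr (v _); apply/funext => q; rewrite mul1r.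
 by apply: (addrI (v (fun _ : M => 1 : R^o))); rewrite addr0.
have := tangent_linear (a - 1) tv s1 s1; rewrite !v1 mulr0 addr0 => <-.
by congr (v _); apply/funext => q; rewrite mulr1 subrK.
Qed.

Lemma smooth_at_sum p (I : Type) (s : seq I) (f : I -> M -> R^o) :
 (forall i, smooth_at p (f i)) -> smooth_at p (fun q => \sum_(i <- s) f i q : R^o).
Proof.
move=> sf; elim: s => [|i s IH].
 apply: smooth_near (smooth_cst hM p 0) => //.
 by have F := mnbhs_filter hM p; apply: filterE => q; rewrite big_nil.
apply: smooth_near (smooth_at_add hM (sf i) IH) => //.
by have F := mnbhs_filter hM p; apply: filterE => q; rewrite big_cons.
Qed.

Lemma tangent_sum p v (I : Type) (s : seq I) (f : I -> M -> R^o) : tangent p v ->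
 (forall i, smooth_at p (f i)) -> v (fun q => \sum_(i <- s) f i q) = \sum_(i <- s) v (f i).
Proof.
move=> tv sf; elim: s => [|i s IH].
 rewrite big_nil -[RHS](tangent_cst 0 tv); congr (v _); apply/funext => q.
 by rewrite big_nil.
rewrite big_cons -IH -(tangent_add tv (sf i)); last exact: smooth_at_sum.
by congr (v _); apply/funext => q; rewrite big_cons.
Qed.

Lemma vecT c p a : atlas M c -> c.1 p -> tangent p (vec c p a).
Proof.
move=> ac cp; have E f : smooth_at p (f : M -> R^o) ->
  vec c p a f = 'D_a (f \o cinv c p : _ -> R^o) (c.2 p).
 by move=> sf; rewrite /vec asboolT.
have D f : smooth_at p (f : M -> R^o) -> derivable (f \o cinv c p : _ -> R^o) (c.2 p) a.
 by move/(smoothP hM _ ac cp)/sm_diff => d; exact: diff_derivable.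
split=> [b f g sf sg|f g sf sg|f g sf n|f nf].
- rewrite !E //; last first.
  apply: smooth_at_add => //; apply: smooth_at_mul => //; exact: smooth_cst.
 rewrite (_ : _ \o _ = b *: (f \o cinv c p : _ -> R^o) + (g \o cinv c p : _ -> R^o)) //.
 rewrite deriveD; [|apply: derivableZ; exact: D|exact: D].
 by rewrite deriveZ //; exact: D.
- rewrite !E //; last exact: smooth_at_mul.
 rewrite (_ : _ \o _ = (f \o cinv c p : _ -> R^o) * (g \o cinv c p : _ -> R^o)) //.
 rewrite deriveM; [|exact: D|exact: D].
 by rewrite /= cinvK.
- rewrite !E //; last exact: smooth_near n sf.
 by apply: near_eq_derive; have := (mnbhsP hM _ ac cp).1 n.
- by rewrite /vec asboolF.
Qed.

Lemma crd_vec c p a : atlas M c -> c.1 p -> crd c (vec c p a) = a.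
Proof.
move=> ac cp; apply/rowP => i; rewrite mxE /vec asboolT; last exact: smooth_coord.
rewrite -[RHS](derive_coord a (c.2 p) i); apply: near_eq_derive.
have h := cinvP hM ac cp.
by apply: filterS h => z [_ E] /=; rewrite E.
Qed.

(** Hadamard's lemma: a derivation kills constants and, by the Leibniz rule, sees of each product
    $(x_i - p_i) g_i$ only the value of $g_i$ at the point. The coefficients do not depend on the
    derivation, which [tangentE] exploits by comparing with a coordinate derivation. *)
Lemma tangent_formula c p f : atlas M c -> c.1 p -> smooth_at p (f : M -> R^o) ->
 exists g : 'I_(mdim M) -> R, forall v, tangent p v -> v f = \sum_i crd c v 0 i * g i.
Proof.
move=> ac cp sf; have := sf => /(smoothP hM _ ac cp)/hadamard[g [sg gE]].
exists (fun i => g i (c.2 p)) => v tv.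
have sgc i : smooth_at p (g i \o c.2 : M -> R^o) by exact: smooth_at_fun.
have sc i : smooth_at p (fun q => c.2 q 0 i + - c.2 p 0 i : R^o).
 by apply: smooth_at_add => //; [exact: smooth_coord|exact: smooth_cst].
pose S i q : R^o := (c.2 q 0 i + - c.2 p 0 i) * (g i \o c.2) q.
have sS i : smooth_at p (S i) by exact: smooth_at_mul.
rewrite (tangent_local (g := fun q => f p + \sum_(i <- enum 'I_(mdim M)) S i q) tv sf).
 rewrite (tangent_add tv (smooth_cst hM p (f p)) (smooth_at_sum _ sS)).
 rewrite (tangent_cst _ tv) add0r (tangent_sum _ tv sS) big_enum /=; apply: eq_bigr => i _.
 rewrite /S (tangent_leib tv (sc i) (sgc i)) subrr mul0r add0r.
 rewrite (tangent_add tv (smooth_coord hM i ac cp) (smooth_cst hM p _)).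
 by rewrite (tangent_cst _ tv) addr0 mxE mulrC.
have := near_pre hM ac cp gE; apply: mnbhs_sub => q [cq].
rewrite /= !cinvK // => ->; congr (_ + _); rewrite big_enum /=.
by apply: eq_bigr => i _; rewrite !mxE.
Qed.

Lemma tangentE c p v f : atlas M c -> c.1 p -> tangent p v -> smooth_at p (f : M -> R^o) ->
 v f = 'D_(crd c v) (f \o cinv c p : _ -> R^o) (c.2 p).
Proof.
move=> ac cp tv sf; have [g gE] := tangent_formula ac cp sf.
have := gE _ (vecT (crd c v) ac cp); rewrite crd_vec // -gE // => <-.
by rewrite /vec asboolT.
Qed.

Lemma vec_crd c p v : atlas M c -> c.1 p -> tangent p v -> vec c p (crd c v) = v.
Proof.
move=> ac cp tv; apply/funext => f; have [sf|nf] := pselect (smooth_at p (f : M -> R^o)).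
 by rewrite (tangentE ac cp tv sf) /vec asboolT.
by rewrite (tangent_nonsmooth tv nf) /vec asboolF.
Qed.

Lemma crd_inj c p u v : atlas M c -> c.1 p -> tangent p u -> tangent p v ->
 crd c u = crd c v -> u = v.
Proof. by move=> ac cp tu tv E; rewrite -(vec_crd ac cp tu) -(vec_crd ac cp tv) E. Qed.

Lemma tangent_sub p : is_subspace (@tangent R M p).
Proof.
have [c ac cp] := chart_ex hM p.
have T (a : R) u v : tangent p u -> tangent p v -> tangent p (a *: u + v).
 move=> tu tv; split=> [b f g sf sg|f g sf sg|f g sf n|f nf].
 - by rewrite !fct_lin (tangent_linear b tu sf sg) (tangent_linear b tv sf sg); ring.
 - by rewrite !fct_lin (tangent_leib tu sf sg) (tangent_leib tv sf sg); ring.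
 - by rewrite !fct_lin (tangent_local tu sf n) (tangent_local tv sf n).
 - by rewrite fct_lin (tangent_nonsmooth tu nf) (tangent_nonsmooth tv nf) mulr0 addr0.
split=> //; have t := vecT 0 ac cp.
by have := T (-1) _ _ t t; rewrite scaleN1r addNr.
Qed.

Lemma tangentD p (a : R) u v : tangent p u -> tangent p v -> tangent p (a *: u + v).
Proof. by case: (tangent_sub p) => _; exact. Qed.

Lemma tangent0 p : @tangent R M p 0.
Proof. by case: (tangent_sub p). Qed.

Lemma vecD c p (a : R) x y : atlas M c -> c.1 p -> vec c p (a *: x + y) = a *: vec c p x + vec c p y.
Proof.
move=> ac cp; apply: (crd_inj ac cp); first exact: vecT.
 by apply: tangentD; exact: vecT.
by rewrite crdD (crd_vec x ac cp) (crd_vec y ac cp) (crd_vec _ ac cp).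
Qed.

Lemma vec0 c p : atlas M c -> c.1 p -> vec c p 0 = 0.
Proof. by move=> ac cp; have := vecD (-1) 0 0 ac cp; rewrite scaleN1r oppr0 addr0 scaleN1r addNr. Qed.

Lemma vec_sum c p (I : Type) (s : seq I) (a : I -> R) (x : I -> 'rV[R]_(mdim M)) :
 atlas M c -> c.1 p ->
 vec c p (\sum_(i <- s) a i *: x i) = \sum_(i <- s) a i *: vec c p (x i).
Proof.
move=> ac cp; elim: s => [|i s IH]; first by rewrite !big_nil vec0.
by rewrite !big_cons vecD // IH.
Qed.

End TangentVectors.

Definition dotr n (a b : 'rV[R]_n) : R := (a *m b^T) 0 0.

Lemma dotrE n (a b : 'rV[R]_n) : dotr a b = \sum_i a 0 i * b 0 i.
Proof. by rewrite /dotr mxE; apply: eq_bigr => i _; rewrite mxE. Qed.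

Lemma dotr_ev n (a : 'rV[R]_n) i : dotr a (ev i) = a 0 i.
Proof.
rewrite dotrE (bigD1 i) //= big1 => [|j ji]; first by rewrite mxE !eqxx mulr1 addr0.
by rewrite mxE (negbTE ji) andbF mulr0.
Qed.

Lemma dotrDr n (a : 'rV[R]_n) (t : R) u v : dotr a (t *: u + v) = t * dotr a u + dotr a v.
Proof. by rewrite /dotr linearP mulmxDr -scalemxAr !mxE. Qed.

Lemma dotrDl n (a b : 'rV[R]_n) (t : R) v : dotr (t *: a + b) v = t * dotr a v + dotr b v.
Proof. by rewrite /dotr mulmxDl -scalemxAl !mxE. Qed.

Lemma dotr_inj n (a b : 'rV[R]_n) : (forall v, dotr a v = dotr b v) -> a = b.
Proof. by move=> h; apply/rowP => i; rewrite -!dotr_ev h. Qed.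

Lemma dotr_mulmx m n (a : 'rV[R]_n) (v : 'rV[R]_m) A : dotr a (v *m A) = dotr (a *m A^T) v.
Proof. by rewrite /dotr trmx_mul mulmxA. Qed.

Lemma dotrC n (a b : 'rV[R]_n) : dotr a b = dotr b a.
Proof. by rewrite !dotrE; apply: eq_bigr => i _; rewrite mulrC. Qed.

Definition ccrd M (c : cht M) (p : M) (b : cvec M) : 'rV[R]_(mdim M) := \row_i b (vec c p (ev i)).

Definition covec M (c : cht M) (p : M) (a : 'rV[R]_(mdim M)) : cvec M :=
 restr (@tangent R M p) (fun v => dotr a (crd c v) : R^o).

Section Covectors.
Context {M : charted R} (hM : lman M).
Implicit Types (c : set M * (M -> 'rV[R]_(mdim M))) (p q : M) (v : tvec M).

Lemma covecE c p a v : tangent p v -> covec c p a v = dotr a (crd c v).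
Proof. by move=> tv; rewrite /covec /restr asboolT. Qed.

Lemma covecT c p a : cotangent p (covec c p a).
Proof.
split=> [b u v tu tv|v nv]; last by rewrite /covec /restr asboolF.
by rewrite !covecE //; [rewrite crdD dotrDr|exact: tangentD].
Qed.

Lemma cotangentE c p b v : atlas M c -> c.1 p -> cotangent p b -> tangent p v ->
 b v = dotr (ccrd c p b) (crd c v).
Proof.
move=> ac cp [lb _] tv; rewrite -{1}(vec_crd hM ac cp tv) -{1}(rV_partial_sum (crd c v)).
rewrite vec_sum // dotrE.
have t0 := tangent0 hM p.
have b0 : b 0 = 0 by have := lb (-1) _ _ t0 t0; rewrite scaleN1r addNr mulN1r addNr.
have tev i : tangent p (vec c p (ev i)) by exact: vecT.
rewrite -[RHS]big_enum -[in LHS]big_enum /=.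
elim: (enum _) => [|i s IH]; first by rewrite !big_nil b0.
have ts : tangent p (\sum_(i <- s) crd c v 0 i *: vec c p (ev i)).
 elim: (s) => [|j s' IH']; first by rewrite big_nil.
 by rewrite big_cons; exact: tangentD.
by rewrite !big_cons (lb _ _ _ (tev i) ts) IH; congr (_ + _); rewrite [ccrd c p b 0 i]mxE mulrC.
Qed.

Lemma cotangent_inj c p a b : atlas M c -> c.1 p -> cotangent p a -> cotangent p b ->
 ccrd c p a = ccrd c p b -> a = b.
Proof.
move=> ac cp ta tb E; apply/funext => v; have [tv|nv] := pselect (tangent p v).
 by rewrite (cotangentE ac cp ta tv) E -(cotangentE ac cp tb tv).
by case: ta => _ -> //; case: tb => _ ->.
Qed.

Lemma ccrd_covec c p a : atlas M c -> c.1 p -> ccrd c p (covec c p a) = a.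
Proof.
move=> ac cp; apply/rowP => i; rewrite mxE covecE; last exact: vecT.
by rewrite crd_vec // dotr_ev.
Qed.

Lemma covec_ccrd c p b : atlas M c -> c.1 p -> cotangent p b -> covec c p (ccrd c p b) = b.
Proof.
move=> ac cp tb; apply: (cotangent_inj ac cp) => //; first exact: covecT.
exact: ccrd_covec.
Qed.

Lemma ccrdD c p (t : R) a b : ccrd c p (t *: a + b) = t *: ccrd c p a + ccrd c p b.
Proof. by apply/rowP => i; rewrite !mxE. Qed.

Lemma cotangentD p (t : R) (a b : cvec M) : cotangent p a -> cotangent p b ->
 cotangent p (t *: a + b).
Proof.
move=> [la na] [lb nb]; split=> [s u v tu tv|v nv].
 by rewrite !fct_lin (la _ _ _ tu tv) (lb _ _ _ tu tv); ring.
by rewrite fct_lin na // nb // mulr0 addr0.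
Qed.

Lemma dif_cotangent p (f : M -> R^o) : smooth_at p f -> cotangent p (dif f p).
Proof.
move=> sf; split=> [s u v tu tv|v nv]; last by rewrite /dif /restr asboolF.
by rewrite /dif /restr !asboolT //; exact: tangentD.
Qed.

Lemma difE p (f : M -> R^o) v : tangent p v -> dif f p v = v f.
Proof. by move=> tv; rewrite /dif /restr asboolT. Qed.

Lemma ccrd_dif c p (f : M -> R^o) : atlas M c -> c.1 p -> smooth_at p f ->
 forall v : 'rV[R]_(mdim M), dotr (ccrd c p (dif f p)) v = 'D_v (f \o cinv c p : _ -> R^o) (c.2 p).
Proof.
move=> ac cp sf v; have tv := vecT hM v ac cp.
have := cotangentE ac cp (dif_cotangent sf) tv; rewrite crd_vec // => <-.
by rewrite difE // (tangentE hM ac cp tv sf) crd_vec.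
Qed.

Lemma dif_coord c p i : atlas M c -> c.1 p ->
 dif (fun q => c.2 q 0 i : R^o) p = covec c p (ev i).
Proof.
move=> ac cp; apply/funext => v; rewrite /dif /covec /restr; case: ifP => // _.
by rewrite dotrC dotr_ev mxE.
Qed.

End Covectors.

Section Push.
Context {M N : charted R} (hM : lman M) (hN : lman N).
Implicit Types (c : set M * (M -> 'rV[R]_(mdim M))) (d : set N * (N -> 'rV[R]_(mdim N))).

Lemma pushT (phi : M -> N) p v : smooth_map_at phi p -> tangent p v ->
 tangent (phi p) (push phi p v).
Proof.
move=> s tv; split=> [b f g sf sg|f g sf sg|f g sf n|f nf]; rewrite /push.
- rewrite !asboolT //; last first.
  by apply: smooth_at_add => //; apply: smooth_at_mul => //; exact: smooth_cst.
 exact: tangent_linear (smooth_comp hM hN s sf) (smooth_comp hM hN s sg).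
- rewrite !asboolT //; last exact: smooth_at_mul.
 exact: tangent_leib (smooth_comp hM hN s sf) (smooth_comp hM hN s sg).
- rewrite !asboolT //; last exact: smooth_near n sf.
 by apply: tangent_local (smooth_comp hM hN s sf) _ => //; exact: smap_cont n.
- by rewrite asboolF.
Qed.

Lemma push_crd (phi : M -> N) p v c d : atlas M c -> c.1 p -> atlas N d -> d.1 (phi p) ->
 smooth_map_at phi p -> tangent p v ->
 crd d (push phi p v) = crd c v *m Jac (hat c d phi p) (c.2 p).
Proof.
move=> ac cp ad dp s tv; have [_ sh] := (smapP hM hN ac cp ad dp).1 s.
rewrite -JacE_sm //; apply/rowP => j; rewrite mxE.
have sd : smooth_at (phi p) (fun q => d.2 q 0 j : R^o) by exact: smooth_coord.
rewrite /push asboolT // (tangentE hM ac cp tv (smooth_comp hM hN s sd)).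
by rewrite derive_rV //; apply: diff_derivable; exact: sm_diff.
Qed.

Lemma copullT (phi : M -> N) p b : smooth_map_at phi p -> cotangent (phi p) b ->
 cotangent p (copull phi p b).
Proof.
move=> s [lb nb]; split=> [t u v tu tv|v nv]; last by rewrite /copull /restr asboolF.
rewrite /copull /restr !asboolT //; last exact: tangentD.
rewrite -lb; [|exact: pushT|exact: pushT]; congr (b _).
apply/funext => f; rewrite fct_lin /push fct_lin.
by case: ifP => // _; rewrite mulr0 addr0.
Qed.

Lemma copull_ccrd (phi : M -> N) p b c d : atlas M c -> c.1 p -> atlas N d -> d.1 (phi p) ->
 smooth_map_at phi p -> cotangent (phi p) b ->
 ccrd c p (copull phi p b) = ccrd d (phi p) b *m (Jac (hat c d phi p) (c.2 p))^T.
Proof.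
move=> ac cp ad dp s tb; apply/dotr_inj => v; rewrite -dotr_mulmx.
have tv := vecT hM v ac cp.
have := cotangentE hM ac cp (copullT s tb) tv; rewrite crd_vec // => <-.
rewrite /copull /restr asboolT // (cotangentE hN ad dp tb); last exact: pushT.
by rewrite (push_crd ac cp ad dp s tv) crd_vec.
Qed.

End Push.

End TangentCoordinates.

(** * Bivectors, two-forms and curves in coordinates *)

Section Tensors.
Context {R : realType}.
Implicit Types M N : charted R.

Section Bilinear.
Context {V : lmodType R} (F : set V) (hF : is_subspace F).

Lemma subspace_sum (I : Type) (s : seq I) (a : I -> R) (x : I -> V) :
 (forall i, F (x i)) -> F (\sum_(i <- s) a i *: x i).
Proof.
by case: hF => F0 FD Fx; elim: s => [|i s IH]; rewrite ?big_nil // big_cons; exact: FD.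
Qed.

Lemma linear_on0 f : linear_on F f -> f 0 = 0.
Proof.
case: hF => F0 _ lf; have := lf (-1) 0 0 F0 F0.
by rewrite scaleN1r addNr mulN1r addNr.
Qed.

Lemma linear_on_sum f (I : Type) (s : seq I) (a : I -> R) (x : I -> V) : linear_on F f ->
 (forall i, F (x i)) -> f (\sum_(i <- s) a i *: x i) = \sum_(i <- s) a i * f (x i).
Proof.
move=> lf Fx; elim: s => [|i s IH]; first by rewrite !big_nil linear_on0.
by rewrite !big_cons (lf _ _ _ (Fx i) (subspace_sum s a Fx)) IH.
Qed.

(** [skew_form] states linearity in the second slot; skewness transfers it to the first. *)
Lemma skew_bilin n b (x : 'I_n -> V) (u v : 'rV[R]_n) : skew_form F b -> (forall i, F (x i)) ->
 b (\sum_i u 0 i *: x i) (\sum_j v 0 j *: x j) = dotr (u *m \matrix_(i, j) b (x i) (x j)) v.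
Proof.
move=> [lb sb] Fx; have Fs (w : 'rV[R]_n) := subspace_sum (index_enum 'I_n) (fun j => w 0 j : R) Fx.
rewrite (linear_on_sum _ _ (lb _ (Fs u)) Fx) dotrE; apply: eq_bigr => j _.
rewrite mulrC; congr (_ * _); rewrite (sb _ _ (Fs u) (Fx j)).
rewrite (linear_on_sum _ _ (lb _ (Fx j)) Fx) -sumrN mxE; apply: eq_bigr => i _.
by rewrite mxE -mulrN -(sb _ _ (Fx i) (Fx j)).
Qed.

End Bilinear.

Section Poisson.
Context {M : charted R} (hM : lman M) (pi : bivector M).
Implicit Types (c : set M * (M -> 'rV[R]_(mdim M))).

(** The matrix of the bivector, in the convention that the components of [sharp] applied to a
    covector [a] are [ccrd c q a *m PM c q]. *)
Definition PM c q : 'M[R]_(mdim M) := \matrix_(i, j) pi q (covec c q (ev i)) (covec c q (ev j)).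

Lemma cotangent_sub (p : M) : is_subspace (@cotangent R M p).
Proof.
split; last by move=> a u v; exact: cotangentD.
by split=> [b u v _ _|v _] //; rewrite mulr0 addr0.
Qed.

Lemma covec_lin c q (a : R) x y : covec c q (a *: x + y) = a *: covec c q x + covec c q y.
Proof.
apply/funext => v; rewrite fct_lin /covec /restr; case: ifP => _; last by rewrite mulr0 addr0.
exact: dotrDl.
Qed.

Lemma covec_sum c q (a : 'rV[R]_(mdim M)) : covec c q a = \sum_i a 0 i *: covec c q (ev i).
Proof.
rewrite -{1}(rV_partial_sum a); elim: (index_enum _) => [|i s IH].
 rewrite !big_nil; apply/funext => v; rewrite /covec /restr; case: ifP => // _.
 by rewrite /dotr mul0mx mxE.
by rewrite !big_cons covec_lin IH.
Qed.

Lemma pi_crd c q a b : skew_form (cotangent q) (pi q) -> atlas M c -> c.1 q ->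
 cotangent q a -> cotangent q b -> pi q a b = dotr (ccrd c q a *m PM c q) (ccrd c q b).
Proof.
move=> sk ac cq ta tb.
rewrite -{1}(covec_ccrd hM ac cq ta) -{1}(covec_ccrd hM ac cq tb) !covec_sum.
by rewrite (skew_bilin (cotangent_sub q)) // => i; exact: covecT.
Qed.

Lemma PM_skew c q : skew_form (cotangent q) (pi q) -> (PM c q)^T = - PM c q.
Proof.
by move=> [_ sk]; apply/matrixP => i j; rewrite !mxE; apply: sk; exact: covecT.
Qed.

Lemma sharp_vec c q a : skew_form (cotangent q) (pi q) -> atlas M c -> c.1 q ->
 cotangent q a -> sharp pi q a = vec c q (ccrd c q a *m PM c q).
Proof.
move=> sk ac cq ta; apply/funext => f; rewrite /sharp /vec; case: asboolP => sf.
 rewrite (pi_crd sk ac cq ta (dif_cotangent hM sf)) dotrC.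
 by rewrite dotrC -(ccrd_dif hM ac cq sf) dotrC.
rewrite (_ : dif f q = 0); first by case: sk => l _; rewrite (linear_on0 (cotangent_sub q) (l _ ta)).
apply/funext => v; rewrite /dif /restr; case: asboolP => // tv.
exact: tangent_nonsmooth tv sf.
Qed.

Lemma sharpT q a : skew_form (cotangent q) (pi q) -> cotangent q a ->
 tangent q (sharp pi q a).
Proof.
move=> sk ta; have [c ac cq] := chart_ex hM q.
by rewrite (sharp_vec sk ac cq ta); exact: vecT.
Qed.

Lemma sharp_crd c q a : skew_form (cotangent q) (pi q) -> atlas M c -> c.1 q ->
 cotangent q a -> crd c (sharp pi q a) = ccrd c q a *m PM c q.
Proof. by move=> sk ac cq ta; rewrite (sharp_vec sk ac cq ta) crd_vec. Qed.

Context (U : set M) (hpi : poisson_on U pi).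

Lemma PM_smooth c p : atlas M c -> c.1 p -> U p -> smM (c.2 p) (fun z => PM c (cinv c p z)).
Proof.
move=> ac cp Up i j; have [_ sb _] := hpi Up.
have := sb _ _ (smooth_coord hM i ac cp) (smooth_coord hM j ac cp).
move=> /(smoothP hM _ ac cp); apply: sm_near.
have h := cinvP hM ac cp; apply: filterS h => z [cz _].
by rewrite /= /bracket mxE !(dif_coord _ ac cz).
Qed.

Lemma dif_lin c q (a : 'rV[R]_(mdim M)) : atlas M c -> c.1 q ->
 dif (fun q => dotr a (c.2 q) : R^o) q = covec c q a.
Proof.
move=> ac cq; have sf : smooth_at q (fun q => dotr a (c.2 q) : R^o).
 apply: smooth_near (smooth_at_fun hM (g := fun z => (z *m a^T) 0 0) ac cq _) => //.
  by have F := mnbhs_filter hM q; apply: filterE => q'; rewrite /= dotrC.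
 exact: (sm_rVP _ _).1 (sm_lin _ _) 0.
apply: (cotangent_inj hM ac cq); first exact: dif_cotangent.
 exact: covecT.
rewrite ccrd_covec //; apply/dotr_inj => v; rewrite ccrd_dif //.
transitivity ('D_v (fun z => (z *m a^T) 0 0 : R^o) (c.2 q)).
 apply: near_eq_derive; have h := cinvP hM ac cq; apply: filterS h => z [_ E].
 by rewrite /= E dotrC.
rewrite -(derive_rV 0 (g := fun z => z *m a^T)); last first.
 by apply: diff_derivable; apply: sm_diff; exact: sm_lin.
rewrite (JacE_sm _ (sm_lin _ _)) dotrC /dotr; congr ((_ *m _) _ _); apply/matrixP => i j.
rewrite mxE (_ : 'D_(ev i) _ _ = ev i *m a^T); first by rewrite -rowE mxE.
apply: derive_val; apply: is_d_eps => e e0; exists 1 => // s _.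
by rewrite mulmxDl addrK -scalemxAl subrr normr0 mulr_ge0 // ltW.
Qed.

(** The Jacobi identity is tested on functions linear in the chart. Their differentials have
    constant components, so that only derivatives of the matrix remain. *)
Lemma PM_jacobi c p : mopen U -> atlas M c -> c.1 p -> U p -> forall a b g,
 'D_(a *m PM c p) (fun z => dotr (b *m PM c (cinv c p z)) g : R^o) (c.2 p)
 + 'D_(b *m PM c p) (fun z => dotr (g *m PM c (cinv c p z)) a : R^o) (c.2 p)
 + 'D_(g *m PM c p) (fun z => dotr (a *m PM c (cinv c p z)) b : R^o) (c.2 p) = 0.
Proof.
move=> oU ac cp Up a b g; have [sk sb J] := hpi Up.
pose f x : M -> R^o := fun q => dotr x (c.2 q).
have sf x : smooth_at p (f x).
 apply: smooth_near (smooth_at_fun hM (g := fun z => (z *m x^T) 0 0) ac cp _) => //.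
  by have F := mnbhs_filter hM p; apply: filterE => q'; rewrite /= /f dotrC.
 exact: (sm_rVP _ _).1 (sm_lin _ _) 0.
have B x y z : bracket pi (f x) (bracket pi (f y) (f z)) p =
  'D_(x *m PM c p) (fun w => dotr (y *m PM c (cinv c p w)) z : R^o) (c.2 p).
 have sh := sb _ _ (sf y) (sf z); rewrite {1}/bracket.
 rewrite (pi_crd sk ac cp (dif_cotangent hM (sf x)) (dif_cotangent hM sh)).
 rewrite dotrC ccrd_dif // dif_lin // ccrd_covec //.
 have h1 := cinvP hM ac cp; have h2 := (mnbhsP hM _ ac cp).1 (open_mn oU Up).
 apply: near_eq_derive; apply: filterS2 h1 h2 => w [cw _] Uw; rewrite /= /bracket.
 have [skw _ _] := hpi Uw.
 by rewrite !dif_lin // (pi_crd skw ac cw) ?ccrd_covec //; exact: covecT.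
by have := J _ _ _ (sf a) (sf b) (sf g); rewrite !B.
Qed.

End Poisson.

Section Forms.
Context {M : charted R} (hM : lman M) (eta : M -> tvec M -> tvec M -> R^o).
Implicit Types (c : set M * (M -> 'rV[R]_(mdim M))).

Definition EM c q : 'M[R]_(mdim M) := \matrix_(i, j) eta q (vec c q (ev i)) (vec c q (ev j)).

Lemma vec_partial c q (a : 'rV[R]_(mdim M)) : atlas M c -> c.1 q ->
 vec c q a = \sum_i a 0 i *: vec c q (ev i).
Proof. by move=> ac cq; rewrite -{1}(rV_partial_sum a) vec_sum. Qed.

Lemma eta_crd c q u v : skew_form (tangent q) (eta q) -> atlas M c -> c.1 q ->
 tangent q u -> tangent q v -> eta q u v = dotr (crd c u *m EM c q) (crd c v).
Proof.
move=> sk ac cq tu tv; rewrite -{1}(vec_crd hM ac cq tu) -{1}(vec_crd hM ac cq tv).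
rewrite !(vec_partial _ ac cq) (skew_bilin (tangent_sub hM q)) // => i.
exact: vecT.
Qed.

Lemma EM_skew c q : skew_form (tangent q) (eta q) -> atlas M c -> c.1 q -> (EM c q)^T = - EM c q.
Proof.
move=> [_ sk] ac cq; apply/matrixP => i j; rewrite !mxE; apply: sk; exact: vecT.
Qed.

Lemma vec_cinv c p z (f : M -> R^o) a : atlas M c -> c.1 p -> c.1 (cinv c p z) ->
 c.2 (cinv c p z) = z -> smooth_at (cinv c p z) f ->
 vec c (cinv c p z) a f = 'D_a (f \o cinv c p : _ -> R^o) z.
Proof.
move=> ac cp cz E sf; rewrite /vec asboolT // E; apply: near_eq_derive.
have := cinvP hM ac cz; rewrite E; apply: filterS => w [cw Ew] /=.
by rewrite -Ew !cinvK.
Qed.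

Lemma vec_field c p a : atlas M c -> c.1 p -> vfield_at p (fun q => vec c q a).
Proof.
move=> ac cp; split.
 by exists c.1; split=> //; [exact: copen|move=> q cq; exact: vecT].
move=> f sf; apply/(smoothP hM _ ac cp).
move: (sf) => /(smoothP hM _ ac cp)/(sm_D a); apply: sm_near.
have h1 := cinvP hM ac cp; have h2 := (mnbhsP hM _ ac cp).1 (smooth_at_mnbhs hM sf).
by apply: filterS2 h1 h2 => z [cz E] sz; rewrite /= vec_cinv.
Qed.

Lemma lie_vec c p a b : atlas M c -> c.1 p ->
 lie (fun q => vec c q a) (fun q => vec c q b) p = 0.
Proof.
move=> ac cp; apply/funext => f; rewrite /lie; case: asboolP => // sf.
have h a' b' : vec c p a' (fun q => vec c q b' f) = 'D_a' ('D_b' (f \o cinv c p : _ -> R^o)) (c.2 p).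
 have [_ h] := vec_field b' ac cp; rewrite /vec asboolT; last exact: h.
 apply: near_eq_derive.
 have h1 := cinvP hM ac cp; have h2 := (mnbhsP hM _ ac cp).1 (smooth_at_mnbhs hM sf).
 by apply: filterS2 h1 h2 => z [cz E] sz; have /= := vec_cinv b' ac cp cz E sz.
by rewrite !h schwarz_real ?subrr //; apply/(smoothP hM _ ac cp).
Qed.

Context (D : set M) (heta : closed_form_on D eta).

Lemma EM_smooth c p : atlas M c -> c.1 p -> D p -> smM (c.2 p) (fun z => EM c (cinv c p z)).
Proof.
move=> ac cp Dp i j; have [_ se _] := heta Dp.
have := se _ _ (vec_field (ev i) ac cp) (vec_field (ev j) ac cp).
move=> /(smoothP hM _ ac cp); apply: sm_near.
by have h := cinvP hM ac cp; apply: filterS h => z _; rewrite /= mxE.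
Qed.

(** Fields with constant components in the chart commute, so the three bracket terms of the exterior
    derivative drop out. *)
Lemma EM_closed c p : mopen D -> atlas M c -> c.1 p -> D p -> forall u v w,
 'D_u (fun z => dotr (v *m EM c (cinv c p z)) w : R^o) (c.2 p)
 - 'D_v (fun z => dotr (u *m EM c (cinv c p z)) w : R^o) (c.2 p)
 + 'D_w (fun z => dotr (u *m EM c (cinv c p z)) v : R^o) (c.2 p) = 0.
Proof.
move=> oD ac cp Dp u v w; have [[lsk sk] se cl] := heta Dp.
have Y a := vec_field a ac cp.
have E a b x : vec c p a (fun q => eta q (vec c q b) (vec c q x)) =
  'D_a (fun z => dotr (b *m EM c (cinv c p z)) x : R^o) (c.2 p).
 rewrite /vec asboolT; last exact: se (Y b) (Y x).
 apply: near_eq_derive.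
 have h1 := cinvP hM ac cp; have h2 := (mnbhsP hM _ ac cp).1 (open_mn oD Dp).
 apply: filterS2 h1 h2 => z [cz _] Dz /=; have [skz _ _] := heta Dz.
 rewrite (eta_crd skz ac cz); [|exact: vecT|exact: vecT].
 by rewrite (crd_vec hM b ac cz) (crd_vec hM x ac cz).
have e0 x : tangent p x -> eta p 0 x = 0.
 move=> tx; rewrite sk //; last exact: tangent0.
 by rewrite (linear_on0 (tangent_sub hM p) (lsk _ tx)) oppr0.
have := cl _ _ _ (Y u) (Y v) (Y w); rewrite !(lie_vec _ _ ac cp) !E.
rewrite (e0 _ (vecT hM u ac cp)) (e0 _ (vecT hM v ac cp)) (e0 _ (vecT hM w ac cp)).
by rewrite !subr0 addr0.
Qed.

End Forms.

Section Curves.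
Context {M : charted R} (hM : lman M).
Implicit Types (c : set M * (M -> 'rV[R]_(mdim M))) (g : R -> M).

Definition mcont g (t : R) := forall A, mnbhs (g t) A -> \forall s \near t, A (g s).

(** [integral_curve] speaks of functions along the curve only. Applied to the indicator of an open
    neighborhood, which is smooth at the point because it is locally constant there, it forces the
    curve to stay in the neighborhood for a short time. *)
Lemma icurve_cont (Y : M -> tvec M) g a b t : integral_curve Y g a b -> a < t < b ->
 mcont g t.
Proof.
move=> ic tab A [ O [oO Og OA]].
pose f q : R^o := if `[< O q >] then 1 else 0.
have sf : smooth_at (g t) f.
 apply: smooth_near (smooth_cst hM (g t) 1) => //.
 by exists O; split=> // q Oq; rewrite /f asboolT.
have /is_d_cont := ic t tab f sf.
rewrite /f /= => cf; have /= := @cvgr_gt _ _ _ _ _ _ cf 0.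
rewrite asboolT // => /(_ _ ltr01); apply: filterS => s.
by case: asboolP => [/OA //|_]; rewrite ltxx.
Qed.

Lemma integral_curve_crd (Y : M -> tvec M) g a b t c : integral_curve Y g a b -> a < t < b ->
 atlas M c -> c.1 (g t) ->
 is_d t (fun s : R^o => c.2 (g s)) (crd c (Y (g t))).
Proof.
move=> ic tab ac cg; apply/is_d_rVP => j; rewrite mxE.
exact: ic t tab _ (smooth_coord hM j ac cg).
Qed.

Lemma chart_cont c g t : atlas M c -> c.1 (g t) -> mcont g t ->
 {for t, continuous (fun s : R => c.2 (g s))}.
Proof.
move=> ac cg mc A nA; have := mc _ (near_pre hM ac cg nA).
by apply: filterS => s [].
Qed.

(** Where the curves meet, both solve one equation in one chart and coincide nearby; where they
    differ, separation keeps them apart nearby. Equality thus propagates along $[0, 1]$. The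
    equation is asked for [0 < s < 1] because in the gluing of flows it is obtained by dividing by
    [s]. *)
Lemma curve_unique g1 g2 :
 (forall t, 0 <= t <= 1 -> mcont g1 t /\ mcont g2 t) ->
 (forall t, 0 <= t <= 1 -> g1 t = g2 t -> exists c (u : 'rV[R]_(1 + mdim M) -> 'rV[R]_(mdim M)),
  [/\ atlas M c, c.1 (g1 t), sm (tx t (c.2 (g1 t))) u &
   \forall s \near t, 0 < s < 1 ->
   is_d s (fun s : R^o => c.2 (g1 s)) (u (tx s (c.2 (g1 s)))) /\
   is_d s (fun s : R^o => c.2 (g2 s)) (u (tx s (c.2 (g2 s))))]) ->
 g1 0 = g2 0 -> g1 1 = g2 1.
Proof.
move=> mc loc; apply: (@segment_induction _ (fun t => g1 t = g2 t)) => t0 t01.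
have [mc1 mc2] := mc t0 t01; have [E|N] := pselect (g1 t0 = g2 t0); last first.
 case: hM => _ _ _ /(_ _ _ N)[ O [ O' [oO oO' O1 O2 I]]].
 have h1 := mc1 _ (open_mn oO O1); have h2 := mc2 _ (open_mn oO' O2).
 have : \forall s \near t0, O (g1 s) /\ O' (g2 s) by apply: filterS2 h1 h2.
 move=> /nbhs_ballP[e e0 he]; exists e => // t1 t2 _ _ d1 _ E1; exfalso.
 have [] := he t1; first by rewrite /ball /= distrC.
 by rewrite E1 => a b; have : (O `&` O') (g2 t1) by []; rewrite I.
have [c [u [ac cg su h]]] := loc t0 t01 E.
have [e e0 uniq] := local_uniqueness su.
have c1 := chart_cont ac cg mc1.
have cg2 : c.1 (g2 t0) by rewrite -E.
have c2 := chart_cont ac cg2 mc2.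
have n1 : \forall s \near t0, `|c.2 (g1 s) - c.2 (g1 t0)| < e.
 have h' : \forall s \near t0, ball (c.2 (g1 t0)) e (c.2 (g1 s)) := c1 _ (nbhsx_ballx _ _ e0).
 apply: filterS h' => s.
 by rewrite -ball_normE /= distrC.
have n2 : \forall s \near t0, `|c.2 (g2 s) - c.2 (g1 t0)| < e.
 have h' : \forall s \near t0, ball (c.2 (g2 t0)) e (c.2 (g2 s)) := c2 _ (nbhsx_ballx _ _ e0).
 apply: filterS h' => s.
 by rewrite -ball_normE /= distrC E.
have m1 := mc1 _ (open_mn (copen hM ac) cg).
have m2 := mc2 _ (open_mn (copen hM ac) cg2).
have : \forall s \near t0, [/\ `|c.2 (g1 s) - c.2 (g1 t0)| < e,
  `|c.2 (g2 s) - c.2 (g1 t0)| < e & [/\ c.1 (g1 s), c.1 (g2 s) &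
   0 < s < 1 -> is_d s (fun s : R^o => c.2 (g1 s)) (u (tx s (c.2 (g1 s)))) /\
   is_d s (fun s : R^o => c.2 (g2 s)) (u (tx s (c.2 (g2 s))))]].
 by apply: filterS2 (filterI n1 n2) (filterI (filterI m1 m2) h) => s [a b] [[a' b'] d]; split.
move=> /nbhs_ballP[d d0 hd]; pose r := Num.min d e / 2.
have r0 : 0 < r by rewrite /r divr_gt0 // lt_min d0 e0.
have rd : r < d.
 by rewrite /r ltr_pdivrMr //; apply: le_lt_trans (_ : d < _); rewrite ?ge_min ?lexx // ltr_pMr // ltr1n.
have re : r < e.
 by rewrite /r ltr_pdivrMr //; apply: le_lt_trans (_ : e < _); rewrite ?ge_min ?lexx ?orbT // ltr_pMr // ltr1n.
exists r => // t1 t2 h1 h2 d1 d2 E1.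
have hd' s : t0 - r <= s <= t0 + r -> ball t0 d s.
 rewrite /ball /= distrC ltr_norml => /andP[a b]; clear - rd a b.
 by apply/andP; split; lra.
have in1 s : `|s - t0| < r -> t0 - r <= s <= t0 + r.
 by rewrite ltr_norml => /andP[a b]; clear - a b; apply/andP; split; lra.
have [_ _ [a1 _ _]] := hd _ (hd' _ (in1 _ d1)).
have [_ _ [a2 b2 _]] := hd _ (hd' _ (in1 _ d2)).
apply: (chart_inj hM ac a2 b2).
have hI s : (Num.max 0 (t0 - r) <= s <= Num.min 1 (t0 + r)) = (0 <= s <= 1) && (t0 - r <= s <= t0 + r).
 rewrite ge_max le_min; by case: (0 <= s); case: (t0 - r <= s); case: (s <= 1); case: (s <= t0 + r).
have I1 : Num.max 0 (t0 - r) <= t1 <= Num.min 1 (t0 + r) by rewrite hI h1 in1.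
have I2 : Num.max 0 (t0 - r) <= t2 <= Num.min 1 (t0 + r) by rewrite hI h2 in1.
apply: (uniq (fun s => c.2 (g1 s)) (fun s => c.2 (g2 s)) _ _ _ _ _ _ _ _ I1 I2 _).
- by rewrite lt_max; apply/orP; right; lra.
- by rewrite gt_min; apply/orP; right; lra.
- move=> s; rewrite hI => /andP[s01 hs]; have [x1 x2 [x3 x4 _]] := hd _ (hd' _ hs).
 have [y1 y2] := mc s s01.
 by split; [exact: (chart_cont ac x3 y1)|exact: (chart_cont ac x4 y2)|exact: x1|exact: x2].
- move=> s; rewrite gt_max lt_min => /andP[/andP[s0 hs1] /andP[s1 hs2]].
 have hs : t0 - r <= s <= t0 + r by apply/andP; split; exact: ltW.
 by have [_ _ [_ _ x]] := hd _ (hd' s hs); apply: x; rewrite s0.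
- by congr (c.2 _).
Qed.

End Curves.

End Tensors.

(** * Total spaces of dual bundles *)

Section Bundles.
Context {R : realType}.
Implicit Types M N : charted R.

(** If [K0] is a right inverse at the point, [A *m K0] stays invertible nearby and its inverse
    corrects [K0] smoothly. *)
Lemma smooth_rinv n p q z (A : 'rV[R]_n -> 'M[R]_(p, q)) : smM z A -> row_free (A z) ->
 exists K : 'rV[R]_n -> 'M[R]_(q, p), smM z K /\ \forall w \near z, A w *m K w = 1%:M.
Proof.
move=> sA /row_freeP[K0 AK]; have sAK : smM z (fun w => A w *m K0) by exact: smM_mul (smM_cst _ _).
have u : A z *m K0 \in unitmx by rewrite AK unitmx1.
exists (fun w => K0 *m invmx (A w *m K0)); split.
 by apply: smM_mul; [exact: smM_cst|exact: smM_invmx].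
by have h := unit_near sAK u; apply: filterS h => w uw; rewrite mulmxA mulmxV.
Qed.

Section DualBundle.
Context {M N : charted R} (hM : lman M) (hN : lman N) (phi : N -> M) (F : N -> set (tvec M))
 (hphi : forall x, smooth_map_at phi x) (r : nat) (hF : subbundle phi F r).
Local Notation E := (dual_bundle phi F r).

Definition ebase (e : E) : N := base e.

Definition fchart (c : cht N) (O : set N) (s : 'I_r -> N -> tvec M) :
  set E * (E -> 'rV[R]_(mdim E)) :=
 (ebase @^-1` O,
  fun e => row_mx (c.2 (base e)) (\row_(k < r) fib e (s k (base e)))).

Lemma fatlas c O s : atlas N c -> mopen O -> O `<=` c.1 -> frame_on phi F O s ->
 atlas E (fchart c O s).
Proof. by move=> ac oO Oc fr; exists c, O, s; split. Qed.

Lemma frame_sub (O O' : set N) (s : 'I_r -> N -> tvec M) : O' `<=` O ->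
 frame_on phi F O s -> frame_on phi F O' s.
Proof. by move=> OO h q /OO /h. Qed.

Lemma fchart_ex c (x : N) : atlas N c -> c.1 x ->
 exists O (s : 'I_r -> N -> tvec M), [/\ mopen O, O x, O `<=` c.1 & frame_on phi F O s].
Proof.
move=> ac cx; have [_ /(_ x)[ O [s [oO Ox fr]]]] := hF.
exists (O `&` c.1), s; split; [|by []|by move=> q []|].
 by apply: mopenI => //; exact: copen ac.
by apply: frame_sub fr => q [].
Qed.

Lemma dual_ext (e e' : E) : base e = base e' -> fib e = fib e' -> e = e'.
Proof.
case: e => [[q f] h]; case: e' => [[q' f'] h']; rewrite /base /fib /= => Eq Ef.
by subst q' f'; congr exist; exact: Prop_irrelevance.
Qed.

Lemma frame_span q (s : 'I_r -> N -> tvec M) v : is_basis (F q) (fun k => s k q) -> F q v ->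
 exists a : 'I_r -> R, v = \sum_k a k *: s k q.
Proof. by case=> _ _ h /h[a /= /eqP]; rewrite subr_eq0 => /eqP; exists a. Qed.

Lemma frame_free q (s : 'I_r -> N -> tvec M) a b : is_basis (F q) (fun k => s k q) ->
 \sum_k a k *: s k q = \sum_k b k *: s k q -> forall k, a k = b k.
Proof.
case=> _ h _ E k; apply/eqP; rewrite -subr_eq0; apply/eqP.
apply: (h (fun k => a k - b k)) => /=; under eq_bigr do rewrite scalerBl.
by rewrite sumrB E subrr.
Qed.

Lemma dual_eq q (s : 'I_r -> N -> tvec M) f f' : is_basis (F q) (fun k => s k q) ->
 lin_dual (F q) f -> lin_dual (F q) f' -> (forall k, f (s k q) = f' (s k q)) -> f = f'.
Proof.
move=> bs [lf nf] [lf' nf'] h; apply/funext => v.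
have [Fv|nv] := pselect (F q v); last by rewrite nf // nf'.
have [Fs _ _] := bs; have [a ->] := frame_span bs Fv; have sF : is_subspace (F q) by case: hF.
rewrite (linear_on_sum sF _ _ lf Fs) (linear_on_sum sF _ _ lf' Fs).
by apply: eq_bigr => k _; rewrite h.
Qed.

Lemma dual_ex q (s : 'I_r -> N -> tvec M) (y : 'I_r -> R) : is_basis (F q) (fun k => s k q) ->
 exists e : E, base e = q /\ forall k, fib e (s k q) = y k.
Proof.
move=> bs; have sF : is_subspace (F q) by case: hF.
have [A hA] : exists A : tvec M -> 'I_r -> R, forall v, F q v -> v = \sum_k A v k *: s k q.
 have h v : exists a : 'I_r -> R, F q v -> v = \sum_k a k *: s k q.
  have [Fv|nv] := pselect (F q v); last by exists (fun _ => 0).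
  by have [a va] := frame_span bs Fv; exists a.
 by have [A hA] := choice h; exists A.
pose f (v : tvec M) : R^o := if `[< F q v >] then \sum_k A v k * y k else 0.
have Hf : lin_dual (F q) f.
 split=> [t u v Fu Fv|v nv]; last by rewrite /f asboolF.
 have Fuv : F q (t *: u + v) by case: sF => _; exact.
 rewrite /f !asboolT // mulr_sumr -big_split /=; apply: eq_bigr => k _.
 rewrite mulrA -mulrDl; congr (_ * _).
 apply: (frame_free (b := fun k => t * A u k + A v k) bs).
 rewrite -hA //; under eq_bigr do rewrite scalerDl -scalerA.
 by rewrite big_split /= -scaler_sumr -!hA.
exists (exist _ (q, f) Hf : E); split=> // k; have [Fs _ _] := bs.
rewrite /fib /= /f asboolT // (bigD1 k) //= big1 => [|l lk].
 rewrite addr0 (_ : A (s k q) k = 1) ?mul1r //.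
 apply: (etrans (frame_free (b := fun l => (l == k)%:R) bs _ k)); last by rewrite eqxx.
 rewrite -hA // (bigD1 k) //= eqxx scale1r big1 ?addr0 // => l /negbTE ->.
 by rewrite scale0r.
rewrite (_ : A (s k q) l = 0) ?mul0r //.
apply: (etrans (frame_free (b := fun l => (l == k)%:R) bs _ l)); last by rewrite (negbTE lk).
rewrite -hA // (bigD1 k) //= eqxx scale1r big1 ?addr0 // => j /negbTE ->.
by rewrite scale0r.
Qed.

Lemma fchart_image c O s (A : set N) (z : 'rV[R]_(mdim N + r)) : atlas N c -> O `<=` c.1 ->
 frame_on phi F O s ->
 (exists e : E, [/\ O (ebase e), A (ebase e) & (fchart c O s).2 e = z]) <->
 (exists q, [/\ O q, A q & c.2 q = lp z]).
Proof.
move=> ac Oc fr; split=> [[e [Oe Ae <-]]|[q [Oq Aq E0]]].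
 by exists (base e); split; rewrite // /lp row_mxKl.
have [bs _] := fr _ Oq; have [e [Ee fe]] := dual_ex (fun k => rp z 0 k) bs.
exists e; split; rewrite /ebase ?Ee //.
rewrite /fchart /= Ee E0 -[RHS](hsubmxK z); congr row_mx.
by apply/rowP => k; rewrite mxE fe.
Qed.

Lemma open_lp (m n : nat) (V : set 'rV[R]_m) : open V -> open ((@lp R m n) @^-1` V).
Proof.
move=> oV; have h := @open_preimage R (m + n) 'rV[R]_m (@lp R m n) V oV.
by apply: h => x; have := sm_cont (sm_lsub x).
Qed.

Lemma base_open (A : set N) : mopen A -> mopen (ebase @^-1` A).
Proof.
move=> oA [C1 C2] [c [ O [s [ac [oO Oc] fr /= -> ->]]]].
have := open_lp (n := r) (mopenI hN oO oA ac); congr open; apply/seteqP.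
split=> [z [q [cq [Oq Aq]] E0]|_ [e [Oe Ae] <-]].
 have [|e [Oe Ae <-]] := (fchart_image A z ac Oc fr).2 _; first by exists q; split.
 by exists e.
have [q [Oq Aq E0]] := (fchart_image A _ ac Oc fr).1 (ex_intro _ e (And3 Oe Ae erefl)).
by exists q; [split=> //; exact: Oc|].
Qed.

Lemma fchart_inj c O s (e e' : E) : atlas N c -> O `<=` c.1 -> frame_on phi F O s ->
 O (base e) -> O (base e') -> (fchart c O s).2 e = (fchart c O s).2 e' -> e = e'.
Proof.
move=> ac Oc fr Oe Oe' /eq_row_mx[E1 E2].
have Eb : base e = base e' by apply: (chart_inj hN ac) E1; exact: Oc.
apply: dual_ext => //; have [bs _] := fr _ Oe.
have he := svalP e; have he' := svalP e'; rewrite -/(base e) -/(fib e) in he.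
rewrite -/(base e') -/(fib e') -Eb in he'.
apply: (dual_eq bs he he') => k; move/rowP: E2 => /(_ k); rewrite !mxE => ->.
by rewrite Eb.
Qed.

(** The rows are the components of the frame vectors; a right inverse of this matrix converts
    components in the chart [d] into coefficients in the frame. *)
Definition Smx (d : cht M) (s : 'I_r -> N -> tvec M) (q : N) : 'M[R]_(r, mdim M) :=
 \matrix_(k, j) s k q (fun p => d.2 p 0 j).

Lemma Smx_smooth c d O s x : atlas N c -> c.1 x -> atlas M d -> d.1 (phi x) -> O x ->
 frame_on phi F O s -> smM (c.2 x) (fun z => Smx d s (cinv c x z)).
Proof.
move=> ac cx ad dx Ox fr k j; have [_ /(_ k)[_ h]] := fr _ Ox.
have := h _ (smooth_coord hM j ad dx) => /(smoothP hN _ ac cx); apply: sm_near.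
by have h' := cinvP hN ac cx; apply: filterS h' => z _; rewrite /= mxE.
Qed.

Lemma Smx_row d s q k : row k (Smx d s q) = crd d (s k q).
Proof. by apply/rowP => j; rewrite !mxE. Qed.

Lemma crd_sum d (s : 'I_r -> tvec M) (a : 'I_r -> R) :
 crd d (\sum_k a k *: s k) = \sum_k a k *: crd d (s k).
Proof.
elim: (index_enum _) => [|k t IH]; first by rewrite !big_nil; apply/rowP => j; rewrite !mxE.
by rewrite !big_cons crdD IH.
Qed.

Lemma crd_frame d s q (a : 'rV[R]_r) : crd d (\sum_k a 0 k *: s k q) = a *m Smx d s q.
Proof. by rewrite crd_sum mulmx_sum_row; apply: eq_bigr => k _; rewrite Smx_row. Qed.

Lemma frame_tangent O (s : 'I_r -> N -> tvec M) q k : O q -> frame_on phi F O s -> tangent (phi q) (s k q).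
Proof. by move=> Oq /(_ _ Oq)[_ /(_ k)[/mnbhs_self]]. Qed.

Lemma Smx_free d O s q : atlas M d -> d.1 (phi q) -> O q -> frame_on phi F O s ->
 row_free (Smx d s q).
Proof.
move=> ad dq Oq fr; apply: inj_row_free => a; rewrite -crd_frame => E.
have [bs _] := fr _ Oq; apply/rowP => k; rewrite mxE.
apply: (frame_free (a := fun k => a 0 k) (b := fun _ => 0) bs).
have t0 := tangent0 hM (phi q).
transitivity (0 : tvec M); last by rewrite big1 // => l _; rewrite scale0r.
apply: (crd_inj hM ad dq) => //.
 apply: (subspace_sum (tangent_sub hM (phi q))) => l; exact: frame_tangent fr.
by rewrite E; apply/rowP => j; rewrite !mxE.
Qed.

(** The second frame is expressed in the first by a matrix [T], smooth because the first frame has a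
    smooth right inverse. Fibre coordinates are values on the frame vectors, hence change by the
    transpose of [T]. *)
Lemma fchart_transition c O s c' O' s' (e : E) : atlas N c -> mopen O -> O `<=` c.1 ->
 frame_on phi F O s -> atlas N c' -> mopen O' -> O' `<=` c'.1 -> frame_on phi F O' s' ->
 O (base e) -> O' (base e) -> smooth_in (fchart c O s) e (fchart c' O' s').2.
Proof.
move=> ac oO Oc fr ac' oO' Oc' fr' Oe Oe'; set x := base e.
have cx := Oc _ Oe; have cx' := Oc' _ Oe'; have [d ad dx] := chart_ex hM (phi x).
have sS := Smx_smooth ac cx ad dx Oe fr; have sS' := Smx_smooth ac cx ad dx Oe' fr'.
have fS : row_free (Smx d s (cinv c x (c.2 x))).
 by rewrite cinvK //; exact: Smx_free fr.
have [K [sK KE]] := smooth_rinv sS fS.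
pose T z : 'M[R]_r := Smx d s' (cinv c x z) *m K z.
have sT : smM (c.2 x) T by exact: smM_mul.
pose g (w : 'rV[R]_(mdim N + r)) := row_mx ((c'.2 \o cinv c x) (lp w)) (rp w *m (T (lp w))^T).
pose w0 : 'rV[R]_(mdim N + r) := row_mx (c.2 x) (\row_(k < r) fib e (s k x)).
have lw0 : lp w0 = c.2 x by rewrite /lp row_mxKl.
have sg : sm w0 g.
 apply/smM_row; apply: smM_rowmx.
  apply/smM_row; apply: sm_comp_rV; first exact: sm_lsub.
  by rewrite lw0; exact: chart_change.
 apply: smM_mul; first exact/smM_row/sm_rsub.
 apply: smM_tr; apply: smM_comp; first exact: sm_lsub.
 by rewrite lw0.
case: sg => V [oV Vw sg].
have dnear : mnbhs x (fun q => d.1 (phi q)).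
 by have h := smap_cont hN hM (hphi x) (open_mn (copen hM ad) dx); exact: h.
have : \forall z \near c.2 x, [/\ O (cinv c x z), O' (cinv c x z), d.1 (phi (cinv c x z)) &
   Smx d s (cinv c x z) *m K z = 1%:M].
 have h1 := (mnbhsP hN _ ac cx).1 (mnbhsI hN (open_mn oO Oe) (open_mn oO' Oe')).
 have h2 := (mnbhsP hN _ ac cx).1 dnear.
 by apply: filterS3 h1 h2 KE => z [a b] dz Kz; split.
move=> /near_open[V' [oV' V'x hV']].
exists (V `&` (@lp R (mdim N) r) @^-1` V'), g; split.
- by apply: openI => //; exact: open_lp.
- by split=> //; rewrite /= /lp row_mxKl.
- by move=> k; apply: Ck_sub (sg k) => w [].
move=> e' /= Oe1 [_]; rewrite /= /lp row_mxKl => /hV'.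
have ck : cinv c x (c.2 (base e')) = base e' := cinvK hN x ac (Oc _ Oe1).
rewrite ck => -[_ Oe1' dq Kq].
rewrite /g /= /lp /rp row_mxKl row_mxKr /= ck.
congr row_mx; set q := base e' in Oe1 Oe1' dq Kq ck *.
have [bs _] := fr _ Oe1; have [[Fs' _ _] _] := fr' _ Oe1'.
have [Fs _ _] := bs; have sF : is_subspace (F q) by case: hF.
have [lf _] := svalP e'; rewrite -/(base e') -/q -/(fib e') in lf.
apply/rowP => k; rewrite !mxE; have [a Ea] := frame_span bs (Fs' k).
have Ta : row k (T (c.2 q)) = \row_l a l.
 rewrite /T ck row_mul Smx_row Ea (_ : \sum_l _ = \sum_l (\row_l a l) 0 l *: s l q); last first.
  by apply: eq_bigr => l _; rewrite mxE.
 by rewrite crd_frame -mulmxA Kq mulmx1.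
rewrite Ea (linear_on_sum sF _ _ lf Fs); apply: eq_bigr => l _.
by rewrite !mxE mulrC; congr (_ * _); move/rowP: Ta => /(_ l); rewrite !mxE.
Qed.

Lemma fchartP C : atlas E C -> exists c O s,
 [/\ atlas N c, mopen O, O `<=` c.1, frame_on phi F O s & C = fchart c O s].
Proof.
case: C => C1 C2 [c [ O [s [ac [oO Oc] fr /= -> ->]]]].
by exists c, O, s; split.
Qed.

Lemma echart_ex (e : E) : exists c O (s : 'I_r -> N -> tvec M),
 [/\ atlas N c, mopen O, O `<=` c.1, frame_on phi F O s & O (base e)].
Proof.
have [c ac cx] := chart_ex hN (base e); have [ O [s [oO Oe Oc fr]]] := fchart_ex ac cx.
by exists c, O, s; split.
Qed.

(** Separation has two cases: points over different base points are separated by open sets of the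
    base, points of one fibre by balls in a common chart. *)
Lemma bundle_lman : lman E.
Proof.
have op C : atlas E C -> mopen C.1.
 by move=> /fchartP[c [ O [s [ac oO Oc fr ->]]]]; exact: base_open.
have tr C C' p : atlas E C -> atlas E C' -> C.1 p -> C'.1 p -> smooth_in C p C'.2.
 move=> /fchartP[c [ O [s [ac oO Oc fr ->]]]] /fchartP[c' [ O' [s' [ac' oO' Oc' fr' ->]]]].
 by move=> Op Op'; exact: fchart_transition.
split=> //.
- move=> e; have [c [ O [s [ac oO Oc fr Oe]]]] := echart_ex e.
 by exists (fchart c O s) => //; exact: fatlas.
- move=> C aC; split; last exact: op.
 move: aC => /fchartP[c [ O [s [ac oO Oc fr ->]]]] e e' Oe Oe'; exact: fchart_inj.
- move=> e e' N'; have [Eb|Nb] := pselect (ebase e = ebase e'); last first.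
  have [_ _ _ /(_ _ _ Nb)[ O [ O' [oO oO' Oe Oe' I]]]] := hN.
  exists (ebase @^-1` O), (ebase @^-1` O'); split=> //; try exact: base_open.
  by rewrite -preimage_setI I preimage_set0.
 have [c [ O [s [ac oO Oc fr Oe]]]] := echart_ex e.
 have Oe' : O (base e') by rewrite -[base e']Eb.
 have aC := fatlas ac oO Oc fr.
 pose z : 'rV[R]_(mdim E) := (fchart c O s).2 e; pose z' : 'rV[R]_(mdim E) := (fchart c O s).2 e'.
 have zz : 0 < `|z - z'|.
  rewrite normr_gt0 subr_eq0; apply/eqP => h; apply: N'; exact: (fchart_inj ac Oc fr Oe Oe' h).
 exists [set q | (fchart c O s).1 q /\ ball z (`|z - z'| / 2) ((fchart c O s).2 q)],
  [set q | (fchart c O s).1 q /\ ball z' (`|z - z'| / 2) ((fchart c O s).2 q)]; split.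
 + by apply: mopen_chart0 => //; exact: ball_open.
 + by apply: mopen_chart0 => //; exact: ball_open.
 + by split=> //; apply: ballxx; rewrite divr_gt0.
 + by split=> //; apply: ballxx; rewrite divr_gt0.
 apply/seteqP; split=> // q [[_ b1] [_ b2]]; move: b1 b2.
 rewrite -ball_normE /= => b1 b2; have := ler_distD ((fchart c O s).2 q : 'rV[R]_(mdim E)) z z'.
 rewrite (distrC ((fchart c O s).2 q : 'rV[R]_(mdim E)) z') => h.
 have := le_lt_trans h (ltrD b1 b2).
 by rewrite -splitr ltxx.
Qed.

Definition zs (x : N) : E := zero_section F x.
Definition fscale (t : R) (e : E) : E := fib_scale t e.

Lemma fscaleE c O s t (e : E) : (fchart c O s).2 (fscale t e) =
 row_mx (lp ((fchart c O s).2 e : 'rV[R]_(mdim N + r))) (t *: rp ((fchart c O s).2 e : 'rV[R]_(mdim N + r))).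
Proof.
rewrite /fchart /= /lp /rp row_mxKl row_mxKr; congr row_mx.
by apply/rowP => k; rewrite !mxE.
Qed.

Lemma zsE c O s x : (fchart c O s).2 (zs x) = row_mx (c.2 x) 0.
Proof. by rewrite /fchart /=; congr row_mx; apply/rowP => k; rewrite !mxE. Qed.

Section AtPoint.
Context c O (s : 'I_r -> N -> tvec M) (ac : atlas N c) (oO : mopen O) (Oc : O `<=` c.1)
 (fr : frame_on phi F O s).
Local Notation C := (fchart c O s).

Let aC : atlas E C. Proof. exact: fatlas. Qed.

Lemma hat_base (e : E) : O (ebase e) -> forall z : 'rV[R]_(mdim N + r),
 C.1 (cinv C e z) -> C.2 (cinv C e z) = z -> hat C c ebase e z = lp z.
Proof. by move=> Oe z _ Ez; rewrite -{2}Ez /lp row_mxKl. Qed.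

Lemma base_smooth (e : E) : O (ebase e) -> smooth_map_at ebase e.
Proof.
move=> Oe; apply/(smapP bundle_lman hN aC Oe ac (Oc Oe)); split.
 exists (ebase @^-1` O); split=> //; first exact: base_open.
 by move=> e' /Oc.
apply: sm_near (sm_lsub _); have h := cinvP bundle_lman aC Oe.
by apply: filterS h => z [h1 h2]; rewrite (hat_base Oe h1 h2).
Qed.

Lemma zs_smooth x : O x -> smooth_map_at zs x.
Proof.
move=> Ox; apply/(smapP hN bundle_lman (phi := zs) ac (Oc Ox) (c' := C) aC Ox); split.
 by exists O; split.
apply: sm_near (_ : sm _ (fun z => row_mx z 0)).
 have h := cinvP hN ac (Oc Ox); apply: filterS h => z [h1 h2].
 by rewrite -[hat _ _ _ _ _]/(C.2 (zs (cinv c x z))) zsE h2.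
by apply/smM_row/smM_rowmx; [exact/smM_row/sm_id|exact: smM_cst].
Qed.

Lemma crd_zs x v : O x -> tangent x v -> crd C (push zs x v) = row_mx (crd c v) 0.
Proof.
move=> Ox tv; rewrite (push_crd hN bundle_lman (phi := zs) ac (Oc Ox) aC Ox (zs_smooth Ox) tv).
have sh := ((smapP hN bundle_lman (phi := zs) ac (Oc Ox) (c' := C) aC Ox).1 (zs_smooth Ox)).2.
rewrite -JacE_sm //.
have E1 : \forall z \near c.2 x, hat c C zs x z = row_mx z (0 : 'rV[R]_r).
 have h := cinvP hN ac (Oc Ox); apply: filterS h => z [h1 h2].
 by rewrite -[hat _ _ _ _ _]/(C.2 (zs (cinv c x z))) zsE h2.
rewrite (near_eq_derive _ E1); apply: derive_val; apply: is_d_eps => e e0; exists 1 => // t _.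
rewrite opp_row_mx add_row_mx addrK subr0 scale_row_mx opp_row_mx add_row_mx subrr.
by rewrite scaler0 subr0 row_mx0 normr0 mulr_ge0 // ltW.
Qed.

(** In a bundle chart, $t \mapsto te$ is a straight line from the zero section, and its velocity is
    the fibre part of [e]. *)
Lemma vertical_vec (e : E) : O (ebase e) ->
 vertical e = vec C (zs (ebase e)) (row_mx 0 (\row_(k < r) fib e (s k (base e)))).
Proof.
move=> Oe; set w := row_mx 0 _; apply/funext => f; rewrite /vertical /vec.
rewrite -[zero_section F (base e)]/(zs (ebase e)).
case: asboolP => // sf; set x := zs _ in sf *.
have Cx : C.1 x by [].
have ez : C.2 x = row_mx (c.2 (ebase e)) 0 by exact: zsE.
have Ep t : C.2 (fscale t e) = C.2 x + t *: w.
 rewrite fscaleE ez /w scale_row_mx add_row_mx scaler0 addr0 add0r /lp /rp row_mxKl row_mxKr.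
 by [].
rewrite derive1E; move: sf => /(smoothP bundle_lman _ aC Cx) sf.
have := @line_derive R _ R^o (f \o cinv C x) (C.2 x) w 0.
rewrite scale0r addr0 => /(_ (sm_diff sf)) D; apply: derive_val; move: D.
congr is_derive; apply/funext => t /=; rewrite -Ep cinvK //; exact: bundle_lman.
Qed.

End AtPoint.

End DualBundle.
End Bundles.

(** * The bundle TX^perp of a coregular submanifold *)

Section Coregular.
Context {R : realType}.

Lemma Jac_near n m (f g : 'rV[R]_n -> 'rV[R]_m) z : (\forall w \near z, f w = g w) ->
 Jac f z = Jac g z.
Proof. by move=> h; apply/matrixP => i j; rewrite !mxE (near_eq_derive _ h). Qed.

Lemma smM_nbhs n p q z (A : 'rV[R]_n -> 'M[R]_(p, q)) : smM z A -> \forall w \near z, smM w A.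
Proof.
move=> sA; have h : \forall w \near z, forall ab : 'I_p * 'I_q, sm w (fun z => A z ab.1 ab.2 : R^o).
 have h' (ab : 'I_p * 'I_q) : \forall w \near z, sm w (fun z => A z ab.1 ab.2 : R^o).
  exact: sm_nbhs (sA ab.1 ab.2).
 exact: (@filter_forall _ _ (fun (ab : 'I_p * 'I_q) w => sm w (fun z => A z ab.1 ab.2 : R^o)) _ _ h').
by apply: filterS h => w h a b; exact: (h (a, b)).
Qed.

Lemma mulmx_row_inj m n (A B : 'M[R]_(m, n)) : (forall u : 'rV[R]_m, u *m A = u *m B) -> A = B.
Proof. by move=> h; apply/row_matrixP => i; rewrite !rowE h. Qed.

Lemma hat_indep (M N : charted R) (hM : lman M) c (d : cht N) (phi : M -> N) p q :
 atlas M c -> c.1 q -> \forall z \near c.2 q, hat c d phi p z = hat c d phi q z.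
Proof.
move=> ac cq; have h := cinvP hM ac cq; apply: filterS h => z [cz E].
by rewrite -{1}E hatK.
Qed.

Lemma push_crdp (M N : charted R) (hM : lman M) (hN : lman N) (phi : M -> N) p q v c d :
 atlas M c -> c.1 q -> atlas N d -> d.1 (phi q) -> smooth_map_at phi q -> tangent q v ->
 crd d (push phi q v) = crd c v *m Jac (hat c d phi p) (c.2 q).
Proof.
move=> ac cq ad dq s tv; rewrite (push_crd hM hN ac cq ad dq s tv).
by rewrite (Jac_near (hat_indep hM d phi p ac cq)).
Qed.

Lemma smooth_along_crd (M N : charted R) (hM : lman M) (hN : lman N) (phi : N -> M) p
  (s : N -> tvec M) c d : smooth_map_at phi p ->
 atlas N c -> c.1 p -> atlas M d -> d.1 (phi p) -> mnbhs p (fun q => tangent (phi q) (s q)) ->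
 sm (c.2 p) (fun z => crd d (s (cinv c p z))) -> smooth_along phi p s.
Proof.
move=> sp ac cp ad dp tn ss; split=> // f sf; apply/(smoothP hN _ ac cp).
have [nd sh] := (smapP hN hM ac cp ad dp).1 sp.
move: (sf) => /(smoothP hM _ ad dp) sf'.
have nf := smap_cont hN hM sp (smooth_at_mnbhs hM sf).
have E0 : hat c d phi p (c.2 p) = d.2 (phi p) by rewrite hatK.
pose G z : R^o := \sum_j crd d (s (cinv c p z)) 0 j *
  'D_(ev j) (f \o cinv d (phi p) : _ -> R^o) (hat c d phi p z).
have sG : sm (c.2 p) G.
 apply: sm_sum => j; apply: sm_mul; first by move/sm_rVP: ss; exact.
 by apply: (sm_comp (f := 'D_(ev j) _)) sh _; rewrite E0; exact: sm_D.
apply: sm_near sG.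
have h0 := cinvP hN ac cp.
have h1 := (mnbhsP hN _ ac cp).1 (mnbhsI hN tn nf); have h2 := (mnbhsP hN _ ac cp).1 nd.
have h3 : \forall z \near c.2 p, sm (hat c d phi p z) (f \o cinv d (phi p) : _ -> R^o).
 have hS := sm_nbhs sf'; rewrite -E0 in hS.
 exact: (near_comp (P := fun w => sm w (f \o cinv d (phi p) : _ -> R^o)) (sm_cont sh) hS).
apply: filterS3 (filterI h0 h3) h1 h2 => z [[cz Ez] sz] [tz fz] dz.
rewrite /G /= (tangentE hM ad dz tz fz).
have E1 : d.2 (phi (cinv c p z)) = hat c d phi p z by [].
rewrite E1 (derive_sumE (W := R^o) _ (sm_diff _)); last first.
 have := (smoothP hM _ ad dz).1 fz; rewrite E1; apply: sm_near.
 by rewrite -E1; have h := cinvP hM ad dz; apply: filterS h => w [dw Ew].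
apply: eq_bigr => j _; congr (_ * _); apply: near_eq_derive.
rewrite -E1; have h := cinvP hM ad dz; apply: filterS h => w [dw Ew] /=.
by rewrite -Ew !cinvK.
Qed.

Context {M X : charted R} (hM : lman M) (hX : lman X) (pi : bivector M) (i : X -> M)
 (hpi : poisson_on setT pi) (hi : embedding i) (r : nat) (hr : coregular i pi r).

Lemma pi_skew q : skew_form (cotangent q) (pi q).
Proof. by have [] := hpi (I : setT q). Qed.

Lemma embS x : smooth_map_at i x. Proof. by case: hi. Qed.

Lemma sharp_lin q (t : R) a b : cotangent q a -> cotangent q b ->
 sharp pi q (t *: a + b) = t *: sharp pi q a + sharp pi q b.
Proof.
move=> ta tb; have [d ad dq] := chart_ex hM q; have sk := pi_skew q.
rewrite !(sharp_vec hM sk ad dq) //; last exact: cotangentD.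
by rewrite ccrdD mulmxDl -scalemxAl (vecD hM).
Qed.

Lemma annihilator_lin x (t : R) a b : annihilator i x a -> annihilator i x b ->
 annihilator i x (t *: a + b).
Proof.
move=> [ta ha] [tb hb]; split; first exact: cotangentD.
by move=> v tv; rewrite fct_lin ha // hb // mulr0 addr0.
Qed.

Lemma perp_subspace x : is_subspace (perp i pi x).
Proof.
have T (t : R) u v : perp i pi x u -> perp i pi x v -> perp i pi x (t *: u + v).
 move=> [a ha <-] [b hb <-]; exists (t *: a + b); first exact: annihilator_lin.
 by apply: sharp_lin; [case: ha|case: hb].
split=> //.
have h0 : annihilator i x 0.
 by split; [have [] := cotangent_sub (i x)|].
have P0 : perp i pi x (sharp pi (i x) 0) by exists 0.
by have := T (-1) _ _ P0 P0; rewrite scaleN1r addNr.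
Qed.

Lemma perp_tangent x v : perp i pi x v -> tangent (i x) v.
Proof. by move=> [a [ta _] <-]; apply: sharpT => //; exact: pi_skew. Qed.

Section Frame.
Context c d (x : X) (ac : atlas X c) (ad : atlas M d).
Let I_ := Jac (hat c d i x).

Lemma Im_smooth : c.1 x -> d.1 (i x) -> smM (c.2 x) I_.
Proof. by move=> cx dx; have [_ h] := (smapP hX hM ac cx ad dx).1 (embS x); exact: smM_Jac. Qed.

Lemma push_I q v : c.1 q -> d.1 (i q) -> tangent q v -> crd d (push i q v) = crd c v *m I_ (c.2 q).
Proof. by move=> cq dq; exact: (push_crdp hX hM _ ac cq ad dq (embS q)). Qed.

Lemma I_inj q (u : 'rV[R]_(mdim X)) : c.1 q -> d.1 (i q) -> u *m I_ (c.2 q) = 0 -> u = 0.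
Proof.
move=> cq dq E; have tu := vecT hX u ac cq; have t0 := vecT hX 0 ac cq.
case: hi => si inj _ _; have E1 := push_I cq dq tu; have E2 := push_I cq dq t0.
rewrite (crd_vec hX u ac cq) E in E1; rewrite (crd_vec hX 0 ac cq) mul0mx in E2.
have V : vec c q u = vec c q 0.
 apply: (inj q _ _ tu t0); have p1 := pushT hX hM (si q) tu.
 exact: (crd_inj hM ad dq p1 (pushT hX hM (si q) t0) (etrans E1 (esym E2))).
by rewrite -(crd_vec hX u ac cq) V (crd_vec hX 0 ac cq).
Qed.

Lemma tangent_imageP q v : c.1 q -> d.1 (i q) -> tangent (i q) v ->
 tangent_image i q v <-> exists u : 'rV[R]_(mdim X), crd d v = u *m I_ (c.2 q).
Proof.
move=> cq dq tv; split=> [[w tw <-]|[u E]]; first by exists (crd c w); rewrite push_I.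
have tu := vecT hX u ac cq; exists (vec c q u) => //.
apply: (crd_inj hM ad dq) => //; first by apply: pushT => //; exact: embS.
by rewrite push_I // (crd_vec hX _ ac cq).
Qed.

Lemma annihilatorP q a : c.1 q -> d.1 (i q) -> cotangent (i q) a ->
 annihilator i q a <-> ccrd d (i q) a *m (I_ (c.2 q))^T = 0.
Proof.
move=> cq dq ta; have pt v : tangent q v -> tangent (i q) (push i q v).
 by apply: pushT => //; exact: embS.
split=> [[_ h]|E].
 apply/dotr_inj => u; rewrite -dotr_mulmx; have tu := vecT hX u ac cq.
 rewrite -[u in LHS](crd_vec hX u ac cq) -push_I // -(cotangentE hM ad dq ta); last exact: pt.
 by rewrite h; [rewrite /dotr mul0mx mxE|exists (vec c q u)].
split=> // _ [w tw <-]; rewrite (cotangentE hM ad dq ta); last exact: pt.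
by rewrite push_I // dotr_mulmx E /dotr mul0mx mxE.
Qed.

(** The rows of [B] are covectors whose images under [sharp] represent the basis of the quotient
    supplied by [coregular]. *)
Lemma coregular_B q : c.1 q -> d.1 (i q) -> exists B : 'M[R]_(r, mdim M),
 (forall e : 'rV[R]_r, (exists u, e *m (B *m PM pi d (i q)) = u *m I_ (c.2 q)) -> e = 0) /\
 (forall b : 'rV[R]_(mdim M), exists (e : 'rV[R]_r) u,
   b *m PM pi d (i q) = e *m (B *m PM pi d (i q)) + u *m I_ (c.2 q)).
Proof.
move=> cq dq; have [b [bF bI bS]] := hr q; have sk := pi_skew (i q).
have tF v : (sharp pi (i q) @` cotangent (i q)) v -> tangent (i q) v.
 by move=> [a ta <-]; exact: sharpT.
have [be hbe] : exists be : 'I_r -> cvec M, forall k, cotangent (i q) (be k) /\ sharp pi (i q) (be k) = b k.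
 have h k : exists a, cotangent (i q) a /\ sharp pi (i q) a = b k.
  by have [a ta E] := bF k; exists a.
 by have [f hf] := choice h; exists f.
pose B : 'M[R]_(r, mdim M) := \matrix_(k, j) ccrd d (i q) (be k) 0 j.
have rB k : row k (B *m PM pi d (i q)) = crd d (b k).
 have [tb <-] := hbe k; rewrite row_mul (sharp_crd hM sk ad dq tb); congr (_ *m _).
 by apply/rowP => j; rewrite !mxE.
have rE (e : 'rV[R]_r) : e *m (B *m PM pi d (i q)) = crd d (\sum_k e 0 k *: b k).
 by rewrite mulmx_sum_row crd_sum; apply: eq_bigr => k _; rewrite rB.
have te (e : 'I_r -> R) : tangent (i q) (\sum_k e k *: b k).
 by apply: (subspace_sum (tangent_sub hM (i q))) => k; exact: tF.
exists B; split=> [e [u]|a].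
 rewrite rE => E; apply/rowP => k; rewrite mxE.
 by apply: (bI (fun k => e 0 k)); apply/(tangent_imageP cq dq (te _)); exists u.
have ta := covecT hM d (i q) a.
set s := sharp pi (i q) (covec d (i q) a); have Ps : (sharp pi (i q) @` cotangent (i q)) s by exists (covec d (i q) a).
have [e he] := bS s Ps.
have ts : tangent (i q) s by apply: tF; exists (covec d (i q) a).
have tse : tangent (i q) (s - \sum_k e k *: b k).
 by have := tangentD hM (-1) (te e) ts; rewrite scaleN1r addrC.
move: he => /(tangent_imageP cq dq tse)[u E]; exists (\row_k e k), u.
rewrite rE (eq_bigr (fun k => e k *: b k)) => [|k _]; last by rewrite mxE.
rewrite -E -{1}(ccrd_covec hM a ad dq) -(sharp_crd hM sk ad dq ta) -/s.
by apply/rowP => j; rewrite !mxE addrC [X in X + _]/GRing.add /= /GRing.opp /= subrK.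
Qed.

End Frame.

(** Constant rank enters twice. At [x] it gives covectors [B] whose images under [sharp] are
    independent of $TX$. This persists nearby, and the part of a smooth right inverse that is dual
    to [B] consists of covectors [A] that annihilate $TX$ and pair to the identity with these
    images; [sharp] of the rows of [A] is the frame. At nearby points, the rank being still [r]
    shows that the frame spans. *)
Theorem perp_subbundle : subbundle i (perp i pi) r.
Proof.
split; first exact: perp_subspace.
move=> x; have [c ac cx] := chart_ex hX x; have [d ad dx] := chart_ex hM (i x).
pose I_ := Jac (hat c d i x); pose Pi z := PM pi d (i (cinv c x z)).
have sI : smM (c.2 x) I_ by exact: Im_smooth.
have nd := smap_cont hX hM (embS x) (open_mn (copen hM ad) dx).
have [_ si] := (smapP hX hM ac cx ad dx).1 (embS x).
have sPi : smM (c.2 x) Pi.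
 have := smM_comp (A := fun z => PM pi d (cinv d (i x) z)) si; rewrite hatK //.
 move=> /(_ (PM_smooth hM hpi ad dx I)) sP a b; move: (sP a b); apply: sm_near.
 have h := (mnbhsP hX _ ac cx).1 nd; apply: filterS h => z dz.
 by rewrite /hat /= cinvK.
have [B [BI _]] := coregular_B x ac ad cx dx.
have sC : smM (c.2 x) (fun z => col_mx (I_ z) (B *m Pi z)).
 have h : smM (c.2 x) (fun z => B *m Pi z) by apply: smM_mul => //; exact: smM_cst.
 move=> a b; have [a' Ea|a' Ea] := split_ordP a.
  by apply: sm_near (sI a' b); apply: filterE => z; rewrite Ea col_mxEu.
 by apply: sm_near (h a' b); apply: filterE => z; rewrite Ea col_mxEd.
have Pix : Pi (c.2 x) = PM pi d (i x) by rewrite /Pi cinvK.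
have fC : row_free (col_mx (I_ (c.2 x)) (B *m Pi (c.2 x))).
 apply: inj_row_free => v; rewrite -[v]hsubmxK mul_row_col => E0.
 have e0 : rsubmx v = 0.
  apply: BI; exists (- lsubmx v); rewrite mulNmx -Pix.
  by apply/eqP; rewrite -addr_eq0 addrC; apply/eqP.
 rewrite e0 mul0mx addr0 in E0; have l0 : lsubmx v = 0 by exact: (@I_inj c d x ac ad x _ cx dx E0).
 by rewrite e0 l0 row_mx0.
have [K [sK KE]] := smooth_rinv sC fC.
pose A z : 'M[R]_(r, mdim M) := (rsubmx (K z))^T.
have sA : smM (c.2 x) A.
 by move=> a b; apply: sm_near (sK b (rshift _ a)); apply: filterE => z; rewrite !mxE.
pose s k q : tvec M := sharp pi (i q) (covec d (i q) (row k (A (c.2 q)))).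
have AE z : col_mx (I_ z) (B *m Pi z) *m K z = 1%:M ->
  A z *m (I_ z)^T = 0 /\ B *m Pi z *m (A z)^T = 1%:M.
 rewrite -[K z]hsubmxK mul_col_row scalar_mx_block => /eq_block_mx[_ E1 _ E2].
 by rewrite /A trmxK; split=> //; rewrite -trmx_mul E1 trmx0.
have : \forall z \near c.2 x, (d.1 (i (cinv c x z)) /\ smM z (fun z => A z *m Pi z)) /\
  (A z *m (I_ z)^T = 0 /\ B *m Pi z *m (A z)^T = 1%:M).
 have h1 := (mnbhsP hX _ ac cx).1 nd.
 have sAP : smM (c.2 x) (fun z => A z *m Pi z) by exact: smM_mul.
 have h3 : \forall z \near c.2 x, smM z (fun z => A z *m Pi z) by exact: smM_nbhs.
 apply: filterS3 h1 h3 KE => z dz sz Kz; split=> //; exact: AE.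
move=> /(near_pre hX ac cx)[ O [oO Ox hO]].
exists O, s; split=> // q Oq.
have [cq [[dq sAP] [AI BA]]] := hO _ Oq; rewrite cinvK // in dq.
have Piq : Pi (c.2 q) = PM pi d (i q) by rewrite /Pi cinvK.
have sk := pi_skew (i q).
have skP := PM_skew hM d sk; rewrite -Piq in skP.
have ta k : cotangent (i q) (covec d (i q) (row k (A (c.2 q)))) by exact: covecT.
have cs k : crd d (s k q) = row k (A (c.2 q)) *m Pi (c.2 q).
 by rewrite (sharp_crd hM sk ad dq (ta k)) ccrd_covec // Piq.
have ps k : perp i pi q (s k q).
 exists (covec d (i q) (row k (A (c.2 q)))) => //.
 apply: (@annihilatorP c d x ac ad q _ cq dq (ta k)).2; rewrite ccrd_covec //.
 by rewrite -row_mul -/I_ AI row0.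
have cse (e : 'rV[R]_r) : crd d (\sum_k e 0 k *: s k q) = e *m (A (c.2 q) *m Pi (c.2 q)).
 by rewrite crd_sum mulmx_sum_row; apply: eq_bigr => k _; rewrite cs row_mul.
have APB : A (c.2 q) *m Pi (c.2 q) *m B^T = - 1%:M.
 have := congr1 trmx BA; rewrite !trmx_mul trmxK trmx1 skP.
 by rewrite mulmxA mulmxN mulNmx => /eqP; rewrite eqr_oppLR => /eqP.
split; last first.
 move=> k; apply: (smooth_along_crd hM hX (embS q) ac cq ad dq).
  exists O; split=> // q' Oq'; have [cq' [[dq' _] _]] := hO _ Oq'; rewrite cinvK // in dq'.
  by apply: sharpT => //; [exact: pi_skew|exact: covecT].
 apply/smM_row; move=> a b; rewrite ord1.
 apply: sm_near (sAP k b).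
 have h1 := (mnbhsP hX _ ac cq).1 (open_mn oO Oq); have h2 := cinvP hX ac cq.
 apply: filterS2 h1 h2 => z Oz [cz Ez]; have [_ [[dz _] _]] := hO _ Oz.
 have Ec : cinv c x z = cinv c q z by rewrite -Ez !cinvK.
 rewrite Ez Ec in dz.
 rewrite (sharp_crd hM (pi_skew _) ad dz) ?ccrd_covec //; last exact: covecT.
 by rewrite Ez -row_mul /Pi Ec [RHS]mxE.
split=> // [e|v [a ha <-]].
 move=> E; have := cse (\row_k e k); under eq_bigr do rewrite mxE.
 rewrite E (_ : crd d 0 = 0); last by apply/rowP => j; rewrite !mxE.
 move=> /(congr1 (mulmx^~ B^T)); rewrite mul0mx -mulmxA APB mulmxN mulmx1 => /eqP.
 by rewrite eq_sym oppr_eq0 => /eqP/rowP h k; have := h k; rewrite !mxE.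
have [tA _] := ha; have := (@annihilatorP c d x ac ad q _ cq dq tA).1 ha; rewrite -/I_.
set al := ccrd d (i q) a => aI.
(* The coefficients for which [al'] pairs to zero with the images of [B] under [sharp]; it
   annihilates $TX$ as well. *)
pose e := - (al *m Pi (c.2 q) *m B^T); exists (fun k => e 0 k) => /=.
pose al' := al - e *m A (c.2 q).
have a'I : al' *m (I_ (c.2 q))^T = 0 by rewrite mulmxBl aI -mulmxA AI mulmx0 subr0.
have a'B : al' *m Pi (c.2 q) *m B^T = 0.
 by rewrite /al' 2!mulmxBl -[e *m A _ *m Pi _]mulmxA -[e *m (_ *m _) *m _]mulmxA APB mulmxN mulmx1 opprK /e subrr.
(* Modulo $TX$ the image of [sharp] is spanned by the [r] vectors of [B'], and [T] compares them
   with those of [B]; it is invertible because the latter pair to the identity with [A]. So [al']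
   vanishes on the whole image of [sharp], and by skewness its own image is zero. *)
have a'P : al' *m Pi (c.2 q) = 0.
 have [B' [B'I B'S]] := coregular_B x ac ad cq dq; rewrite -/I_ -Piq in B'I B'S.
 have [T hT] : exists T : 'M[R]_r, exists U, B *m Pi (c.2 q) = T *m (B' *m Pi (c.2 q)) + U *m I_ (c.2 q).
  have h k : exists eu : 'rV[R]_r * 'rV[R]_(mdim X),
    row k B *m Pi (c.2 q) = eu.1 *m (B' *m Pi (c.2 q)) + eu.2 *m I_ (c.2 q).
   by have [e1 [u E]] := B'S (row k B); exists (e1, u).
  have [f hf] := choice h; exists (\matrix_(k, l) (f k).1 0 l), (\matrix_(k, l) (f k).2 0 l).
  have rD (n' m' : nat) (A1 A2 : 'M[R]_(n', m')) k' : row k' (A1 + A2) = row k' A1 + row k' A2.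
   by apply/rowP => l; rewrite !mxE.
  apply/row_matrixP => k; rewrite row_mul hf rD !row_mul.
  by congr (_ + _); congr (_ *m _); apply/rowP => l; rewrite !mxE.
 have [U' hU] := hT.
 have uT : T \in unitmx.
  rewrite -row_free_unit; apply: inj_row_free => y yT.
  have h : y *m (B *m Pi (c.2 q)) = y *m U' *m I_ (c.2 q).
   by rewrite hU mulmxDr [y *m (T *m _)]mulmxA yT mul0mx add0r mulmxA.
  have h2 : y *m (B *m Pi (c.2 q)) *m (A (c.2 q))^T = 0.
   by rewrite h -mulmxA -[I_ _ *m _]trmxK trmx_mul trmxK AI trmx0 mulmx0.
  by move: h2; rewrite -mulmxA BA mulmx1.
 apply/dotr_inj => b; rewrite [RHS]/dotr mul0mx mxE.
 have [e1 [u1 E1]] := B'S b.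
 rewrite dotrC /dotr trmx_mul skP mulNmx mulmxN mulmxA E1 mulmxDl.
 have -> : u1 *m I_ (c.2 q) *m al'^T = 0.
  by rewrite -mulmxA -[I_ _ *m _]trmxK trmx_mul trmxK a'I trmx0 mulmx0.
 have -> : e1 *m (B' *m Pi (c.2 q)) = e1 *m invmx T *m (B *m Pi (c.2 q) - U' *m I_ (c.2 q)).
  by rewrite hU addrK [_ *m (T *m _)]mulmxA mulmxKV.
 rewrite addr0 -[e1 *m _ *m _ *m _]mulmxA mulmxBl.
 have -> : U' *m I_ (c.2 q) *m al'^T = 0.
  by rewrite -mulmxA -[I_ _ *m _]trmxK trmx_mul trmxK a'I trmx0 mulmx0.
 have -> : B *m Pi (c.2 q) *m al'^T = 0.
  have := congr1 trmx a'B; rewrite !trmx_mul trmxK trmx0 skP mulmxA mulmxN mulNmx => /eqP.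
  by rewrite oppr_eq0 => /eqP.
 by rewrite subr0 mulmx0 oppr0 mxE.
apply/eqP; rewrite subr_eq0; apply/eqP.
apply: (crd_inj hM ad dq); first exact: sharpT.
 apply: (subspace_sum (tangent_sub hM (i q))) => k; exact: perp_tangent.
rewrite cse (sharp_crd hM sk ad dq tA) -/al -Piq; apply/eqP; rewrite -subr_eq0; apply/eqP.
by rewrite mulmxA -mulmxBl.
Qed.

End Coregular.

(** * Smoothness of the time-one flow of a vector field on a manifold *)

Section Flow.
Context {R : realType}.
Implicit Types M N T : charted R.

Lemma smooth_map_id M (hM : lman M) (p : M) : smooth_map_at id p.
Proof.
have [c ac cp] := chart_ex hM p; exists c; split=> //.
 by exists c.1; split=> //; exact: copen.
apply/(smooth_atVP hM _ ac cp); apply: sm_near (sm_id _).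
by have h := cinvP hM ac cp; apply: filterS h => z [].
Qed.

Section VectorField.
Context {T : charted R} (hT : lman T) (Y : T -> tvec T) (hY : forall p, vfield_at p Y).

Lemma vfield_sm c p q : atlas T c -> c.1 q -> sm (c.2 q) (fun z => crd c (Y (cinv c p z))).
Proof.
move=> ac cq; apply/sm_rVP => j.
have [_ h] := hY q; have := h _ (smooth_coord hT j ac cq) => /(smoothP hT _ ac cq).
apply: sm_near; have h' := cinvP hT ac cq; apply: filterS h' => z [cz E].
by rewrite /= mxE -E !cinvK.
Qed.

Lemma mcont_cinv c p (a : R -> 'rV[R]_(mdim T)) t : atlas T c -> c.1 p ->
 (exists q, c.1 q /\ c.2 q = a t) -> {for t, continuous a} -> mcont (fun s => cinv c p (a s)) t.
Proof.
move=> ac cp [q [cq E]] ca A; rewrite -E cinvK // => nA.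
have h := (mnbhsP hT _ ac cq).1 nA; rewrite E in h.
have h2 := cinvP hT ac cq; rewrite E in h2.
have hh : \forall z \near a t, A (cinv c q z) /\ (c.1 (cinv c q z) /\ c.2 (cinv c q z) = z).
 by apply: filterI h h2.
have nn : \forall s \near t, A (cinv c q (a s)) /\ (c.1 (cinv c q (a s)) /\ c.2 (cinv c q (a s)) = a s) := ca _ hh.
apply: filterS nn => s [As [cs Es]].
have <- : cinv c q (a s) = cinv c p (a s) by rewrite -Es !cinvK.
exact: As.
Qed.

Lemma is_derive_rescale m (f : R -> 'rV[R]_m) (a b s : R) df :
 is_d (a + s * b) (f : R^o -> _) df ->
 is_d s (fun s : R^o => f (a + s * b)) (b *: df).
Proof.
move=> /is_d_rVP h; apply/is_d_rVP => j; rewrite mxE mulrC.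
have dg : is_d s (fun s : R^o => a + s * b : R^o) (b : R^o).
 apply: is_d_eps => e e0; exists 1 => // t _.
 rewrite (_ : _ - _ - _ = 0) ?normr0 ?mulr_ge0 //; first exact: ltW.
 by rewrite /GRing.scale /=; ring.
exact: (@is_derive1_comp R (fun z => f z 0 j) (fun s => a + s * b) s _ _ (h j) dg).
Qed.

Lemma affine_cont (a b s : R) : {for s, continuous (fun s : R => a + s * b)}.
Proof.
apply: (@is_d_cont R R^o _ _ b).
apply: is_d_eps => e' e'0; exists 1 => // h _.
rewrite (_ : _ - _ - _ = 0) ?normr0 ?mulr_ge0 //; first exact: ltW.
by rewrite /GRing.scale /=; ring.
Qed.

Lemma affine_near (a b s x y : R) : x < a + s * b < y -> \forall s' \near s, x < a + s' * b < y.
Proof.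
move=> /andP[h1 h2]; have n : \forall z \near a + s * b, x < z < y.
 have n1' : \forall z \near a + s * b, x < z by exact: lt_nbhsr.
 have n2' : \forall z \near a + s * b, z < y by exact: lt_nbhsl.
 by apply: filterS2 n1' n2' => z -> ->.
exact: affine_cont n.
Qed.

Lemma is_derive_near (W : normedModType R) (f g : R^o -> W) (t : R) df : (\forall s \near t, f s = g s) ->
 is_d t f df -> is_d t g df.
Proof. by move=> h D; apply: near_eq_is_derive h D. Qed.

Lemma cinvV c p z : atlas T c -> (exists q, c.1 q /\ c.2 q = z) ->
 c.1 (cinv c p z) /\ c.2 (cinv c p z) = z.
Proof. by move=> ac [q [cq <-]]; rewrite cinvK. Qed.

Lemma integral_curve_unique (gam del : R -> T) (a b : R) : a < 0 -> 1 < b ->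
 integral_curve Y gam a b -> integral_curve Y del a b -> gam 0 = del 0 -> gam 1 = del 1.
Proof.
move=> a0 b1 ig id; have ab t : 0 <= t <= 1 -> a < t < b.
 by move=> /andP[t0 t1]; rewrite (lt_le_trans a0 t0) (le_lt_trans t1 b1).
have cg t (ht : 0 <= t <= 1) := icurve_cont hT ig (ab t ht).
have cd t (ht : 0 <= t <= 1) := icurve_cont hT id (ab t ht).
apply: (curve_unique hT) => [t ht|t ht E]; first by split; [exact: cg|exact: cd].
have [c ac cp] := chart_ex hT (gam t).
exists c, (fun z => crd c (Y (cinv c (gam t) (sp z)))); split=> //.
 apply: (scomp (@sp R (mdim T)) (fun z => crd c (Y (cinv c (gam t) z)))); first exact: sm_sp.
 by rewrite sp_tx; exact: vfield_sm.
have n1 := cg t ht _ (open_mn (copen hT ac) cp).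
have cp' : c.1 (del t) by rewrite -E.
have n2 := cd t ht _ (open_mn (copen hT ac) cp').
have n3 : \forall s \near t, a < s < b.
 have /andP[h1 h2] := ab t ht.
 have n1' : \forall s \near t, a < s by exact: lt_nbhsr.
 have n2' : \forall s \near t, s < b by exact: lt_nbhsl.
 by apply: filterS2 n1' n2' => s -> ->.
apply: filterS3 n1 n2 n3 => s c1 c2 hs _; rewrite !sp_tx !cinvK //.
by split; [exact: integral_curve_crd ig hs ac c1|exact: integral_curve_crd id hs ac c2].
Qed.

Context (Sg : set T) (oSg : mopen Sg) (gam : T -> R -> T) (eps : T -> R)
 (hgam : forall p, Sg p -> [/\ 0 < eps p, gam p 0 = p & integral_curve Y (gam p) (- eps p) (1 + eps p)]).

(** For times [t1] and [t2] close to [t0], uniqueness writes the position at [t2] as the local flow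
    for time [t2 - t1] applied to the position at [t1], so smoothness in the starting point passes
    from one time to the other. The curves [gam] are integral curves chosen point by point, without
    any regularity in the starting point. *)
Lemma flow_step p t0 : Sg p -> 0 <= t0 <= 1 -> exists2 e, 0 < e & forall t1 t2,
 0 <= t1 <= 1 -> 0 <= t2 <= 1 -> `|t1 - t0| < e -> `|t2 - t0| < e ->
 smooth_map_at (gam^~ t1) p -> smooth_map_at (gam^~ t2) p.
Proof.
move=> Sp ht0; set p0 := gam p t0; have [c ac cp0] := chart_ex hT p0.
have icont q t (Sq : Sg q) : 0 <= t <= 1 -> mcont (gam q) t.
 move=> /andP[h0 h1]; have [e0 _ ic] := hgam Sq; apply: (icurve_cont hT ic).
 by apply/andP; split; lra.
have su := vfield_sm p0 ac cp0.
pose V (z : 'rV[R]_(mdim T)) := exists q, c.1 q /\ c.2 q = z.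
have nV : \forall z \near c.2 p0, V z.
 by have h := cinvP hT ac cp0; apply: filterS h => z [h1 h2]; exists (cinv c p0 z).
have [e e0 [Phi [Phi0 hPhi]]] := short_flow su nV.
have nc := icont p t0 Sp ht0 _ (open_mn (copen hT ac) cp0).
have cc := chart_cont hT ac cp0 (icont p t0 Sp ht0).
have nb : \forall s \near t0, ball (c.2 p0) e (c.2 (gam p s)) := cc _ (nbhsx_ballx _ _ e0).
have nbb : \forall s \near t0, c.1 (gam p s) /\ ball (c.2 p0) e (c.2 (gam p s)) by apply: filterI nc nb.
move: nbb => /nbhs_ballP[d d0 hd].
exists (Num.min d (e / 2)); first by rewrite lt_min d0 divr_gt0.
move=> t1 t2 h1 h2; rewrite !lt_min => /andP[a1 b1] /andP[a2 b2] s1.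
have [c1 B1] : c.1 (gam p t1) /\ ball (c.2 p0) e (c.2 (gam p t1)).
 by apply: hd; rewrite /ball /= distrC.
have dt : `|t2 - t1| < e.
 have := ler_distD t0 t2 t1; rewrite [`|t0 - t1|]distrC => h.
 by rewrite (le_lt_trans h) // [e]splitr ltrD.
have nS : mnbhs p Sg by exact: open_mn.
have nb1 : \forall z \near c.2 (gam p t1), `|z - c.2 p0| < e.
 have o : open (ball (c.2 p0) e) by exact: ball_open.
 by have := open_nbhs_nbhs (conj o B1); rewrite -norm_ballE.
have n1 : mnbhs p (fun q => c.1 (gam q t1) /\ `|c.2 (gam q t1) - c.2 p0| < e).
 exact: smap_cont s1 (near_pre hT ac c1 nb1).
(* Both sides are reparametrized affinely by $[0, 1]$ so that [curve_unique] applies, whichever of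
   [t1] and [t2] is larger. *)
have key q : Sg q -> c.1 (gam q t1) -> `|c.2 (gam q t1) - c.2 p0| < e ->
  gam q t2 = cinv c p0 (Phi (tx (t2 - t1) (c.2 (gam q t1)))).
 move=> Sq cq1 bq.
 pose g1 s := gam q (t1 + s * (t2 - t1)); set z1 := c.2 (gam q t1) in bq *.
 pose g2 s := cinv c p0 (Phi (tx (0 + s * (t2 - t1)) z1)).
 have hs s : 0 <= s <= 1 -> - e < 0 + s * (t2 - t1) < e.
  move=> /andP[s0 s1']; rewrite add0r -ltr_norml normrM (ger0_norm s0).
  by apply: le_lt_trans dt; rewrite ler_piMl.
 have ht s : 0 <= s <= 1 -> 0 <= t1 + s * (t2 - t1) <= 1.
  move: h1 h2 => /andP[x0 x1] /andP[y0 y1] /andP[s0 s1']; clear - x0 x1 y0 y1 s0 s1'; apply/andP; split; nra.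
 have [eq0 _ icq] := hgam Sq; set ee := eps q in eq0 icq.
 have dg s : - ee < t1 + s * (t2 - t1) < 1 + ee -> c.1 (g1 s) ->
   is_d s (fun s : R^o => c.2 (g1 s)) ((t2 - t1) *: crd c (Y (g1 s))).
  move=> h01 c1s; apply: (@is_derive_rescale _ (fun s => c.2 (gam q s)) t1 (t2 - t1)).
  exact: (integral_curve_crd hT icq).
 have dP s : - e < 0 + s * (t2 - t1) < e -> is_d s
   (fun s : R^o => Phi (tx (0 + s * (t2 - t1)) z1)) ((t2 - t1) *: crd c (Y (g2 s))).
  move=> hs'; have [_ _ D] := hPhi _ _ hs' bq.
  exact: (@is_derive_rescale _ (fun s => Phi (tx s z1)) 0 (t2 - t1)).
 have VPhi s : - e < 0 + s * (t2 - t1) < e -> V (Phi (tx (0 + s * (t2 - t1)) z1)).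
  by move=> hs'; have [] := hPhi _ _ hs' bq.
 have E1 : gam q t2 = g1 1 by rewrite /g1; congr (gam q _); ring.
 have E2 : cinv c p0 (Phi (tx (t2 - t1) z1)) = g2 1 by rewrite /g2 mul1r add0r.
 have mc1 s : 0 <= s <= 1 -> mcont g1 s.
  by move=> h01 A /(icont q _ Sq (ht s h01)) nA; exact: affine_cont nA.
 rewrite E1 E2; apply: (curve_unique hT).
 - move=> s h01; split; first exact: mc1.
  by apply: mcont_cinv (VPhi s (hs s h01)) (is_d_cont (dP s (hs s h01))).
 - move=> s h01 Es; have [c2 Ec] := cinvV p0 ac (VPhi s (hs s h01)).
  have c1s : c.1 (g1 s) by rewrite Es.
  exists c, (fun z => (t2 - t1) *: crd c (Y (cinv c p0 (sp z)))); split=> //.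
   apply/smM_row; apply: smM_scale; first exact: sm_cst.
   apply/smM_row; apply: (scomp (@sp R (mdim T)) (fun z => crd c (Y (cinv c p0 z)))); first exact: sm_sp.
   by rewrite sp_tx; exact: vfield_sm.
  have m1 := mc1 s h01 _ (open_mn (copen hT ac) c1s).
  have m2 : \forall s' \near s, - ee < t1 + s' * (t2 - t1) < 1 + ee.
   by apply: affine_near; move: (ht s h01) => /andP[x0 x1]; clear - eq0 x0 x1; apply/andP; split; lra.
  have m3 := affine_near (hs s h01).
  have m4 : \forall s' \near s, \forall s2 \near s', - e < 0 + s2 * (t2 - t1) < e.
   by apply: filterS m3 => s'; exact: affine_near.
  apply: filterS3 m1 m2 (filterI m3 m4) => s' c1s' h1s' [h2s' h3s'] _.
  rewrite !sp_tx [cinv c p0 (c.2 (g1 s'))]cinvK //; split; first exact: dg.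
  have [c2' Ec'] := cinvV p0 ac (VPhi s' h2s').
  rewrite [cinv c p0 (c.2 (g2 s'))]cinvK //; apply: is_derive_near (dP s' h2s').
  by apply: filterS h3s' => s2 /VPhi/(cinvV p0 ac)[].
 by rewrite /g1 /g2 mul0r !addr0 Phi0 // /z1 cinvK.
have n2 : mnbhs p (fun q => cinv c p0 (Phi (tx (t2 - t1) (c.2 (gam q t1)))) = gam q t2).
 by apply: mnbhs_sub (mnbhsI hT nS n1) => q [Sq [cq1 bq]]; rewrite key.
apply: (smooth_map_near hT hT n2).
apply: (smap_comp hT hT hT (phi := gam^~ t1) (psi := fun q => cinv c p0 (Phi (tx (t2 - t1) (c.2 q)))) s1).
have t12 : - e < t2 - t1 < e by rewrite -ltr_norml.
have bp := nbhs_singleton nb1.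
have [sP VP _] := hPhi _ _ t12 bp; have [c2 Ec2] := cinvV p0 ac VP.
apply/(smapP hT hT (phi := fun q => cinv c p0 (Phi (tx (t2 - t1) (c.2 q)))) ac c1 ac c2); split.
 apply: mnbhs_sub (near_pre hT ac c1 nb1) => q [cq bq].
 by have [_ Vq _] := hPhi _ _ t12 bq; have [] := cinvV p0 ac Vq.
apply: sm_near (sm_comp_rV (sm_tx_row (sm_cst _ (t2 - t1 : R^o)) (sm_id _)) sP).
have h := cinvP hT ac c1; apply: filterS2 nb1 h => z bz [cz Ez].
by rewrite /hat /= Ez; have [_ Vz _] := hPhi _ _ t12 bz; have [_ ->] := cinvV p0 ac Vz.
Qed.

Theorem flow_smooth p : Sg p -> smooth_map_at (gam^~ 1) p.
Proof.
move=> Sp; apply: (@segment_induction _ (fun t => smooth_map_at (gam^~ t) p)).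
 by move=> t0 ht0; have [e e0 h] := flow_step Sp ht0; exists e.
apply: (smooth_map_near hT hT _ (smooth_map_id hT p)).
by exists Sg; split=> // q Sq; have [_ -> _] := hgam Sq.
Qed.

End VectorField.
End Flow.

(** * The inclusion of the dual of TX^perp in the cotangent bundle *)

Section Exponential.
Context {R : realType}.

Section Cotangent.
Context {M : charted R} (hM : lman M).

Definition cframe (d : cht M) : 'I_(mdim M) -> M -> tvec M := fun k q => vec d q (ev k).

Lemma cframe_on d : atlas M d -> frame_on id (@tangent R M) d.1 (cframe d).
Proof.
move=> ad q dq; split; last by move=> k; exact: vec_field.
split; first by move=> k; exact: vecT.
 move=> a /= E k; have := vec_partial hM (\row_k a k) ad dq; under eq_bigr do rewrite mxE.
 rewrite E => /(congr1 (crd d)); rewrite crd_vec // => /rowP/(_ k); rewrite !mxE => ->.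
 by [].
move=> v tv; exists (fun k => crd d v 0 k) => /=.
by rewrite -(vec_partial hM _ ad dq) (vec_crd hM ad dq tv) subrr.
Qed.

Lemma tangent_subbundle : subbundle id (@tangent R M) (mdim M).
Proof.
split; first by move=> q; exact: tangent_sub.
move=> p; have [d ad dp] := chart_ex hM p.
by exists d.1, (cframe d); split=> //; [exact: copen|exact: cframe_on].
Qed.

Lemma cotangent_lman : lman (cotangent_bundle M).
Proof. exact: (bundle_lman hM hM (smooth_map_id hM) tangent_subbundle). Qed.

Definition tchart (d : cht M) : cht (cotangent_bundle M) :=
 fchart id (@tangent R M) d d.1 (cframe d).

Lemma tchart_atlas d : atlas M d -> atlas (cotangent_bundle M) (tchart d).
Proof.
move=> ad; apply: fatlas => //; first exact: copen.
exact: cframe_on.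
Qed.

End Cotangent.

Context {M X : charted R} (hM : lman M) (hX : lman X) (pi : bivector M) (i : X -> M)
 (hpi : poisson_on setT pi) (hi : embedding i) (r : nat) (hr : coregular i pi r).
Local Notation E := (perp_dual i pi r).
Local Notation hF := (perp_subbundle hM hX hpi hi hr).

Lemma perp_lman : lman E.
Proof. exact: (bundle_lman hM hX (embS hi) hF). Qed.

Context (W : X -> set (tvec M)) (hW : is_complement i pi r W).

(** [xget] picks the component in the perp space along [W]. It is unique because the two subspaces
    meet in zero, and uniqueness makes it linear in the vector. *)
Lemma jmap_cotangent (e : E) : cotangent (i (base e)) (jmap i pi W (base e) (fib e)).
Proof.
have [sW cW] := hW; set q := base e; have [Wt WI Wc] := cW q.
split=> [t u v tu tv|v nv]; last by rewrite /jmap /restr asboolF.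
have sp := perp_subspace hM i hpi q; have [sWq _] := sW; move: sWq => /(_ q) sWq.
pose P v := xget 0 [set a | perp i pi q a /\ W q (v - a)].
have PP v' : tangent (i q) v' -> perp i pi q (P v') /\ W q (v' - P v').
 by move=> tv'; have [a pa wa] := Wc _ tv'; exact: (@xgetPex _ 0 [set a | perp i pi q a /\ W q (v' - a)] (ex_intro _ a (conj pa wa))).
have [Pu Wu] := PP u tu; have [Pv Wv] := PP v tv.
have tuv : tangent (i q) (t *: u + v) by exact: tangentD.
have [Puv Wuv] := PP _ tuv.
have lin0 : P (t *: u + v) = t *: P u + P v.
 have [_ pD] := sp; have [_ wD] := sWq.
 have h1 : perp i pi q (P (t *: u + v) - (t *: P u + P v)).
  by rewrite addrC -scaleN1r; exact: (pD (-1) _ _ (pD t _ _ Pu Pv) Puv).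
 have h2 : W q (P (t *: u + v) - (t *: P u + P v)).
  have := wD (-1) _ _ Wuv (wD t _ _ Wu Wv); congr (W q _).
  by rewrite scaleN1r opprB scalerBr [_ - _ + (v - _)]addrACA -opprD addrA subrK.
 have : [set 0] (P (t *: u + v) - (t *: P u + P v)) by rewrite -WI.
 by move=> /eqP; rewrite subr_eq0 => /eqP.
have [lf _] := svalP e.
rewrite /jmap /restr !asboolT // -/(P u) -/(P v) -/(P _) lin0.
exact: lf.
Qed.

Definition jlift (e : E) : cotangent_bundle M :=
 exist _ (i (base e), jmap i pi W (base e) (fib e)) (jmap_cotangent e).

(** A frame of the perp bundle stacked on a frame of [W] is a matrix with a smooth right inverse;
    the columns dual to the first frame represent the projection along [W]. *)
Lemma jmap_smooth c d x O s : atlas X c -> atlas M d -> O `<=` c.1 -> d.1 (i x) ->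
 mopen O -> O x -> frame_on i (perp i pi) O s ->
 exists J : 'rV[R]_(mdim X) -> 'M[R]_(r, mdim M), smM (c.2 x) J /\
  mnbhs x (fun q => [/\ O q, d.1 (i q), Smx d s q *m (J (c.2 q))^T = 1%:M &
   forall e : E, base e = q -> ccrd d (i q) (fib (jlift e)) = (\row_k fib e (s k q)) *m J (c.2 q)]).
Proof.
move=> ac ad Oc dx oO Ox fr; have [sW cW] := hW; have cx := Oc _ Ox.
have [_ /(_ x)[ O' [w [oO' O'x frw]]]] := sW.
have sS := Smx_smooth hM hX ac cx ad dx Ox fr; have sw := Smx_smooth hM hX ac cx ad dx O'x frw.
pose A z := col_mx (Smx d s (cinv c x z)) (Smx d w (cinv c x z)).
have sA : smM (c.2 x) A.
 move=> a b; have [a' Ea|a' Ea] := split_ordP a.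
  by apply: sm_near (sS a' b); apply: filterE => z; rewrite Ea /A col_mxEu.
 by apply: sm_near (sw a' b); apply: filterE => z; rewrite Ea /A col_mxEd.
have Fsum (n : nat) (F : X -> set (tvec M)) (t : 'I_n -> X -> tvec M) q (a : 'rV[R]_n) :
  is_subspace (F q) -> is_basis (F q) (fun k => t k q) -> F q (\sum_k a 0 k *: t k q).
 by move=> sF [Ft _ _]; exact: (subspace_sum sF).
have fA : row_free (A (c.2 x)).
 rewrite /A cinvK //; apply: inj_row_free => v; rewrite -[v]hsubmxK mul_row_col -!crd_frame.
 have [bs _] := fr _ Ox; have [bw _] := frw _ O'x; have [Wt WI Wc] := cW x.
 have ps := Fsum _ _ _ _ (lsubmx v) (perp_subspace hM i hpi x) bs.
 have pw := Fsum _ _ _ _ (rsubmx v) (sW.1 x) bw.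
 set a := \sum_k _ in ps *; set b := \sum_k _ in pw * => Eab.
 have ta := perp_tangent hM hpi ps; have tb := Wt _ pw.
 have ab0 : a = - b.
  have t0 := tangent0 hM (i x).
  have tNb : tangent (i x) (- b) by have := tangentD hM (-1) tb t0; rewrite scaleN1r addr0.
  apply: (crd_inj hM ad dx ta tNb); apply/rowP => j; move/rowP: Eab => /(_ j).
  by rewrite !mxE => /eqP; rewrite addr_eq0 => /eqP.
 have a0 : a = 0.
  suff : [set 0] a by []; rewrite -WI; split=> //.
  have [w0 wD] := sW.1 x; have := wD (-1) _ _ pw w0; rewrite scaleN1r addr0 -ab0.
  by [].
 have b0 : b = 0 by apply/eqP; rewrite -oppr_eq0 -ab0 a0.
 have e1 : lsubmx v = 0.
  apply/rowP => k; rewrite [RHS]mxE; apply: (frame_free (a := fun k => lsubmx v 0 k) (b := fun _ => 0) bs).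
  by rewrite -/a a0 big1 // => l _; rewrite scale0r.
 have e2 : rsubmx v = 0.
  apply/rowP => k; rewrite [RHS]mxE; apply: (frame_free (a := fun k => rsubmx v 0 k) (b := fun _ => 0) bw).
  by rewrite -/b b0 big1 // => l _; rewrite scale0r.
 by rewrite e1 e2 row_mx0.
have [K [sK KE]] := smooth_rinv sA fA.
exists (fun z => (lsubmx (K z))^T); split.
 by move=> a b; apply: sm_near (sK b (lshift _ a)); apply: filterE => z; rewrite !mxE.
have nd := smap_cont hX hM (embS hi x) (open_mn (copen hM ad) dx).
have n1 := near_pre hX ac cx KE.
have n2 := mnbhsI hX (open_mn oO Ox) (open_mn oO' O'x).
apply: mnbhs_sub (mnbhsI hX (mnbhsI hX nd n1) n2) => q [[/= dq [cq]]].
rewrite /A cinvK // => KEq [Oq O'q].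
have := KEq; rewrite -[K _]hsubmxK mul_col_row scalar_mx_block => /eq_block_mx[E1 _ E2 _].
split=> //; first by rewrite trmxK row_mxKl.
move=> e Ee; have je : cotangent (i q) (fib (jlift e)) by rewrite -Ee; exact: jmap_cotangent.
rewrite row_mxKl; apply/dotr_inj => v; have tv := vecT hM v ad dq.
rewrite -[v in LHS](crd_vec hM v ad dq) -(cotangentE hM ad dq je tv).
have [Wt WI Wc] := cW q.
rewrite /jlift /fib /= -/(fib e) Ee /jmap /restr asboolT //.
set u := vec d (i q) v in tv *.
have [a0 pa0 wa0] := Wc _ tv.
have [Pu Wu] := @xgetPex _ 0 [set a | perp i pi q a /\ W q (u - a)] (ex_intro _ a0 (conj pa0 wa0)).
set p := xget _ _ in Pu Wu *.
have [bs _] := fr _ Oq; have [bw _] := frw _ O'q.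
have [a Ea] := frame_span bs Pu; have [b Eb] := frame_span bw Wu.
have [lf _] := svalP e; rewrite -/(base e) -/(fib e) Ee in lf.
have [Fs _ _] := bs.
rewrite Ea (linear_on_sum (perp_subspace hM i hpi q) _ _ lf Fs).
have Eu : v = (\row_k a k) *m Smx d s q + (\row_k b k) *m Smx d w q.
 rewrite -!crd_frame -[LHS](crd_vec hM v ad dq) -/u.
 under eq_bigr do rewrite mxE; under [in X in _ + X]eq_bigr do rewrite mxE.
 rewrite -Ea -Eb; apply/rowP => j; rewrite !mxE addrC.
 by rewrite [X in X + _]/GRing.add /= /GRing.opp /= subrK.
rewrite /dotr -mulmxA -trmx_mul Eu mulmxDl -!mulmxA E1 E2 mulmx1 mulmx0 addr0.
rewrite -/(dotr _ _) dotrE; apply: eq_bigr => k _; rewrite !mxE mulrC.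
by [].
Qed.

Lemma jlift_fscale t (e : E) : jlift (fscale t e) = fscale t (jlift e) :> cotangent_bundle M.
Proof.
apply: dual_ext => //; apply/funext => v; rewrite /fib /= /jmap /restr.
by case: ifP => // _; rewrite mulr0.
Qed.

Lemma jlift_smooth e : smooth_map_at jlift e.
Proof.
have [c [ O [s [ac oO Oc fr Oe]]]] := echart_ex hX hF e.
have [d ad dx] := chart_ex hM (i (base e)).
have [J [sJ nJ]] := jmap_smooth ac ad Oc dx oO Oe fr.
have aC := fatlas ac oO Oc fr; set C := fchart i (perp i pi) c O s in aC.
have aD := tchart_atlas hM ad; have Ce : C.1 e by [].
have hE := perp_lman; have De : (tchart d).1 (jlift e) by [].
have sb := base_smooth hM hX (embS hi) hF ac oO Oc fr Oe.
have nJ' := smap_cont hE hX sb nJ.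
apply/(smapP hE (cotangent_lman hM) aC Ce aD De); split.
 by apply: mnbhs_sub nJ' => e' [_ dq _ _].
have [_ sI] := (smapP hX hM ac (Oc _ Oe) ad dx).1 (embS hi (base e)).
have lE : lp (C.2 e : 'rV[R]_(mdim X + r)) = c.2 (base e) by rewrite /lp row_mxKl.
pose g (z : 'rV[R]_(mdim X + r)) := row_mx (hat c d i (base e) (lp z)) (rp z *m J (lp z)).
have sg : sm (C.2 e : 'rV[R]_(mdim X + r)) g.
 apply/smM_row; apply: smM_rowmx.
  by apply/smM_row; apply: sm_comp_rV; [exact: sm_lsub|rewrite lE].
 apply: smM_mul; first exact/smM_row/sm_rsub.
 by apply: smM_comp; [exact: sm_lsub|rewrite lE].
apply: sm_near sg.
have h1 := (mnbhsP hE _ aC Ce).1 nJ'; have h2 := cinvP hE aC Ce.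
apply: filterS2 h1 h2 => z [Oz dz _ hz] [_ Ez].
rewrite -{1}Ez /g /C /fchart /= /lp /rp row_mxKl row_mxKr hatK //; last exact: Oc.
by rewrite -hz.
Qed.

End Exponential.

(** * The exponential map of a Poisson spray *)

Section SprayExponential.
Context {R : realType}.

Lemma is_derive_rescale_real (f : R -> R) (b s : R) df :
 is_d (s * b) (f : R^o -> R^o) df ->
 is_d s (fun s : R^o => f (s * b) : R^o) (b * df).
Proof.
move=> h; rewrite mulrC.
have dg : is_d s (fun s : R^o => s * b : R^o) (b : R^o).
 apply: is_d_eps => e e0; exists 1 => // t _.
 rewrite (_ : _ - _ - _ = 0) ?normr0 ?mulr_ge0 //; first exact: ltW.
 by rewrite /GRing.scale /=; ring.
exact: (@is_derive1_comp R f (fun s => s * b) s _ _ h dg).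
Qed.

(** Agreement to the right of zero determines the derivative. This is the form that fits the spray,
    which is homogeneous for positive factors. *)
Lemma right_derive_unique m (f g : R^o -> 'rV[R]_m) a b :
 is_d 0 f a -> is_d 0 g b ->
 (forall t : R, 0 <= t <= 1 -> f t = g t) -> a = b.
Proof.
move=> df dg E; apply/eqP; rewrite -subr_eq0 -normr_le0; apply/ler_addgt0Pl => e e0.
rewrite addr0; have e2 : 0 < e / 2 by rewrite divr_gt0.
have [r1 r10 h1] := is_derive_1 df e2; have [r2 r20 h2] := is_derive_1 dg e2.
pose s := Num.min 1 (Num.min (r1 / 2) (r2 / 2)).
have s0 : 0 < s by rewrite !lt_min ltr01 !divr_gt0.
have [sa sb sc] : [/\ s <= 1, s <= r1 / 2 & s <= r2 / 2].
 by rewrite /s !ge_min !lexx !orbT; split.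
have n1 : `|s| < r1 by rewrite gtr0_norm //; lra.
have n2 : `|s| < r2 by rewrite gtr0_norm //; lra.
have := h1 _ n1; have := h2 _ n2; rewrite !addr0 (E 0) ?lexx ?ler01 // (E s) ?(ltW s0) //.
set w := g s - g 0; rewrite (gtr0_norm s0) => h3 h4.
have : s * `|a - b| <= e * s.
 rewrite -(gtr0_norm s0) -normrZ (gtr0_norm s0) scalerBr.
 have -> : s *: a - s *: b = (w - s *: b) - (w - s *: a) by apply/rowP => l; rewrite !mxE; ring.
 by apply: le_trans (ler_normB _ _) _; lra.
by rewrite mulrC ler_pM2r.
Qed.

Lemma fscale_smooth (M N : charted R) (hM : lman M) (hN : lman N) (phi : N -> M)
 (hphi : forall x, smooth_map_at phi x) (F : N -> set (tvec M)) r (hF : subbundle phi F r) t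
 (e : dual_bundle phi F r) : smooth_map_at (fscale t : dual_bundle phi F r -> _) e.
Proof.
have hE := bundle_lman hM hN hphi hF.
have [c [ O [s [ac oO Oc fr Oe]]]] := echart_ex hN hF e.
have aC := fatlas ac oO Oc fr; set C := fchart phi F c O s in aC.
have Ce : C.1 e by []; have Ce' : C.1 (fscale t e) by [].
apply/(smapP hE hE (phi := fscale t) aC Ce aC Ce'); split.
 by exists C.1; split=> //; exact: copen hE _ aC.
apply: sm_near (_ : sm _ (fun z : 'rV[R]_(mdim N + r) => row_mx (lp z) (t *: rp z))).
 have h := cinvP hE aC Ce; apply: filterS h => z [h1 h2].
 by rewrite -[hat _ _ _ _ _]/(C.2 (fscale t (cinv C e z))) fscaleE -/C h2.
apply/smM_row; apply: smM_rowmx; first exact/smM_row/sm_lsub.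
by apply: smM_scale; [exact: sm_cst|exact/smM_row/sm_rsub].
Qed.

Section Spray.
Context {M : charted R} (hM : lman M) (pi : bivector M) (hpi : poisson_on setT pi).
Local Notation T := (cotangent_bundle M).
Context (chi : T -> tvec T) (hchi : poisson_spray pi chi) (Sg : set T) (oSg : mopen Sg)
 (Sg0 : forall q, Sg (zs id (@tangent R M) (mdim M) q))
 (hexp : forall xi, Sg xi -> exists p, spray_exp chi xi p).
Let hT : lman T := cotangent_lman hM.
Let pr (xi : T) : M := base xi.
Let ms (t : R) (xi : T) : T := fscale t xi.

Let pr_smooth (xi : T) : smooth_map_at pr xi.
Proof.
have [d ad dx] := chart_ex hM (pr xi).
exact: (base_smooth hM hM (smooth_map_id hM) (tangent_subbundle hM) ad (copen hM ad) _
 (cframe_on hM ad) dx).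
Qed.

Let ms_smooth t (xi : T) : smooth_map_at (ms t) xi.
Proof. exact: (fscale_smooth hM hM (smooth_map_id hM) (tangent_subbundle hM)). Qed.

Lemma msK t (xi : T) : 0 < t -> ms t^-1 (ms t xi) = xi.
Proof.
move=> t0; apply: dual_ext => //; apply/funext => v.
by rewrite /fib /= mulrA mulVf ?mul1r // gt_eqF.
Qed.

Lemma msKV t (xi : T) : 0 < t -> ms t (ms t^-1 xi) = xi.
Proof. by move=> t0; rewrite -{1}[t]invrK msK // invr_gt0. Qed.

(** Homogeneity of the spray with the push-forward by the inverse dilation unfolded: the form in
    which it acts on functions. *)
Lemma spray_scale t (xi : T) (f : T -> R^o) : 0 < t -> smooth_at (ms t xi) f ->
 chi (ms t xi) f = t * chi xi (f \o ms t).
Proof.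
move=> t0 sf; have [_ _ /(_ t xi t0)] := hchi; rewrite -/(ms _ _) => E.
have sft : smooth_at xi (f \o ms t) by exact: (smooth_comp hT hT (ms_smooth t xi) sf).
have := congr1 (fun v : tvec T => v (f \o ms t)) E; rewrite /push.
rewrite -[fib_scale t^-1 _]/(ms t^-1 (ms t xi)) msK // asboolT // => {}E.
rewrite -[RHS]E; congr (chi _ _); apply/funext => eta /=.
by rewrite -[fib_scale t^-1 _]/(ms t^-1 eta) msKV.
Qed.

Lemma spray_flow : exists (gam : T -> R -> T) (eps : T -> R), forall xi, Sg xi ->
 [/\ 0 < eps xi, gam xi 0 = xi & integral_curve chi (gam xi) (- eps xi) (1 + eps xi)].
Proof.
have h xi : exists ge : (R -> T) * R, Sg xi ->
  [/\ 0 < ge.2, ge.1 0 = xi & integral_curve chi ge.1 (- ge.2) (1 + ge.2)].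
 have [Sx|nS] := pselect (Sg xi); last by exists (fun _ => xi, 0).
 by have [p [g [e [e0 g0 ic _]]]] := hexp Sx; exists (g, e).
have [f hf] := choice h; exists (fun xi => (f xi).1), (fun xi => (f xi).2) => xi; exact: hf.
Qed.

(** Homogeneity makes $s \mapsto m_t \gamma_\xi(ts)$ the integral curve from $t\xi$, so $\exp(t\xi)$
    is the projection of $\gamma_\xi(t)$. Letting $t$ tend to zero gives the value on the zero
    section, and differentiating at zero gives [sharp] as the derivative along the fibre. *)
Theorem spray_exponential : exists Ex : T -> M,
 [/\ (forall xi, Sg xi -> smooth_map_at Ex xi),
   (forall xi p, Sg xi -> spray_exp chi xi p -> p = Ex xi),
   (forall xi, Sg xi -> spray_exp chi xi (Ex xi)),
   (forall q, Ex (zs id (@tangent R M) (mdim M) q) = q) &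
   (forall xi d, atlas M d -> d.1 (pr xi) -> is_d 0
     (fun t : R^o => d.2 (Ex (ms t xi))) (ccrd d (pr xi) (fib xi) *m PM pi d (pr xi)))].
Proof.
have [gam [eps hg]] := spray_flow; have [vchi prchi _] := hchi.
pose Ex xi := pr (gam xi 1).
have sEx xi : Sg xi -> smooth_map_at Ex xi.
 move=> Sx; have s1 := flow_smooth hT vchi oSg hg Sx.
 exact: (smap_comp hT hT hM s1 (pr_smooth _)).
have hom t xi : 0 < t <= 1 -> Sg xi -> Sg (ms t xi) -> Ex (ms t xi) = pr (gam xi t).
 move=> /andP[t0 t1] Sx Stx; have [e0 g0 ic] := hg _ Sx; have [e0' g0' ic'] := hg _ Stx.
 pose m := Num.min (eps xi) (eps (ms t xi)).
 have m0 : 0 < m by rewrite lt_min e0 e0'.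
 have [ma mb] : m <= eps xi /\ m <= eps (ms t xi) by rewrite /m !ge_min !lexx orbT.
 pose del s := ms t (gam xi (s * t)).
 have E1 : pr (gam xi t) = pr (del 1) by rewrite /del mul1r.
 rewrite E1 /Ex; congr pr; apply: (@integral_curve_unique _ _ hT _ vchi _ _ (- m) (1 + m)).
 - by rewrite oppr_lt0.
 - by rewrite ltrDl.
 - by move=> s /andP[h1 h2] f sf; apply: ic' => //; apply/andP; split; lra.
 - move=> s /andP[h1 h2] f sf; rewrite /del (spray_scale t0 sf).
  apply: (is_derive_rescale_real (f := f \o ms t \o gam xi)).
  apply: ic; first by apply/andP; split; nra.
  exact: (smooth_comp hT hT (ms_smooth t _) sf).
 by rewrite g0' /del mul0r g0.
have Ex0 q : Ex (zs id (@tangent R M) (mdim M) q) = q.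
 (* The zero covector is fixed by dilations, so the projected curve is constant on $(0, 1]$;
    continuity at zero identifies the constant with [q]. *)
 set z := zs _ _ _ q; have Sz : Sg z by exact: Sg0.
 have mz t : ms t z = z.
  by apply: dual_ext => //; apply/funext => v; rewrite /fib /= mulr0.
 have [e0 g0 ic] := hg _ Sz.
 apply: contrapT => N; have [_ _ _ /(_ _ _ N)[ O [ O' [oO oO' Oe Oq I]]]] := hM.
 have c0 : mcont (gam z) 0 by apply: (icurve_cont hT ic); apply/andP; split; lra.
 have n0 : mnbhs (gam z 0) (pr @^-1` O').
  apply: (smap_cont hT hM (pr_smooth _)); rewrite g0; exact: open_mn.
 have := c0 _ n0 => /nbhs_ballP[r r0 hr].
 pose t := Num.min 1 (r / 2); have t0 : 0 < t by rewrite lt_min ltr01 divr_gt0.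
 have [ta tb] : t <= 1 /\ t <= r / 2 by rewrite /t !ge_min !lexx orbT.
 have := hom t z; rewrite mz t0 ta => /(_ erefl Sz Sz) E.
 have : O' (pr (gam z t)).
  by apply: hr; rewrite /ball /= sub0r normrN gtr0_norm //; lra.
 by rewrite -E => O'E; have : (O `&` O') (Ex z) by []; rewrite I.
exists Ex; split=> // [xi p Sx [g [e [e0 g0 ic ->]]]|xi Sx|xi d ad dx].
- have [e0' g0' ic'] := hg _ Sx; pose m := Num.min e (eps xi).
 have m0 : 0 < m by rewrite lt_min e0 e0'.
 have [ma mb] : m <= e /\ m <= eps xi by rewrite /m !ge_min !lexx orbT.
 rewrite /Ex /pr; congr base; apply: (@integral_curve_unique _ _ hT _ vchi _ _ (- m) (1 + m)).
 + by rewrite oppr_lt0.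
 + by rewrite ltrDl.
 + by move=> s /andP[h1 h2] f sf; apply: ic => //; apply/andP; split; lra.
 + by move=> s /andP[h1 h2] f sf; apply: ic' => //; apply/andP; split; lra.
 by rewrite g0 g0'.
- by have [e0 g0 ic] := hg _ Sx; exists (gam xi), (eps xi); split.
set q := pr xi in dx *; set y := ccrd d q (fib xi).
have aC := tchart_atlas hM ad; set C := tchart d in aC.
set z0 := zs id (@tangent R M) (mdim M) q; have Cz : C.1 z0 by [].
pose w : 'rV[R]_(mdim M + mdim M) := row_mx 0 y.
have Cms t : C.2 (ms t xi) = C.2 z0 + t *: w.
 rewrite fscaleE zsE /w scale_row_mx scaler0 add_row_mx addr0 add0r /lp /rp row_mxKl row_mxKr.
 by [].
have dEx : d.1 (Ex z0) by rewrite Ex0.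
have [_ sh] := (smapP hT hM aC Cz ad dEx).1 (sEx z0 (Sg0 q)).
have D0 := @line_derive R _ _ (hat C d Ex z0) (C.2 z0) w 0.
rewrite scale0r addr0 in D0; have {}D0 := D0 (sm_diff sh).
have D : is_d 0 (fun t : R^o => d.2 (Ex (ms t xi)))
  ('D_w (hat C d Ex z0) (C.2 z0)).
 move: D0; congr is_derive; apply/funext => t; rewrite -Cms.
 by rewrite -[hat _ _ _ _ _]/(d.2 (Ex (cinv C z0 (C.2 (ms t xi))))) cinvK.
have [r r0 hr] : exists2 r : R, 0 < r & forall t : R, `|t| < r -> Sg (ms t xi).
 have n1 := (mnbhsP hT _ aC Cz).1 (open_mn oSg (Sg0 q)).
 have cl : {for (0 : R), continuous (fun t : R => C.2 z0 + t *: w)}.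
  apply: (@is_d_cont _ _ _ _ w); apply: is_d_eps => e' e'0; exists 1 => // h _.
  rewrite (_ : _ - _ - _ = 0) ?normr0 ?mulr_ge0 //; first exact: ltW.
  by rewrite addr0 scale0r addr0 [C.2 z0 + _]addrC addrK /GRing.scale /= mulr1 subrr.
 have n2 : \forall z \near C.2 z0 + 0 *: w, Sg (cinv C z0 z) by rewrite scale0r addr0.
 have := cl _ n2 => /nbhs_ballP[r r0 hr]; exists r => // t tr.
 have : Sg (cinv C z0 (C.2 z0 + t *: w)) by apply: hr; rewrite /ball /= sub0r normrN.
 by rewrite -Cms cinvK.
(* [xi] itself may lie outside [Sg]. The derivative is computed for the scaled covector [ms tau xi]
   and divided by [tau] at the end. *)
pose tau := r / 2; have tau0 : 0 < tau by rewrite divr_gt0.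
have Sxi : Sg (ms tau xi) by apply: hr; rewrite gtr0_norm // /tau; lra.
have [e0 g0 ic] := hg _ Sxi.
have D1 : is_d 0 (fun t : R^o => d.2 (Ex (ms (0 + t * tau) xi)))
  (tau *: 'D_w (hat C d Ex z0) (C.2 z0)).
 apply: (@is_derive_rescale R _ (fun t => d.2 (Ex (ms t xi)))).
 by rewrite mul0r addr0.
have D2 : is_d 0 (fun t : R^o => d.2 (pr (gam (ms tau xi) t)))
  (tau *: (y *m PM pi d q)).
 apply/is_d_rVP => j.
 have sj : smooth_at q (fun p => d.2 p 0 j : R^o) by exact: smooth_coord.
 have spj : smooth_at (gam (ms tau xi) 0) ((fun p => d.2 p 0 j : R^o) \o pr).
  have sj' : smooth_at (pr (ms tau xi)) (fun p : M => d.2 p 0 j : R^o) := sj.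
  by rewrite g0; exact: (smooth_comp hT hM (pr_smooth (ms tau xi)) sj').
 have h0 : - eps (ms tau xi) < 0 < 1 + eps (ms tau xi) by apply/andP; split; lra.
 have Dj := ic 0 h0 _ spj.
 rewrite (_ : (tau *: (y *m PM pi d q)) 0 j = chi (gam (ms tau xi) 0) ((fun p => d.2 p 0 j : R^o) \o pr)); first exact: Dj.
 rewrite g0; apply: esym.
 have tx : cotangent q (fib (ms tau xi)) by exact: (svalP (ms tau xi)).
 have := congr1 (fun v : tvec M => v (fun p => d.2 p 0 j : R^o)) (prchi (ms tau xi)).
 rewrite /push asboolT // => ->.
 have := sharp_crd hM (pi_skew hpi q) ad dx tx => /rowP/(_ j); rewrite [LHS]mxE => ->.
 have -> : ccrd d q (fib (ms tau xi)) = tau *: y by apply/rowP => l; rewrite !mxE.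
 by rewrite -scalemxAl.
have E := right_derive_unique D1 D2.
have {}E : tau *: 'D_w (hat C d Ex z0) (C.2 z0) = tau *: (y *m PM pi d q).
 apply: E => t /andP[t0 t1]; rewrite add0r.
 have mm : ms (t * tau) xi = ms t (ms tau xi).
  by apply: dual_ext => //; apply/funext => v; rewrite /fib /= mulrA.
 have [->|tn] := eqVneq t 0.
  rewrite mul0r g0 (_ : ms 0 xi = z0) ?Ex0 //.
  by apply: dual_ext => //; apply/funext => v; rewrite /fib /= mul0r.
 have tp : 0 < t by rewrite lt_def tn t0.
 rewrite mm; congr (d.2 _); apply: hom => //; first by rewrite tp t1.
 rewrite -mm; apply: hr; rewrite ger0_norm ?mulr_ge0 ?(ltW tau0) // /tau; nra.
move: D; rewrite (_ : 'D_w _ _ = y *m PM pi d q) //.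
by have := congr1 (fun v => tau^-1 *: v) E; rewrite !scalerA mulVf ?gt_eqF // !scale1r.
Qed.

End Spray.
End SprayExponential.

(** * The germ of the saturation along X *)

Section Germ.
Context {R : realType}.

Lemma line_cont n (a u : 'rV[R]_n) (t : R) : {for t, continuous (fun t : R => a + t *: u)}.
Proof.
apply: (@is_d_cont R _ (fun t : R^o => a + t *: u) t u); apply: is_d_eps => e e0.
exists 1 => // h _; rewrite [X in `|X|](_ : _ = 0) ?normr0 ?mulr_ge0 ?(ltW e0) //.
by apply/rowP => j; rewrite !mxE /GRing.scale /=; ring.
Qed.

Lemma emb_Jac_free (P M : charted R) (hP : lman P) (hM : lman M) (k : P -> M) p c d :
 embedding k -> atlas P c -> c.1 p -> atlas M d -> d.1 (k p) ->
 row_free (Jac (hat c d k p) (c.2 p)).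
Proof.
move=> [sk ij _ _] ac cp ad dk; apply: inj_row_free => u E.
have tu := vecT hP u ac cp; have t0 := vecT hP 0 ac cp.
have E1 := push_crd hP hM ac cp ad dk (sk p) tu; have E2 := push_crd hP hM ac cp ad dk (sk p) t0.
rewrite (crd_vec hP u ac cp) E in E1; rewrite (crd_vec hP 0 ac cp) mul0mx in E2.
have V : vec c p u = vec c p 0.
 apply: (ij p _ _ tu t0); have p1 := pushT hP hM (sk p) tu.
 exact: (crd_inj hM ad dk p1 (pushT hP hM (sk p) t0) (etrans E1 (esym E2))).
by rewrite -(crd_vec hP u ac cp) V (crd_vec hP 0 ac cp).
Qed.

(** Continuity of [h] comes from the subspace topology. Then the embedding followed by a linear left
    inverse of its differential is locally invertible, and [h] is that inverse applied to [g]
    followed by the same linear map. *)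
Lemma embedding_lift (P M Q : charted R) (hP : lman P) (hM : lman M) (hQ : lman Q)
  (k : P -> M) (g : Q -> M) (h : Q -> P) q : embedding k -> smooth_map_at g q ->
 mnbhs q (fun q' => k (h q') = g q') -> smooth_map_at h q.
Proof.
move=> ek sg kh; have [sk _ _ top] := ek; have E0 := mnbhs_self kh.
have hc (A : set P) : mnbhs (h q) A -> mnbhs q (h @^-1` A).
 move=> [ O [oO Oh OA]]; have [ O' oO' EO] := top O oO.
 have n1 : mnbhs (g q) O' by apply: open_mn => //; rewrite -E0; move: Oh; rewrite EO.
 have n2 := smap_cont hQ hM sg n1.
 apply: mnbhs_sub (mnbhsI hQ kh n2) => q' [Eq O'g]; apply: OA.
 by rewrite EO /= Eq.
have [c ac cq] := chart_ex hQ q; have [b ab bh] := chart_ex hP (h q).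
have [d ad dk] := chart_ex hM (k (h q)).
have nb := hc _ (open_mn (copen hP ab) bh).
apply/(smapP hQ hP ac cq ab bh); split=> //.
have dg : d.1 (g q) by rewrite -E0.
have [_ sgh] := (smapP hQ hM ac cq ad dg).1 sg.
have [_ skh] := (smapP hP hM ab bh ad dk).1 (sk (h q)).
have /row_freeP[L JL] := emb_Jac_free hP hM ek ab bh ad dk.
pose kL z := hat b d k (h q) z *m L.
have skL : sm (b.2 (h q)) kL by have := sm_comp_rV skh (sm_lin _ L).
have JkL : Jac kL (b.2 (h q)) = 1%:M.
 apply: Jac_eq => // v; rewrite (derive_compE (f := fun z => z *m L)); last 2 first.
 - exact: sm_diff skh.
 - by apply: sm_diff; exact: sm_lin.
 rewrite (JacE_sm _ skh) (_ : 'D_ _ _ _ = v *m Jac (hat b d k (h q)) (b.2 (h q)) *m L).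
  by rewrite -mulmxA JL.
 apply: derive_val; apply: is_d_eps => e e0; exists 1 => // t _.
 by rewrite mulmxDl addrK -scalemxAl subrr normr0 mulr_ge0 // ltW.
have [|H [sH _ HK _]] := inverse_function skL; first by rewrite JkL unitmx1.
have Eg : hat c d g q (c.2 q) *m L = kL (b.2 (h q)) by rewrite /kL !hatK // E0.
have sC : sm (c.2 q) (fun z => H (hat c d g q z *m L)).
 have sgL : sm (c.2 q) (fun z => hat c d g q z *m L) by have := sm_comp_rV sgh (sm_lin _ L).
 by rewrite -Eg in sH; have := sm_comp_rV sgL sH.
have n3 := hc _ (near_pre hP ab bh HK).
apply: sm_near sC.
have m1 := (mnbhsP hQ _ ac cq).1 n3; have m2 := (mnbhsP hQ _ ac cq).1 kh.
have m3 := cinvP hQ ac cq.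
apply: filterS3 m1 m2 m3 => z [bz Hz] kz [cz Ez].
rewrite -{1}Ez hatK // -kz; move: Hz; by rewrite /kL hatK // => ->.
Qed.

Section Data.
Context {M X P : charted R} (hM : lman M) (hX : lman X) (hP : lman P) (pi : bivector M)
 (i : X -> M) (hpi : poisson_on setT pi) (hi : embedding i) (r : nat) (hr : coregular i pi r)
 (W : X -> set (tvec M)) (hW : is_complement i pi r W) (k : P -> M) (piP : bivector P)
 (hk : poisson_submanifold pi k) (hpiP : poisson_on setT piP) (hkP : poisson_map_on setT piP pi k)
 (chi : cotangent_bundle M -> tvec (cotangent_bundle M)) (hchi : poisson_spray pi chi)
 (Sg : set (cotangent_bundle M)) (oSg : mopen Sg)
 (Sg0 : forall q, Sg (zs id (@tangent R M) (mdim M) q))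
 (hexp : forall xi, Sg xi -> exists p, spray_exp chi xi p) (hran : range i `<=` range k)
 (hsat : range k = [set p | exists xi, [/\ Sg xi, range i (base xi) & spray_exp chi xi p]]).
Local Notation E := (perp_dual i pi r).
Local Notation zE := (zs i (perp i pi) r).
Local Notation fcE := (fchart i (perp i pi)).
Let hF := perp_subbundle hM hX hpi hi hr.
Let hE : lman E := perp_lman hM hX hpi hi hr.
Let jl := jlift hM hpi hW (r := r).

Lemma jl_zs x : jl (zE x) = zs id (@tangent R M) (mdim M) (i x).
Proof.
apply: dual_ext => //; apply/funext => v; rewrite /fib /= /jmap /restr.
by case: ifP.
Qed.

(** On [DE], [f] sends [e] to the point of [P] over $\exp(j(e))$. The matrix [I0] is the
    differential of the inclusion of $X$ in $P$ and [Jm] that of $k^* \circ j$; so the differential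
    of [f] along $X$ is the inclusion on $TX$ and $\pi_P^\sharp \circ k^* \circ j$ on the fibres,
    and the last two clauses give the matrices of $\sigma$ and $\tau$. The clause on [p], [e] and
    [xi] is there to deduce surjectivity from the description of the saturation. *)
Theorem saturation_germ : exists (f : E -> P) (DE : set E),
 [/\ mopen DE, (forall x, DE (zE x)), (forall e, DE e -> smooth_map_at f e),
   (forall x, k (f (zE x)) = i x) /\
    (forall p (e : E) xi, Sg xi -> base xi = i (base e) ->
      fib xi = jmap i pi W (base e) (fib e) -> spray_exp chi xi (k p) -> DE e /\ f e = p) &
   forall x c O s b, atlas X c -> mopen O -> O `<=` c.1 -> frame_on i (perp i pi) O s -> O x ->
    atlas P b -> b.1 (f (zE x)) ->
   exists (I0 : 'M[R]_(mdim X, mdim P)) (Jm : 'M[R]_(r, mdim P)),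
   [/\ row_free (col_mx I0 (Jm *m PM piP b (f (zE x)))),
     Jac (hat (fcE c O s) b f (zE x)) ((fcE c O s).2 (zE x)) =
      col_mx I0 (Jm *m PM piP b (f (zE x))),
     (forall e1 e2 : E, base e1 = x -> base e2 = x ->
       pi (i x) (jmap i pi W x (fib e1)) (jmap i pi W x (fib e2)) =
       dotr ((\row_k fib e1 (s k x)) *m Jm *m PM piP b (f (zE x)) *m Jm^T) (\row_k fib e2 (s k x))) &
     (forall (e : E) v, base e = x -> tangent x v ->
       jmap i pi W x (fib e) (push i x v) = dotr ((\row_k fib e (s k x)) *m Jm *m I0^T) (crd c v))]].
Proof.
have [Ex [sEx Exu Exs Ex0 dEx]] := spray_exponential hM hpi hchi oSg Sg0 hexp.
pose Xi (e : E) : M := Ex (jl e).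
have sjl e : smooth_map_at jl e by exact: jlift_smooth.
have hT := cotangent_lman hM.
pose DE : set E := jl @^-1` Sg.
have oDE : mopen DE.
 apply/(mopenP hE) => e De; apply: (smap_cont hE hT (sjl e)).
 exact: open_mn.
have DEz x : DE (zE x) by rewrite /DE /= jl_zs; exact: Sg0.
have sXi e : DE e -> smooth_map_at Xi e.
 move=> De; exact: (smap_comp hE hT hM (sjl e) (sEx _ De)).
have [ek kpi] := hk; have [sk kij kinj _] := ek.
have lift e : exists p, DE e -> k p = Xi e.
 have [De|nD] := pselect (DE e); last first.
  by have [x _ _] := hran (ex_intro2 _ _ (base e) I erefl : range i (i (base e))); exists x.
 (* The covectors $j(e)$ sit over $X$, and the saturation contains the exponential of every covector
    of [Sg] over $X$, whatever complement was used to describe it. *)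
 have : range k (Xi e).
  by rewrite hsat; exists (jl e); split; [exact: De|by exists (base e)|exact: Exs].
 by move=> [p _ E]; exists p.
have [f hf] := choice lift.
have sf e : DE e -> smooth_map_at f e.
 move=> De; apply: (embedding_lift hP hM hE ek (sXi e De)).
 exists DE; split=> // e' De'; exact: hf.
have kf x : k (f (zE x)) = i x by rewrite hf // /Xi jl_zs Ex0.
exists f, DE; split=> //.
 split=> // p e xi Sxi bx fx sx.
 have xE : xi = jl e by exact: dual_ext.
 have De : DE e by rewrite /DE /= -xE.
 by split=> //; apply: kinj; rewrite hf // /Xi -xE; apply: esym; exact: Exu.
move=> x c O s b ac oO Oc fr Ox ab bf.
have cx := Oc _ Ox; have [d ad dx] := chart_ex hM (i x).
have dk : d.1 (k (f (zE x))) by rewrite kf.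
have aC := fatlas ac oO Oc fr; set C := fcE c O s in aC *.
have Cz : C.1 (zE x) by [].
set p0 := f (zE x) in bf dk *; set Pi := PM piP b p0.
set G := Jac _ _.
pose kJ := Jac (hat b d k p0) (b.2 p0).
have kJf : row_free kJ by exact: emb_Jac_free.
pose PiM := PM pi d (i x).
(* [k] is a Poisson map: along [k], the bivector of $M$ is the image of that of $P$. *)
have PiE : PiM = kJ^T *m Pi *m kJ.
 apply: mulmx_row_inj => a; apply: dotr_inj => a'.
 have ta := covecT hM d (i x) a; have ta' := covecT hM d (i x) a'.
 have tka : cotangent (k p0) (covec d (i x) a) by rewrite kf.
 have tka' : cotangent (k p0) (covec d (i x) a') by rewrite kf.
 have := hkP (I : setT p0) tka tka'; rewrite kf (pi_crd hM (pi_skew hpi (i x)) ad dx ta ta').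
 rewrite !ccrd_covec // (pi_crd hP (pi_skew hpiP p0) ab bf); try exact: copullT.
 rewrite !(copull_ccrd hP hM ab bf ad dk (sk p0)) // -/kJ kf !ccrd_covec // => <-.
 by rewrite dotr_mulmx trmxK !mulmxA.
have [J [sJ /mnbhs_self[_ _ SJ jE]]] := jmap_smooth hM hX hpi hi hW ac ad Oc dx oO Ox fr.
pose Jm := J (c.2 x) *m kJ^T.
have Dz := DEz x.
have [_ sfh] := (smapP hE hP aC Cz ab bf).1 (sf _ Dz).
have tz v : tangent (zE x) (vec C (zE x) v) by exact: (vecT hE v aC Cz).
pose I0 : 'M[R]_(mdim X, mdim P) := usubmx (G : 'M[R]_(mdim X + r, mdim P)).
have Edx : d.1 (Xi (zE x)) by rewrite /Xi jl_zs Ex0.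
have Gk : G *m kJ = Jac (hat C d Xi (zE x)) (C.2 (zE x)).
 have [_ skh] := (smapP hP hM ab bf ad dk).1 (sk p0).
 have Ep : hat C b f (zE x) (C.2 (zE x)) = b.2 p0 by rewrite hatK.
 rewrite /G /kJ -Ep -Jac_comp; [|exact: sm_diff|by rewrite Ep; exact: sm_diff].
 apply: Jac_near; have n1 := (mnbhsP hE _ aC Cz).1 (open_mn oDE Dz).
 have n2 := smap_cont hE hP (sf _ Dz) (open_mn (copen hP ab) bf).
 have n3 := (mnbhsP hE _ aC Cz).1 n2.
 apply: filterS2 n1 n3 => z Dz' bz; rewrite /hat /= cinvK //.
 by rewrite hf.
have [_ sXh] := (smapP hE hM aC Cz ad Edx).1 (sXi _ Dz).
have Iu (u : 'rV[R]_(mdim X)) : row_mx u 0 *m Jac (hat C d Xi (zE x)) (C.2 (zE x)) =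
  u *m Jac (hat c d i x) (c.2 x).
 rewrite -(JacE_sm _ sXh).
 have D1 := @line_derive R _ _ (hat C d Xi (zE x)) (C.2 (zE x)) (row_mx u (0 : 'rV[R]_r)) 0.
 rewrite scale0r addr0 in D1; have {}D1 := D1 (sm_diff sXh).
 have [_ sih] := (smapP hX hM ac cx ad dx).1 (embS hi x).
 have D2 := @line_derive R _ _ (hat c d i x) (c.2 x) u 0.
 rewrite scale0r addr0 in D2; have {}D2 := D2 (sm_diff sih).
 have [_ V1] := D1; have [_ V2] := D2; rewrite -(JacE_sm _ sih) -V1 -V2.
 apply: near_eq_derive.
 have cl : {for (0 : R), continuous (fun t : R => c.2 x + t *: u)} by exact: line_cont.
 have n1 : \forall t \near (0 : R), c.1 (cinv c x (c.2 x + t *: u)) /\ O (cinv c x (c.2 x + t *: u)).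
  have n2 : \forall z \near c.2 x + 0 *: u, c.1 (cinv c x z) /\ O (cinv c x z).
   rewrite scale0r addr0; apply: filterI; last exact: ((mnbhsP hX _ ac cx).1 (open_mn oO Ox)).
   by have h := cinvP hX ac cx; apply: filterS h => z [].
  exact: cl _ n2.
 have n3 : \forall t \near (0 : R), c.2 (cinv c x (c.2 x + t *: u)) = c.2 x + t *: u.
  have n2 : \forall z \near c.2 x + 0 *: u, c.2 (cinv c x z) = z.
   by rewrite scale0r addr0; have h := cinvP hX ac cx; apply: filterS h => z [].
  exact: cl _ n2.
 apply: filterS2 n1 n3 => t [c1 O1] c2.
 have -> : C.2 (zE x) + t *: row_mx u 0 = C.2 (zE (cinv c x (c.2 x + t *: u))).
  by rewrite !zsE c2 scale_row_mx add_row_mx scaler0 addr0.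
 rewrite hatK; [|exact: hE|exact: aC|exact: O1].
 rewrite -{2}c2 hatK; [|exact: hX|exact: ac|exact: c1].
 by rewrite /Xi jl_zs Ex0.
have ey (y : 'rV[R]_r) : row_mx 0 y *m Jac (hat C d Xi (zE x)) (C.2 (zE x)) =
  y *m J (c.2 x) *m PiM.
 have [bs _] := fr _ Ox; have [e [Ee fe]] := dual_ex hF (fun l => y 0 l) bs.
 have yE : \row_l fib e (s l x) = y by apply/rowP => l; rewrite mxE fe.
 rewrite -(JacE_sm _ sXh).
 have D1 := @line_derive R _ _ (hat C d Xi (zE x)) (C.2 (zE x)) (row_mx (0 : 'rV[R]_(mdim X)) y) 0.
 rewrite scale0r addr0 in D1; have {}D1 := D1 (sm_diff sXh).
 have bj : base (jl e) = i x by rewrite -Ee.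
 have dje : d.1 (base (jl e)) by rewrite bj.
 have D2 := dEx (jl e) d ad dje.
 have [_ V1] := D1; rewrite -V1; have [_] := D2; rewrite bj (jE _ Ee) yE => <-.
 have -> : (fun s : R^o => hat C d Xi (zE x) (C.2 (zE x) + s *: row_mx 0 y)) =
  (fun t : R^o => d.2 (Ex (fscale t (jl e)))); last by [].
 apply/funext => t; rewrite -[fscale t (jl e)]jlift_fscale.
 have -> : C.2 (zE x) + t *: row_mx 0 y = C.2 (fscale t e).
  rewrite fscaleE /C zsE /fchart /= Ee yE /lp /rp row_mxKl row_mxKr.
  by rewrite scale_row_mx add_row_mx scaler0 addr0 add0r.
 have Ce : C.1 (fscale t e) by rewrite /C /fchart /= /ebase /= -[base _]/(base e) Ee.
 by rewrite hatK.
have Ik : I0 *m kJ = Jac (hat c d i x) (c.2 x).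
 apply: mulmx_row_inj => u; rewrite -Iu -Gk [in RHS]mulmxA.
 rewrite -[G in RHS](@vsubmxK _ (mdim X) r) mul_row_col mul0mx addr0.
 by rewrite -mulmxA.
have dG : dsubmx (G : 'M[R]_(mdim X + r, mdim P)) = Jm *m Pi.
 have : dsubmx (G : 'M[R]_(mdim X + r, mdim P)) *m kJ = Jm *m Pi *m kJ.
  apply: mulmx_row_inj => y; have := ey y; rewrite -Gk [in LHS]mulmxA.
  rewrite -[G in LHS](@vsubmxK _ (mdim X) r) mul_row_col mul0mx add0r => E.
  by rewrite mulmxA E PiE /Jm !mulmxA.
 by move: kJf => /row_freeP[L KL] /(congr1 (mulmx^~ L)); rewrite -!mulmxA KL !mulmx1.
exists I0, Jm; split.
(* For $(u, y)$ in the kernel, the relation is moved to $M$ and paired with covectors [al] in the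
   annihilator of $TX$ whose images under [sharp] are the frame. This kills the part of [u] and, by
   skewness, leaves [y] up to sign; then [u] vanishes because [i] is an immersion. *)
- apply: inj_row_free => v; rewrite -[v](@hsubmxK _ _ (mdim X) r) mul_row_col.
 set u := lsubmx v; set y := rsubmx v => E0.
 have {}E0 : u *m Jac (hat c d i x) (c.2 x) + y *m J (c.2 x) *m PiM = 0.
  have := congr1 (mulmx^~ kJ) E0; rewrite mul0mx mulmxDl -Ik PiE /Jm.
  by rewrite !mulmxA.
 have [al [alI alS]] : exists al : 'M[R]_(r, mdim M), al *m (Jac (hat c d i x) (c.2 x))^T = 0 /\
   Smx d s x = al *m PiM.
  have [bs _] := fr _ Ox; have [Ps _ _] := bs.
  have h l : exists a, annihilator i x a /\ sharp pi (i x) a = s l x.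
   by have [a aa E] := Ps l; exists a.
  have [a ha] := choice h; exists (\matrix_(l, j) ccrd d (i x) (a l) 0 j); split.
   apply/row_matrixP => l; rewrite row_mul row0.
   have [aa _] := ha l; have [ta _] := aa.
   have := (@annihilatorP _ _ _ hM hX i hi c d x ac ad x _ cx dx ta).1 aa => <-.
   by congr (_ *m _); apply/rowP => j; rewrite !mxE.
  apply/row_matrixP => l; rewrite Smx_row row_mul; have [[ta _] <-] := ha l.
  rewrite (sharp_crd hM (pi_skew hpi (i x)) ad dx ta); congr (_ *m _).
  by apply/rowP => j; rewrite !mxE.
 have skP := PM_skew hM d (pi_skew hpi (i x)); rewrite -/PiM in skP.
 have y0 : y = 0.
  have := congr1 (mulmx^~ al^T) E0; rewrite mul0mx mulmxDl -[u *m _ *m _]mulmxA.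
  rewrite -[Jac _ _ *m al^T]trmxK trmx_mul trmxK alI trmx0 mulmx0 add0r.
  rewrite -!mulmxA -[PiM *m al^T]trmxK trmx_mul trmxK skP mulmxN -alS linearN /= mulmxN mulmxN.
  rewrite -[J _ *m _]trmxK trmx_mul trmxK SJ trmx1 mulmx1 => /eqP.
  by rewrite oppr_eq0 => /eqP.
 have u0 : u = 0.
  apply: (@I_inj _ _ _ hM hX i hi c d x ac ad x _ cx dx).
  by move: E0; rewrite y0 !mul0mx addr0.
 by rewrite u0 y0 row_mx0.
- by rewrite -dG /I0 vsubmxK.
- move=> e1 e2 b1 b2; have j1 := jE _ b1; have j2 := jE _ b2.
 have t1 : cotangent (i (base e1)) (fib (jl e1)) := svalP (jl e1).
 have t2 : cotangent (i (base e2)) (fib (jl e2)) := svalP (jl e2).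
 rewrite b1 in t1; rewrite b2 in t2.
 have F1 : jmap i pi W x (fib e1) = fib (jl e1) by rewrite -b1.
 have F2 : jmap i pi W x (fib e2) = fib (jl e2) by rewrite -b2.
 rewrite F1 F2 (pi_crd hM (pi_skew hpi (i x)) ad dx t1 t2) j1 j2.
 by rewrite -/PiM PiE dotr_mulmx /Jm trmx_mul trmxK !mulmxA.
move=> e v be tv; have je := jE _ be.
have t1 : cotangent (i (base e)) (fib (jl e)) := svalP (jl e).
rewrite be in t1; have F1 : jmap i pi W x (fib e) = fib (jl e) by rewrite -be.
have tp := pushT hX hM (embS hi x) tv.
rewrite F1 (cotangentE hM ad dx t1 tp) je.
rewrite (push_crd hX hM ac cx ad dx (embS hi x) tv) -Ik dotr_mulmx trmx_mul /Jm.
by rewrite !mulmxA.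
Qed.

End Data.
End Germ.

HB.instance Definition _ (R : realType) (d : nat) :=
 Uniform_isComplete.Build 'rV[R]_d.+1 (@cauchy_cvg 'rV[R]_d.+1).

(** * The dimension of the saturation *)

Section Dimension.
Context {R : realType}.

Lemma grid_index (h t : R) K : 0 <= h -> 0 <= t <= K.+1%:R * h ->
 exists i : 'I_K.+1, i%:R * h <= t <= i.+1%:R * h.
Proof.
move=> h0; elim: K => [|K IH] /andP[t0 t1].
 by exists ord0; rewrite mul0r t0 t1.
have [tK|tK] := lerP t (K.+1%:R * h).
 have [|i hi] := IH; first by rewrite t0 tK.
 by exists (widen_ord (leqnSn _) i).
by exists ord_max; rewrite /= (ltW tK) t1.
Qed.

(** Pigeonhole: the cube is cut into $(q(N + 1))^n$ cells of side less than the separation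
    [c / N.+1], so different points lie in different cells. *)
Lemma separated_grid n d (N q : nat) (a : 'rV[R]_n) (s c : R) (x : {ffun 'I_d -> 'I_N.+1} -> 'rV[R]_n) :
 (0 < q)%N -> 0 < s -> s < q%:R * c ->
 (forall al j, a 0 j <= x al 0 j <= a 0 j + s) ->
 (forall al be, al != be -> c / N.+1%:R <= `|x al - x be|) ->
 (N.+1 ^ d <= (q * N.+1) ^ n)%N.
Proof.
move=> q0 s0 sqc xin sep; pose K := (q * N.+1)%N; have K0 : (0 < K)%N by rewrite muln_gt0 q0.
pose h := s / K%:R; have KR : 0 < K%:R :> R by rewrite ltr0n.
have h0 : 0 < h by rewrite divr_gt0.
have ex al : exists f : {ffun 'I_n -> 'I_K.-1.+1}, forall j,
  (f j)%:R * h <= x al 0 j - a 0 j <= (f j).+1%:R * h.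
 have e j : exists i : 'I_K.-1.+1, i%:R * h <= x al 0 j - a 0 j <= i.+1%:R * h.
  apply: grid_index; first exact: ltW.
  rewrite prednK // /h mulrCA divff ?mulr1; last by rewrite gt_eqF.
  by move: (xin al j) => /andP[x1 x2]; lra.
 have [f hf] := choice e; exists [ffun j => f j] => j; rewrite ffunE; exact: hf.
have [f hf] := choice ex.
have inj : injective f.
 move=> al be E; apply/eqP; apply: contraT => ne; have := sep _ _ ne.
 rewrite leNgt => /negP[]; apply: le_lt_trans (_ : h < _); last first.
  rewrite /h /K natrM invfM mulrA ltr_pM2r ?invr_gt0 ?ltr0n //.
  by rewrite ltr_pdivrMr ?ltr0n // mulrC.
 apply/(norm_le_rV _ (ltW h0)) => j; rewrite !mxE.
 have /andP[x1 x2] := hf al j; have /andP[y1 y2] := hf be j; rewrite -E in y1 y2.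
 move: x1 x2 y1 y2; rewrite -natr1 mulrDl mul1r; set u := _ * h => x1 x2 y1 y2.
 by rewrite ler_norml; lra.
have := leq_card f inj; rewrite !card_ffun !card_ord prednK //.
Qed.

(** Otherwise the image would come arbitrarily close to all $(N + 1)^d$ points of a grid near [y].
    By the Lipschitz bound, points of the cube with such images are separated, and a cube of
    dimension $n < d$ has no room for that many. *)
Lemma lipschitz_sparse n d (g : 'rV[R]_n -> 'rV[R]_d) (a : 'rV[R]_n) (s L : R) (y : 'rV[R]_d) (rho : R) :
 (n < d)%N -> 0 < s -> 0 <= L -> 0 < rho ->
 (forall x x' : 'rV[R]_n, (forall j, a 0 j <= x 0 j <= a 0 j + s) -> (forall j, a 0 j <= x' 0 j <= a 0 j + s) ->
   `|g x - g x'| <= L * `|x - x'|) ->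
 exists y' rho', [/\ 0 < rho', `|y' - y| < rho &
  forall x : 'rV[R]_n, (forall j, a 0 j <= x 0 j <= a 0 j + s) -> rho' <= `|g x - y'|].
Proof.
move=> nd s0 L0 rho0 lip; apply: contrapT => nex.
pose c := rho / (4 * (L + 1)); have c0 : 0 < c by rewrite divr_gt0 // mulr_gt0 // ltr_wpDl.
have [q hq] : exists q : nat, s / c < q%:R.
 by exists (Num.truncn (s / c)).+1; exact: (truncnS_gt (s / c)).
have q0 : (0 < q)%N by rewrite -(ltr0n R); apply: le_lt_trans hq; rewrite divr_ge0 // ltW.
have sqc : s < q%:R * c by rewrite -ltr_pdivrMr.
(* With this [N] the count $(N + 1)^d \le (q(N + 1))^n$ fails, since $q^n < N + 1$ and $n < d$. *)
pose N := (q ^ n)%N.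
pose yy (al : {ffun 'I_d -> 'I_N.+1}) : 'rV[R]_d := \row_j (y 0 j + rho / 2 * ((al j)%:R / N.+1%:R)).
have N0 : 0 < N.+1%:R :> R by rewrite ltr0n.
have ynear al : `|yy al - y| < rho.
 apply/(rV_norm_lt _ rho0) => j; rewrite !mxE addrAC subrr add0r.
 have b1 : 0 <= (al j)%:R / N.+1%:R :> R by rewrite divr_ge0 // ltW.
 have b2 : (al j)%:R / N.+1%:R <= 1 :> R by rewrite ler_pdivrMr // mul1r ler_nat ltnW.
 rewrite ger0_norm ?mulr_ge0 //; last lra.
 by move: b1 b2; set t := _ / _ => b1 b2; nra.
have hx al : exists x : 'rV[R]_n, (forall j, a 0 j <= x 0 j <= a 0 j + s) /\ `|g x - yy al| < rho / (8 * N.+1%:R).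
 apply: contrapT => h; apply: nex; exists (yy al), (rho / (8 * N.+1%:R)); split=> //.
  by rewrite divr_gt0 // mulr_gt0.
 move=> x hx; rewrite leNgt; apply/negP => lt; apply: h; by exists x.
have [x xP] := choice hx.
have sepx al be : al != be -> c / N.+1%:R <= `|x al - x be|.
 move=> ne.
 have [x1 e1] := xP al; have [x2 e2] := xP be.
 have yne : rho / (2 * N.+1%:R) <= `|yy al - yy be|.
  have [j nej] : exists j, al j != be j.
   apply/existsP; rewrite -negb_forall; apply: contra ne => /forallP h.
   by apply/eqP/ffunP => j; apply/eqP.
  apply: le_trans (coord_le _ j); rewrite !mxE opprD addrACA subrr add0r -mulrBr -mulrBl.
  have dn : 1 <= `|(al j)%:R - (be j)%:R| :> R.
   have : (al j : nat) != be j by [].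
   rewrite neq_ltn => /orP[lt|lt].
    rewrite distrC ger0_norm; last by rewrite subr_ge0 ler_nat ltnW.
    by rewrite lerBrDr -(natrD _ 1) ler_nat add1n.
   rewrite ger0_norm; last by rewrite subr_ge0 ler_nat ltnW.
   by rewrite lerBrDr -(natrD _ 1) ler_nat add1n.
  rewrite [X in _ <= X]normrM [X in _ <= _ * X]normrM normfV (gtr0_norm N0) [`|rho / 2|]gtr0_norm ?divr_gt0 //.
  rewrite invfM mulrA; apply: ler_wpM2l; first by rewrite divr_ge0 // ltW.
  by rewrite ler_peMl // invr_ge0 ltW.
 have := ler_distD (g (x al)) (yy al) (yy be); rewrite [`|yy al - g _|]distrC => t1.
 have := ler_distD (g (x be)) (g (x al)) (yy be) => t2.
 have := lip _ _ x1 x2 => t3.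
 rewrite /c; move: yne t1 t2 t3 e1 e2.
 have E8 : rho / (8 * N.+1%:R) = rho / N.+1%:R / 8 by rewrite invfM mulrCA mulrA [LHS]mulrC mulrA; field; rewrite gt_eqF.
 have E2 : rho / (2 * N.+1%:R) = rho / N.+1%:R / 2 by field; rewrite gt_eqF.
 rewrite E8 E2; set w := rho / N.+1%:R; set D := `|x al - x be|.
 move=> h1 h2 h3 h4 h5 h6; have hD : w / 4 <= L * D by lra.
 have D0 : 0 <= D by rewrite normr_ge0.
 rewrite (_ : rho / (4 * (L + 1)) / N.+1%:R = w / 4 / (L + 1)); last first.
  by rewrite /w; field; rewrite !gt_eqF // ltr_wpDl.
 rewrite ler_pdivrMr; last by rewrite ltr_wpDl.
 by nra.
have := @separated_grid n d N q a s c x q0 s0 sqc (fun al => (xP al).1) sepx.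
rewrite leqNgt => /negP; apply; rewrite expnMn.
have : (q ^ n * N.+1 ^ n < N.+1 * N.+1 ^ n)%N by rewrite ltn_pmul2r // expn_gt0.
by rewrite -expnS => h; apply: leq_trans h _; rewrite leq_exp2l // ?ltnS // expn_gt0 q0.
Qed.

(** Near each point a smooth map is Lipschitz on a small cube with rational corner, so countably
    many pairs of an index and a cube account for all values. If $n < d$, each of these images keeps
    a positive distance from the points of an open dense set, and by Baire's theorem some point of
    the ball is in all these sets. *)
Lemma smooth_cover_dim n d (Z : nat -> set 'rV[R]_n) (g : nat -> 'rV[R]_n -> 'rV[R]_d) y0 (rho : R) :
 0 < rho -> (forall k z, Z k z -> sm z (g k)) ->
 (forall y, `|y - y0| < rho -> exists k z, Z k z /\ g k z = y) -> (d <= n)%N.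
Proof.
move=> rho0 sg cov; rewrite leqNgt; apply/negP => nd.
case: d nd g y0 sg cov => // d nd g y0 sg cov.
pose cube (q : 'rV[rat]_n) (m : nat) (x : 'rV[R]_n) :=
 forall j, ratr (q 0 j) <= x 0 j <= ratr (q 0 j) + m.+1%:R^-1.
pose good k q m := exists2 L : R, 0 <= L & forall x x', cube q m x -> cube q m x' ->
 `|g k x - g k x'| <= L * `|x - x'|.
pose far k q m (y : 'rV[R]_d.+1) := exists2 e : R, 0 < e & forall x, cube q m x -> e <= `|g k x - y|.
(* Codes of no cube, or of a cube on which the map is not Lipschitz, impose no condition. *)
pose F (i : nat) : set 'rV[R]_d.+1 := [set y | forall k q m,
 unpickle i = Some (k, q, m) -> good k q m -> far k q m y].
have oF i : open (F i) /\ dense (F i).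
 case iE: (unpickle i : option (nat * 'rV[rat]_n * nat)%type) => [[[k q] m]|].
 - have [gd|ng] := pselect (good k q m); last first.
   have -> : F i = setT.
    apply/seteqP; split=> // y _ k' q' m'; rewrite iE => -[<- <- <-] gd; exfalso; exact: ng.
   split; first exact: openT.
   by move=> O [y Oy] _; exists y.
  have FE : F i = [set y | far k q m y].
   apply/seteqP; split=> [y Fy|y fy k' q' m']; first exact: Fy iE gd.
   by rewrite iE => -[<- <- <-].
  rewrite FE; split.
   rewrite openE => y [e e0 he]; apply/nbhs_ballP; exists (e / 2); first by rewrite /= divr_gt0.
   move=> y'; rewrite -ball_normE /= => yy'; exists (e / 2); first by rewrite divr_gt0.
   move=> x cx; have := he _ cx; have := ler_distD y' (g k x) y.
   rewrite [`|y' - y|]distrC; lra.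
  move=> O [y Oy] oO; have : nbhs y O by exact: open_nbhs_nbhs.
  move=> /nbhs_ballP[e e0 eO]; case: gd => L L0 lip.
  have s0 : 0 < m.+1%:R^-1 :> R by rewrite invr_gt0 ltr0n.
  have [x x' hx hx'|y' [e' [e'0 yy' h]]] := @lipschitz_sparse n d.+1 (g k)
    (\row_j ratr (q 0 j)) m.+1%:R^-1 L y e nd s0 L0 e0.
   by apply: lip => j; [have := hx j|have := hx' j]; rewrite mxE.
  exists y'; split; first by apply: eO; rewrite -ball_normE /= distrC.
  by exists e' => // x cx; apply: h => j; rewrite mxE; exact: cx.
 have -> : F i = setT by apply/seteqP; split=> // y _ k' q' m'; rewrite iE.
 split; first exact: openT.
 by move=> O [y Oy] _; exists y.
have ne : ball y0 rho !=set0 by exists y0; exact: ballxx.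
have [y [By Fy]] := @Baire R 'rV[R]_d.+1 F oF _ ne (ball_open y0 rho).
have yb : `|y - y0| < rho by move: By; rewrite -ball_normE /= distrC.
have [k [z [Zz gz]]] := cov _ yb.
have [L [r [L0 r0 lip]]] := sm_lip (sg _ _ Zz).
have [m hm] : exists m : nat, m.+1%:R^-1 < r.
 exists (Num.truncn (r^-1)); rewrite invf_plt ?posrE ?ltr0n //; exact: truncnS_gt.
have s0 : 0 < m.+1%:R^-1 :> R by rewrite invr_gt0 ltr0n.
have [q hq] : exists q : 'rV[rat]_n, cube q m z.
 have h j : exists q : rat, ratr q <= z 0 j <= ratr q + m.+1%:R^-1.
  have lt : z 0 j - m.+1%:R^-1 < z 0 j by rewrite ltrBlDr ltrDl.
  have [q] := rat_in_itvoo lt; rewrite in_itv /= => /andP[h1 h2]; exists q.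
  by rewrite (ltW h2) -lerBlDr ltW.
 have [f hf] := choice h; exists (\row_j f j) => j; rewrite mxE; exact: hf.
have cz x : cube q m x -> `|x - z| < r.
 move=> cx; apply: le_lt_trans hm; apply/(norm_le_rV _ (ltW s0)) => j; rewrite !mxE.
 have /andP[x1 x2] := cx j; have /andP[y1 y2] := hq j.
 move: x1 x2 y1 y2; set a := ratr _; set w := _^-1; move: (x 0 j) (z 0 j) a w => xj zj a w x1 x2 y1 y2.
 by rewrite ler_norml; lra.
have gd : good k q m.
 by exists L => // x x' cx cx'; apply: lip; exact: cz.
have [e e0 he] := Fy (pickle (k, q, m)) I k q m (pickleK _) gd.
by have := he _ hq; rewrite gz subrr normr0 leNgt e0.
Qed.

Lemma smooth_surjection_dim (E P : charted R) (hE : lman E) (hP : lman P) (C : nat -> cht E)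
  (A : nat -> set E) (f : E -> P) (DE : set E) (p0 : P) :
 (forall e, exists k, A k e) ->
 (forall k e, A k e -> [/\ atlas E (C k), mopen (A k) & A k `<=` (C k).1]) ->
 mopen DE -> (forall e, DE e -> smooth_map_at f e) -> (forall p, exists2 e, DE e & f e = p) ->
 (mdim P <= mdim E)%N.
Proof.
move=> covA hA oDE sf surj; have [b ab bp] := chart_ex hP p0; have [e0 _ _] := surj p0.
have oU : mopen (DE `&` f @^-1` b.1).
 apply/(mopenP hE) => e [De be]; apply: (mnbhsI hE); first exact: open_mn.
 by apply: (smap_cont hE hP (sf e De)); apply: open_mn => //; exact: copen ab.
pose Z k (z : 'rV[R]_(mdim E)) := exists e, [/\ A k e, DE e, b.1 (f e) & (C k).2 e = z].
pose g k := hat (C k) b f e0.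
have nV : \forall z \near b.2 p0, exists q, b.1 q /\ b.2 q = z.
 by have h := cinvP hP ab bp; apply: filterS h => z [h1 h2]; exists (cinv b p0 z).
move: nV => /nbhs_ballP[rho rho0 hrho].
apply: (@smooth_cover_dim (mdim E) (mdim P) Z g (b.2 p0) rho rho0).
 move=> k z [e [Ae De be <-]]; have [aC oA AC] := hA k e Ae.
 have [_ s] := (smapP hE hP aC (AC _ Ae) ab be).1 (sf e De).
 apply: sm_near s.
 by have h := hat_indep hE b f e0 aC (AC _ Ae); apply: filterS h => w E'; rewrite /g E'.
move=> y yb; have [q [bq Eq]] : exists q, b.1 q /\ b.2 q = y.
 by apply: hrho; rewrite -ball_normE /= distrC.
have [e De fe] := surj q; have [k Ake] := covA e; have [aC oA AC] := hA k e Ake.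
exists k, ((C k).2 e); split; first by exists e; split=> //; rewrite fe.
by rewrite /g hatK ?fe //; exact: AC.
Qed.

(** Second countability of the base: for each basic open set one bundle chart whose domain contains
    it is chosen, if there is any, and these charts cover. *)
Lemma bundle_countable (M N : charted R) (hN : is_manifold N) (phi : N -> M) (F : N -> set (tvec M)) r
  (hF : subbundle phi F r) :
 exists (C : nat -> cht (dual_bundle phi F r)) (A : nat -> set (dual_bundle phi F r)),
  (forall e, exists k, A k e) /\
  (forall k e, A k e -> [/\ atlas (dual_bundle phi F r) (C k), mopen (A k) & A k `<=` (C k).1]).
Proof.
have hN' := manifold_lman hN; have [_ _ _ _ [B [oB hB]]] := hN.
pose good k (d : cht N * (set N * ('I_r -> N -> tvec M))) :=
 [/\ atlas N d.1, mopen d.2.1, d.2.1 `<=` d.1.1, frame_on phi F d.2.1 d.2.2 & B k `<=` d.2.1].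
have h k : exists d, (exists d, good k d) -> good k d.
 have [[d hd]|n] := pselect (exists d, good k d); first by exists d.
 have c0 : cht N := (setT, fun _ => 0 : 'rV[R]_(mdim N)).
 by exists (c0, (set0, fun _ _ => 0 : tvec M)).
have [d hd] := choice h.
exists (fun k => fchart phi F (d k).1 (d k).2.1 (d k).2.2).
exists (fun k e => good k (d k) /\ B k (ebase e)); split.
 move=> e; have [c [ O [s [ac oO Oc fr Oe]]]] := echart_ex hN' hF e.
 have [k [Bk BO]] := hB (base e) O oO Oe; exists k; split=> //.
 by apply: hd; exists (c, (O, s)); split.
move=> k e [gk _]; have [ac oO Oc fr BO] := gk; split; first exact: fatlas.
 have := base_open hN' hF (oB k); congr mopen; apply/seteqP; split=> [e' Be|e' []] //.
by move=> e' [_ Be]; exact: BO.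
Qed.

End Dimension.

(** * Linear algebra of the Moser equations *)

Section MoserAlgebra.
Context {R : realType}.

Lemma derive_dotr n p z v (a b : 'rV[R]_n -> 'rV[R]_p) : sm z a -> sm z b ->
 'D_v (fun z => dotr (a z) (b z) : R^o) z = dotr ('D_v a z) (b z) + dotr (a z) ('D_v b z).
Proof.
move=> /smM_row sa /smM_row sb; have sbt := smM_tr sb.
rewrite -(derive_smM v 0 0 (smM_mul sa sbt)) (derive_mul v sa sbt) mxE; congr (_ + _).
rewrite /dotr; congr ((_ *m _) 0 0); apply/matrixP => i j; rewrite ord1 (derive_smM v i 0 sbt) mxE.
by rewrite (derive_smM v 0 i sb); apply: near_eq_derive; apply: filterE => w; rewrite mxE.
Qed.

Lemma sm_mulmx n p q z (a : 'rV[R]_n -> 'rV[R]_p) (A : 'rV[R]_n -> 'M[R]_(p, q)) :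
 sm z a -> smM z A -> sm z (fun z => a z *m A z).
Proof. by move=> sa sA; apply/smM_row; apply: smM_mul => //; exact/smM_row. Qed.

Lemma sm_dotr n p z (a b : 'rV[R]_n -> 'rV[R]_p) : sm z a -> sm z b ->
 sm z (fun z => dotr (a z) (b z) : R^o).
Proof.
by move=> sa sb; have := smM_mul ((smM_row _ _).2 sa) (smM_tr ((smM_row _ _).2 sb)); move/(_ 0 0).
Qed.

Lemma derive_bil n p q z v (a : 'rV[R]_n -> 'rV[R]_p) (A : 'rV[R]_n -> 'M[R]_(p, q)) b :
 sm z a -> smM z A -> sm z b ->
 'D_v (fun z => dotr (a z *m A z) (b z) : R^o) z =
 dotr ('D_v a z *m A z) (b z) + dotr (a z *m 'D_v A z) (b z) + dotr (a z *m A z) ('D_v b z).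
Proof.
move=> sa sA sb; rewrite (derive_dotr v (sm_mulmx sa sA) sb).
rewrite (derive_mul v ((smM_row _ _).2 sa) sA) -[X in dotr (X + _)]scale1r dotrDl mul1r.
by [].
Qed.

Lemma derive_cstv n (W : normedModType R) z (v : 'rV[R]_n) (w : W) : 'D_v (fun _ => w) z = 0.
Proof. exact: derive_cst. Qed.

Lemma derive_bil_cst n p q z v (a : 'rV[R]_p) (A : 'rV[R]_n -> 'M[R]_(p, q)) b : smM z A ->
 'D_v (fun z => dotr (a *m A z) b : R^o) z = dotr (a *m 'D_v A z) b.
Proof.
move=> sA; rewrite (derive_bil v (sm_cst z a) sA (sm_cst z b)) !derive_cstv.
by rewrite mul0mx /dotr trmx0 mul0mx mulmx0 !mxE add0r addr0.
Qed.

Lemma derive_smMc n m p q z v (g : 'rV[R]_n -> 'rV[R]_m) (A : 'rV[R]_m -> 'M[R]_(p, q)) :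
 sm z g -> smM (g z) A -> 'D_v (fun z => A (g z)) z = 'D_('D_v g z) A (g z).
Proof.
move=> sg sA; apply/matrixP => i j.
rewrite (derive_smM v i j (smM_comp sg sA)) (derive_smM _ i j sA).
exact: (derive_compE (f := fun z => A z i j : R^o) v (sm_diff sg) (sm_diff (sA i j))).
Qed.

Lemma dotr_skew n (A : 'M[R]_n) a b : A^T = - A -> dotr (a *m A) b = - dotr (b *m A) a.
Proof.
move=> sk; rewrite -(dotrC b) dotr_mulmx sk /dotr mulmxN mulNmx mxE; congr (- _).
Qed.

Lemma dotrNl n (a b : 'rV[R]_n) : dotr (- a) b = - dotr a b.
Proof. by rewrite /dotr mulNmx mxE. Qed.

Lemma dotrDl1 n (a b v : 'rV[R]_n) : dotr (a + b) v = dotr a v + dotr b v.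
Proof. by rewrite -[a]scale1r dotrDl mul1r scale1r. Qed.

(** The bare arithmetic of [pull_closed], kept apart so that [lra] meets variables instead of
    derivatives; the equalities are fed to it one at a time. *)
Lemma cancel_sum (x y z a1 a2 a3 b1 b2 b3 c1 c2 c3 : R) :
 x = a1 + b1 + c1 -> y = a2 + b2 + c2 -> z = a3 + b3 + c3 ->
 a2 = a1 -> forall f, a3 = f -> c3 = c2 -> c1 = - f -> b1 - b2 + b3 = 0 -> x - y + z = 0.
Proof. by move=> -> -> -> -> f -> -> -> h; lra. Qed.

Lemma pull_closed n m (g : 'rV[R]_n -> 'rV[R]_m) (eta : 'rV[R]_m -> 'M[R]_m) z T a c :
 sm z g -> smM (g z) eta -> (eta (g z))^T = - eta (g z) ->
 (forall u v w, dotr (v *m 'D_u eta (g z)) w - dotr (u *m 'D_v eta (g z)) w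
   + dotr (u *m 'D_w eta (g z)) v = 0) ->
 'D_T (fun z => dotr ('D_a g z *m eta (g z)) ('D_c g z) : R^o) z
 - 'D_a (fun z => dotr ('D_T g z *m eta (g z)) ('D_c g z) : R^o) z
 + 'D_c (fun z => dotr ('D_T g z *m eta (g z)) ('D_a g z) : R^o) z = 0.
Proof.
move=> sg se sk cl; have seg := smM_comp sg se.
have sD v := sm_D v sg.
have eT := derive_smMc T sg se; have ea := derive_smMc a sg se.
have ec := derive_smMc c sg se.
have E1 := derive_bil T (sD a) seg (sD c).
have E2 := derive_bil a (sD T) seg (sD c).
have E3 := derive_bil c (sD T) seg (sD a).
rewrite eT in E1; rewrite ea in E2; rewrite ec in E3.
have F1 := dotr_skew ('D_a g z) ('D_T ('D_c g) z) sk.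
have C := cl ('D_T g z) ('D_a g z) ('D_c g z).
have S1 := congr1 (fun u => dotr (u *m eta (g z)) ('D_c g z)) (schwarz a T sg).
have S2 := congr1 (fun u => dotr (u *m eta (g z)) ('D_a g z)) (schwarz c T sg).
have S3 := congr1 (fun u => dotr ('D_T g z *m eta (g z)) u) (schwarz c a sg).
have K := cancel_sum E1 E2 E3.
have K1 := K S1.
have K2 := K1 _ S2.
have K3 := K2 S3.
have K4 := K3 F1.
exact: (K4 C).
Qed.

(** The homogeneous Moser equations on $X$. With the third inserted in the second, they say that $c
    = b + (1 - t)\xi J_m$ annihilates the rows of [G], which is square by the dimension count, so $c
    = 0$. Then $(v, \xi)$ lies in the kernel of [G]. *)
Lemma core_injective N r d (G : 'M[R]_(N + r, d)) (I0 : 'M[R]_(N, d)) (Jm : 'M[R]_(r, d)) (P0 : 'M[R]_d)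
  (t : R) (v : 'rV[R]_N) (xi : 'rV[R]_r) (b : 'rV[R]_d) :
 P0^T = - P0 -> G = col_mx I0 (Jm *m P0) -> (d <= N + r)%N -> row_free G ->
 (1 - t) *: (xi *m Jm *m I0^T) + b *m I0^T = 0 ->
 - (1 - t) *: (v *m I0 *m Jm^T) - (1 - t ^+ 2) *: (xi *m Jm *m P0 *m Jm^T) - t *: (b *m P0 *m Jm^T) = 0 ->
 v *m I0 + t *: (xi *m Jm *m P0) - b *m P0 = 0 ->
 [/\ v = 0, xi = 0 & b = 0].
Proof.
move=> skP GE dn fG e1 e2 e3.
have GTi (c : 'rV[R]_d) : c *m G^T = 0 -> c = 0.
 have rk : \rank G = (N + r)%N by apply/eqP.
 have dE : d = (N + r)%N by apply/eqP; rewrite eqn_leq dn -rk rank_leq_col.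
 have fT : row_free G^T by rewrite /row_free mxrank_tr rk -dE.
 by move=> h; apply: (row_free_inj fT); rewrite h mul0mx.
have Gi (w : 'rV[R]_(N + r)) : w *m G = 0 -> w = 0.
 by move=> h; apply: (row_free_inj fG); rewrite h mul0mx.
pose c := b + (1 - t) *: (xi *m Jm).
have cI : c *m I0^T = 0 by rewrite mulmxDl -scalemxAl addrC.
have vI : v *m I0 = b *m P0 - t *: (xi *m Jm *m P0).
 by rewrite -[RHS]add0r -e3 addrA subrK addrK.
have cP : c *m P0 *m Jm^T = 0.
 move: e2; rewrite vI mulmxBl -scalemxAl /c 2!mulmxDl -!scalemxAl => e2.
 apply/eqP; rewrite -oppr_eq0; apply/eqP; rewrite -[RHS]e2.
 apply/rowP => j; rewrite !mxE; ring.
have c0 : c = 0.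
 apply: GTi; rewrite GE tr_col_mx mul_mx_row cI trmx_mul skP mulNmx mulmxN mulmxA cP oppr0.
 by rewrite row_mx0.
have bE : b = - ((1 - t) *: (xi *m Jm)).
 by apply/eqP; rewrite -addr_eq0; apply/eqP.
have wG : row_mx v xi *m G = 0.
 rewrite GE mul_row_col mulmxA vI bE mulNmx -scalemxAl.
 by apply/rowP => j; rewrite !mxE; ring.
have w0 := Gi _ wG.
have v0 : v = 0 by have := congr1 lsubmx w0; rewrite row_mxKl => ->; apply/rowP => j; rewrite !mxE.
have xi0 : xi = 0 by have := congr1 rsubmx w0; rewrite row_mxKr => ->; apply/rowP => j; rewrite !mxE.
by split=> //; rewrite bE xi0 mul0mx scaler0 oppr0.
Qed.

End MoserAlgebra.

(** * The Moser identity: the pulled back Dirac structure is constant in time *)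

Section MoserIdentity.
Context {R : realType}.

(** The rows of the Jacobian matrix that belong to the space variables, time being held fixed. *)
Definition Jsp n m (g : 'rV[R]_(1 + n) -> 'rV[R]_m) Y : 'M[R]_(n, m) := row_mx 0 1%:M *m Jac g Y.

Lemma JspE n m (g : 'rV[R]_(1 + n) -> 'rV[R]_m) Y v : sm Y g -> v *m Jsp g Y = 'D_(tx 0 v) g Y.
Proof.
move=> sg; rewrite (JacE_sm _ sg) /Jsp mulmxA mul_mx_row mulmx0 mulmx1; congr (row_mx _ _ *m _).
by apply/matrixP => i j; rewrite !ord1 !mxE mul0rn.
Qed.

Lemma sm_Jsp n m (g : 'rV[R]_(1 + n) -> 'rV[R]_m) Y : sm Y g -> smM Y (Jsp g).
Proof. by move=> sg; apply: smM_mul; [exact: smM_cst | exact: smM_Jac]. Qed.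

Lemma derive_subE n z v (f g : 'rV[R]_n -> R^o) : sm z f -> sm z g ->
 'D_v (fun z => f z - g z : R^o) z = 'D_v f z - 'D_v g z.
Proof.
move=> sf sg; rewrite -deriveB //; exact: diff_derivable (sm_diff _).
Qed.

Lemma derive_addE n z v (f g : 'rV[R]_n -> R^o) : sm z f -> sm z g ->
 'D_v (fun z => f z + g z : R^o) z = 'D_v f z + 'D_v g z.
Proof.
move=> sf sg; rewrite -deriveD //; exact: diff_derivable (sm_diff _).
Qed.

Lemma derive_oppE n z v (f : 'rV[R]_n -> R^o) : sm z f ->
 'D_v (fun z => - f z : R^o) z = - 'D_v f z.
Proof. by move=> sf; rewrite -deriveN //; exact: diff_derivable (sm_diff _). Qed.

Lemma derive_skew n p x (A : 'rV[R]_n -> 'M[R]_p) u a b : smM x A ->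
 (\forall z \near x, (A z)^T = - A z) ->
 dotr (a *m 'D_u A x) b = - dotr (b *m 'D_u A x) a.
Proof.
move=> sA sk; rewrite -(derive_bil_cst u a b sA) -(derive_bil_cst u b a sA).
have sb : sm x (fun z => dotr (b *m A z) a : R^o).
 by apply: sm_dotr; [apply: sm_mulmx => //; exact: sm_cst | exact: sm_cst].
rewrite -(derive_oppE u sb); apply: near_eq_derive; apply: filterS sk => z h.
exact: dotr_skew.
Qed.

Lemma sm_pull n m Y (g : 'rV[R]_n -> 'rV[R]_m) (eta : 'rV[R]_m -> 'M[R]_m) u v :
 sm Y g -> smM (g Y) eta -> sm Y (fun Z => dotr ('D_u g Z *m eta (g Z)) ('D_v g Z) : R^o).
Proof.
move=> sg se; apply: sm_dotr; last exact: sm_D.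
by apply: sm_mulmx; [exact: sm_D | exact: (smM_comp sg se)].
Qed.

Lemma dotr0l p (a : 'rV[R]_p) : dotr 0 a = 0. Proof. by rewrite /dotr mul0mx mxE. Qed.

Lemma dotr0r p (a : 'rV[R]_p) : dotr a 0 = 0. Proof. by rewrite dotrC dotr0l. Qed.

Lemma dotrBl p (a b v : 'rV[R]_p) : dotr (a - b) v = dotr a v - dotr b v.
Proof. by rewrite dotrDl1 dotrNl. Qed.

Lemma dotr_sandwich p q (a c : 'rV[R]_p) (J : 'M[R]_(p, q)) A :
 dotr (a *m (J *m A *m J^T)) c = dotr (a *m J *m A) (c *m J).
Proof. by rewrite dotr_mulmx !mulmxA. Qed.

Lemma exterior_sum (x y z x' y' z' u v u' : R) : x - y + z = 0 -> x' - y' + z' = 0 ->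
 y - y' = - (u + v) -> z - z' = - (u' + v) -> x - x' = u' - u.
Proof. by move=> h1 h2 h3 h4; lra. Qed.

Lemma jacobi_sum (z1 z2 a7 a9 a10 : R) : z1 = 0 -> z2 = 0 ->
 a7 + a10 + a9 = 0 -> forall a6, a10 = - a6 -> forall a3 a1, a3 = - a1 -> forall a5 a8, a5 = - a8 ->
 forall a2 a4, a1 - a2 + (a3 + a4) + (a5 + a6) - a7 = - (z1 + (a2 - a4) + z2 - - (a8 - a9)).
Proof. by move=> -> -> h x6 h6 x3 x1 h1 x5 x8 h5 x2 x4; lra. Qed.

Section Form.
Variables (n d : nat) (Y T : 'rV[R]_(1 + n)).
Variables (psi kap : 'rV[R]_(1 + n) -> 'rV[R]_n) (h be : 'rV[R]_(1 + n) -> 'rV[R]_d).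
Variables (eta : 'rV[R]_n -> 'M[R]_n).
Context (spsi : sm Y psi) (skap : sm Y kap) (sh : sm Y h) (sbe : sm Y be).
Definition good_form (x : 'rV[R]_n) := [/\ smM x eta, (eta x)^T = - eta x &
 forall u v w, dotr (v *m 'D_u eta x) w - dotr (u *m 'D_v eta x) w + dotr (u *m 'D_w eta x) v = 0].
Context (epsi : good_form (psi Y)) (ekap : good_form (kap Y)).

Context (primitive : forall c, \forall Z \near Y, dotr ('D_T psi Z *m eta (psi Z)) ('D_(tx 0 c) psi Z) - dotr ('D_T kap Z *m eta (kap Z)) ('D_(tx 0 c) kap Z) = - dotr (be Z) ('D_(tx 0 c) h Z)).

(** The matrix of $\psi^*\eta - \kappa^*\eta$ on space vectors. In the application [psi] is the flow
    and [kap] the flow followed by the dilation. *)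
Definition pull_diff Z : 'M[R]_n :=
 Jsp psi Z *m eta (psi Z) *m (Jsp psi Z)^T - Jsp kap Z *m eta (kap Z) *m (Jsp kap Z)^T.

Lemma sm_pull_diff : smM Y pull_diff.
Proof.
have [e1 _ _] := epsi; have [e2 _ _] := ekap.
apply: smM_add; last apply: smM_opp.
 apply: smM_mul; last by apply: smM_tr; exact: sm_Jsp.
 by apply: smM_mul; [exact: sm_Jsp | exact: (smM_comp spsi e1)].
apply: smM_mul; last by apply: smM_tr; exact: sm_Jsp.
by apply: smM_mul; [exact: sm_Jsp | exact: (smM_comp skap e2)].
Qed.

Lemma pull_diffE Z a c : sm Z psi -> sm Z kap -> dotr (a *m pull_diff Z) c =
 dotr ('D_(tx 0 a) psi Z *m eta (psi Z)) ('D_(tx 0 c) psi Z)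
 - dotr ('D_(tx 0 a) kap Z *m eta (kap Z)) ('D_(tx 0 c) kap Z).
Proof.
move=> s1 s2; rewrite -(JspE a s1) -(JspE c s1) -(JspE a s2) -(JspE c s2).
by rewrite /pull_diff mulmxBr dotrBl; congr (_ - _); exact: dotr_sandwich.
Qed.

(** Cartan's formula: both pulled back forms are closed, so the derivative of their difference along
    $T$ is the exterior derivative of its contraction with $T$, which by [primitive] is $-\langle
    \beta, dh \rangle$. *)
Lemma derive_pull_diff a c : 'D_T (fun Z => dotr (a *m pull_diff Z) c : R^o) Y =
 dotr ('D_(tx 0 c) be Y) ('D_(tx 0 a) h Y) - dotr ('D_(tx 0 a) be Y) ('D_(tx 0 c) h Y).
Proof.
have [e1 k1 c1] := epsi; have [e2 k2 c2] := ekap.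
have n1 : \forall Z \near Y, sm Z psi by exact: sm_nbhs.
have n2 : \forall Z \near Y, sm Z kap by exact: sm_nbhs.
have E : \forall Z \near Y, dotr (a *m pull_diff Z) c =
  dotr ('D_(tx 0 a) psi Z *m eta (psi Z)) ('D_(tx 0 c) psi Z)
  - dotr ('D_(tx 0 a) kap Z *m eta (kap Z)) ('D_(tx 0 c) kap Z).
 by apply: filterS2 n1 n2 => Z h1 h2; exact: pull_diffE.
rewrite (near_eq_derive _ E).
have := derive_subE T (sm_pull (tx 0 a) (tx 0 c) spsi e1) (sm_pull (tx 0 a) (tx 0 c) skap e2).
move=> ->.
have P1 := pull_closed T (tx 0 a) (tx 0 c) spsi e1 k1 c1.
have P2 := pull_closed T (tx 0 a) (tx 0 c) skap e2 k2 c2.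
have D1 := near_eq_derive (tx 0 a) (primitive c).
have D2 := near_eq_derive (tx 0 c) (primitive a).
rewrite (derive_subE _ (sm_pull T (tx 0 c) spsi e1) (sm_pull T (tx 0 c) skap e2)) in D1.
rewrite (derive_subE _ (sm_pull T (tx 0 a) spsi e1) (sm_pull T (tx 0 a) skap e2)) in D2.
have sd v : sm Y (fun Z => dotr (be Z) ('D_(tx 0 v) h Z) : R^o) by apply: sm_dotr => //; exact: sm_D.
rewrite (derive_oppE _ (sd c)) (derive_dotr _ sbe (sm_D _ sh)) in D1.
rewrite (derive_oppE _ (sd a)) (derive_dotr _ sbe (sm_D _ sh)) (schwarz _ _ sh) in D2.
have K1 := exterior_sum P1 P2.
have K2 := K1 _ _ _ D1.
exact: (K2 _ D2).
Qed.

Variable Pm : 'rV[R]_d -> 'M[R]_d.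
Definition good_biv (x : 'rV[R]_d) := [/\ smM x Pm, (\forall z \near x, (Pm z)^T = - Pm z) &
 forall a b g, dotr (b *m 'D_(a *m Pm x) Pm x) g + dotr (g *m 'D_(b *m Pm x) Pm x) a
  + dotr (a *m 'D_(g *m Pm x) Pm x) b = 0].
Context (gP : good_biv (h Y)) (base_curve : \forall Z \near Y, 'D_T h Z = be Z *m Pm (h Z)).

(** A row $(w, \beta)$ times this matrix is $(a, 0)$ exactly when $\beta$ exhibits $(w, a)$ as an
    element of the pull-back by [h] of the graph of the bivector, gauge transformed by
    [pull_diff]. *)
Definition moser_mx Z : 'M[R]_(n + d) := block_mx (pull_diff Z) (Jsp h Z) (Jsp h Z)^T (- Pm (h Z)).

Lemma sm_moser_mx : smM Y moser_mx.
Proof.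
have [p1 _ _] := gP; apply: smM_block.
- exact: sm_pull_diff.
- exact: sm_Jsp.
- by apply: smM_tr; exact: sm_Jsp.
- by apply: smM_opp; exact: (smM_comp sh p1).
Qed.

Lemma dotr_row p q (a b : 'rV[R]_p) (c e : 'rV[R]_q) :
 dotr (row_mx a c) (row_mx b e) = dotr a b + dotr c e.
Proof. by rewrite /dotr tr_row_mx mul_row_col mxE. Qed.

Lemma moser_mxE Z w b c q : dotr (row_mx w b *m moser_mx Z) (row_mx c q) =
 dotr (w *m pull_diff Z) c + dotr (c *m Jsp h Z) b + dotr (w *m Jsp h Z) q - dotr (b *m Pm (h Z)) q.
Proof.
rewrite /moser_mx mul_row_block dotr_row !dotrDl1 mulmxN dotrNl.
by rewrite -(dotrC c (b *m _)) dotr_mulmx trmxK !addrA.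
Qed.

Lemma derive_Jsp c q : 'D_T (fun Z => dotr (c *m Jsp h Z) q : R^o) Y =
 dotr ('D_(tx 0 c) be Y *m Pm (h Y)) q + dotr (be Y *m 'D_('D_(tx 0 c) h Y) Pm (h Y)) q.
Proof.
have [p1 _ _] := gP.
have nh : \forall Z \near Y, sm Z h by exact: sm_nbhs.
have E : \forall Z \near Y, dotr (c *m Jsp h Z) q = dotr ('D_(tx 0 c) h Z) q.
 by apply: filterS nh => Z sZ; rewrite JspE.
rewrite (near_eq_derive _ E) (derive_dotr _ (sm_D _ sh) (sm_cst _ _)) derive_cstv.
rewrite (schwarz _ _ sh) (near_eq_derive _ base_curve).
rewrite (derive_mul _ ((smM_row _ _).2 sbe) (smM_comp sh p1)) (derive_smMc _ sh p1).
by rewrite dotrDl1 dotr0r addr0.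
Qed.

(** The rate at which the covector part of a solution changes along $T$ while its vector part stays
    put; [moser_constant] shows that it is exactly this. *)
Definition correction (w : 'rV[R]_n) (b : 'rV[R]_d) : 'rV[R]_d :=
 'D_(tx 0 w) be Y - \row_i dotr (be Y *m 'D_(ev i) Pm (h Y)) b.

Lemma correctionE w b p :
 dotr (correction w b) p = dotr ('D_(tx 0 w) be Y) p - dotr (be Y *m 'D_p Pm (h Y)) b.
Proof.
have [p1 _ _] := gP.
rewrite /correction dotrDl1 dotrNl; congr (_ - _).
pose F := fun z => dotr (be Y *m Pm z) b : R^o.
have sF : sm (h Y) F.
 by apply: sm_dotr; [apply: sm_mulmx => //; exact: sm_cst | exact: sm_cst].
have DF v : 'D_v F (h Y) = dotr (be Y *m 'D_v Pm (h Y)) b by exact: derive_bil_cst.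
rewrite -[RHS](DF p) [RHS](derive_sumE _ (sm_diff sF)) dotrE; apply: eq_bigr => i _.
by rewrite mxE (DF (ev i)) mulrC.
Qed.

(** Every change of the matrix is absorbed by a change of the covector part: the change of the form
    comes from [derive_pull_diff], and the changes of the bivector match by the Jacobi identity. *)
Lemma derive_moser w b c q : 'D_(tx 0 w) h Y = b *m Pm (h Y) ->
 dotr (row_mx w b *m 'D_T moser_mx Y) (row_mx c q) =
  - dotr (row_mx 0 (correction w b) *m moser_mx Y) (row_mx c q).
Proof.
move=> E2; have [p1 k1 J] := gP.
rewrite -(derive_bil_cst T (row_mx w b) (row_mx c q) sm_moser_mx).
rewrite (_ : (fun z => _) = (fun Z => dotr (w *m pull_diff Z) c + dotr (c *m Jsp h Z) b
  + dotr (w *m Jsp h Z) q - dotr (b *m Pm (h Z)) q)); last first.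
 by apply/funext => Z; exact: moser_mxE.
have sPh := smM_comp sh p1; have sJ := sm_Jsp sh.
have sl m (A : _ -> 'M[R]_(m, _)) a e : smM Y A -> sm Y (fun Z => dotr (a *m A Z) e : R^o).
 by move=> sA; apply: sm_dotr; [apply: sm_mulmx => //; exact: sm_cst | exact: sm_cst].
have s1 : sm Y (fun Z => dotr (w *m pull_diff Z) c : R^o) by apply: sl; exact: sm_pull_diff.
have s2 : sm Y (fun Z => dotr (c *m Jsp h Z) b : R^o) by apply: sl.
have s3 : sm Y (fun Z => dotr (w *m Jsp h Z) q : R^o) by apply: sl.
have s4 : sm Y (fun Z => dotr (b *m Pm (h Z)) q : R^o) := sl _ _ (fun Z => Pm (h Z)) b q sPh.
rewrite (derive_subE T (sm_add (sm_add s1 s2) s3) s4) (derive_addE T (sm_add s1 s2) s3).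
rewrite (derive_addE T s1 s2) derive_pull_diff !derive_Jsp (derive_bil_cst T b q sPh).
rewrite (derive_smMc T sh p1) (nbhs_singleton base_curve) E2.
rewrite moser_mxE mul0mx mul0mx (dotrC _ (correction w b)) (JspE _ sh) correctionE.
have sk := nbhs_singleton k1.
rewrite (dotr_skew (correction w b) q sk) (dotrC _ (correction w b)) correctionE.
have j := J (be Y) b q.
have d1 := derive_skew (b *m Pm (h Y)) q (be Y) p1 k1.
have d3 := dotr_skew ('D_(tx 0 c) be Y) b sk; have d5 := dotr_skew ('D_(tx 0 w) be Y) q sk.
rewrite (dotrC (b *m _)) in d3; rewrite (dotrC (q *m _)) in d5.
have K1 := jacobi_sum (dotr0l c) (dotr0l q) j.
have K2 := K1 _ d1.
have K3 := K2 _ _ d3.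
have K4 := K3 _ _ d5.
exact: K4.
Qed.

(** The family of pulled back Dirac structures does not move: for a fixed covector [a0] the solution
    varies in its covector part only, so the vector related to [a0] stays the same. *)
Lemma moser_constant (a0 : 'rV[R]_n) : moser_mx Y \in unitmx ->
 'D_T (fun Z => lsubmx (row_mx a0 0 *m invmx (moser_mx Z))) Y = 0.
Proof.
move=> uA; pose x Z := row_mx a0 0 *m invmx (moser_mx Z).
have sA := sm_moser_mx; have sx : smM Y x by apply: smM_mul; [exact: smM_cst | exact: smM_invmx].
have nA := unit_near sA uA.
have nx : \forall Z \near Y, x Z *m moser_mx Z = row_mx a0 0.
 by apply: filterS nA => Z uZ; rewrite /x mulmxKV.
have xY := nbhs_singleton nx.
have E2 : 'D_(tx 0 (lsubmx (x Y))) h Y = rsubmx (x Y) *m Pm (h Y).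
 have := congr1 rsubmx xY; rewrite -{1}[x Y]hsubmxK /moser_mx mul_row_block !row_mxKr.
 by rewrite mulmxN (JspE _ sh) => /eqP; rewrite subr_eq0 => /eqP.
have key : 'D_T x Y *m moser_mx Y = row_mx 0 (correction (lsubmx (x Y)) (rsubmx (x Y))) *m moser_mx Y.
 have := derive_mul T sx sA; rewrite (near_eq_derive _ nx) derive_cstv => /esym/eqP.
 rewrite addr_eq0 => /eqP ->; apply: dotr_inj => y; rewrite dotrNl -{1}[x Y]hsubmxK -[y]hsubmxK.
 by rewrite derive_moser // opprK.
have Dx : 'D_T x Y = row_mx 0 (correction (lsubmx (x Y)) (rsubmx (x Y))).
 by have := congr1 (fun m => m *m invmx (moser_mx Y)) key; rewrite !mulmxK.
pose L : 'M[R]_(n + d, n) := col_mx 1%:M 0.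
have lE (y : 'rV[R]_(n + d)) : lsubmx y = y *m L.
 by rewrite -{2}[y]hsubmxK mul_row_col mulmx1 mulmx0 addr0.
rewrite (_ : (fun Z => _) = (fun Z => x Z *m L)); last by apply/funext => Z; rewrite lE.
rewrite (derive_mul T sx (smM_cst Y L)) derive_cstv mulmx0 addr0 -lE Dx.
by rewrite row_mxKl.
Qed.

End Form.
End MoserIdentity.

(** * The Moser field near the zero section *)

Section MoserField.
Context {R : realType}.

Lemma unitmx_inj p (A : 'M[R]_p) : (forall y : 'rV[R]_p, y *m A = 0 -> y = 0) -> A \in unitmx.
Proof.
move=> h; rewrite -row_free_unit -kermx_eq0; apply/eqP/row_matrixP => i.
by rewrite row0; apply: h; rewrite -row_mul mulmx_ker row0.
Qed.

Lemma tm_near n t (x : 'rV[R]_n) (e : R) : 0 < e -> \forall Y \near tx t x, `|tm Y - t| < e.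
Proof.
move=> e0; have [rho rho0 hr] := (cont_epsP _ _).1 (sm_cont (sm_tm (tx t x))) _ e0.
apply/nbhs_ballP; exists rho => //= Y; rewrite -ball_normE /= distrC => /hr.
by rewrite tm_tx.
Qed.

Lemma tm_near_ne n t (x : 'rV[R]_n) : t != 0 -> \forall Y \near tx t x, tm Y != 0.
Proof.
rewrite -normr_gt0 => /(tm_near t x) h; apply: filterS h => Y; apply: contraTneq => ->.
by rewrite sub0r normrN ltxx.
Qed.

Variables (N r d : nat).
Implicit Types (t : R) (z : 'rV[R]_(N + r)) (Y : 'rV[R]_(1 + (N + r))).

(** In a bundle chart, [dil t] is fibrewise multiplication by [t], and [vert] is the Euler field as
    a linear map. *)
Definition dil t : 'M[R]_(N + r) := block_mx 1%:M 0 0 t%:M.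
Definition vert : 'M[R]_(N + r) := block_mx 0 0 0 1%:M.

Lemma dil1 : dil 1 = 1%:M. Proof. by rewrite /dil -scalar_mx_block. Qed.

Lemma dilE t : dil t = dil 0 + t *: vert.
Proof.
by rewrite /dil /vert scale_block_mx add_block_mx !scaler0 !addr0 scalemx1 raddf0 add0r.
Qed.

Lemma dil_tr t : (dil t)^T = dil t.
Proof. by rewrite /dil tr_block_mx !trmx0 !tr_scalar_mx. Qed.

Lemma vert_dil t : vert *m dil t = t *: vert.
Proof.
by rewrite /vert /dil mulmx_block scale_block_mx !mul0mx !mulmx0 !mul1mx !scaler0 !addr0 !add0r scalemx1.
Qed.

Lemma mul_dil t z : z *m dil t = row_mx (lsubmx z) (t *: rsubmx z).
Proof.
by rewrite -{1}[z]hsubmxK /dil mul_row_block !mulmx0 mulmx1 addr0 add0r mul_mx_scalar.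
Qed.

Lemma mul_vert z : z *m vert = row_mx 0 (rsubmx z).
Proof. by rewrite -{1}[z]hsubmxK /vert mul_row_block !mulmx0 mulmx1 !addr0 add0r. Qed.

Variables (f : 'rV[R]_(N + r) -> 'rV[R]_d) (eta : 'rV[R]_(N + r) -> 'M[R]_(N + r)).
Variables (Pm : 'rV[R]_d -> 'M[R]_d) (z0 : 'rV[R]_(N + r)).

Definition mscale Y := sp Y *m dil (tm Y).
Definition Bm Y := eta (sp Y) - dil (tm Y) *m eta (mscale Y) *m dil (tm Y).
Definition Fm Y := dil (tm Y) *m Jac f (mscale Y).
(** The matrix of the system for $(w, \beta)$: [Bm] is the matrix of $\eta - m_t^*\eta$ and [Fm] the
    differential of $f \circ m_t$ acting on rows. *)
Definition Am Y : 'M[R]_(N + r + d) := block_mx (Bm Y) (Fm Y) (Fm Y)^T (- Pm (f (mscale Y))).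
Definition rhs Y : 'rV[R]_(N + r + d) := row_mx (sp Y *m vert *m eta (sp Y)) 0.

Context (z0v : rsubmx z0 = 0) (sf : sm z0 f) (se : smM z0 eta) (sP : smM (f z0) Pm).
Variables (I0 : 'M[R]_(N, d)) (Jm : 'M[R]_(r, d)).
Context (skP : (Pm (f z0))^T = - Pm (f z0)) (JE : Jac f z0 = col_mx I0 (Jm *m Pm (f z0)))
 (fJ : row_free (Jac f z0)) (dn : (d <= N + r)%N)
 (eE : eta z0 = block_mx 0 (- (I0 *m Jm^T)) (Jm *m I0^T) (- (Jm *m Pm (f z0) *m Jm^T))).

Lemma z0_dil t : z0 *m dil t = z0.
Proof. by rewrite mul_dil z0v scaler0 -[RHS]hsubmxK z0v. Qed.

Lemma z0_vert : z0 *m vert = 0.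
Proof. by rewrite mul_vert z0v row_mx0. Qed.

Lemma mscale0 t : mscale (tx t z0) = z0.
Proof. by rewrite /mscale sp_tx z0_dil. Qed.

Lemma sm_dil Y : smM Y (fun Y => dil (tm Y)).
Proof.
rewrite (_ : (fun Y => _) = (fun Y => dil 0 + (tm Y : R^o) *: vert)); last by apply/funext => Z; rewrite dilE.
by apply: smM_add; [exact: smM_cst | apply: smM_scale; [exact: sm_tm | exact: smM_cst]].
Qed.

Lemma sm_mscale Y : sm Y mscale.
Proof. by apply: sm_mulmx; [exact: sm_sp | exact: sm_dil]. Qed.

Lemma smM_Bm Y : smM (sp Y) eta -> smM (mscale Y) eta -> smM Y Bm.
Proof.
move=> s1 s2; apply: smM_add; first exact: (smM_comp (sm_sp Y) s1).
apply: smM_opp; apply: smM_mul (sm_dil Y); apply: smM_mul (sm_dil Y) _.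
exact: (smM_comp (sm_mscale Y) s2).
Qed.

Lemma smM_Fm Y : sm (mscale Y) f -> smM Y Fm.
Proof. by move=> s; apply: smM_mul (sm_dil Y) _; exact: (smM_comp (sm_mscale Y) (smM_Jac s)). Qed.

Lemma smM_Am Y : smM (sp Y) eta -> smM (mscale Y) eta -> sm (mscale Y) f ->
 smM (f (mscale Y)) Pm -> smM Y Am.
Proof.
move=> s1 s2 s3 s4; apply: smM_block.
- exact: smM_Bm.
- exact: smM_Fm.
- by apply: smM_tr; exact: smM_Fm.
- by apply: smM_opp; exact: (smM_comp (sm_comp_rV (sm_mscale Y) s3) s4).
Qed.

Lemma smM_Am0 t : smM (tx t z0) Am.
Proof. by apply: smM_Am; rewrite ?mscale0 ?sp_tx. Qed.

Lemma Bm0 t : Bm (tx t z0) =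
 block_mx 0 (- ((1 - t) *: (I0 *m Jm^T))) ((1 - t) *: (Jm *m I0^T)) (- ((1 - t ^+ 2) *: (Jm *m Pm (f z0) *m Jm^T))).
Proof.
rewrite /Bm mscale0 sp_tx tm_tx eE /dil !mulmx_block !mul0mx !mulmx0 !mul1mx !mulmx1 !addr0 !add0r.
rewrite !mul_scalar_mx !mul_mx_scalar opp_block_mx add_block_mx subr0.
congr block_mx; rewrite ?scalerN ?opprK.
- by rewrite scalerBl scale1r opprB addrC.
- by rewrite scalerBl scale1r.
- by rewrite scalerA -expr2 scalerBl scale1r opprB addrC.
Qed.

Lemma Fm0 t : Fm (tx t z0) = col_mx I0 (t *: (Jm *m Pm (f z0))).
Proof.
by rewrite /Fm mscale0 tm_tx JE /dil mul_block_col !mul0mx addr0 add0r mul1mx mul_scalar_mx.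
Qed.

Lemma Am0_mul t (v : 'rV[R]_N) (xi : 'rV[R]_r) (b : 'rV[R]_d) : row_mx (row_mx v xi) b *m Am (tx t z0) =
 row_mx (row_mx ((1 - t) *: (xi *m Jm *m I0^T) + b *m I0^T)
  (- (1 - t) *: (v *m I0 *m Jm^T) - (1 - t ^+ 2) *: (xi *m Jm *m Pm (f z0) *m Jm^T)
   - t *: (b *m Pm (f z0) *m Jm^T)))
  (v *m I0 + t *: (xi *m Jm *m Pm (f z0)) - b *m Pm (f z0)).
Proof.
rewrite /Am Bm0 Fm0 mscale0 mul_row_block mul_row_block tr_col_mx mul_mx_row !mulmx0 add0r add_row_mx.
rewrite mul_row_col [b *m - _]mulmxN; congr (row_mx (row_mx _ _) (_ + _)).
- by rewrite -scalemxAr mulmxA.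
- rewrite !mulmxN -!scalemxAr !mulmxA; congr (_ + _); first by rewrite scaleNr.
 rewrite linearZ /= trmx_mul skP mulNmx scalerN mulmxN -scalemxAr.
 by congr (- (_ *: _)); rewrite !mulmxA.
- by rewrite -scalemxAr !mulmxA.
Qed.

Lemma Am0_unit t : Am (tx t z0) \in unitmx.
Proof.
apply: unitmx_inj => y; rewrite -[y]hsubmxK -[lsubmx y]hsubmxK Am0_mul => /eqP.
rewrite -[0 in X in X -> _]row_mx0 -[0 in X in X -> _]row_mx0.
move=> /eqP/eq_row_mx[/eq_row_mx[e1 e2] e3].
have [-> -> ->] := core_injective skP JE dn fJ e1 e2 e3.
by rewrite !row_mx0.
Qed.

Definition Xm Y := rhs Y *m invmx (Am Y).
Definition Zm Y := Xm Y - row_mx (sp Y *m vert) 0.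

Lemma smM_rhs Y : smM (sp Y) eta -> smM Y rhs.
Proof.
move=> s; apply: smM_rowmx; last exact: smM_cst.
apply: smM_mul; last exact: (smM_comp (sm_sp Y) s).
by apply: smM_mul; [apply/smM_row; exact: sm_sp | exact: smM_cst].
Qed.

Lemma smM_Xm0 t : smM (tx t z0) Xm.
Proof.
apply: smM_mul; first by apply: smM_rhs; rewrite sp_tx.
by apply: smM_invmx; [exact: smM_Am0 | exact: Am0_unit].
Qed.

Lemma sm_Zm0 t : sm (tx t z0) Zm.
Proof.
apply: sm_subV; first by apply/smM_row; exact: smM_Xm0.
apply/smM_row; apply: smM_rowmx; last exact: smM_cst.
by apply: smM_mul; [apply/smM_row; exact: sm_sp | exact: smM_cst].
Qed.

Lemma Am_unit_near t : \forall Y \near tx t z0, Am Y \in unitmx.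
Proof. by apply: unit_near; [exact: smM_Am0 | exact: Am0_unit]. Qed.

Lemma Xm0 t : Xm (tx t z0) = 0.
Proof. by rewrite /Xm /rhs sp_tx z0_vert mul0mx row_mx0 mul0mx. Qed.

Lemma Zm0 t : Zm (tx t z0) = 0.
Proof. by rewrite /Zm Xm0 sp_tx z0_vert row_mx0 subr0. Qed.

(** At time zero the dilation kills vertical vectors, so the Euler field with zero covector solves
    the system. *)
Lemma Zm_time0 z : Am (tx 0 z) \in unitmx -> Zm (tx 0 z) = 0.
Proof.
move=> uA; apply/eqP; rewrite subr_eq0 /Xm; apply/eqP.
have v0 : z *m vert *m dil 0 = 0 by rewrite -mulmxA vert_dil scale0r mulmx0.
apply: (can_inj (mulmxK uA)); rewrite mulmxKV // /Am mul_row_block !mul0mx !addr0 /rhs.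
rewrite /Bm /Fm !sp_tx tm_tx mulmxBr !mulmxA v0 !mul0mx subr0.
by [].
Qed.

(** Differentiating [Xm *m Am = rhs] where [Xm] vanishes leaves a linear system along $X$, whose
    solution is checked directly: at every time the vector part has the same linear part as the
    Euler field. *)
Lemma derive_Xm t v : 'D_(tx 0 v) Xm (tx t z0) = row_mx (v *m vert) (t *: (rsubmx v *m Jm)).
Proof.
have sX := smM_Xm0 t; have sA := smM_Am0 t.
have E : \forall Y \near tx t z0, Xm Y *m Am Y = rhs Y.
 by apply: filterS (Am_unit_near t) => Y uY; rewrite /Xm mulmxKV.
have := derive_mul (tx 0 v) sX sA; rewrite (near_eq_derive _ E) Xm0 mul0mx addr0.
have -> : 'D_(tx 0 v) rhs (tx t z0) = row_mx (v *m vert *m eta z0) 0.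
 pose V : 'M[R]_(N + r, N + r + d) := row_mx 1%:M 0.
 have rE : rhs = fun Y => (sp Y *m vert *m eta (sp Y)) *m V.
  by apply/funext => Y; rewrite /V mul_mx_row mulmx1 mulmx0.
 have ss := sm_sp (tx t z0); have sse : smM (tx t z0) (fun Y => eta (sp Y)).
  by apply: (smM_comp ss); rewrite sp_tx.
 have sv : smM (tx t z0) (fun Y => sp Y *m vert) by apply: smM_mul; [exact/smM_row | exact: smM_cst].
 rewrite rE (derive_mul _ (smM_mul sv sse) (smM_cst _ V)) derive_cstv mulmx0 addr0.
 rewrite (derive_mul _ sv sse) sp_tx z0_vert mul0mx addr0.
 rewrite (derive_mul _ ((smM_row _ _).2 ss) (smM_cst _ vert)) derive_cstv mulmx0 addr0 derive_sp sp_tx.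
 by rewrite /V mul_mx_row mulmx1 mulmx0.
move=> e; apply: (can_inj (mulmxK (Am0_unit t))); rewrite -e mul_vert Am0_mul eE.
rewrite mul_row_block !mul0mx !add0r scaler0 sub0r -!scalemxAl; congr (row_mx (row_mx _ _) _).
- by rewrite -scalerDl subrK scale1r mulmxA.
- by rewrite mulmxN !mulmxA scalerA -expr2 -opprD -scalerDl subrK scale1r.
- by rewrite subrr.
Qed.

Lemma derive_Zm t v : 'D_(tx 0 v) Zm (tx t z0) = row_mx 0 (t *: (rsubmx v *m Jm)).
Proof.
pose V : 'M[R]_(1 + (N + r), N + r + d) := col_mx 0 (row_mx vert 0).
have VE Y : Y *m V = row_mx (sp Y *m vert) 0.
 by rewrite -{1}(tx_eta Y) /tx /V mul_row_col mulmx0 add0r mul_mx_row mulmx0.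
have -> : Zm = fun Y => Xm Y - Y *m V by apply/funext => Y; rewrite VE.
have sX := (smM_row _ _).1 (smM_Xm0 t).
rewrite deriveB; [|exact: diff_derivable (sm_diff sX)|exact: diff_derivable (sm_diff (sm_lin _ V))].
rewrite derive_Xm (JacE_sm _ (sm_lin _ V)).
rewrite (Jac_eq (sm_lin _ V) (A := V)) => [|w].
 by rewrite VE sp_tx opp_row_mx add_row_mx subrr oppr0 addr0.
have sid := (smM_row _ _).2 (sm_id (tx t z0)).
rewrite (derive_mul w sid (smM_cst _ V)) derive_cstv mulmx0 addr0.
by congr (_ *m _); exact: derive_id.
Qed.

Lemma sm_inv_time t : t != 0 -> sm (tx t z0) (fun Y => (tm Y)^-1 : R^o).
Proof. by move=> t0; apply: sm_inv; [exact: sm_tm | rewrite tm_tx]. Qed.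

Lemma zero_right n (G : 'rV[R]_(1 + n) -> R^o) (x : 'rV[R]_n) : {for tx 0 x, continuous G} ->
 (forall t, 0 < t <= 1 -> G (tx t x) = 0) -> G (tx 0 x) = 0.
Proof.
move=> /cont_epsP cG h; apply/eqP; rewrite -normr_le0; apply/ler_addgt0Pr => e e0; rewrite add0r.
have [rho rho0 hr] := cG _ e0; pose t := Num.min (rho / 2) 1.
have t0 : 0 < t by rewrite lt_min divr_gt0 // ltr01.
have t1 : t <= 1 by rewrite ge_min lexx orbT.
have tr : t < rho by rewrite gt_min; apply/orP; left; lra.
have := hr (tx t x); rewrite (h t) ?t0 // sub0r normrN => /(_ _)/ltW; apply.
rewrite (_ : _ - _ = tx t 0); last by rewrite /tx opp_row_mx add_row_mx subrr -raddfB subr0.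
by apply/tx_norm_lt; rewrite // normr0 gtr0_norm.
Qed.

(** [W] is the solution minus the Euler field, divided by $t$, and extended over $t = 0$ by
    Hadamard's lemma in time. That it vanishes along $X$, with the derivative of its vector part, is
    computed for $t \neq 0$ and passes to $t = 0$ by continuity. *)
Lemma moser_field : exists W : 'rV[R]_(1 + (N + r)) -> 'rV[R]_(N + r + d),
 forall t, 0 <= t <= 1 -> [/\ sm (tx t z0) W, W (tx t z0) = 0,
  forall v, lsubmx ('D_(tx 0 v) W (tx t z0)) = 0 &
  \forall Y \near tx t z0, Am Y \in unitmx /\
   (row_mx (sp Y *m vert) 0 + tm Y *: W Y) *m Am Y = rhs Y].
Proof.
have sZ0 := (sm_rVP _ _).1 (sm_Zm0 0).
have [g hg] := choice (fun j => hadamard_time (sZ0 j)).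
have un := Am_unit_near 0.
have near_sp (P : 'rV[R]_(1 + (N + r)) -> Prop) : (\forall Y \near tx 0 z0, P Y) ->
  \forall Y \near tx 0 z0, P (tx 0 (sp Y)).
 move=> h; have s0 : sm (tx 0 z0) (fun Y : 'rV[R]_(1 + (N + r)) => tx 0 (sp Y)).
  by apply: sm_tx_row; [exact: sm_cst | exact: sm_sp].
 by apply: (near_comp (P := P) (sm_cont s0)); rewrite sp_tx.
have gE : \forall Y \near tx 0 z0, forall j, Zm Y 0 j = tm Y * g j Y.
 apply: (@filter_forall _ _ (fun j Y => Zm Y 0 j = tm Y * g j Y) (nbhs (tx 0 z0))) => j.
 have n1 := near_sp _ un; have [_ h] := hg j.
 by apply: filterS2 n1 h => Y uY ->; rewrite (Zm_time0 uY) mxE add0r.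
pose W Y := \row_j (if tm Y == 0 then g j Y else (tm Y)^-1 * Zm Y 0 j) : 'rV[R]_(N + r + d).
have W0 : \forall Y \near tx 0 z0, \row_j g j Y = W Y.
 apply: filterS gE => Y h; apply/rowP => j; rewrite [LHS]mxE [RHS]mxE; case: eqP => // /eqP t0.
 by rewrite (h j) mulKf.
have Wt t : t != 0 -> \forall Y \near tx t z0, (tm Y)^-1 *: Zm Y = W Y.
 move=> t0; have h := tm_near_ne z0 t0.
 by apply: filterS h => Y tY; apply/rowP => j; rewrite !mxE (negbTE tY).
have sW t : sm (tx t z0) W.
 have [->|t0] := eqVneq t 0.
  apply: (sm_near W0); apply/sm_rVP => j; under eq_fun do rewrite mxE; exact: (hg j).1.
 apply: (sm_near (Wt t t0)); apply/smM_row; apply: smM_scale; first exact: sm_inv_time.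
 by apply/smM_row; exact: sm_Zm0.
have WZ t : \forall Y \near tx t z0, Zm Y = tm Y *: W Y.
 have [->|t0] := eqVneq t 0.
  by apply: filterS2 gE W0 => Y h <-; apply/rowP => j; rewrite h !mxE.
 have h0 := tm_near_ne z0 t0.
 by apply: filterS2 h0 (Wt t t0) => Y tY <-; rewrite scalerA mulfV // scale1r.
have Wv t : t != 0 -> W (tx t z0) = 0.
 by move=> t0; rewrite -(nbhs_singleton (Wt t t0)) Zm0 scaler0.
have DWv t v : t != 0 -> lsubmx ('D_(tx 0 v) W (tx t z0)) = 0.
 move=> t0; pose c (Y : 'rV[R]_(1 + (N + r))) : 'M[R]_1 := (tm Y)%:M.
 have sc : smM (tx t z0) c.
  move=> i j; rewrite !ord1 /c; under eq_fun do rewrite mxE eqxx mulr1n; exact: sm_tm.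
 have E : \forall Y \near tx t z0, Zm Y = c Y *m W Y.
  by apply: filterS (WZ t) => Y ->; rewrite mul_scalar_mx.
 have := derive_mul (tx 0 v) sc ((smM_row _ _).2 (sW t)).
 rewrite -(near_eq_derive _ E) derive_Zm (Wv _ t0) mulmx0 add0r mul_scalar_mx tm_tx => /(congr1 lsubmx).
 by rewrite row_mxKl linearZ /= => /esym/eqP; rewrite scaler_eq0 (negbTE t0) => /eqP.
exists W => t t01; split=> //.
- have [t0|/Wv //] := eqVneq t 0; rewrite t0; apply/rowP => j.
 rewrite [RHS]mxE; apply: (@zero_right _ (fun Y => W Y 0 j : R^o) z0 (sm_cont ((sm_rVP _ _).1 (sW 0) j))).
 move=> s /andP[s0 _]; by rewrite Wv ?gt_eqF // mxE.
- move=> v; have [t0|t0] := eqVneq t 0; last exact: DWv.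
 rewrite t0; apply/rowP => j; rewrite [LHS]mxE [RHS]mxE.
 have := (@zero_right _ (fun Y => 'D_(tx 0 v) W Y 0 (lshift d j) : R^o) z0
  (sm_cont ((sm_rVP _ _).1 (sm_D (tx 0 v) (sW 0)) _))).
 apply => s /andP[s0 _]; have := DWv s v; rewrite gt_eqF // => /(_ isT)/rowP/(_ j).
 by rewrite [LHS]mxE [RHS]mxE.
- apply: filterS2 (Am_unit_near t) (WZ t) => Y uY <-; split=> //.
 by rewrite /Zm addrC subrK /Xm mulmxKV.
Qed.

End MoserField.

(** * The flow of the Moser field *)

Section MoserFlow.
Context {R : realType}.
Variables (N r d : nat).
Local Notation V := 'rV[R]_(N + r).
Local Notation dil := (@dil R N r).
Local Notation vert := (@vert R N r).

Lemma sm_lsubmx n p q x (g : 'rV[R]_n -> 'rV[R]_(p + q)) : sm x g -> sm x (fun z => lsubmx (g z)).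
Proof.
by move=> /sm_rVP h; apply/sm_rVP => j; under eq_fun do rewrite mxE; exact: h.
Qed.

Lemma sm_rsubmx n p q x (g : 'rV[R]_n -> 'rV[R]_(p + q)) : sm x g -> sm x (fun z => rsubmx (g z)).
Proof.
by move=> /sm_rVP h; apply/sm_rVP => j; under eq_fun do rewrite mxE; exact: h.
Qed.

Lemma derive_lsub n p q x v (g : 'rV[R]_n -> 'rV[R]_(p + q)) : sm x g ->
 'D_v (fun z => lsubmx (g z)) x = lsubmx ('D_v g x).
Proof.
move=> sg; pose L : 'M[R]_(p + q, p) := col_mx 1%:M 0.
have lE (y : 'rV[R]_(p + q)) : lsubmx y = y *m L.
 by rewrite -{2}[y]hsubmxK mul_row_col mulmx1 mulmx0 addr0.
rewrite (_ : (fun Z => _) = (fun Z => g Z *m L)); last by apply/funext => Z; rewrite lE.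
by rewrite (derive_mul v ((smM_row _ _).2 sg) (smM_cst x L)) derive_cstv mulmx0 addr0 lE.
Qed.

Lemma derive_dil (psi : 'rV[R]_(1 + (N + r)) -> V) Z v : sm Z psi ->
 'D_v (fun Y => psi Y *m dil (tm Y)) Z = 'D_v psi Z *m dil (tm Z) + tm v *: (psi Z *m vert).
Proof.
move=> sp'; pose c (Y : 'rV[R]_(1 + (N + r))) : 'M[R]_1 := (tm Y)%:M.
have sc : smM Z c.
 move=> i j; rewrite !ord1 /c; under eq_fun do rewrite mxE eqxx mulr1n; exact: sm_tm.
have Dc : 'D_v c Z = (tm v)%:M.
 apply/matrixP => i j; rewrite !ord1 (derive_smM v 0 0 sc) [RHS]mxE eqxx mulr1n -(derive_tm v Z).
 by apply: near_eq_derive; apply: filterE => w; rewrite /c mxE eqxx mulr1n.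
have sR := (smM_row _ _).2 sp'; have s0 := smM_cst Z (dil 0); have s1 := smM_cst Z vert.
pose A Y := psi Y *m dil 0; pose B Y := c Y *m (psi Y *m vert).
have E : (fun Y => psi Y *m dil (tm Y)) = (fun Y => A Y + B Y).
 by apply/funext => Y; rewrite dilE mulmxDr /B mul_scalar_mx scalemxAr.
have sA : sm Z A by apply/smM_row; exact: smM_mul sR s0.
have sB : sm Z B by apply/smM_row; exact: smM_mul sc (smM_mul sR s1).
rewrite E deriveD; [|exact: diff_derivable (sm_diff sA)|exact: diff_derivable (sm_diff sB)].
rewrite (derive_mul v sR s0) (derive_mul v sc (smM_mul sR s1)) (derive_mul v sR s1).
rewrite !derive_cstv !mulmx0 !addr0 Dc !mul_scalar_mx [dil (tm Z)]dilE mulmxDr -scalemxAr -addrA; congr (_ + _).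
by rewrite addrC.
Qed.

Lemma dotr_scalel n t (x y : 'rV[R]_n) : dotr (t *: x) y = t * dotr x y.
Proof. by rewrite /dotr -scalemxAl mxE. Qed.

Variables (f : V -> 'rV[R]_d) (eta : V -> 'M[R]_(N + r)) (Pm : 'rV[R]_d -> 'M[R]_d).
Local Notation Am := (Am f eta Pm).
Local Notation rhs := (rhs d eta).

Lemma flow_sum (x y a1 a2 a3 : R) : x = a1 - a2 -> y = a3 ->
 forall e g, a1 - a3 + g = e -> e = a2 -> x - y = - g.
Proof. by move=> -> -> e g <- <-; ring. Qed.

Section Along.
Variables (psi u : 'rV[R]_(1 + (N + r)) -> V) (b : 'rV[R]_(1 + (N + r)) -> 'rV[R]_d).
Definition trace Y := tx (tm Y) (psi Y).
Definition dilated Y := psi Y *m dil (tm Y).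
Definition image Y := f (dilated Y).

(** The pair that solves the Moser system is $w = \mathrm{Euler} + tu$ and $\beta = tb$, whereas the
    flow integrates [u]. *)
Definition flow_at Y := [/\ sm Y psi, sm (dilated Y) f, 'D_(tx 1 0) psi Y = u (trace Y) &
 row_mx (psi Y *m vert + tm Y *: u (trace Y)) (tm Y *: b (trace Y)) *m Am (trace Y) = rhs (trace Y)].

Lemma mscale_trace Y : mscale (trace Y) = dilated Y.
Proof. by rewrite /mscale /trace sp_tx tm_tx. Qed.

Lemma derive_image Y v : sm Y psi -> sm (dilated Y) f ->
 'D_v image Y = 'D_v dilated Y *m Jac f (dilated Y).
Proof.
move=> s1 s2; rewrite -(JacE_sm _ s2).
have sd : sm Y dilated by apply: sm_mulmx => //; exact: sm_dil.
exact: (derive_compE (f := f) v (sm_diff sd) (sm_diff s2)).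
Qed.

Lemma flow_system Y : flow_at Y ->
 let w := psi Y *m vert + tm Y *: u (trace Y) in
 w *m Bm eta (trace Y) + (tm Y *: b (trace Y)) *m (Fm f (trace Y))^T = psi Y *m vert *m eta (psi Y) /\
 w *m Fm f (trace Y) = (tm Y *: b (trace Y)) *m Pm (image Y).
Proof.
move=> [_ _ _]; rewrite /prop_in1 /Am /rhs mul_row_block mscale_trace sp_tx => /eq_row_mx[e1 e2].
split=> //; apply/eqP; rewrite -subr_eq0 -mulmxN; exact/eqP.
Qed.

(** Since [vert *m dil t] is $t$ times [vert], the dilated flow moves with $1/t$ times the image of
    $w$ under the dilation; the second Moser equation divided by $t$ gives the claim. *)
Lemma flow_base_curve Y : tm Y != 0 -> flow_at Y -> 'D_(tx 1 0) image Y = b (trace Y) *m Pm (image Y).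
Proof.
move=> t0 fl; have [_ E2] := flow_system fl; have [s1 s2 Dp _] := fl.
apply: (scalerI t0); rewrite (derive_image _ s1 s2) (derive_dil _ s1) tm_tx scale1r Dp.
rewrite [RHS]scalemxAl -E2 /Fm mscale_trace tm_tx mulmxA scalemxAl; congr (_ *m _).
by rewrite mulmxDl -(mulmxA _ vert) vert_dil -scalemxAr scalerDr -scalemxAl addrC.
Qed.

(** The same division by $t$ in the first Moser equation; the term $\alpha$ accounts for the part of
    $w$ that [u] leaves out. The result is the hypothesis [primitive] of the Moser identity. *)
Lemma flow_primitive Y c : tm Y != 0 -> flow_at Y ->
 dotr ('D_(tx 1 0) psi Y *m eta (psi Y)) ('D_(tx 0 c) psi Y)
 - dotr ('D_(tx 1 0) dilated Y *m eta (dilated Y)) ('D_(tx 0 c) dilated Y)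
 = - dotr (b (trace Y)) ('D_(tx 0 c) image Y).
Proof.
move=> t0 fl; have [E1 _] := flow_system fl; have [s1 s2 Dp _] := fl.
set p := psi Y; set t := tm Y; set c1 := 'D_(tx 0 c) psi Y.
have D1 : 'D_(tx 1 0) dilated Y = u (trace Y) *m dil t + p *m vert.
 by rewrite (derive_dil _ s1) Dp tm_tx scale1r.
have D2 : 'D_(tx 0 c) dilated Y = c1 *m dil t.
 by rewrite (derive_dil _ s1) tm_tx scale0r addr0.
have D3 : 'D_(tx 0 c) image Y = c1 *m dil t *m Jac f (dilated Y).
 by rewrite (derive_image _ s1 s2) D2.
move: E1; rewrite -/p -/t; set w := p *m vert + _ => E1.
have X1 : t * dotr (u (trace Y) *m eta p) c1 = dotr (w *m eta p) c1 - dotr (p *m vert *m eta p) c1.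
 by rewrite -dotr_scalel scalemxAl -dotrBl -mulmxBl /w addrC addKr.
have X2 : t * dotr ((u (trace Y) *m dil t + p *m vert) *m eta (dilated Y)) (c1 *m dil t) =
  dotr (w *m (dil t *m eta (dilated Y) *m dil t)) c1.
 rewrite -dotr_scalel scalemxAl dotr_mulmx dil_tr !mulmxA; congr (dotr (_ *m _ *m _) _).
 by rewrite /w mulmxDl -(mulmxA _ vert) vert_dil -scalemxAr scalerDr -scalemxAl addrC.
have X3 := congr1 (fun x => dotr x c1) E1.
rewrite dotrDl1 {1}/Bm mscale_trace sp_tx tm_tx mulmxBr dotrBl -scalemxAl dotr_scalel in X3.
rewrite -dotr_mulmx /Fm mscale_trace tm_tx mulmxA -/t -/p in X3.
rewrite Dp D1 D2 D3; apply: (mulfI t0); rewrite -/t mulrBr mulrN.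
have K1 := flow_sum X1 X2.
exact: (K1 _ _ X3 erefl).
Qed.

End Along.

Variable z0 : V.
Context (z0v : rsubmx z0 = 0) (sf : sm z0 f) (ge : \forall z \near z0, good_form eta z)
 (gP : \forall y \near f z0, good_biv Pm y).
Variables (I0 : 'M[R]_(N, d)) (Jm : 'M[R]_(r, d)).
Context (JE : Jac f z0 = col_mx I0 (Jm *m Pm (f z0))) (fJ : row_free (Jac f z0))
 (dn : (d <= N + r)%N)
 (eE : eta z0 = block_mx 0 (- (I0 *m Jm^T)) (Jm *m I0^T) (- (Jm *m Pm (f z0) *m Jm^T))).

(** This applies wherever the flow is the identity to first order in space: at time zero, and at
    every time along $X$, where it gives the invertibility of the matrix. *)
Lemma moser_mx_start psi Y : sm Y psi -> sm (dilated psi Y) f -> psi Y = sp Y ->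
 (forall v, 'D_(tx 0 v) psi Y = v) ->
 moser_mx psi (dilated psi) (image psi) eta Pm Y = Am Y.
Proof.
move=> s1 s2 pY DY; have sd : sm Y (dilated psi) by apply: sm_mulmx => //; exact: sm_dil.
have row_eq m n (A B : 'M[R]_(m, n)) : (forall v : 'rV[R]_m, v *m A = v *m B) -> A = B.
 by move=> h; apply/row_matrixP => i; rewrite !rowE h.
have J1 : Jsp psi Y = 1%:M by apply: row_eq => v; rewrite JspE // DY mulmx1.
have J2 : Jsp (dilated psi) Y = dil (tm Y).
 by apply: row_eq => v; rewrite JspE // derive_dil // DY tm_tx scale0r addr0.
have dE : dilated psi Y = mscale Y by rewrite /dilated pY.
have si : sm Y (image psi) by apply: (scomp (dilated psi) f sd s2).
have J3 : Jsp (image psi) Y = Fm f Y.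
 apply: row_eq => v; rewrite JspE // derive_image // derive_dil // DY tm_tx scale0r addr0 dE.
 by rewrite /Fm mulmxA.
by rewrite /moser_mx /pull_diff J1 J2 J3 pY dE mul1mx trmx1 mulmx1 dil_tr /image dE.
Qed.

(** At time one the dilation is the identity and the two forms cancel, so the pull-back of the
    bivector is all that remains. *)
Lemma moser_mx_end psi Y : sm Y psi -> tm Y = 1 ->
 moser_mx psi (dilated psi) (image psi) eta Pm Y =
 block_mx 0 (Jsp (image psi) Y) (Jsp (image psi) Y)^T (- Pm (f (psi Y))).
Proof.
move=> s1 t1; have dE : dilated psi Y = psi Y by rewrite /dilated t1 dil1 mulmx1.
have sd : sm Y (dilated psi) by apply: sm_mulmx => //; exact: sm_dil.
have J : Jsp (dilated psi) Y = Jsp psi Y.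
 apply/row_matrixP => i; rewrite [LHS]rowE [RHS]rowE [LHS](JspE _ sd) [RHS](JspE _ s1).
 rewrite derive_dil // t1 dil1 mulmx1 tm_tx.
 by rewrite scale0r addr0.
by rewrite /moser_mx /pull_diff J /image dE subrr.
Qed.

Lemma sm_txr n (z : 'rV[R]_n) t : sm z (fun z => tx t z).
Proof. by apply: sm_tx_row; [exact: sm_cst | exact: sm_id]. Qed.

Lemma derive_slice n m (g : 'rV[R]_(1 + n) -> 'rV[R]_m) t z v : sm (tx t z) g ->
 'D_v (fun z => g (tx t z)) z = 'D_(tx 0 v) g (tx t z).
Proof.
move=> sg; have st := sm_txr z t.
have <- : 'D_v (fun z => tx t z) z = tx 0 v.
 pose L : 'M[R]_(n, 1 + n) := row_mx 0 1%:M.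
 have E : (fun z : 'rV[R]_n => tx t z) = (fun z => z *m L + tx t 0).
  apply/funext => y; rewrite /L mul_mx_row mulmx0 mulmx1 /tx add_row_mx add0r addr0.
  by [].
 have sL : sm z (fun z => z *m L) by exact: sm_lin.
 rewrite E deriveD; [|exact: diff_derivable (sm_diff sL)|exact: derivable_cst].
 rewrite derive_cstv addr0 (derive_mul v ((smM_row _ _).2 (sm_id z)) (smM_cst z L)) derive_cstv.
 rewrite mulmx0 addr0 (_ : 'D_v id z = v); last exact: derive_id.
 by rewrite /L mul_mx_row mulmx0 mulmx1 /tx; congr row_mx; apply/matrixP => i j; rewrite !ord1 !mxE mul0rn.
exact: (derive_compE (f := g) v (sm_diff st) (sm_diff sg)).
Qed.

Lemma derive_time n (W : normedModType R) (g : 'rV[R]_(1 + n) -> W) t x : sm (tx t x) g ->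
 is_d t (fun s : R^o => g (tx s x)) ('D_(tx 1 0) g (tx t x)).
Proof.
have E (s : R) : tx 0 x + s *: tx 1 0 = tx s x by rewrite txZ txD mulr1 scaler0 addr0 add0r.
move=> sg; have := @line_derive _ _ _ g (tx 0 x) (tx 1 0) t; rewrite E.
move=> /(_ (sm_diff sg)); under eq_fun do rewrite E. by [].
Qed.

End MoserFlow.

Lemma interval0 (R : realType) : 0 <= (0 : R) <= 1. Proof. by rewrite lexx ler01. Qed.

Lemma interval1 (R : realType) : 0 <= (1 : R) <= 1. Proof. by rewrite lexx ler01. Qed.

(** Constancy of the vector part, turned into existence of a covector at time one. The matrices are
    abstract so that rewriting does not touch the concrete ones. *)
Lemma solution_transfer (R : realType) n d (A0 A1 B0 B1 : 'M[R]_(n + d)) (a0 : 'rV[R]_n) :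
 A0 = B0 -> A1 = B1 -> A0 \in unitmx -> A1 \in unitmx ->
 lsubmx (row_mx a0 0 *m invmx A1) = lsubmx (row_mx a0 0 *m invmx A0) ->
 forall (w : 'rV[R]_n) (be : 'rV[R]_d), row_mx w be *m B0 = row_mx a0 0 ->
 exists be' : 'rV[R]_d, row_mx w be' *m B1 = row_mx a0 0.
Proof.
move=> <- <- u0 u1 c w be E; exists (rsubmx (row_mx a0 0 *m invmx A1)).
have E0 : row_mx a0 0 *m invmx A0 = row_mx w be by rewrite -E mulmxK.
have wE : w = lsubmx (row_mx a0 0 *m invmx A1) by rewrite c E0 row_mxKl.
by rewrite {1}wE hsubmxK mulmxKV.
Qed.

(** * Existence of the Moser flow in coordinates *)

Section MoserLocal.
Context {R : realType}.
Variables (N r d : nat).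
Local Notation V := 'rV[R]_(N + r).
Local Notation dil := (@dil R N r).
Local Notation vert := (@vert R N r).
Variables (f : V -> 'rV[R]_d) (eta : V -> 'M[R]_(N + r)) (Pm : 'rV[R]_d -> 'M[R]_d).
Local Notation Am := (Am f eta Pm).
Local Notation rhs := (rhs d eta).
Variable z0 : V.
Context (z0v : rsubmx z0 = 0) (sf : sm z0 f) (ge : \forall z \near z0, good_form eta z)
 (gP : \forall y \near f z0, good_biv Pm y).
Variables (I0 : 'M[R]_(N, d)) (Jm : 'M[R]_(r, d)).
Context (JE : Jac f z0 = col_mx I0 (Jm *m Pm (f z0))) (fJ : row_free (Jac f z0))
 (dn : (d <= N + r)%N)
 (eE : eta z0 = block_mx 0 (- (I0 *m Jm^T)) (Jm *m I0^T) (- (Jm *m Pm (f z0) *m Jm^T))).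

(** The last clause is the outcome: if $(w, a_0)$ solves the system at time zero, it lies in the
    pull-back of the bivector by the time-one map, with the same $w$ and $a_0$ and another
    covector. *)
Definition moser_flow (u psi : 'rV[R]_(1 + (N + r)) -> V) :=
 [/\ forall t, 0 <= t <= 1 -> [/\ sm (tx t z0) u, sm (tx t z0) psi, psi (tx t z0) = z0,
    (forall v, 'D_(tx 0 v) psi (tx t z0) = v) &
    \forall Y \near tx t z0, [/\ sm Y psi,
     (forall (w : V) (b : 'rV[R]_d), row_mx w b *m Am Y = rhs Y -> w = sp Y *m vert + tm Y *: u Y) &
     'D_(tx 1 0) psi Y = u (trace psi Y) /\
     exists b : 'rV[R]_d, row_mx (psi Y *m vert + tm Y *: u (trace psi Y)) b *m Am (trace psi Y) =
      rhs (trace psi Y)]],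
  \forall z \near z0, psi (tx 0 z) = z &
  \forall z \near z0, forall (w : V) (be : 'rV[R]_d) (a0 : V), row_mx w be *m Am (tx 0 z) = row_mx a0 0 ->
   exists be' : 'rV[R]_d, row_mx w be' *m block_mx 0 (Jsp (image f psi) (tx 1 z))
    (Jsp (image f psi) (tx 1 z))^T (- Pm (f (psi (tx 1 z)))) = row_mx a0 0].

Lemma moser_local : exists u psi, moser_flow u psi.
Proof.
have [se ske _] := nbhs_singleton ge; have [sP nskP _] := nbhs_singleton gP.
have skP := nbhs_singleton nskP.
have [W hW] := moser_field z0v sf se sP skP JE fJ dn eE.
pose u Y := lsubmx (W Y); pose b Y := rsubmx (W Y).
have hu t : 0 <= t <= 1 -> [/\ sm (tx t z0) u, u (tx t z0) = 0 &
  forall v, 'D_(tx 0 v) u (tx t z0) = 0].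
 move=> /hW[sW W0 DW _]; split; first exact: sm_lsubmx.
  by rewrite /u W0; apply/rowP => j; rewrite !mxE.
 by move=> v; rewrite (derive_lsub _ sW) DW.
have [e e0 [psi [P0 P1 P2 P3]]] := flow_fixed hu.
pose sol Y := [/\ sm Y W, Am Y \in unitmx & (row_mx (sp Y *m vert) 0 + tm Y *: W Y) *m Am Y = rhs Y].
have nsol t : 0 <= t <= 1 -> \forall Y \near tx t z0, sol Y.
 move=> /hW[sW _ _ h]; have n1 : \forall Y \near tx t z0, sm Y W by exact: sm_nbhs.
 by apply: filterS2 n1 h => Y a [b' c].
have WE Y : row_mx (sp Y *m vert) 0 + tm Y *: W Y = row_mx (sp Y *m vert + tm Y *: u Y) (tm Y *: b Y).
 by rewrite -{1}[W Y]hsubmxK scale_row_mx add_row_mx add0r.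
have ball_near t : 0 <= t <= 1 -> \forall Y \near tx t z0, - e < tm Y < 1 + e /\ `|sp Y - z0| < e.
 move=> /andP[t0 t1]; have n1 := tm_near t z0 e0.
 have n2 : \forall Y \near tx t z0, `|sp Y - z0| < e.
  apply: (near_comp (P := fun z => `|z - z0| < e) (sm_cont (sm_sp (tx t z0)))).
  by rewrite sp_tx; exact: near_dist.
 apply: filterS2 n1 n2 => Y; rewrite ltr_norml => /andP[a1 a2] a3; split=> //.
 by apply/andP; split; lra.
have npsi t : 0 <= t <= 1 -> \forall Y \near tx t z0, sm Y psi /\ 'D_(tx 1 0) psi Y = u (trace psi Y).
 move=> /ball_near; apply: filterS => Y [h1 h2]; have [s1 [_ D1]] := P1 _ _ h1 h2.
 have [_ D2] := derive_time s1; move: s1 D1 D2; rewrite tx_eta => s1 D1 D2; split; first exact: s1.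
 by rewrite -D2 D1.
have spsi t (h : 0 <= t <= 1) : sm (tx t z0) psi by have [] := nbhs_singleton (npsi t h).
have str t (h : 0 <= t <= 1) : sm (tx t z0) (trace psi) by apply: sm_tx_row; [exact: sm_tm|exact: spsi].
have tr0 t (h : 0 <= t <= 1) : trace psi (tx t z0) = tx t z0 by rewrite /trace tm_tx P2.
have sdil t (h : 0 <= t <= 1) : sm (tx t z0) (dilated psi) by apply: sm_mulmx; [exact: spsi|exact: sm_dil].
have dil0 t (h : 0 <= t <= 1) : dilated psi (tx t z0) = z0 by rewrite /dilated P2 // z0_dil.
have simg t (h : 0 <= t <= 1) : sm (tx t z0) (image f psi).
 by apply: (scomp (dilated psi) f (sdil t h)); rewrite dil0.
have img0 t (h : 0 <= t <= 1) : image f psi (tx t z0) = f z0 by rewrite /image dil0.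
pose MM := moser_mx psi (dilated psi) (image f psi) eta Pm.
(* Everything that the Moser identity asks for at one time and point. It holds near the segment over
   [z0], hence on a uniform tube around it. *)
pose G Y := [/\ flow_at f eta Pm psi u b Y, good_form eta (psi Y), good_form eta (dilated psi Y),
 good_biv Pm (image f psi Y) & sm (trace psi Y) W /\ MM Y \in unitmx].
have nG t : 0 <= t <= 1 -> \forall Y \near tx t z0, G Y.
 move=> h.
 have n1 := npsi t h.
 have n2 : \forall Y \near tx t z0, sol (trace psi Y).
  by apply: (near_comp (P := sol) (sm_cont (str t h))); rewrite tr0 //; exact: nsol.
 have n3 : \forall Y \near tx t z0, good_form eta (psi Y).
  by apply: (near_comp (P := good_form eta) (sm_cont (spsi t h))); rewrite P2.
 have n4 : \forall Y \near tx t z0, good_form eta (dilated psi Y).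
  by apply: (near_comp (P := good_form eta) (sm_cont (sdil t h))); rewrite dil0.
 have n5 : \forall Y \near tx t z0, good_biv Pm (image f psi Y).
  by apply: (near_comp (P := good_biv Pm) (sm_cont (simg t h))); rewrite img0.
 have n6 : \forall Y \near tx t z0, sm (dilated psi Y) f.
  apply: (near_comp (P := fun z => sm z f) (sm_cont (sdil t h))); rewrite dil0 //; exact: sm_nbhs.
 have n7 : \forall Y \near tx t z0, MM Y \in unitmx.
  apply: unit_near.
   by apply: sm_moser_mx; [exact: spsi|exact: sdil|exact: simg|exact: nbhs_singleton n3
    |exact: nbhs_singleton n4|exact: nbhs_singleton n5].
  rewrite /MM moser_mx_start //; [exact: (Am0_unit z0v skP JE fJ dn eE)|exact: spsi| | |].
  - by rewrite dil0.
  - by rewrite P2 // sp_tx.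
  - by move=> v; exact: P3.
 apply: filterS3 (filterI n1 n2) (filterI n3 n4) (filterI n5 (filterI n6 n7)).
 move=> Y [[a1 a2] [a3 a4 a5]] [a6 a7] [a8 [a9 a10]]; split=> //; split=> //.
 by move: a5; rewrite WE /trace sp_tx tm_tx.
have nnG t : 0 <= t <= 1 -> \forall Y \near tx t z0, \forall Z \near Y, G Z.
 by move=> /nG; exact: nbhs_interior.
have [rho rho0 hrho] := segment_near nnG.
have Gz t z : 0 <= t <= 1 -> `|z - z0| <= rho -> \forall Z \near tx t z, G Z.
 move=> /andP[h0 h1] hz; apply: hrho hz; apply/andP; split; lra.
have nball (m : R) : 0 < m -> \forall z \near z0, `|z - z0| < m by exact: near_dist.
exists u, psi; split.
- move=> t h; have [su _ _] := hu t h; split=> //; [exact: spsi|exact: P2|by move=> v; exact: P3|].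
 have n1 := nsol t h; have n2 := nG t h.
 apply: filterS2 n1 n2 => Y [_ uY sY] [[s1 _ s3 s4] _ _ _ _]; split=> //.
  move=> w b' E; have := etrans E (esym sY); rewrite WE => /(can_inj (mulmxK uY))/eq_row_mx[-> _].
  by [].
 by split=> //; exists (tm Y *: b (trace psi Y)).
- by apply: filterS (nball e e0) => z hz; exact: P0.
- apply: filterS2 (nball _ rho0) (nball _ e0) => z hz hz' w be a0 E.
 have Gt t h := nbhs_singleton (Gz t z h (ltW hz)).
 pose x Y := row_mx a0 0 *m invmx (MM Y).
 have flow_sm Y : G Y -> [/\ sm Y psi, sm Y (dilated psi), sm Y (image f psi),
   sm Y (fun Y => b (trace psi Y)) & smM Y x].
  move=> [[s1 s2 _ _] g1 g2 g3 [sWt uM]].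
  have sd : sm Y (dilated psi) by apply: sm_mulmx; [exact: s1|exact: sm_dil].
  have si : sm Y (image f psi) by exact: (scomp (dilated psi) f sd s2).
  split=> //; last first.
   apply: smM_mul; first exact: smM_cst.
   by apply: smM_invmx uM; apply: sm_moser_mx.
  apply: sm_rsubmx; apply: (scomp (trace psi) W) sWt.
  by apply: sm_tx_row => //; exact: sm_tm.
 have sx t : 0 <= t <= 1 -> sm (tx t z) (fun Y => lsubmx (x Y)).
  by move=> /Gt/flow_sm[_ _ _ _ /smM_row s]; exact: sm_lsubmx.
 (* The division by $t$ behind the Moser identity fails at time zero, but constancy takes the
    derivative at interior times and continuity at the ends. *)
 have const : lsubmx (x (tx 1 z)) = lsubmx (x (tx 0 z)).
  apply: (@curve_const _ _ (fun t => lsubmx (x (tx t z))) 0 1 ler01).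
   move=> s hs; exact: is_d_cont (derive_time (sx s hs)).
  move=> s /andP[s0 s1]; have hs : 0 <= s <= 1 by rewrite !ltW.
  have sn0 : tm (tx s z) != 0 by rewrite tm_tx gt_eqF.
  have D := derive_time (sx s hs).
  have [t1 t2 t3 t4 _] := flow_sm _ (Gt s hs).
  have [_ g1 g2 g3 [_ uM]] := Gt s hs.
  have nG' := Gz s z hs (ltW hz).
  have ntm := tm_near_ne z (_ : s != 0); rewrite tm_tx in sn0.
  have prim c : \forall Y \near tx s z,
    dotr ('D_(tx 1 0) psi Y *m eta (psi Y)) ('D_(tx 0 c) psi Y)
    - dotr ('D_(tx 1 0) (dilated psi) Y *m eta (dilated psi Y)) ('D_(tx 0 c) (dilated psi) Y)
    = - dotr (b (trace psi Y)) ('D_(tx 0 c) (image f psi) Y).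
   by apply: filterS2 nG' (ntm sn0) => Y [fl _ _ _ _] tY; exact: (flow_primitive c tY fl).
  have bc : \forall Y \near tx s z, 'D_(tx 1 0) (image f psi) Y = b (trace psi Y) *m Pm (image f psi Y).
   by apply: filterS2 nG' (ntm sn0) => Y [fl _ _ _ _] tY; exact: (flow_base_curve tY fl).
  have K := moser_constant t1 t2 t3 t4 g1 g2 prim g3 bc a0 uM.
  by rewrite -[0]K.
 have h0 := @interval0 R.
 have h1 := @interval1 R.
 have [[s10 s20 _ _] _ _ _ [_ uM0]] := Gt 0 h0.
 have [[s11 _ _ _] _ _ _ [_ uM1]] := Gt 1 h1.
 have near0 : \forall y \near z, psi (tx 0 y) = y.
  have h : \forall y \near z, `|y - z0| < e.
   apply/nbhs_ballP; exists (e - `|z - z0|); first by rewrite /= subr_gt0.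
   move=> y; rewrite -ball_normE /= => hy; rewrite -(subrK z y) -addrA.
   by apply: le_lt_trans (ler_normD _ _) _; rewrite distrC -ltrBrDr.
  by apply: filterS h => y hy; exact: P0.
 have M0 : MM (tx 0 z) = Am (tx 0 z).
  have pz : psi (tx 0 z) = sp (tx 0 z) by rewrite sp_tx; exact: nbhs_singleton near0.
  apply: moser_mx_start; [exact: s10|exact: s20|exact: pz|] => v.
  by rewrite -(derive_slice v s10) (near_eq_derive _ near0); exact: derive_id.
 have Mend := moser_mx_end f eta Pm s11 (tm_tx 1 z).
 have K := solution_transfer M0 Mend uM0 uM1 const.
 exact: (K w be E).
Qed.

End MoserLocal.

(** * Curves under a change of chart *)

Section Curves.
Context {R : realType} {M : charted R} (hM : lman M).

Lemma is_derive_comp_curve n m (G : 'rV[R]_n -> 'rV[R]_m) (g : R -> 'rV[R]_n) (s : R) a :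
 is_d s (g : R^o -> _) a -> differentiable G (g s) ->
 is_d s (fun s : R^o => G (g s)) ('D_a G (g s)).
Proof.
move=> [dg <-] dG; have fg : differentiable (g : R^o -> _) (s : R^o) by apply/derivable1_diffP.
have fc : differentiable (fun s : R^o => G (g s)) (s : R^o) by exact: differentiable_comp fg dG.
split; first exact: diff_derivable.
exact: (derive_compE (f := G) (1 : R^o) fg dG).
Qed.

Lemma change_chart_sm c c' p : atlas M c -> atlas M c' -> c.1 p -> c'.1 p -> sm (c.2 p) (fun z => c'.2 (cinv c p z)).
Proof.
move=> ac ac' cp c'p.
by have [_] := (smapP hM hM (phi := id) ac cp ac' c'p).1 (smooth_map_id hM p).
Qed.

Lemma crd_change c c' p a : atlas M c -> atlas M c' -> c.1 p -> c'.1 p ->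
 crd c' (vec c p a) = 'D_a (fun z => c'.2 (cinv c p z)) (c.2 p).
Proof.
move=> ac ac' cp c'p; have sG := change_chart_sm ac ac' cp c'p.
apply/rowP => j; rewrite mxE (derive_rV j (diff_derivable (sm_diff sG))) /vec asboolT //.
by apply: smooth_coord.
Qed.

Lemma curve_change_chart c c' (g : R -> M) s a : atlas M c -> atlas M c' -> c.1 (g s) -> c'.1 (g s) ->
 mcont g s -> is_d s (fun s : R^o => c.2 (g s)) a ->
 is_d s (fun s : R^o => c'.2 (g s)) (crd c' (vec c (g s) a)).
Proof.
move=> ac ac' cp c'p mc D; rewrite (crd_change a ac ac' cp c'p).
have sG := change_chart_sm ac ac' cp c'p.
have := is_derive_comp_curve D (sm_diff sG); apply: is_derive_near.
have n1 := mc _ (open_mn (copen hM ac) cp).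
by apply: filterS n1 => s' cs'; rewrite cinvK.
Qed.

End Curves.

Lemma push_comp (R : realType) (M N Q : charted R) (hN : lman N) (hQ : lman Q) (f : M -> N) (g : N -> Q) p v :
 smooth_map_at f p -> smooth_map_at g (f p) -> push (g \o f) p v = push g (f p) (push f p v).
Proof.
move=> sf sg; apply/funext => h; rewrite /push; case: asboolP => // sh.
by rewrite asboolT //; exact: (smooth_comp hN hQ sg sh).
Qed.

(** * The Moser system without coordinates *)

Section System.
Context {R : realType} {M X P : charted R} (hM : lman M) (hX : lman X) (hP : lman P)
 (pi : bivector M) (i : X -> M) (hpi : poisson_on setT pi) (hi : embedding i) (r : nat)
 (hr : coregular i pi r) (piP : bivector P) (hpiP : poisson_on setT piP).
Local Notation E := (perp_dual i pi r).
Local Notation zE := (zs i (perp i pi) r).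
Local Notation fcE := (fchart i (perp i pi)).
Local Notation ZV := 'rV[R]_(mdim X + r).
Local Notation m t := (fscale t : E -> E).
Let hF := perp_subbundle hM hX hpi hi hr.
Let hE : lman E := perp_lman hM hX hpi hi hr.

(** The velocity of $s \mapsto se$ at $s = 1$: the Euler field, written without charts so that
    solutions from different charts can be compared. *)
Definition euler (e : E) : tvec E := fun g =>
 if `[< smooth_at e (g : E -> R^o) >] then derive1 (fun s : R => g (fscale s e)) 1 else 0.

Context (eta : E -> tvec E -> tvec E -> R^o) (f : E -> P).

(** The covector [be] witnesses that $(w, \alpha)$ lies in the pull-back by $f \circ m_t$ of the
    Dirac structure of [piP], gauge transformed by $\eta - m_t^*\eta$. *)
Definition moser_system (t : R) (e : E) (w : tvec E) (be : cvec P) (al : tvec E -> R) : Prop :=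
 (forall v, tangent e v -> eta e w v - eta (m t e) (push (m t) e w) (push (m t) e v)
   + be (push (f \o m t) e v) = al v) /\
 push (f \o m t) e w = sharp piP (f (m t e)) be.

Lemma m_smooth t e : smooth_map_at (m t) e.
Proof. exact: (@fscale_smooth _ _ _ hM hX i (embS hi) (perp i pi) r hF t e). Qed.

Section Chart.
Context c O (s : 'I_r -> X -> tvec M) (ac : atlas X c) (oO : mopen O) (Oc : O `<=` c.1)
 (fr : frame_on i (perp i pi) O s).
Local Notation C := (fcE c O s).
Let aC : atlas E C := fatlas ac oO Oc fr.

Lemma fscale_dil t (e : E) : C.2 (m t e) = (C.2 e : ZV) *m @dil R _ r t.
Proof. by rewrite fscaleE mul_dil. Qed.

Lemma euler_vec (e : E) : O (base e) ->
 euler e = vec C e ((C.2 e : ZV) *m @vert R _ r).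
Proof.
move=> Oe; set w := _ *m vert _ _; apply/funext => g; rewrite /euler /vec.
case: asboolP => // sg; have Ce : C.1 e by [].
pose y : ZV := C.2 e - w.
have Ep t : C.2 (m t e) = y + t *: w.
 have d1 : C.2 e = (C.2 e : ZV) *m @dil R _ r 0 + w.
  by rewrite -{1}[C.2 e](@mulmx1 R 1 (mdim X + r)) -dil1 dilE mulmxDr scale1r.
 have yE : y = (C.2 e : ZV) *m @dil R _ r 0 by rewrite /y {1}d1 addrK.
 by rewrite fscale_dil dilE mulmxDr -scalemxAr -/w yE.
have y1 : y + 1 *: w = C.2 e by rewrite scale1r subrK.
rewrite derive1E; move: sg => /(smoothP hE _ aC Ce) sg.
have := @line_derive R _ R^o (g \o cinv C e) y w 1; rewrite y1.
move=> /(_ (sm_diff sg)) D; apply: derive_val; move: D.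
by congr is_derive; apply/funext => t /=; rewrite -Ep cinvK.
Qed.

Lemma push_m_crd (t : R) (e : E) (w : tvec E) : O (base e) -> tangent e w ->
 crd C (push (m t) e w) = (crd C w : ZV) *m @dil R _ r t.
Proof.
move=> Oe tw; have Ce : C.1 e by []; have Ce' : C.1 (m t e) by [].
rewrite (push_crd hE hE aC Ce aC Ce' (m_smooth t e) tw); congr (_ *m _).
have [_ sh] := (smapP hE hE aC Ce aC Ce').1 (m_smooth t e).
apply: (Jac_eq sh) => v.
have E1 : \forall z \near C.2 e, hat C C (m t) e z = (z : ZV) *m @dil R _ r t.
 have h := cinvP hE aC Ce; apply: filterS h => z [h1 h2].
 by rewrite -[hat _ _ _ _ _]/(C.2 (m t (cinv C e z))) fscale_dil h2.
rewrite (near_eq_derive _ E1).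
have sid := (smM_row _ _).2 (sm_id (C.2 e : ZV)).
have := derive_mul v sid (smM_cst _ (@dil R _ r t)); rewrite derive_cstv mulmx0 addr0.
by move=> ->; congr (_ *m _); exact: derive_id.
Qed.

Context (D : set E) (hD : closed_form_on D eta) (e0 : E) (b : cht P) (ab : atlas P b).
Definition floc : ZV -> 'rV[R]_(mdim P) := hat C b f e0.
Definition etaloc (z : ZV) : 'M[R]_(mdim X + r) := EM eta C (cinv C e0 z).
Definition Ploc (y : 'rV[R]_(mdim P)) : 'M[R]_(mdim P) := PM piP b (cinv b (f e0) y).

Lemma system_crd (t : R) (e : E) (w : tvec E) (be : cvec P) (al : tvec E -> R) a0 : O (base e) -> D e -> D (m t e) ->
 smooth_map_at f (m t e) -> b.1 (f (m t e)) -> tangent e w -> cotangent (f (m t e)) be ->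
 (forall v, tangent e v -> al v = dotr a0 (crd C v)) ->
 (moser_system t e w be al <->
  row_mx (crd C w : ZV) (ccrd b (f (m t e)) be) *m
   Am floc etaloc Ploc (tx t (C.2 e : ZV)) = row_mx a0 0).
Proof.
move=> Oe De Dm sf bf tw tb alE; have Ce : C.1 e by []; have Cm : C.1 (m t e) by [].
have [sk1 _ _] := hD De; have [sk2 _ _] := hD Dm; have [skP _ _] := hpiP (I : setT (f (m t e))).
have mE : mscale (tx t (C.2 e : ZV)) = C.2 (m t e).
 by rewrite /mscale sp_tx tm_tx fscale_dil.
have e1 : etaloc (C.2 e) = EM eta C e by rewrite /etaloc cinvK.
have e2 : etaloc (C.2 (m t e)) = EM eta C (m t e) by rewrite /etaloc cinvK.
have e3 : Ploc (floc (C.2 (m t e))) = PM piP b (f (m t e)) by rewrite /Ploc /floc hatK // cinvK.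
pose J := Jac floc (C.2 (m t e)).
have pE v : tangent e v -> crd b (push (f \o m t) e v) = (crd C v : ZV) *m (@dil R _ r t *m J).
 move=> tv; rewrite (push_comp hE hP v (m_smooth t e) sf) mulmxA -(push_m_crd t Oe tv).
 by apply: (push_crdp hE hP) => //; apply: pushT => //; exact: m_smooth.
have tpm v : tangent e v -> tangent (m t e) (push (m t) e v) by apply: pushT => //; exact: m_smooth.
have smf : smooth_map_at (f \o m t) e by apply: (smap_comp hE hE hP) => //; exact: m_smooth.
have tpf v : tangent e v -> tangent (f (m t e)) (push (f \o m t) e v) by exact: pushT smf.
set w' : ZV := crd C w; set b' := ccrd _ _ _.
have L v : tangent e v -> eta e w v - eta (m t e) (push (m t) e w) (push (m t) e v)
   + be (push (f \o m t) e v) =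
  dotr (w' *m Bm etaloc (tx t (C.2 e : ZV)) +
   b' *m (Fm floc (tx t (C.2 e : ZV)))^T) (crd C v : ZV).
 move=> tv; rewrite (eta_crd hE sk1 aC Ce tw tv) (eta_crd hE sk2 aC Cm (tpm _ tw) (tpm _ tv)).
 rewrite (cotangentE hP ab bf tb (tpf _ tv)) pE // !push_m_crd //.
 rewrite /Bm /Fm mE sp_tx tm_tx e1 e2 dotrDl1 mulmxBr dotrBl -/J dotr_mulmx -/b'.
 by rewrite dotr_mulmx dil_tr !mulmxA.
have K : w' *m Fm floc (tx t (C.2 e : ZV)) = crd b (push (f \o m t) e w).
 rewrite (_ : Fm floc _ = @dil R _ r t *m J); first exact: esym (pE w tw).
 by rewrite /Fm mE tm_tx.
have S : crd b (sharp piP (f (m t e)) be) = b' *m Ploc (floc (C.2 (m t e))).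
 by rewrite e3 (sharp_crd hP skP ab bf tb).
rewrite /Am mul_row_block mE; split=> [[h1 h2]|/eq_row_mx[h1 h2]].
 congr row_mx; last by rewrite K h2 S mulmxN subrr.
 apply: dotr_inj => v; have tv := vecT hE v aC Ce.
 by have := h1 _ tv; rewrite L // alE // crd_vec.
split=> [v tv|]; first by rewrite L // h1 alE.
apply: (crd_inj hP ab bf); [exact: tpf|exact: sharpT|].
by rewrite -K S; apply/eqP; rewrite -subr_eq0 -mulmxN; apply/eqP.
Qed.

End Chart.
End System.

(** * Closed forms and Poisson bivectors as matrices near a point *)

Section LocalTensors.
Context {R : realType} {M : charted R} (hM : lman M).

Lemma cinv_indep c p q : atlas M c -> c.1 q -> \forall z \near c.2 q, cinv c p z = cinv c q z.
Proof.
move=> ac cq; have h := near_image ac cq (copen hM ac) cq.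
by apply: filterS h => z [q' [cq' _ <-]]; rewrite !cinvK.
Qed.

Lemma smM_near n p q z (A B : 'rV[R]_n -> 'M[R]_(p, q)) : (\forall w \near z, A w = B w) ->
 smM z A -> smM z B.
Proof. by move=> h sA i j; apply: sm_near (sA i j); apply: filterS h => w ->. Qed.

Lemma EM_good (U : set M) (eta : M -> tvec M -> tvec M -> R^o) c p q : mopen U -> closed_form_on U eta ->
 atlas M c -> c.1 q -> U q -> good_form (fun z => EM eta c (cinv c p z)) (c.2 q).
Proof.
move=> oU hU ac cq Uq; have h := cinv_indep p ac cq; have [sk _ _] := hU q Uq.
have sE0 : smM (c.2 q) (fun z => EM eta c (cinv c q z)) by exact: (EM_smooth hM hU).
have sE : smM (c.2 q) (fun z => EM eta c (cinv c p z)).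
 by apply: smM_near sE0; apply: filterS h => z ->.
split=> //; first by rewrite cinvK //; exact: EM_skew.
move=> u v w; have D x y w' : 'D_x (fun z => dotr (y *m EM eta c (cinv c q z)) w' : R^o) (c.2 q) =
  dotr (y *m 'D_x (fun z => EM eta c (cinv c p z)) (c.2 q)) w'.
 rewrite -(derive_bil_cst x y w' sE); by apply: near_eq_derive; apply: filterS h => z' ->.
have K := EM_closed hM hU oU ac cq Uq u v w.
by rewrite !D in K.
Qed.

Lemma PM_good (pi : bivector M) c p q : poisson_on setT pi ->
 atlas M c -> c.1 q -> good_biv (fun z => PM pi c (cinv c p z)) (c.2 q).
Proof.
move=> hpi ac cq; have h := cinv_indep p ac cq.
have sE0 : smM (c.2 q) (fun z => PM pi c (cinv c q z)) by exact: (PM_smooth hM hpi).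
have sE : smM (c.2 q) (fun z => PM pi c (cinv c p z)).
 by apply: smM_near sE0; apply: filterS h => z ->.
split=> //.
 apply: filterE => z; apply: PM_skew; by have [] := hpi (cinv c p z) I.
move=> a b g; have K := PM_jacobi hM hpi (mopenT hM) ac cq (I : setT q) a b g.
have D x y w : 'D_x (fun z => dotr (y *m PM pi c (cinv c q z)) w : R^o) (c.2 q) =
  dotr (y *m 'D_x (fun z => PM pi c (cinv c p z)) (c.2 q)) w.
 rewrite -(derive_bil_cst x y w sE); by apply: near_eq_derive; apply: filterS h => z' ->.
rewrite !D in K; rewrite cinvK //.
Qed.

End LocalTensors.

(** * The Moser flow in a bundle chart *)

Section LocalFlow.
Context {R : realType} {M X P : charted R} (hM : lman M) (hX : lman X) (hP : lman P)
 (pi : bivector M) (i : X -> M) (hpi : poisson_on setT pi) (hi : embedding i) (r : nat)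
 (hr : coregular i pi r) (piP : bivector P) (hpiP : poisson_on setT piP).
Local Notation E := (perp_dual i pi r).
Local Notation zE := (zs i (perp i pi) r).
Local Notation fcE := (fchart i (perp i pi)).
Local Notation ZV := 'rV[R]_(mdim X + r).
Local Notation m t := (fscale t : E -> E).
Let hF := perp_subbundle hM hX hpi hi hr.
Let hE : lman E := perp_lman hM hX hpi hi hr.
Context (eta : E -> tvec E -> tvec E -> R^o) (f : E -> P) (D DE : set E) (oD : mopen D)
 (hD : closed_form_on D eta) (Dz : forall x, D (zE x)) (oDE : mopen DE) (DEz : forall x, DE (zE x))
 (sf : forall e, DE e -> smooth_map_at f e) (dn : (mdim P <= mdim X + r)%N).
Local Notation alpha e := (fun v => eta e (euler e) v).

Context (x : X) c O (s : 'I_r -> X -> tvec M) (b : cht P) (ac : atlas X c) (oO : mopen O)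
 (Oc : O `<=` c.1) (fr : frame_on i (perp i pi) O s) (Ox : O x) (ab : atlas P b)
 (bf : b.1 (f (zE x))).
Local Notation C := (fcE c O s).
Let aC : atlas E C := fatlas ac oO Oc fr.
Let Cz : C.1 (zE x) := Ox.
Local Notation z0 := (C.2 (zE x) : ZV).
Context (I0 : 'M[R]_(mdim X, mdim P)) (Jm : 'M[R]_(r, mdim P))
 (fG : row_free (col_mx I0 (Jm *m PM piP b (f (zE x)))))
 (JE : Jac (hat C b f (zE x)) (C.2 (zE x)) = col_mx I0 (Jm *m PM piP b (f (zE x))))
 (eE : EM eta C (zE x) = block_mx 0 (- (I0 *m Jm^T)) (Jm *m I0^T) (- (Jm *m PM piP b (f (zE x)) *m Jm^T))).
Local Notation fl := (floc f c O s (zE x) b).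
Local Notation el := (etaloc eta c O s (zE x)).
Local Notation Pl := (Ploc piP f (zE x) b).

Definition good_point (z : ZV) :=
 exists e, [/\ C.1 e, C.2 e = z, D e, DE e & b.1 (f e)].

Lemma good_near : \forall z \near z0, good_point z.
Proof.
have oU : mopen (D `&` (DE `&` f @^-1` b.1)).
 apply/(mopenP hE) => e [De [DEe be]]; apply: (mnbhsI hE); first exact: open_mn.
 apply: (mnbhsI hE); first exact: open_mn.
 by apply: (smap_cont hE hP (sf DEe)); apply: open_mn => //; exact: copen ab.
have h := near_image aC Cz oU (conj (Dz x) (conj (DEz x) bf)).
by apply: filterS h => z [q [Cq [Dq [DEq bq]] <-]]; exists q.
Qed.

Lemma local_moser : exists u psi, moser_flow fl el Pl z0 u psi.
Proof.
have fl0 : fl z0 = b.2 (f (zE x)) by rewrite /floc hatK.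
have Pl0 : Pl (fl z0) = PM piP b (f (zE x)) by rewrite fl0 /Ploc cinvK.
have el0 : el z0 = EM eta C (zE x) by rewrite /etaloc cinvK.
have h1 : rsubmx z0 = 0 by rewrite zsE row_mxKr.
have h2 : sm z0 fl by have [_] := (smapP hE hP aC Cz ab bf).1 (sf (DEz x)).
have h3 : \forall z \near z0, good_form el z.
 by apply: filterS good_near => z [e [Ce <- De _ _]]; exact: (EM_good hE _ oD hD aC Ce De).
have h4 : \forall y \near fl z0, good_biv Pl y.
 rewrite fl0; have h := near_image ab bf (copen hP ab) bf.
 by apply: filterS h => y [q [bq _ <-]]; exact: (PM_good hP _ hpiP ab bq).
have h5 : Jac fl z0 = col_mx I0 (Jm *m Pl (fl z0)) by rewrite Pl0; exact: JE.
have h6 : row_free (Jac fl z0) by rewrite h5 Pl0.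
have h7 : el z0 = block_mx 0 (- (I0 *m Jm^T)) (Jm *m I0^T) (- (Jm *m Pl (fl z0) *m Jm^T)).
 by rewrite el0 Pl0.
exact: (moser_local h1 h2 h3 h4 h5 h6 dn h7).
Qed.

Lemma point_system t z : good_point z -> good_point (z *m @dil R _ r t) ->
 exists e, [/\ C.1 e, C.2 e = z, cinv C (zE x) z = e & [/\ O (base e), D e, D (m t e),
   smooth_map_at f (m t e) & b.1 (f (m t e))]].
Proof.
move=> [e [Ce Ez De _ _]] [e' [Ce' Ez' De' DEe' be']]; exists e.
have em : m t e = e'.
 by apply: (chart_inj hE aC _ Ce'); rewrite // fscale_dil Ez Ez'.
split=> //; first by rewrite -Ez cinvK.
by rewrite em; split=> //; exact: sf.
Qed.

Lemma floc_sm e : C.1 e -> DE e -> b.1 (f e) -> sm (C.2 e) fl.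
Proof.
move=> Ce De be; have [_ sh] := (smapP hE hP aC Ce ab be).1 (sf De).
apply: sm_near sh; have h := hat_indep hE b f (zE x) aC Ce; by apply: filterS h => z Ez; exact: esym Ez.
Qed.

Lemma alpha_crd e v : C.1 e -> D e -> tangent e v ->
 alpha e v = dotr ((C.2 e : ZV) *m @vert R _ r *m el (C.2 e)) (crd C v).
Proof.
move=> Ce De tv; have [sk _ _] := hD De; rewrite (euler_vec hM hX hpi hi hr ac oO Oc fr Ce).
rewrite (eta_crd hE sk aC Ce (vecT hE _ aC Ce) tv) (crd_vec hE _ aC Ce).
by rewrite /etaloc cinvK.
Qed.

(** A solution of the Moser system, in whatever chart it was found, has the components
    $\mathrm{Euler} + tu$ in this one: the part of the invertibility that does not depend on charts,
    by which flows are compared. *)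
Definition unique_velocity (u : 'rV[R]_(1 + (mdim X + r)) -> ZV) Y := forall e w be,
 C.1 e -> C.2 e = sp Y -> tangent e w -> cotangent (f (m (tm Y) e)) be ->
 moser_system piP eta f (tm Y) e w be (alpha e) -> crd C w = sp Y *m @vert R _ r + tm Y *: u Y.

(** [g e] is the integral curve from [e], for starting points in [Q]. The last group says that $f
    \circ g_1$ is an immersion and carries solutions at time zero to elements of the Dirac structure
    pulled back from [P]. *)
Definition flow_package (u : 'rV[R]_(1 + (mdim X + r)) -> ZV) (g : E -> R -> E) (Q : set E) :=
 [/\ [/\ mopen Q, Q (zE x), Q `<=` C.1 & g (zE x) 1 = zE x],
  (forall e, Q e -> g e 0 = e),
  (forall e t, Q e -> 0 <= t <= 1 -> [/\ mcont (g e) t, C.1 (g e t),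
    is_d t (fun s : R^o => C.2 (g e s)) (u (tx t (C.2 (g e t)))),
    sm (tx t (C.2 (g e t))) u /\ (\forall Y \near tx t (C.2 (g e t) : ZV), unique_velocity u Y) &
    exists be, cotangent (f (m t (g e t))) be /\ moser_system piP eta f t (g e t)
     (vec C (g e t) ((C.2 (g e t) : ZV) *m @vert R _ r + t *: u (tx t (C.2 (g e t))))) be
     (alpha (g e t))]) &
  (forall e, Q e -> [/\ b.1 (f (g e 1)), smooth_map_at (fun e => f (g e 1)) e,
    row_free (Jac (hat C b (fun e => f (g e 1)) e) (C.2 e)) &
    forall w be a0, tangent e w -> cotangent (f (m 0 e)) be ->
     moser_system piP eta f 0 e w be (fun v => dotr a0 (crd C v)) ->
     exists be', [/\ cotangent (f (g e 1)) be',
      (forall v, tangent e v -> be' (push (fun e => f (g e 1)) e v) = dotr a0 (crd C v)) &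
      push (fun e => f (g e 1)) e w = sharp piP (f (g e 1)) be']])].

Lemma local_flow : exists u g Q, flow_package u g Q.
Proof.
have [u [psi [H1 H2 H3]]] := local_moser.
pose im := image fl psi.
pose H (Y : 'rV[R]_(1 + (mdim X + r))) := [/\ sm Y u, good_point (sp Y), good_point (mscale Y) &
 forall (w : ZV) (be : 'rV[R]_(mdim P)), row_mx w be *m Am fl el Pl Y = rhs (mdim P) el Y ->
  w = sp Y *m @vert R _ r + tm Y *: u Y].
have z0v : rsubmx z0 = 0 by rewrite zsE row_mxKr.
have nH t : 0 <= t <= 1 -> \forall Y \near tx t z0, H Y.
 move=> ht; have [su _ _ _ nY] := H1 t ht.
 have n1 : \forall Y \near tx t z0, sm Y u by exact: sm_nbhs.
 have n2 : \forall Y \near tx t z0, good_point (sp Y).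
  by apply: (near_comp (P := good_point) (sm_cont (sm_sp _))); rewrite sp_tx; exact: good_near.
 have n3 : \forall Y \near tx t z0, good_point (mscale Y).
  apply: (near_comp (P := good_point) (sm_cont (sm_mscale (tx t z0)))); rewrite mscale0 //; exact: good_near.
 by apply: filterS3 n1 (filterI n2 n3) nY => Y a [b' c'] [_ d _]; split.
pose HH (Y : 'rV[R]_(1 + (mdim X + r))) := \forall Z \near Y, H Z.
have nHH t : 0 <= t <= 1 -> \forall Y \near tx t z0, HH Y by move=> /nH h; exact: (nbhs_interior h).
pose G (Y : 'rV[R]_(1 + (mdim X + r))) := [/\ HH (trace psi Y), H (trace psi Y), sm Y psi, 'D_(tx 1 0) psi Y = u (trace psi Y) &
 exists be : 'rV[R]_(mdim P), row_mx (psi Y *m @vert R _ r + tm Y *: u (trace psi Y)) be *m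
   Am fl el Pl (trace psi Y) = rhs (mdim P) el (trace psi Y)].
have nG t : 0 <= t <= 1 -> \forall Y \near tx t z0, G Y.
 move=> ht; have [su sp' p0 _ nY] := H1 t ht.
 have st : sm (tx t z0) (trace psi) by apply: sm_tx_row; [exact: sm_tm|exact: sp'].
 have t0 : trace psi (tx t z0) = tx t z0 by rewrite /trace tm_tx p0.
 have n1 : \forall Y \near tx t z0, HH (trace psi Y).
  by apply: (near_comp (P := HH) (sm_cont st)); rewrite t0; exact: nHH.
 apply: filterS2 n1 nY => Y a [c1 _ [c2 c3]]; split=> //; exact: nbhs_singleton a.
have [rho rho0 hrho] := segment_near nG.
have nG' : \forall z \near z0, forall t, 0 <= t <= 1 -> G (tx t z).
 have h : \forall z \near z0, ball z0 rho z by exact: nbhsx_ballx.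
 apply: filterS h => z; rewrite -ball_normE /= distrC => hz t /andP[h0 h1].
 by apply: hrho; [apply/andP; split; lra|exact: ltW].
have i1 := @interval1 R; have i0 := @interval0 R.
have [_ sp1 p1 Dp1 _] := H1 1 i1.
have pt Y : G Y -> good_point (psi Y).
 by move=> [_ [_ h _ _] _ _ _]; move: h; rewrite /trace sp_tx.
have fsm Y : G Y -> tm Y = 1 -> sm Y im.
 move=> GY tY; have [_ _ s1 _ _] := GY; have [e [Ce Ez De DEe be]] := pt _ GY.
 apply: (scomp (dilated psi) fl).
  by apply: sm_mulmx => //; exact: sm_dil.
 by rewrite /dilated tY dil1 mulmx1 -Ez; exact: floc_sm.
have G1 := nbhs_singleton nG' 1 i1.
have sim := fsm _ G1 (tm_tx 1 z0).
have J0 : Jsp im (tx 1 z0) = col_mx I0 (Jm *m PM piP b (f (zE x))).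
 rewrite -JE; apply/row_matrixP => k; rewrite !rowE (JspE _ sim).
 have sd : sm (tx 1 z0) (dilated psi) by apply: sm_mulmx => //; exact: sm_dil.
 have d1 : dilated psi (tx 1 z0) = z0 by rewrite /dilated tm_tx dil1 mulmx1.
 have [_ sh] := (smapP hE hP aC Cz ab bf).1 (sf (DEz x)).
 rewrite (derive_image _ sp1) ?d1 // (derive_dil _ sp1) !tm_tx scale0r addr0 dil1 mulmx1 Dp1.
 by [].
(* Full rank is certified by the right inverse [B] at [z0], whose product with the differential
   stays invertible nearby. *)
have nfree : \forall z \near z0, row_free (Jsp im (tx 1 z)).
 have [B GB] := row_freeP fG.
 have sK : smM z0 (fun z => Jsp im (tx 1 z) *m B).
  apply: smM_mul; last exact: smM_cst.
  exact: (smM_comp (sm_txr z0 1) (sm_Jsp sim)).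
 have uK : Jsp im (tx 1 z0) *m B \in unitmx by rewrite J0 GB unitmx1.
 have h := unit_near sK uK; apply: filterS h => z uz.
 by apply/row_freeP; exists (B *m invmx (Jsp im (tx 1 z) *m B)); rewrite mulmxA mulmxV.
pose K (z : ZV) := [/\ (forall t, 0 <= t <= 1 -> G (tx t z)), psi (tx 0 z) = z, row_free (Jsp im (tx 1 z)) &
 forall (w : ZV) (be : 'rV[R]_(mdim P)) (a0 : ZV), row_mx w be *m Am fl el Pl (tx 0 z) = row_mx a0 0 ->
   exists be' : 'rV[R]_(mdim P), row_mx w be' *m block_mx 0 (Jsp im (tx 1 z))
    (Jsp im (tx 1 z))^T (- Pl (fl (psi (tx 1 z)))) = row_mx a0 0].
have nK : \forall z \near z0, K z.
 by apply: filterS3 (filterI nG' nfree) H2 H3 => z [a1 a2] a3 a4; split.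
have [V [oV Vz VK]] := near_open nK.
pose g e t := cinv C (zE x) (psi (tx t (C.2 e : ZV))).
pose Q : set E := [set e | C.1 e /\ V (C.2 e)].
exists u, g, Q.
have gE e t : Q e -> 0 <= t <= 1 -> [/\ C.1 (g e t), C.2 (g e t) = psi (tx t (C.2 e)), G (tx t (C.2 e)),
  D (g e t) & DE (g e t) /\ b.1 (f (g e t))].
 move=> [Ce /VK[hG _ _ _]] ht; have Gt := hG t ht; have [e' [Ce' Ez De DEe be]] := pt _ Gt.
 have ge : g e t = e' by rewrite /g -Ez cinvK.
 by rewrite ge; split.
have oQ : mopen Q by exact: (mopen_chart hE aC oV).
have Qz : Q (zE x) by split.
split.
- split=> //; first by move=> e [].
 by rewrite /g p1 cinvK.
- by move=> e [Ce /VK[_ h _ _]]; rewrite /g h cinvK.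
- move=> e t Qe ht; have [Cg Eg Gt Dg [DEg bg]] := gE e t Qe ht.
 have [nHt Ht spt Dt [be Ebe]] := Gt; have [sut g1 g2 _] := Ht.
 have trE : trace psi (tx t (C.2 e : ZV)) = tx t (C.2 (g e t)) by rewrite /trace tm_tx Eg.
 have Dcurve : is_d t (fun s : R^o => psi (tx s (C.2 e))) (u (tx t (C.2 (g e t)))).
  by have := derive_time spt; rewrite Dt trE.
 split=> //.
 + apply: (mcont_cinv hE aC Cz); first by exists (g e t).
  exact: is_d_cont Dcurve.
 + have st : sm (tx t (C.2 e : ZV)) (trace psi) by apply: sm_tx_row; [exact: sm_tm|exact: spt].
  have ct := is_d_cont (derive_time st).
  have n : \forall s' \near t, H (trace psi (tx s' (C.2 e : ZV))).
   move: nHt ct; rewrite /HH; move: (H) (trace psi) => H' q nHt ct.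
   exact: (ct _ nHt).
  apply: is_derive_near Dcurve; apply: filterS n => s' [_ gs _ _].
  by move: gs; rewrite /trace sp_tx /g => -[e' [Ce' <- _ _ _]]; rewrite cinvK.
 + rewrite -trE; split=> //; apply: filterS nHt => Y [_ gY1 gY2 uY] e' w be' Ce' Ee' tw tb hs.
  have [e2 [Ce2 Ee2 _ [Oe2 De2 Dm2 sf2 bf2]]] := point_system gY1 gY2.
  have ee : e2 = e' by apply: (chart_inj hE aC Ce2 Ce'); rewrite Ee2 Ee'.
  rewrite ee in Oe2 De2 Dm2 sf2 bf2.
  have := (system_crd hM hX hP hpi hi hr hpiP ac oO Oc fr hD (zE x) ab Oe2 De2 Dm2 sf2 bf2 tw tb
   (fun v tv => alpha_crd Ce' De2 tv)).1 hs.
  by rewrite Ee' tx_eta => /uY.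
 + rewrite trE in g1 g2; rewrite /mscale sp_tx tm_tx in g1 g2.
  have [e2 [Ce2 Ee2 _ [Oe2 De2 Dm2 sf2 bf2]]] := point_system g1 g2.
  have ee : e2 = g e t by apply: (chart_inj hE aC Ce2 Cg); rewrite Ee2.
  rewrite ee in Oe2 De2 Dm2 sf2 bf2.
  exists (covec b (f (m t (g e t))) be); split; first exact: covecT.
  have tv := vecT hE ((C.2 (g e t) : ZV) *m @vert R _ r + t *: u (tx t (C.2 (g e t)))) aC Cg.
  apply: (system_crd hM hX hP hpi hi hr hpiP ac oO Oc fr hD (zE x) ab Oe2 De2 Dm2 sf2 bf2 tv (covecT hP _ _ _)
   (fun v tv => alpha_crd Cg De2 tv)).2.
  rewrite (crd_vec hE _ aC Cg) (ccrd_covec hP be ab bf2).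
  rewrite trE tm_tx -Eg in Ebe; apply: (etrans Ebe).
  rewrite /rhs sp_tx; exact: erefl.
- move=> e Qe; have [Cg Eg Gt Dg [DEg bg]] := gE e 1 Qe i1; have [Ce Ve] := Qe.
 have [_ psi0 free K4] := VK _ Ve.
 pose F := fun e => f (g e 1); pose Hm := Jsp im (tx 1 (C.2 e : ZV)).
 have simg := fsm _ Gt (tm_tx 1 _).
 have s1 : sm (C.2 e : ZV) (fun z => im (tx 1 z)).
  exact: (scomp (fun z => tx 1 z) im (sm_txr _ 1) simg).
 have nF : \forall z \near C.2 e, im (tx 1 (z : ZV)) = hat C b F e z.
  have h := cinvP hE aC Ce; apply: filterS h => z [c1 c2].
  rewrite /im /image /dilated tm_tx dil1 mulmx1.
  by rewrite -[hat _ _ _ _ _]/(b.2 (f (cinv C (zE x) (psi (tx 1 (C.2 (cinv C e z) : ZV)))))) c2.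
 have s2 := sm_near nF s1.
 have smF : smooth_map_at F e.
  apply/(smapP hE hP aC Ce ab bg); split=> //.
  by exists Q; split=> // e' Qe'; have [_ _ _ _ []] := gE e' 1 Qe' i1.
 have JF : Jac (hat C b F e) (C.2 e) = Hm.
  apply: (Jac_eq s2) => v; rewrite -(near_eq_derive v nF) /Hm (JspE _ simg).
  exact: derive_slice.
 split=> //; first by rewrite JF.
 move=> w be a0 tw tb hs.
 have [hG _ _ _] := VK _ Ve.
 have [_ [_ g1 g2 _] _ _ _] := hG 0 i0.
 rewrite /mscale /trace !sp_tx !tm_tx psi0 in g1 g2.
 have [e2 [Ce2 Ee2 _ [Oe2 De2 Dm2 sf2 bf2]]] := point_system g1 g2.
 have ee : e2 = e by apply: (chart_inj hE aC Ce2 Ce); rewrite Ee2.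
 rewrite ee in Oe2 De2 Dm2 sf2 bf2.
 have sys := (system_crd hM hX hP hpi hi hr hpiP ac oO Oc fr hD (zE x) ab Oe2 De2 Dm2 sf2 bf2 tw tb
  (fun v _ => erefl (dotr a0 (crd C v)))).1 hs.
 have [be' Ebe'] := K4 _ _ _ sys.
 move: Ebe'; rewrite mul_row_block mulmx0 add0r => /eq_row_mx[E1 E2].
 have PlE : Pl (fl (psi (tx 1 (C.2 e)))) = PM piP b (F e).
  by rewrite -Eg /floc hatK // /Ploc cinvK.
 have tb' := covecT hP b (F e) be'.
 exists (covec b (F e) be'); split=> //.
  move=> v tv; rewrite (covecE _ _ (pushT hE hP smF tv)) (push_crd hE hP aC Ce ab bg smF tv) JF.
  by rewrite dotr_mulmx E1.
 have [skP _ _] := hpiP (I : setT (F e)).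
 have tF := pushT hE hP smF tw.
 apply: (crd_inj hP ab bg tF); [exact: sharpT|].
 rewrite (push_crd hE hP aC Ce ab bg smF tw) JF (sharp_crd hP skP ab bg tb') ccrd_covec //.
 apply/eqP; rewrite -subr_eq0 -mulmxN -PlE; apply/eqP; exact: E2.
Qed.

End LocalFlow.

(** [sharp] is defined by pairing with differentials, and a Poisson map preserves the pairing of
    pulled back covectors. Functions that are not smooth are treated apart, both sides being zero on
    them. *)
Lemma push_sharp (R : realType) (P M : charted R) (hP : lman P) (hM : lman M) (piP : bivector P) (pi : bivector M)
 (k : P -> M) q b : smooth_map_at k q -> skew_form (cotangent (k q)) (pi (k q)) ->
 (forall a b, cotangent (k q) a -> cotangent (k q) b -> piP q (copull k q a) (copull k q b) = pi (k q) a b) ->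
 cotangent (k q) b -> push k q (sharp piP q (copull k q b)) = sharp pi (k q) b.
Proof.
move=> sk [lin _] hk cb; apply/funext => h; rewrite /push /sharp; case: asboolP => sh.
 rewrite -hk //; last exact: dif_cotangent.
 congr (piP _ _ _); apply/funext => v; rewrite /dif /copull /restr; case: asboolP => // tv.
 by rewrite asboolT; [rewrite /push asboolT|exact: (pushT hP hM sk tv)].
have -> : dif h (k q) = 0.
 by apply/funext => v; rewrite /dif /restr; case: asboolP => // tv; exact: (tangent_nonsmooth tv sh).
by rewrite (linear_on0 (cotangent_sub (k q)) (lin _ cb)).
Qed.

Lemma sharp_pairing (R : realType) (M : charted R) (hM : lman M) (pi : bivector M) q a b :
 skew_form (cotangent q) (pi q) -> cotangent q a -> cotangent q b -> b (sharp pi q a) = pi q a b.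
Proof.
move=> sk ca cb; have [c ac cq] := chart_ex hM q.
rewrite (cotangentE hM ac cq cb (sharpT hM sk ca)) (sharp_crd hM sk ac cq ca).
by rewrite (pi_crd hM sk ac cq ca cb) dotrC.
Qed.

Lemma push_near (R : realType) (M N : charted R) (hM : lman M) (hN : lman N) (phi phi' : M -> N) p v :
 mnbhs p (fun q => phi q = phi' q) -> smooth_map_at phi p -> tangent p v -> push phi p v = push phi' p v.
Proof.
move=> n s tv; apply/funext => h; rewrite /push -(mnbhs_self n); case: asboolP => // sh.
apply: (tangent_local tv); first exact: (smooth_comp hM hN s sh).
by apply: mnbhs_sub n => q /= ->.
Qed.

Lemma row_free_cancel (R : realType) n d (J : 'M[R]_(n, d)) (a b : 'rV[R]_d) : (d <= n)%N -> row_free J ->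
 a *m J^T = b *m J^T -> a = b.
Proof.
move=> dn fJ; have rk : \rank J = n by apply/eqP.
have dE : d = n by apply/eqP; rewrite eqn_leq dn -rk rank_leq_col.
by apply: row_free_inj; rewrite /row_free mxrank_tr rk -dE.
Qed.

(** * Gluing the local flows *)

Section Glue.
Context {R : realType} {M X P : charted R} (hM : lman M) (hX : lman X) (hP : lman P)
 (pi : bivector M) (i : X -> M) (hpi : poisson_on setT pi) (hi : embedding i) (r : nat)
 (hr : coregular i pi r) (piP : bivector P) (hpiP : poisson_on setT piP).
Local Notation E := (perp_dual i pi r).
Local Notation zE := (zs i (perp i pi) r).
Local Notation fcE := (fchart i (perp i pi)).
Local Notation m t := (fscale t : E -> E).
Local Notation pr := (@base R X M (perp i pi) : E -> X).
Let hF := perp_subbundle hM hX hpi hi hr.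
Let hE : lman E := perp_lman hM hX hpi hi hr.
Context (eta : E -> tvec E -> tvec E -> R^o) (f : E -> P).

Lemma tx_cont n (a : R -> 'rV[R]_n) (t : R) : {for t, continuous a} ->
 {for t, continuous (fun s : R => tx s (a s))}.
Proof.
move=> ca; apply/cont_rVP => j; have ca' := (cont_rVP _ _).1 ca.
case: (split_ordP j) => k ->.
 have -> : (fun s : R => (tx s (a s)) 0 (lshift n k) : R^o) = (fun s : R => s).
  by apply/funext => s; rewrite /tx row_mxEl ord1 mxE eqxx mulr1n.
 exact: cvg_id.
have -> : (fun s : R => (tx s (a s)) 0 (rshift 1 k) : R^o) = (fun s : R => a s 0 k : R^o).
 by apply/funext => s; rewrite /tx row_mxEr.
exact: ca'.
Qed.

Definition flow_data x c O s b u g Q := [/\ atlas X c, mopen O, O `<=` c.1, frame_on i (perp i pi) O s &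
 [/\ atlas P b, O x & flow_package piP eta f x c O s b u g Q]].

(** At a common point and a positive time both fields $\mathrm{Euler} + tu$ solve the same system,
    so they agree by [unique_velocity], and so do the velocities after division by $t$. The two
    curves thus solve one equation in one chart and [curve_unique] concludes. *)
Lemma flow_agree x c O s b u g Q x' c' O' s' b' u' g' Q' e :
 flow_data x c O s b u g Q -> flow_data x' c' O' s' b' u' g' Q' -> Q e -> Q' e -> g e 1 = g' e 1.
Proof.
move=> [ac oO Oc fr [ab Ox [[oQ _ QC _] g0 gt _]]] [ac' oO' Oc' fr' [ab' Ox' [[oQ' _ QC' _] g0' gt' _]]] Qe Qe'.
set C := fcE c O s; set C' := fcE c' O' s'.
have aC : atlas E C by exact: fatlas.
have aC' : atlas E C' by exact: fatlas.
apply: (curve_unique hE).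
- by move=> t ht; have [] := gt e t Qe ht; have [] := gt' e t Qe' ht.
- move=> t ht Et; have [mt Ct dt [sut nut] _] := gt e t Qe ht; exists C, u; split=> //.
 have [mt' Ct' _ _ _] := gt' e t Qe' ht.
 have Cgt : C.1 (g' e t) by rewrite -Et.
 have n1 : \forall s0 \near t, C.1 (g' e s0) by exact: mt' _ (open_mn (copen hE aC) Cgt).
 have ct := tx_cont (chart_cont hE aC Cgt mt').
 have n2 : \forall s0 \near t, unique_velocity piP eta f c O s u (tx s0 (C.2 (g' e s0))).
  by apply: ct; rewrite -Et.
 apply: filterS2 n1 n2 => s0 Cs us /andP[s00 s01].
 have hs0 : 0 <= s0 <= 1 by rewrite !ltW.
 split; first by have [] := gt e s0 Qe hs0.
 have [ms' Cs' ds' _ [be [tb hsys]]] := gt' e s0 Qe' hs0.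
 set p := g' e s0 in Cs us ms' Cs' ds' be tb hsys *.
 have D := curve_change_chart hE aC' aC Cs' Cs ms' ds'.
 set a' := u' _ in D hsys.
 have tv y := vecT hE y aC' Cs'.
 have tbm : cotangent (f (m (tm (tx s0 (C.2 p : 'rV[R]_(mdim X + r)))) p)) be by rewrite tm_tx.
 have hsys' := hsys; rewrite -{1 2}(tm_tx s0 (C.2 p : 'rV[R]_(mdim X + r))) in hsys'.
 have := us p _ be Cs _ (tv _) tbm hsys'; rewrite sp_tx tm_tx => /(_ erefl).
 rewrite -[_ + _ *: a']addrC (vecD hE s0 _ _ aC' Cs') crdD.
 rewrite -(euler_vec hM hX hpi hi hr ac' oO' Oc' fr' Cs') (euler_vec hM hX hpi hi hr ac oO Oc fr Cs).
 have K (x1 x2 v1 v2 : 'rV[R]_(mdim X + r)) : v2 = v1 -> s0 *: x1 + v2 = v1 + s0 *: x2 -> x1 = x2.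
  by move=> ->; rewrite addrC => /addrI; apply: scalerI; rewrite gt_eqF.
 have cE := crd_vec hE ((C.2 p : 'rV[R]_(mdim X + r)) *m @vert R _ r) aC Cs.
 by move=> /(K _ _ _ _ cE) E1; rewrite -E1; exact: D.
- by rewrite g0 // g0'.
Qed.

Definition flow_value e p := exists x c O s b u g Q, [/\ flow_data x c O s b u g Q, Q e & p = f (g e 1)].

(** By [flow_agree] the value does not depend on the local flow that is picked; where there is none,
    [f] serves as the default. *)
Definition glued (e : E) : P := match pselect (exists p, flow_value e p) with
 | left h => sval (cid h) | right _ => f e end.

Lemma gluedE x c O s b u g Q e : flow_data x c O s b u g Q -> Q e -> glued e = f (g e 1).
Proof.
move=> h Qe; rewrite /glued; case: pselect => [h'|n]; last first.
 by exfalso; apply: n; exists (f (g e 1)), x, c, O, s, b, u, g, Q.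
case: cid => p /= [x' [c' [ O' [s' [b' [u' [g' [Q' [h2 Qe' ->]]]]]]]]].
by congr f; exact: flow_agree h2 h Qe' Qe.
Qed.

Context (W : X -> set (tvec M)) (D U : set E) (oD : mopen D) (hD : closed_form_on D eta)
 (piU : bivector E) (k : P -> M) (hk : embedding k) (hkP : poisson_map_on setT piP pi k)
 (hU : U `<=` D) (hmodel : local_model eta U piU)
 (eta0 : forall x v1 v2, tangent x v1 -> tangent x v2 -> eta (zE x) (push zE x v1) (push zE x v2) = 0)
 (kf : forall x, k (f (zE x)) = i x) (sfz : forall x, smooth_map_at f (zE x))
 (exist_flow : forall x, exists c O s b u g Q, flow_data x c O s b u g Q).

Lemma pr_smooth e : smooth_map_at pr e.
Proof.
have [c [ O [s [ac oO Oc fr Oe]]]] := echart_ex hX hF e.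
exact: (base_smooth hM hX (embS hi) hF ac oO Oc fr Oe).
Qed.

Lemma zE_smooth x : smooth_map_at zE x.
Proof.
have [c [ O [s [ac oO Oc fr Oe]]]] := echart_ex hX hF (zE x).
exact: (zs_smooth hM hX (embS hi) hF ac oO Oc fr Oe).
Qed.

Lemma m0E (e : E) : m 0 e = zE (base e).
Proof. by apply: dual_ext => //; apply/funext => v; rewrite /fib /= mul0r. Qed.

(** At time zero, $f \circ m_0$ followed by [k] is [i] after the bundle projection, and $m_0^*\eta$
    vanishes because $\eta$ has no component on $TX$. So membership in the Dirac structure of the
    local model is the system at time zero, with the covector on $M$ pulled back to [P] by [k]. *)
Lemma model_system e a : U e -> cotangent e a -> exists be,
 cotangent (f (m 0 e)) be /\ moser_system piP eta f 0 e (sharp piU e a) be a.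
Proof.
move=> Ue ca; have [oU Uz pU gU] := hmodel; have [skU _ _] := pU e Ue.
pose v := sharp piU e a; have tv : tangent e v by exact: sharpT.
have : poisson_graph piU e (v, a) by split.
rewrite -gU // => -[a1 [_ [b1 [tpv [b2 [cb2 pv]] /= b1E] /= a1E]] /= aE].
have m0f : m 0 = zE \o pr :> (E -> E) by apply/funext => e'; exact: m0E.
exists (copull k (f (m 0 e)) b2).
have kfm : k (f (m 0 e)) = i (base e) by rewrite m0E kf.
have sk := embS hk.
have cb2' : cotangent (k (f (m 0 e))) b2 by rewrite kfm.
have sfm : smooth_map_at (f \o m 0) e.
 by apply: (smap_comp hE hE hP (m_smooth hM hX hpi hi hr 0 e)); rewrite m0E.
have pkE w : push k (f (m 0 e)) (push (f \o m 0) e w) = push i (base e) (push pr e w).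
 rewrite -(push_comp hP hM w sfm (sk _)).
 have -> : k \o (f \o m 0) = i \o pr.
  by apply/funext => e'; rewrite /= m0E kf.
 exact: (push_comp hX hM w (pr_smooth e) (embS hi _)).
have cop : cotangent (f (m 0 e)) (copull k (f (m 0 e)) b2) by apply: copullT => //; exact: sk.
split; first exact: cop.
split=> [w tw|].
 have tpw : tangent (base e) (push pr e w) by exact: (pushT hE hX (pr_smooth e) tw).

 have -> : eta (m 0 e) (push (m 0) e (sharp piU e a)) (push (m 0) e w) = 0.
  rewrite m0E m0f !(push_comp hX hE _ (pr_smooth e) (zE_smooth _)).
  exact: eta0.
 have av : a w = a1 w + restr (tangent e) (eta e v) w := congr1 (fun h : cvec E => h w) aE.
 rewrite subr0 -/v av a1E b1E /restr /copull /restr !asboolT //; last exact: (pushT hE hP sfm tw).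
 by rewrite pkE addrC.
have [_ inj _ _] := hk.
apply: (inj (f (m 0 e))); [exact: (pushT hE hP sfm tv)| |].
 by apply: (sharpT hP) => //; have [] := hpiP (I : setT (f (m 0 e))).
rewrite pkE -/v [push i _ _]pv.
have [skM _ _] := hpi (I : setT (k (f (m 0 e)))).
have PS := push_sharp hP hM (sk (f (m 0 e))) skM (hkP I) cb2'.
by rewrite PS kfm.
Qed.

Local Notation F := glued.
Context (dn : (mdim P <= mdim X + r)%N).
Definition glued_dom : set E := [set e | U e /\ exists x c O s b u g Q, flow_data x c O s b u g Q /\ Q e].

Lemma glued_near x c O s b u g Q e : flow_data x c O s b u g Q -> Q e ->
 mnbhs e (fun e' => f (g e' 1) = F e').
Proof.
move=> h Qe; have [_ _ _ _ [_ _ [[oQ _ _ _] _ _ _]]] := h.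
by exists Q; split=> // e' Qe'; rewrite (gluedE h Qe').
Qed.

Lemma glued_dom_open : mopen glued_dom.
Proof.
have [oU _ _ _] := hmodel; apply/(mopenP hE) => e [Ue [x [c [ O [s [b [u [g [Q [h Qe]]]]]]]]]].
have [_ _ _ _ [_ _ [[oQ _ _ _] _ _ _]]] := h.
apply: mnbhs_sub (mnbhsI hE (open_mn oU Ue) (open_mn oQ Qe)) => e' [Ue' Qe'].
by split=> //; exists x, c, O, s, b, u, g, Q.
Qed.

Lemma glued_dom_zs x : glued_dom (zE x) /\ F (zE x) = f (zE x).
Proof.
have [c [ O [s [b [u [g [Q h]]]]]]] := exist_flow x; have [_ _ _ _ [_ _ [[_ Qz _ gz] _ _ _]]] := h.
have [_ Uz _ _] := hmodel.
split; last by rewrite (gluedE h Qz) gz.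
by split; [exact: Uz|exists x, c, O, s, b, u, g, Q].
Qed.

Lemma glued_smooth e : glued_dom e -> smooth_map_at F e.
Proof.
move=> [_ [x [c [ O [s [b [u [g [Q [h Qe]]]]]]]]]].
have [_ _ _ _ [_ _ [_ _ _ /(_ e Qe)[_ s1 _ _]]]] := h.
exact: (smooth_map_near (phi := fun e' => f (g e' 1)) hE hP (glued_near h Qe) s1).
Qed.

Lemma glued_immersion e : glued_dom e -> exists C b, [/\ atlas E C, C.1 e, atlas P b, b.1 (F e) &
 row_free (Jac (hat C b F e) (C.2 e))].
Proof.
move=> De; have sF := glued_smooth De; move: De => [_ [x [c [ O [s [b [u [g [Q [h Qe]]]]]]]]]].
have [ac oO Oc fr [ab _ [[_ _ QC _] _ _ /(_ e Qe)[be s1 fJ _]]]] := h.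
have aC : atlas E (fcE c O s) by exact: fatlas.
exists (fcE c O s), b; split; [exact: aC|exact: QC|exact: ab|by rewrite (gluedE h Qe); exact: be|].
rewrite -(@Jac_near _ _ _ (hat (fcE c O s) b (fun e => f (g e 1)) e)) //.
have n := (mnbhsP hE _ aC (QC _ Qe)).1 (glued_near h Qe).
by apply: filterS n => z Ez; rewrite /hat /= Ez.
Qed.

(** The Hamiltonian vector of the pulled back covector solves the system at time zero, hence is
    related to the same covector at time one. The differential being invertible by the dimension
    count, the covector found on [P] must be [a], and pairing with [b] concludes. *)
Lemma glued_poisson e a b : glued_dom e -> cotangent (F e) a -> cotangent (F e) b ->
 piU e (copull F e a) (copull F e b) = piP (F e) a b.
Proof.
move=> De ca cb; have sF := glued_smooth De.
have [Ue [x [c [ O [s [b' [u [g [Q [h Qe]]]]]]]]]] := De.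
have [ac oO Oc fr [ab _ [[_ _ QC _] _ _ /(_ e Qe)[be s1 fJ hsys]]]] := h.
have aC : atlas E (fcE c O s) by exact: fatlas.
have Ce := QC _ Qe; have FE := gluedE h Qe; have nF := glued_near h Qe.
have [oU Uz pU gU] := hmodel; have [skU _ _] := pU e Ue.
have [skP _ _] := hpiP (I : setT (F e)).
have cfa : cotangent e (copull F e a) by apply: copullT.
have cfb : cotangent e (copull F e b) by apply: copullT.
have [be0 [tb0 [S1 S2]]] := model_system Ue cfa.
set w := sharp piU e (copull F e a) in S1 S2.
have tw : tangent e w by exact: sharpT.
have al v : tangent e v -> copull F e a v = dotr (ccrd (fcE c O s) e (copull F e a)) (crd (fcE c O s) v).
 by move=> tv; rewrite -(cotangentE hE aC Ce cfa tv).
have [be' [cb' B1 B2]] := hsys w be0 _ tw tb0 (conj (fun v tv => etrans (S1 v tv) (al v tv)) S2).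
have ab' : b'.1 (f (g e 1)) by [].
have ca' : cotangent (f (g e 1)) a by rewrite -FE.
have be'a : be' = a.
 apply: (cotangent_inj hP ab ab' cb' ca').
 apply: (row_free_cancel dn fJ); apply: dotr_inj => y; rewrite -!dotr_mulmx.
 have ty := vecT hE y aC Ce; have tF := pushT hE hP s1 ty.
 have := B1 _ ty; rewrite -al // /copull /restr asboolT // -(push_near hE hP nF s1 ty).
 rewrite (cotangentE hP ab ab' cb' tF) (cotangentE hP ab ab' ca' tF).
 by rewrite (push_crd hE hP aC Ce ab ab' s1 ty) (crd_vec hE _ aC Ce).
rewrite -(sharp_pairing hE skU cfa cfb) -/w /copull /restr asboolT //.
rewrite -(push_near hE hP nF s1 tw) B2 be'a -FE.
exact: sharp_pairing.
Qed.

End Glue.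

(** * Immersions between manifolds of equal dimension *)

Section LocalDiffeo.
Context {R : realType} {E P : charted R} (hE : lman E) (hP : lman P) (F : E -> P) (Q : set E)
 (oQ : mopen Q) (sF : forall e, Q e -> smooth_map_at F e)
 (imm : forall e, Q e -> exists C b, [/\ atlas E C, C.1 e, atlas P b, b.1 (F e) & row_free (Jac (hat C b F e) (C.2 e))])
 (dn : (mdim P <= mdim E)%N).

Lemma dimension_cast n d : n = d -> exists (A : 'M[R]_(d, n)) (B : 'M[R]_(n, d)), A *m B = 1%:M /\ B *m A = 1%:M.
Proof. by move=> ->; exists 1%:M, 1%:M; rewrite mulmx1. Qed.

(** The rank and [dn] make the two dimensions equal, but only by a proved equation; the mutually
    inverse matrices [A] and [B] pass between the two types of row vectors so that the inverse
    function theorem applies. *)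
Lemma local_inverse e : Q e -> exists h : P -> E, [/\ smooth_map_at h (F e), h (F e) = e,
 mnbhs e (fun e' => h (F e') = e') & mnbhs (F e) (fun p => F (h p) = p)].
Proof.
move=> Qe; have [C [b [aC Ce ab be fJ]]] := imm Qe.
have [n1 sh] := (smapP hE hP aC Ce ab be).1 (sF Qe).
set J := Jac _ _ in fJ; have rk : \rank J = mdim E by apply/eqP.
have dE : mdim E = mdim P by apply/eqP; rewrite eqn_leq dn -rk rank_leq_col.
have [A [B [AB BA]]] := dimension_cast dE.
pose G z := hat C b F e z *m A.
have sG : sm (C.2 e) G by apply: sm_mulmx sh (smM_cst _ _).
have JG : Jac G (C.2 e) = J *m A.
 apply: (Jac_eq sG) => v.
 by rewrite (derive_mul v ((smM_row _ _).2 sh) (smM_cst _ A)) derive_cstv mulmx0 addr0 (JacE_sm _ sh) mulmxA.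
have uG : Jac G (C.2 e) \in unitmx.
 apply: unitmx_inj => y; rewrite JG mulmxA => /(congr1 (mulmx^~ B)); rewrite -!mulmxA AB mulmx1 mul0mx.
 by rewrite -[RHS](mul0mx _ J) => /(row_free_inj fJ).
have [h0 [sh0 h0e h0G Gh0]] := inverse_function sG uG.
have GE q : C.1 q -> G (C.2 q) = b.2 (F q) *m A by move=> Cq; rewrite /G hatK.
pose h p := cinv C e (h0 (b.2 p *m A)).
have he : h (F e) = e by rewrite /h -GE // h0e cinvK.
have sl : sm (b.2 (F e)) (fun y => y *m A) by exact: sm_lin.
have s1 : sm (b.2 (F e)) (fun y => h0 (y *m A)).
 by apply: (scomp (fun y => y *m A) h0 sl); rewrite -GE.
have c1 := sm_cont s1; have e1 : h0 (b.2 (F e) *m A) = C.2 e by rewrite -GE.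
have nC : \forall y \near b.2 (F e), C.1 (cinv C e (h0 (y *m A))) /\ C.2 (cinv C e (h0 (y *m A))) = h0 (y *m A).
 apply: (near_comp (P := fun z => C.1 (cinv C e z) /\ C.2 (cinv C e z) = z) c1).
 by rewrite e1; exact: (cinvP hE aC Ce).
have nb : \forall y \near b.2 (F e), b.1 (F (cinv C e (h0 (y *m A)))).
 apply: (near_comp (P := fun z => b.1 (F (cinv C e z))) c1); rewrite e1.
 exact: (mnbhsP hE _ aC Ce).1 n1.
have nG : \forall y \near b.2 (F e), G (h0 (y *m A)) = y *m A.
 apply: (near_comp (P := fun z => G (h0 z) = z) (sm_cont sl)); rewrite -GE //.
exists h; split=> //.
- apply/(smapP hP hE ab be aC); rewrite ?he //; split.
  apply: mnbhs_sub (near_pre hP ab be nC) => p [bp [c2 _]].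
  exact: c2.
 apply: sm_near s1; have hb := cinvP hP ab be; apply: filterS2 nC hb => y [c2 c3] [b1 b2].
 by rewrite -[hat _ _ _ _ _]/(C.2 (h (cinv b (F e) y))) /h b2 c3.
-
 have n3 := near_pre hE aC Ce h0G.
 apply: mnbhs_sub n3 => q [Cq Eq]; by rewrite /h -GE // Eq cinvK.
- have nall : \forall y \near b.2 (F e), (C.1 (cinv C e (h0 (y *m A))) /\ C.2 (cinv C e (h0 (y *m A))) = h0 (y *m A)) /\
   (b.1 (F (cinv C e (h0 (y *m A)))) /\ G (h0 (y *m A)) = y *m A) by apply: filterS3 nC nb nG.
 have n3 := near_pre hP ab be nall.
 apply: mnbhs_sub n3 => p [bp [[c2 c3] [b2 g1]]].
 apply: (chart_inj hP ab _ bp); first exact: b2.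
 have := g1; rewrite -c3 GE // => /(congr1 (mulmx^~ B)); rewrite -!mulmxA AB !mulmx1.
 by move=> E1; exact: E1.
Qed.

Lemma open_map e A : Q e -> mnbhs e A -> mnbhs (F e) (F @` A).
Proof.
move=> Qe nA; have [h [sh he n1 n2]] := local_inverse Qe.
have n3 : mnbhs (F e) (h @^-1` A) by apply: (smap_cont hP hE sh); rewrite he.
by apply: mnbhs_sub (mnbhsI hP n3 n2) => p [Ap Fp]; exists (h p).
Qed.

Lemma local_injective e : Q e -> exists B, [/\ mopen B, B e, B `<=` Q &
 forall a b, B a -> B b -> F a = F b -> a = b].
Proof.
move=> Qe; have [h [_ _ n1 _]] := local_inverse Qe.
have [B [oB Be BS]] := mnbhsI hE n1 (open_mn oQ Qe).
exists B; split=> // [a /BS[]//|a b /BS[Ea _] /BS[Eb _] E1].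
by rewrite -Ea -Eb E1.
Qed.

End LocalDiffeo.

(** * Regularity of manifolds *)

Section Regular.
Context {R : realType} {P : charted R} (hPm : is_manifold P).
Let hP : lman P := manifold_lman hPm.

(** The closed coordinate ball [K] is compact. If every neighborhood of [q] met the open ball, the
    traces of these neighborhoods on [K] would form a filter with a cluster point in [K]; separation
    forces this point to be [q], which then lies in [V]. *)
Lemma regular (p : P) (V : set P) : mnbhs p V -> exists V' : set P, [/\ mopen V', V' p &
 forall q, ~ V q -> mnbhs q (fun q' => ~ V' q')].
Proof.
move=> nV; have [c ac cp] := chart_ex hP p.
have n1 := (mnbhsP hP _ ac cp).1 nV; have n2 := cinvP hP ac cp.
have : \forall z \near c.2 p, V (cinv c p z) /\ (c.1 (cinv c p z) /\ c.2 (cinv c p z) = z).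
 by apply: filterS2 n1 n2.
move=> /nbhs_ballP[e e0 he]; pose K := [set z | `|z - c.2 p| <= e / 2].
have eh : e / 2 < e by rewrite ltr_pdivrMr // ltr_pMr // ltr1n.
have KV z : K z -> V (cinv c p z) /\ (c.1 (cinv c p z) /\ c.2 (cinv c p z) = z).
 by move=> Kz; apply: he; rewrite -ball_normE /= distrC; exact: le_lt_trans Kz eh.
have cK : compact K.
 apply: bounded_closed_compact.
  exists (`|c.2 p| + e / 2); split => [|m hm z Kz]; first exact: num_real.
  apply: le_trans (ltW hm); rewrite -[z](subrK (c.2 p)) addrC.
  by apply: le_trans (ler_normD _ _) _; rewrite lerD2l.
 rewrite (_ : K = closed_ball (c.2 p) (e / 2)); first exact: closed_ball_closed.
 rewrite closed_ballE ?divr_gt0 // /closed_ball_ /K.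
 by apply/seteqP; split => z /=; rewrite distrC.
exists [set q | c.1 q /\ `|c.2 q - c.2 p| < e / 2]; split.
- apply: (mopen_chart hP ac (V := [set z | `|z - c.2 p| < e / 2])).
 by rewrite norm_ballE; exact: ball_open.
- by split=> //; rewrite subrr normr0 divr_gt0.
move=> q nVq; apply: contrapT => nq.
pose FF : set (set 'rV[R]_(mdim P)) := [set S | exists2 A, mnbhs q A & forall z, K z -> A (cinv c p z) -> S z].
have pF : ProperFilter FF.
 split.
  move=> [A nA hA]; apply: nq; apply: mnbhs_sub nA => q' Aq' [cq' hq'].
  by apply: (hA (c.2 q')); [exact: ltW|rewrite cinvK].
 split.
 - by exists setT => //; exact: open_mn (mopenT hP) I.
 - move=> S T [A nA hA] [B nB hB]; exists (A `&` B); first exact: mnbhsI.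
  by move=> z Kz [Az Bz]; split; [exact: hA|exact: hB].
 - by move=> S T ST [A nA hA]; exists A => // z Kz Az; exact: ST (hA z Kz Az).
have FK : FF K by exists setT => //; exact: open_mn (mopenT hP) I.
have [z [Kz clz]] := cK FF pF FK.
have [Vz [c1 c2]] := KV z Kz.
have qz : cinv c p z <> q by move=> E; apply: nVq; rewrite -E.
case: hPm => _ _ _ /(_ _ _ qz)[ O [ O' [oO oO' Oz O'q I0]]] _.
have nO : nbhs z (fun z' => O (cinv c p z')).
 have h := (mnbhsP hP _ ac c1).1 (open_mn oO Oz); rewrite c2 in h.
 have h2 := cinv_indep hP p ac c1; rewrite c2 in h2.
 by apply: filterS2 h h2 => z' Oz' ->.
have FO : FF (fun z' => O' (cinv c p z')) by exists O' => //; exact: open_mn.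
have [z' [h1 h2]] := clz _ _ FO nO.
by have : (O `&` O') (cinv c p z') by []; rewrite I0.
Qed.

End Regular.

(** * Injectivity on a neighborhood of X *)

Section Tube.
Context {R : realType} {E P X : charted R} (hE : lman E) (hPm : is_manifold P) (hX : lman X).
Let hP : lman P := manifold_lman hPm.
Context (F : E -> P) (Q : set E) (zE : X -> E) (pr : E -> X) (m : R -> E -> E)
 (sF : forall e, Q e -> smooth_map_at F e) (Qz : forall x, Q (zE x))
 (omap : forall e A, Q e -> mnbhs e A -> mnbhs (F e) (F @` A))
 (linj : forall e, Q e -> exists B, [/\ mopen B, B e, B `<=` Q & forall a b, B a -> B b -> F a = F b -> a = b])
 (sz : forall x, smooth_map_at zE x) (m0 : forall e, m 0 e = zE (pr e)) (m1 : forall e, m 1 e = e)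
 (mc : forall e t, mcont (m^~ e) t)
 (emb : forall O, mopen O -> exists2 O', mopen O' & O = (fun x => F (zE x)) @^-1` O')
 (star : forall x A, mnbhs (zE x) A -> exists N, [/\ mopen N, N (zE x), N `<=` A & forall e t, N e -> 0 <= t <= 1 -> N (m t e)]).

(** The times at which the path $m_t b$ is in [B] form an open set. If the path left [B] at [t0], a
    point [s] of [B] with the same image could be separated from it; at nearby times with the path
    still in [B], injectivity would put the path close to [s], a contradiction. So the path,
    starting in [B], ends there. *)
Lemma tube_section (B : set E) (b : E) :
 mopen B -> B `<=` Q -> (forall a b, B a -> B b -> F a = F b -> a = b) ->
 (forall t, 0 <= t <= 1 -> Q (m t b) /\ (F @` B) (F (m t b))) -> B (m 0 b) -> B b.
Proof.
move=> oB BQ Binj hF B0; rewrite -(m1 b).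
apply: (@segment_induction _ (fun t => B (m t b))) => // t0 ht0.
have [Bt|nBt] := pselect (B (m t0 b)).
 have h : \forall t \near t0, B (m t b) := mc (open_mn oB Bt).
 move: h => /nbhs_ballP[e e0 he]; exists e => // t1 t2 _ _ _ h2 _.
 by apply: he; rewrite /ball /= distrC.
have [Qt [s Bs Fs]] := hF t0 ht0.
have sm : s <> m t0 b by move=> E1; apply: nBt; rewrite -E1.
case: hE => _ _ _ /(_ _ _ sm)[ O [ O' [oO oO' Os O't I0]]].
have nF : mnbhs (F (m t0 b)) (F @` (B `&` O)).
 by rewrite -Fs; apply: omap; [exact: BQ|apply: mnbhsI => //; exact: open_mn].
have n1 : \forall t \near t0, O' (m t b) := mc (open_mn oO' O't).
have n2 : \forall t \near t0, (F @` (B `&` O)) (F (m t b)) := mc (smap_cont hE hP (sF Qt) nF).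
have : \forall t \near t0, O' (m t b) /\ (F @` (B `&` O)) (F (m t b)) by apply: filterS2 n1 n2.
move=> /nbhs_ballP[e e0 he]; exists e => // t1 t2 _ _ h1 _ B1; exfalso.
have [] := he t1; first by rewrite /ball /= distrC.
move=> O1 [s' [Bs' Os'] Fs']; have E1 := Binj _ _ Bs' B1 Fs'.
have : (O `&` O') (m t1 b) by split=> //; rewrite -E1.
by rewrite I0.
Qed.

(** Around each point of $X$, a set [B] of injectivity comes with an open [V] in its image that
    meets $X$ only where the zero section is in [B]. A countable base numbers these data, and [N x]
    is cut down so that, for each of the finitely many numbers up to [j x], its image lies in the
    corresponding [V] or avoids the corresponding basic set. Two points with the same image are then
    compared in the data of smaller number. *)
Lemma tubular_injective (Q' : set E) : mopen Q' -> Q' `<=` Q -> (forall x, Q' (zE x)) ->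
 exists U, [/\ mopen U, (forall x, U (zE x)), U `<=` Q' &
  forall a b, U a -> U b -> F a = F b -> a = b].
Proof.
move=> oQ' Q'Q Q'z; pose iota x := F (zE x).
have [Bs hBs] : exists Bs : nat -> set P, (forall k, mopen (Bs k)) /\
  forall p O, mopen O -> O p -> exists k, Bs k p /\ Bs k `<=` O by case: hPm.
have [oBs cBs] := hBs.
pose nice (B : set E) (V V' : set P) := [/\ [/\ mopen B, B `<=` Q & forall a b, B a -> B b -> F a = F b -> a = b],
 mopen V, V `<=` F @` B, (forall y, V (iota y) -> B (zE y)) &
 mopen V' /\ forall q, ~ V q -> mnbhs q (fun q' => ~ V' q')].
have loc x : exists B V V', nice B V V' /\ V' (iota x).
 have [B [oB Bx BQ Binj]] := linj (Qz x).
 have oX : mopen (fun y => B (zE y)).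
  by apply/(mopenP hX) => y By; apply: (smap_cont hX hE (sz y)); exact: open_mn.
 have [ O' oO' EO] := emb oX.
 have n1 : mnbhs (iota x) (F @` B) by apply: omap => //; exact: open_mn.
 have O'E y : B (zE y) = O' (iota y) := congr1 (fun S : set X => S y) EO.
 have O'x : O' (iota x) by rewrite -O'E.
 have [V [oV Vx VS]] := mnbhsI hP n1 (open_mn oO' O'x).
 have [V' [oV' V'x hV']] := regular hPm (open_mn oV Vx).
 exists B, V, V'; split=> //; split=> //; first by move=> q /VS[].
 by move=> y /VS[_]; rewrite O'E.
pose good k := exists B V V', nice B V V' /\ Bs k `<=` V'.
have [D hD] : exists D : nat -> set E * set P * set P, forall k, good k ->
  nice (D k).1.1 (D k).1.2 (D k).2 /\ Bs k `<=` (D k).2.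
 have h k : exists d : set E * set P * set P, good k -> nice d.1.1 d.1.2 d.2 /\ Bs k `<=` d.2.
  have [[B [V [V' g]]]|n] := pselect (good k); first by exists (B, V, V').
  by exists (set0, set0, set0) => g; exfalso; apply: n.
 by have [D hD] := choice h; exists D.
have idx x : exists k, good k /\ Bs k (iota x).
 have [B [V [V' [g V'x]]]] := loc x; have [_ _ _ _ [oV' _]] := g.
 have [k [Bk kV]] := cBs _ _ oV' V'x; exists k; split=> //; by exists B, V, V'.
have [j hj] := choice idx.
pose dich k (A : set E) := good k -> (forall e, A e -> (D k).1.2 (F e)) \/ (forall e, A e -> ~ Bs k (F e)).
have near1 x k : exists A, mnbhs (zE x) A /\ dich k A.
 have [gk|ngk] := pselect (good k); last by exists setT; split=> [|/ngk//]; exact: open_mn (mopenT hE) I.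
 have [[_ oV _ _ [_ hV']] BV] := hD k gk.
 have [Vx|nVx] := pselect ((D k).1.2 (iota x)).
  exists (F @^-1` (D k).1.2); split=> [|_]; last by left.
  by apply: (smap_cont hE hP (sF (Qz x))); exact: open_mn.
 exists (F @^-1` (fun q => ~ (D k).2 q)); split=> [|_].
  by apply: (smap_cont hE hP (sF (Qz x))); exact: hV'.
 by right=> e ne /BV.
have near2 x n : exists A, mnbhs (zE x) A /\ forall k, (k < n)%N -> dich k A.
 elim: n => [|n [A [nA hA]]]; first by exists setT; split=> //; exact: open_mn (mopenT hE) I.
 have [A' [nA' hA']] := near1 x n; exists (A `&` A'); split; first exact: mnbhsI.
 move=> k; rewrite ltnS leq_eqVlt => /orP[/eqP->|kn] gk.
  by have [h|h] := hA' gk; [left=> e [_ /h]|right=> e [_ /h]].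
 by have [h|h] := hA k kn gk; [left=> e [/h]|right=> e [/h]].
have loc2 x : exists N, [/\ mopen N, N (zE x), (forall e t, N e -> 0 <= t <= 1 -> N (m t e)),
  N `<=` Q' & [/\ forall k, (k <= j x)%N -> dich k N, N `<=` (D (j x)).1.1 & forall e, N e -> Bs (j x) (F e)]].
 have [gk Bx] := hj x; have [[[oB _ _] _ _ hV [_ hV']] BV] := hD _ gk.
 have Vx : (D (j x)).1.2 (iota x).
  by apply: contrapT => /hV'/mnbhs_self; apply; exact: BV.
 have n1 := open_mn oB (hV _ Vx).
 have n2 : mnbhs (zE x) (F @^-1` Bs (j x)).
  by apply: (smap_cont hE hP (sF (Qz x))); exact: open_mn.
 have [A [nA hA]] := near2 x (j x).+1.
 have [N [oN Nz NS stN]] := star (mnbhsI hE (mnbhsI hE nA (open_mn oQ' (Q'z x))) (mnbhsI hE n1 n2)).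
 exists N; split=> //; first by move=> e /NS[[]].
 split=> [k kj gk1| |]; [|by move=> e /NS[_ []]|by move=> e /NS[_ []]].
 by have [h|h] := hA k kj gk1; [left=> e /NS[[/h]]|right=> e /NS[[/h]]].
have [N hN] := choice loc2.
exists (fun e => exists x, N x e); split.
- by apply/(mopenP hE) => e [x Ne]; have [oN _ _ _ _] := hN x; exists (N x); split=> // e' Ne'; exists x.
- by move=> x; exists x; have [] := hN x.
- by move=> e [x Ne]; have [_ _ _ h _] := hN x; exact: h.
(* The image of [b] is in the basic set of number [j x], so [N y] does not avoid that set and is
   mapped into the corresponding [V]. The path from [b] to the zero section stays over [V], and
   [tube_section] puts [b] in the same set of injectivity as [a]. *)
have key x y a b : (j x <= j y)%N -> N x a -> N y b -> F a = F b -> a = b.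
 move=> jxy Na Nb E1; have [gk _] := hj x; have [[[oB BQ Binj] _ VF hV _] BV] := hD _ gk.
 have [_ _ _ _ [_ NB NBs]] := hN x; have [_ _ stN NQ [hd _ _]] := hN y.
 have [h|h] := hd _ jxy gk; last by exfalso; apply: (h b Nb); rewrite -E1; exact: NBs.
 apply: (Binj a b) => //; first exact: NB.
 apply: (tube_section oB BQ Binj) => [t ht|].
  by have Nt := stN b t Nb ht; split; [exact: Q'Q (NQ _ Nt)|exact: VF (h _ Nt)].
 by rewrite m0; apply: hV; rewrite /iota -m0; apply: h; apply: stN => //; exact: interval0.
move=> a b [x Na] [y Nb] E1; have [jxy|jyx] := leqP (j x) (j y); first exact: key jxy Na Nb E1.
by apply: esym; exact: (key y x b a (ltnW jyx) Nb Na (esym E1)).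
Qed.

End Tube.

(** * Starlike neighborhoods, the form along X, and the conclusion *)

Section Final.
Context {R : realType} {M X P : charted R} (hM : lman M) (hX : lman X) (hP : lman P)
 (pi : bivector M) (i : X -> M) (hpi : poisson_on setT pi) (hi : embedding i) (r : nat)
 (hr : coregular i pi r).
Local Notation E := (perp_dual i pi r).
Local Notation zE := (zs i (perp i pi) r).
Local Notation fcE := (fchart i (perp i pi)).
Local Notation ZV := 'rV[R]_(mdim X + r).
Local Notation m t := (fscale t : E -> E).
Let hF := perp_subbundle hM hX hpi hi hr.
Let hE : lman E := perp_lman hM hX hpi hi hr.

Lemma dil_norm (v : ZV) t : 0 <= t <= 1 -> `|v *m @dil R _ r t| <= `|v|.
Proof.
move=> /andP[t0 t1]; apply/(norm_le_rV _ (normr_ge0 v)) => j; rewrite mul_dil.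
case: (split_ordP j) => l ->; rewrite ?row_mxEl ?row_mxEr mxE.
 exact: coord_le.
by rewrite mxE normrM (ger0_norm t0) -[leRHS]mul1r; apply: ler_pM => //; exact: coord_le.
Qed.

(** Balls around a point of the zero section in a bundle chart are starlike: fibrewise contraction
    fixes the center and does not increase the maximum norm. *)
Lemma star_zs x A : mnbhs (zE x) A -> exists N, [/\ mopen N, N (zE x), N `<=` A &
 forall e t, N e -> 0 <= t <= 1 -> N (m t e)].
Proof.
move=> nA; have [c [ O [s [ac oO Oc fr Oe]]]] := echart_ex hX hF (zE x).
set C := fcE c O s; have aC : atlas E C by exact: fatlas.
have Cz : C.1 (zE x) by exact: Oe.
have /nbhs_ballP[d d0 hd] := (mnbhsP hE _ aC Cz).1 nA.
pose V := [set z : ZV | `|z - C.2 (zE x)| < d].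
have VE : V = ball (C.2 (zE x)) d by exact: norm_ballE.
exists [set e | C.1 e /\ V (C.2 e)]; split.
- by apply: (mopen_chart hE aC); rewrite VE; exact: ball_open.
- by split=> //; rewrite /V /= subrr normr0.
- by move=> e [Ce Ve]; have := hd (C.2 e); rewrite -VE => /(_ Ve); rewrite cinvK.
move=> e t [Ce Ve] ht; split=> //.
have fd : C.2 (m t e) = (C.2 e : ZV) *m @dil R _ r t by exact: fscale_dil.
suff : `|(C.2 (m t e) : ZV) - C.2 (zE x)| < d by [].
rewrite fd.
have z0d : (C.2 (zE x) : ZV) *m @dil R _ r t = C.2 (zE x).
 by apply: z0_dil; rewrite zsE row_mxKr.
by rewrite -{1}z0d -mulmxBl; exact: le_lt_trans (dil_norm _ ht) Ve.
Qed.

Lemma fscale_mcont (e : E) t : mcont (fun s => m s e) t.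
Proof.
have [c [ O [s [ac oO Oc fr Oe]]]] := echart_ex hX hF e.
set C := fcE c O s; have aC : atlas E C by exact: fatlas.
have Ce s' : C.1 (m s' e) by exact: Oe.
pose a (s' : R) := (C.2 e : ZV) *m @dil R _ r 0 + s' *: ((C.2 e : ZV) *m @vert R _ r).
have aE s' : a s' = C.2 (m s' e) by rewrite fscale_dil dilE mulmxDr -scalemxAr.
have -> : (fun s' => m s' e) = (fun s' => cinv C e (a s')).
 by apply/funext => s'; rewrite aE cinvK.
by apply: (mcont_cinv hE aC Oe); [exists (m t e); rewrite aE|exact: line_cont].
Qed.

Context (W : X -> set (tvec M)) (D : set E) (eta : E -> tvec E -> tvec E -> R^o)
 (heta : closed_extension W D eta).

(** Every tangent vector at the zero section splits into a push-forward from $X$ and a vertical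
    vector, so the prescription $-\sigma - \tau$ determines all blocks; they have the shape that the
    Moser field requires. *)
Lemma extension_matrix x c O s (I0 : 'M[R]_(mdim X, mdim P)) (Jm : 'M[R]_(r, mdim P)) Pi :
 atlas X c -> mopen O -> O `<=` c.1 -> frame_on i (perp i pi) O s -> O x ->
 (forall e1 e2 : E, base e1 = x -> base e2 = x ->
   pi (i x) (jmap i pi W x (fib e1)) (jmap i pi W x (fib e2)) =
   dotr ((\row_k fib e1 (s k x)) *m Jm *m Pi *m Jm^T) (\row_k fib e2 (s k x))) ->
 (forall (e : E) v, base e = x -> tangent x v ->
   jmap i pi W x (fib e) (push i x v) = dotr ((\row_k fib e (s k x)) *m Jm *m I0^T) (crd c v)) ->
 EM eta (fcE c O s) (zE x) = block_mx 0 (- (I0 *m Jm^T)) (Jm *m I0^T) (- (Jm *m Pi *m Jm^T)).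
Proof.
move=> ac oO Oc fr Ox hs ht; have [oD Dz cD ext] := heta.
set C := fcE c O s; have aC : atlas E C by exact: fatlas.
have Cz : C.1 (zE x) by exact: Ox.
have [sk _ _] := cD _ (Dz x).
have decomp (a : ZV) : exists (e : E), [/\ base e = x, (\row_k fib e (s k x)) = rsubmx a &
  vec C (zE x) a = push zE x (vec c x (lsubmx a)) + vertical e].
 have [bs _] := fr _ Ox; have [e [Ee fe]] := dual_ex hF (fun l => rsubmx a 0 l) bs.
 have yE : \row_l fib e (s l x) = rsubmx a by apply/rowP => l; rewrite mxE fe.
 exists e; split=> //; have Oe : O (ebase e) by rewrite /ebase Ee.
 rewrite (vertical_vec hM hX (embS hi) hF ac oO Oc fr Oe) -[base e]/(ebase e) /ebase Ee yE.
 have tc := vecT hX (lsubmx a) ac (Oc _ Ox).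
 have tp := pushT hX hE (zs_smooth hM hX (embS hi) hF ac oO Oc fr Ox) tc.
 rewrite -(vec_crd hE aC Cz tp) (crd_zs hM hX (embS hi) hF ac oO Oc fr Ox tc) crd_vec //; last exact: Oc.
 rewrite -[X in X + _]scale1r -(vecD hE 1 _ _ aC Cz) scale1r add_row_mx addr0 add0r.
 by rewrite hsubmxK.
apply: mulmx_row_inj => a1; apply: dotr_inj => a2.
have [e1 [b1 y1 v1]] := decomp a1; have [e2 [b2 y2 v2]] := decomp a2.
have tz a := vecT hE a aC Cz; have tc a := vecT hX a ac (Oc _ Ox).
have := eta_crd hE sk aC Cz (tz a1) (tz a2); rewrite !crd_vec // => <-.
rewrite v1 v2 ext // hs // !ht // y1 y2 !crd_vec //; try exact: Oc.
have -> : a1 *m block_mx 0 (- (I0 *m Jm^T)) (Jm *m I0^T) (- (Jm *m Pi *m Jm^T)) =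
  row_mx (rsubmx a1 *m Jm *m I0^T) (- (lsubmx a1 *m I0 *m Jm^T) - rsubmx a1 *m Jm *m Pi *m Jm^T).
 by rewrite -{1}[a1]hsubmxK mul_row_block mulmx0 add0r !mulmxN !mulmxA.
have -> : dotr (rsubmx a2 *m Jm *m I0^T) (lsubmx a1) = dotr (lsubmx a1 *m I0 *m Jm^T) (rsubmx a2).
 by rewrite dotrC dotr_mulmx trmxK dotr_mulmx.
have -> z : dotr z a2 = dotr z (row_mx (lsubmx a2) (rsubmx a2)) by rewrite hsubmxK.
rewrite dotr_row dotrBl dotrNl.
by set p1 := dotr _ _; set p2 := dotr _ _; set p3 := dotr _ _; move: p1 p2 p3 => p1 p2 p3; ring.
Qed.

(** The prescription along $X$ with zero fibre vectors: both $\sigma$ and $\tau$ vanish there. *)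
Lemma extension_zero x v1 v2 : tangent x v1 -> tangent x v2 ->
 eta (zE x) (push zE x v1) (push zE x v2) = 0.
Proof.
move=> t1 t2; have [oD Dz cD ext] := heta.
have V0 : vertical (zE x) = 0 :> tvec E.
 apply/funext => g; rewrite /vertical; case: asboolP => // sg.
 rewrite (_ : (fun t : R => _) = fun=> g (zE x)); first by rewrite derive1_cst.
 by apply/funext => t; congr g; apply: dual_ext => //; apply/funext => v; rewrite /fib /= mulr0.
have := ext x v1 v2 (zE x) (zE x) t1 t2 erefl erefl; rewrite V0 !addr0 => ->.
have J0 : jmap i pi W x (fib (zE x)) = 0.
 by apply/funext => v; rewrite /jmap /restr /fib /=; case: asboolP.
have [sk _ _] := hpi (I : setT (i x)).
rewrite J0 (linear_on0 (cotangent_sub (i x)) (sk.1 _ _)); last by case: (cotangent_sub (i x)).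
by rewrite subrr subr0 oppr0.
Qed.

End Final.

Theorem theoremB (R : realType) (M X P : charted R)
 (pi : bivector M) (i : X -> M) (r : nat)
 (W : X -> set (tvec M))
 (D : set (perp_dual i pi r))
 (eta : perp_dual i pi r -> tvec (perp_dual i pi r) ->
     tvec (perp_dual i pi r) -> R^o)
 (U : set (perp_dual i pi r)) (piU : bivector (perp_dual i pi r))
 (k : P -> M) (piP : bivector P)
 (hM : is_manifold M) (hX : is_manifold X) (hP : is_manifold P)
 (hpi : poisson_on setT pi)
 (hi : embedding i) (hr : coregular i pi r)
 (hW : is_complement i pi r W)
 (heta : closed_extension W D eta)
 (hU : U `<=` D) (hmodel : local_model eta U piU)
 (hsat : local_saturation i pi r k piP) :
 exists (V : set P) (U' : set (perp_dual i pi r)),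
  [/\ mopen V /\ k @^-1` range i `<=` V,
    [/\ mopen U', (forall x, U' (zero_section (perp i pi) x)) & U' `<=` U] &
    poisson_diffeo V piP U' piU].
Proof.
have lM := manifold_lman hM; have lX := manifold_lman hX; have lP := manifold_lman hP.
have [hk hpiP hkP [chi [W' [Sg [[hchi hW' oSg Sg0 hexp] ran1 ran0 ran2 _]]]]] := hsat.
have hF := perp_subbundle lM lX hpi hi hr; have hE := perp_lman lM lX hpi hi hr.
pose E := perp_dual i pi r; pose zE : X -> E := zs i (perp i pi) r.
have [ek kpi] := hk; have [sk _ kinj _] := ek.
(* The complement [W'] in the description of the saturation may differ from [W]. The map built from
   [W'] covers all of [P], which gives the dimension count. *)
have [f' [DE' [oDE' DEz' sf' [kf' surj'] _]]] := saturation_germ lM lX lP hpi hi hr hW' hk hpiP hkP hchi oSg Sg0 hexp ran0 ran2.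
have onto p : exists2 e, DE' e & f' e = p.
 have : range k (k p) by exists p.
 rewrite ran1 => -[e [xi [Sx bx fx ex]]]; have [De Ee] := surj' p e xi Sx bx fx ex.
 by exists e.
(* If [P] is empty so is the bundle, and the empty maps do; otherwise there is a point from which to
   take charts and a default value. *)
have [[p0 _]|nP] := pselect (exists p : P, True); last first.
 have nE (e : E) : False by apply: nP; exists (f' e).
 have nP' (p : P) : False by apply: nP; exists p.
 exists set0, U; have [oU Uz _ _] := hmodel; split.
 - split; first by apply/(mopenP lP) => p.
  by move=> p; case: (nP' p).
 - by split.
 exists (fun p => False_rect E (nP' p)), (fun e => False_rect P (nE e)).
 by split=> [p|e|p]; [case: (nP' p)|case: (nE e)|case: (nP' p)].
have [Cc [Ac [cov hAc]]] := bundle_countable hX hF.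
have dn : (mdim P <= mdim X + r)%N.
 exact: (smooth_surjection_dim hE lP p0 cov hAc oDE' sf' onto).
(* The map built from the complement [W] of the local model and the same spray. This is the one that
   the Moser argument deforms. *)
have [f [DE [oDE DEz sf [kf _] germ]]] := saturation_germ lM lX lP hpi hi hr hW hk hpiP hkP hchi oSg Sg0 hexp ran0 ran2.
have [oD Dz cD _] := heta.
have flows x : exists c O s b u g Q, flow_data piP eta f x c O s b u g Q.
 have [c [ O [s [ac oO Oc fr Oe]]]] := echart_ex lX hF (zE x).
 have [b ab bf] := chart_ex lP (f (zE x)).
 have [I0 [Jm [fG JE hs ht]]] := germ x c O s b ac oO Oc fr Oe ab bf.
 have eE := extension_matrix lM lX hpi hi hr heta ac oO Oc fr Oe hs ht.
 have [u [g [Q pk]]] := local_flow lM lX lP hpi hi hr hpiP oD cD Dz oDE DEz sf dn ac oO Oc fr Oe ab bf fG JE eE.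
 by exists c, O, s, b, u, g, Q; split.
pose F := glued piP eta f; pose G := glued_dom piP eta f U.
have G0 x := glued_dom_zs lM lX hpi hi hr hmodel flows x.
have oG : mopen G by exact: (glued_dom_open lM lX hpi hi hr hmodel).
have sF e : G e -> smooth_map_at F e by exact: glued_smooth.
have imm e (Ge : G e) := glued_immersion lM lX lP hpi hi hr Ge.
have FP e a b : G e -> cotangent (F e) a -> cotangent (F e) b -> piU e (copull F e a) (copull F e b) = piP (F e) a b.
 apply: (glued_poisson lM lX lP hpi hi hr hpiP ek hkP hmodel _ kf _ dn).
  by move=> x v1 v2; exact: (extension_zero hpi heta).
 by move=> x; exact: sf.
have linv e (Ge : G e) := local_inverse hE lP sF imm dn Ge.
have Fz x : F (zE x) = f (zE x) by have [] := G0 x.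
(* The inclusion of $X$ in [P] is a topological embedding because that of $X$ in [M] factors through
   it. *)
have emb O : mopen O -> exists2 O' : set P, mopen O' & O = (fun x => F (zE x)) @^-1` O'.
 move=> oO; have [_ _ _ /(_ O oO)[ O' oO' ->]] := hi.
 exists (k @^-1` O'); last by apply/funext => x; rewrite /preimage /= Fz kf.
 by apply/(mopenP lP) => p O'p; apply: (smap_cont lP lM (sk p)); exact: open_mn.
have [U' [oU' U'z U'G Finj]] : exists U' : set E, [/\ mopen U', forall x, U' (zE x), U' `<=` G &
  forall a b, U' a -> U' b -> F a = F b -> a = b].
 apply: (@tubular_injective R E P X hE hP lX F G zE (@base R X M (perp i pi) : E -> X) (fun t e => fscale t e : E)) => //.
 - by move=> x; have [] := G0 x.
 - by move=> e A Ge nA; exact: (open_map hE lP sF imm dn Ge nA).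
 - by move=> e Ge; exact: (local_injective hE lP oG sF imm dn Ge).
 - by move=> x; exact: (zE_smooth lM lX hpi hi hr).
 - by move=> e; exact: m0E.
 - by move=> e; apply: dual_ext => //; apply/funext => v; rewrite /fib /= mul1r.
 - by move=> e t; exact: (fscale_mcont lM lX hpi hi hr).
 - by move=> x A; exact: (star_zs lM lX hpi hi hr).
 - by move=> x; have [] := G0 x.
have [e0 _ _] := onto p0.
(* The inverse of [F] on [U'], by choice; near each image point it agrees with a local inverse,
   which makes it smooth. *)
pose phi (p : P) : E := match pselect (exists e, U' e /\ F e = p) with
 | left h => sval (cid h) | right _ => e0 end.
have phiP p : (exists e, U' e /\ F e = p) -> U' (phi p) /\ F (phi p) = p.
 by rewrite /phi; case: pselect => // h _; case: cid.
have phiK e : U' e -> phi (F e) = e.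
 move=> Ue; have [u1 u2] := phiP (F e) (ex_intro _ e (conj Ue erefl)); exact: Finj.
have sphi e : U' e -> smooth_map_at phi (F e).
 move=> Ue; have [h [sh he n1 n2]] := linv e (U'G e Ue).
 have n3 : mnbhs (F e) (h @^-1` U') by apply: (smap_cont lP hE sh); rewrite he; exact: open_mn.
 apply: (smooth_map_near (phi := h) lP hE _ sh).
 by apply: mnbhs_sub (mnbhsI lP n2 n3) => p [Ep Uh]; rewrite -{2}Ep phiK.
exists (F @` U'), U'; split.
- split.
  apply/(mopenP lP) => _ [e Ue <-]; apply: (open_map hE lP sF imm dn (U'G e Ue)).
  exact: open_mn.
 move=> p [x _ ix]; exists (zE x); first exact: U'z.
 by apply: kinj; rewrite Fz kf.
- by split=> // e /U'G[].
exists phi, F; split.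
- move=> _ [e Ue <-]; rewrite phiK //; split=> //; exact: sphi.
- by move=> e Ue; split; [exists e|exact: phiK|exact: sF (U'G e Ue)].
move=> _ [e Ue <-] a b; rewrite (phiK e Ue) => ca cb.
have sp' := sphi e Ue; have sFe := sF e (U'G e Ue).
have cop c : cotangent e c -> cotangent (F e) (copull phi (F e) c).
 by move=> cc; apply: copullT => //; rewrite phiK.
(* Near [e], [phi] after [F] is the identity, so pulling a covector back by [phi] and then by [F]
   returns it; the Poisson property of [F] thus becomes that of [phi]. *)
have back c : cotangent e c -> copull F e (copull phi (F e) c) = c.
 move=> cc; apply/funext => v; rewrite /copull /restr; case: asboolP => tv; last first.
  by have [_ h] := cc; rewrite h.
 rewrite asboolT; last exact: (pushT hE lP sFe tv).
 have sp2 : smooth_map_at phi (F e) by [].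
 rewrite -(push_comp lP hE v sFe sp2); congr c.
 have n : mnbhs e (fun e' => id e' = (phi \o F) e').
  by exists U'; split=> // e' Ue'; rewrite /= phiK.
 rewrite -(push_near hE hE n (smooth_map_id hE e) tv).
 apply/funext => h; rewrite /push; case: asboolP => // nh.
 by rewrite (tangent_nonsmooth tv nh).
have := FP e _ _ (U'G e Ue) (cop a ca) (cop b cb).
by rewrite !back.
Qed.
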